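(* Let $n\ge3$, $p\in[0,1)$ and $j\in\{1,\dots,n-2\}$ with $(p,j)\neq(0,1)$. Assume that $K$ is an origin-symmetric convex body in $\mathbb R^n$ satisfying $h_K^{1-p}s_j(K,\cdot)=g$ for some even measurable function $g$ on $\mathbb S^{n-1}$ with $\|\log g\|_{L^\infty}<\infty$. Then there is a constant $C>1$ depending only on $n$, $p$ and $\|\log g\|_{L^\infty}$ such that $C^{-1}<h_K(x)<C$ for all $x\in\mathbb S^{n-1}$. Moreover, the upper bound $h_K<C$ holds also without the restriction $(p,j)\neq(0,1)$.
   Context: A convex body is a compact convex set with nonempty interior; $h_K(x)=\max_{y\in K}\langle x,y\rangle$. The $j$-th area measure is $S_j(K,\cdot)=S(K[j],B_2^n[n-1-j],\cdot)$ (mixed area measure). Where $h_K$ is twice differentiable at $u\in\mathbb S^{n-1}$, let $\lambda_1,\dots,\lambda_{n-1}$ be the eigenvalues of $(D_{e_i}D_{e_k}h_K(u))_{i,k=1}^{n-1}$ for an orthonormal basis of $u^\perp$, and $s_j(K,u)=\binom{n-1}j^{-1}\sum_{i_1<\dots<i_j}\lambda_{i_1}\cdots\lambda_{i_j}$; this a.e.-defined function is the density of the absolutely continuous part of $S_j(K,\cdot)$ with respect to $\mathcal H^{n-1}$. ''$K$ satisfies $h_K^{1-p}s_j(K,\cdot)=g$'' means that $S_j(K,\cdot)$ is absolutely continuous with respect to $\mathcal H^{n-1}$ and the equality holds $\mathcal H^{n-1}$-a.e. *)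

(* Defs.v *)
From HB Require Import structures.
From mathcomp Require Import all_boot all_order all_algebra.
From mathcomp Require Import all_classical all_reals all_analysis.
Set Implicit Arguments. Unset Strict Implicit. Unset Printing Implicit Defensive.
Import Order.TTheory GRing.Theory Num.Theory.
Import numFieldNormedType.Exports.
Local Open Scope classical_set_scope.
Local Open Scope ring_scope.

Section ConvexGeometry.
Variables (R : realType) (n : nat).
Local Notation V := 'rV[R]_n.

Definition dotp (x y : V) : R := \sum_(i < n) x ord0 i * y ord0 i.
Definition enorm (x : V) : R := Num.sqrt (dotp x x).

Definition sphere : set V := [set u | enorm u = 1].

Definition convex_set_rV (K : set V) : Prop :=
  forall x y (t : R), K x -> K y -> 0 <= t <= 1 -> K (t *: x + (1 - t) *: y).
Definition convex_body (K : set V) : Prop :=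
  compact K /\ convex_set_rV K /\ (K°) !=set0.
Definition origin_symmetric (K : set V) : Prop := forall x, K x -> K (- x).

Definition supp_fun (K : set V) (x : V) : R := sup [set dotp x y | y in K].

Definition borel (A : set V) : Prop := <<s open >> A.

Definition box (a b : V) : set V :=
  [set x | forall i, a ord0 i <= x ord0 i <= b ord0 i].
Definition boxvol (a b : V) : R := \prod_(i < n) (b ord0 i - a ord0 i).
Definition leb_outer (A : set V) : \bar R :=
  ereal_inf [set s | exists a b : nat -> V,
     [/\ (forall k i, a k ord0 i <= b k ord0 i),
         A `<=` \bigcup_k box (a k) (b k) &
         s = (\sum_(0 <= k <oo) (boxvol (a k) (b k))%:E)%E]].

(* the spherical Lebesgue measure = H^{n-1} restricted to S^{n-1}:
   sigma(w) = n * Lebesgue measure of the cone {t u : 0 < t <= 1, u in w} *)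
Definition cone01 (w : set V) : set V :=
  [set x | exists t : R, exists2 u, w u & 0 < t <= 1 /\ x = t *: u].
Definition sph_outer (w : set V) : \bar R := ((n%:R)%:E * leb_outer (cone01 w))%E.

Definition sph_ae (P : V -> Prop) : Prop :=
  sph_outer [set u | sphere u /\ ~ P u] = 0%E.

Definition distK (K : set V) (x : V) : R := inf [set enorm (x - y) | y in K].
Definition local_parallel (K : set V) (eps : R) (w : set V) : set V :=
  [set x | 0 < distK K x <= eps /\
     exists2 y, K y & enorm (x - y) = distK K x /\
                      w ((distK K x)^-1 *: (x - y))].

(* S : nat -> set V -> R is the family of area measures S_0(K,.),...,
   S_{n-1}(K,.) on Borel subsets of the sphere: the local Steiner formula
   (Schneider, Convex Bodies, Thm 4.2.1 / (4.2.?) and (4.2.24)):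
     lambda_n(M_eps(K,w)) = 1/n sum_{m=0}^{n-1} eps^{n-m} C(n,m) S_m(K,w)
   for all eps > 0; this determines each S_m(K,w) uniquely, and
   S_m(K,.) = S(K[m], B[n-1-m], .). *)
Definition area_measures (K : set V) (S : nat -> set V -> R) : Prop :=
  forall w, borel w -> w `<=` sphere -> forall eps : R, 0 < eps ->
    leb_outer (local_parallel K eps w) =
    ((n%:R)^-1 * \sum_(m < n) eps ^+ (n - m) * 'C(n, m)%:R * S m w)%:E.

Definition area_abs_cont (K : set V) (j : nat) : Prop :=
  forall S, area_measures K S ->
    forall w, borel w -> w `<=` sphere -> sph_outer w = 0%E -> S j w = 0.

Definition hessian_at (f : V -> R) (u : V) (A : 'M[R]_n) : Prop :=
  A^T = A /\ exists grad : V, forall e : R, 0 < e -> exists2 d : R, 0 < d &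
    forall y : V, enorm y < d ->
      `| f (u + y) - f u - dotp grad y - 2^-1 * (y *m A *m y^T) ord0 ord0 |
        <= e * enorm y ^+ 2.

(* normalized j-th elementary symmetric function of the eigenvalues of an
   m x m matrix M (the roots of its characteristic polynomial):
   binom(m,j)^{-1} * e_j(lambda_1..lambda_m), with
   e_j = (-1)^j * coefficient of X^(m-j) in char_poly M *)
Definition norm_elem_sym (m : nat) (M : 'M[R]_m) (j : nat) : R :=
  ('C(m, j)%:R)^-1 * ((-1) ^+ j * (char_poly M)`_(m - j)).

(* s_j(K,u) = s: h_K is twice differentiable at u, and for (any) orthonormal
   basis e_1..e_{n-1} of u^perp (rows of E), s is the normalized j-th
   elementary symmetric function of the eigenvalues of (D_{e_i}D_{e_k}h_K(u)) *)
Definition sj_at (K : set V) (j : nat) (u : V) (s : R) : Prop :=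
  exists A : 'M[R]_n, hessian_at (supp_fun K) u A /\
    forall E : 'M[R]_(n.-1, n), E *m E^T = 1%:M -> E *m u^T = 0 ->
      s = norm_elem_sym (E *m A *m E^T) j.

Definition solves_Lp_Christoffel_Minkowski (K : set V) (p : R) (j : nat)
    (g : V -> R) : Prop :=
  area_abs_cont K j /\
  sph_ae (fun u => exists2 s, sj_at K j u s & supp_fun K u `^ (1 - p) * s = g u).

Definition even_on_sphere (g : V -> R) : Prop :=
  forall u, sphere u -> g (- u) = g u.
Definition measurable_on_sphere (g : V -> R) : Prop :=
  forall B : set R, open B -> borel (sphere `&` g @^-1` B).

Definition ess_bound_log (g : V -> R) (M : R) : Prop :=
  sph_ae (fun u => 0 < g u /\ `| ln (g u) | <= M).
Definition Linf_norm_log (g : V -> R) (M : R) : Prop :=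
  ess_bound_log g M /\ forall M', M' < M -> ~ ess_bound_log g M'.

End ConvexGeometry.

(* Main.v *)
(* An origin-symmetric body is compared with volumes of local parallel sets.  For a bounded Borel set [C]
   the volume of [x] whose difference with its nearest point of [s K] lies in [C] is a polynomial in [s]
   with nonnegative coefficients [Sig K m C]; on cones these are the area measures.  Where [h_K] has
   Hessian [A] at [u], the normal map [x |-> x - proj x] is expanded near height [t] by
   [det (1 + A / t)], which turns bounds on [s_j] into bounds on volumes: from below directly, and from
   above after choosing the height at which [det (1 + A / t)] is dominated by its [j]-th term.

   Upper bound: let [b_1 >= b_2 >= ...] be the widths of [K] along a greedy orthonormal frame.
   The points outside [K] at distance at most [eps] whose normal has a large first component have
   volume [O(eps prod_(k >= 2) (b_k + eps))], since they are disjoint from their translates by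
   [2 eps] along the first axis; hence [b_2 ... b_(j+1)] is bounded below by [c b_1^(p-1)].
   The total mass of [S_j] is at least [c b_1 ... b_j], by monotonicity in [K] (the ball is a limit of
   zonotopes, and the volume of [K + t Z] is affine in each segment of [Z]), and at most
   [C b_1^(p-1) sqrt (b_1 / b_2)], by integrating the density over the layers of [h_K].  The two bounds
   force [b_1] to be bounded.

   Lower bound: if the least value [r] of [h_K], taken at [e], is tiny, then [K] is close to its projection
   [L] along [e], whose [S_j]-mass of a cone of aperture [d] around [e] is of order [d^(n-1-j)]; the
   density bound allows only [C d^(n-2+p)], a contradiction for small [d] as [j > 1 - p]. *)
Require Import Defs.
From HB Require Import structures.
From mathcomp Require Import all_boot all_order all_algebra.
From mathcomp Require Import fingroup perm.
From mathcomp Require Import all_classical all_reals all_analysis.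
From mathcomp Require Import zify ring lra.
From mathcomp Require complex.
Set Implicit Arguments. Unset Strict Implicit. Unset Printing Implicit Defensive.
Import Order.TTheory GRing.Theory Num.Theory.
Import numFieldNormedType.Exports.
Local Open Scope classical_set_scope.
Local Open Scope ring_scope.

(** * Lebesgue outer measure and linear images *)

Section BoxContent.
Variables (R : realType) (n' : nat).
Local Notation n := n'.+1.
Local Notation V := 'rV[R]_n.
Local Open Scope ereal_scope.

(** All constants are fixed before the body, whereas the second-order expansion of [h_K] is given
    only almost everywhere and with no control on its remainder. Volumes are therefore compared on
    countably many pieces along which an expansion is uniform. Such pieces need not be measurable,
    so the arguments run with the outer measure, its continuity along increasing sequences, and
    Borel hulls. Absolute continuity enters through one fact: Borel sets of directions of measure
    zero carry no [S_j]-mass, which disposes of the exceptional directions. The Steiner polynomial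
    is taken in the dilation factor of the body, not in the distance: it then exists for every
    bounded Borel set of normal vectors, such as a ball translated away from the origin or a cone
    truncated by a hyperplane. For a body contained in a hyperplane its coefficients are invariant
    under translation along the normal and multiply by a power under squeezing, and this gives the
    mass of thin cones. In the products of widths, the height [eps] is put between the widths that
    are kept and those left out, so that all powers of [eps] cancel. *)

Definition box_le (a b : V) := forall i, (a ord0 i <= b ord0 i)%R.

Lemma box_inj (a b a' b' : V) : box_le a b -> box_le a' b' ->
  box a b = box a' b' -> a = a' /\ b = b'.
Proof.
move=> ab ab' E.
have aa : box a b a by move=> i; rewrite lexx ab.
have bb : box a b b by move=> i; rewrite lexx ab.
have aa' : box a' b' a' by move=> i; rewrite lexx ab'.
have bb' : box a' b' b' by move=> i; rewrite lexx ab'.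
rewrite E in aa bb; rewrite -E in aa' bb'.
split; apply/rowP => i; apply/eqP; rewrite eq_le.
  by move: (aa i) (aa' i) => /andP[-> _] /andP[-> _].
by move: (bb i) (bb' i) => /andP[_ ->] /andP[_ ->].
Qed.

Lemma boxvol_ge0 (a b : V) : box_le a b -> (0 <= boxvol a b)%R.
Proof. by move=> ab; apply: prodr_ge0 => i _; rewrite subr_ge0 ab. Qed.

Definition is_box (A : set V) (c : V * V) := box_le c.1 c.2 /\ A = box c.1 c.2.

(** Every set counts as measurable in the underlying space, and nonempty sets other than boxes get
    the value [+oo]. A covering of finite total content thus consists of boxes and empty sets, and
    [leb_outer] becomes the extension [mu_ext] of this content. The box chosen by [cid] does not
    matter, by [box_inj]. *)
Definition box_content (A : set (g_sigma_algebraType [set: set V])) : \bar R :=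
  match pselect (exists c, is_box A c) with
  | left e => (boxvol (projT1 (cid e)).1 (projT1 (cid e)).2)%:E
  | right _ => if pselect (A = set0) then 0 else +oo
  end.

Lemma box_contentE (a b : V) : box_le a b ->
  box_content (box a b) = (boxvol a b)%:E.
Proof.
move=> ab; rewrite /box_content; case: pselect => [e|]; last first.
  by case; exists (a, b).
by case: (cid e) => -[c d] /= [cd] /(box_inj ab cd) [-> ->].
Qed.

Lemma box_content_ge0 A : 0 <= box_content A.
Proof.
rewrite /box_content; case: pselect => [e|_]; last by case: pselect.
by case: (cid e) => -[c d] /= [cd _]; rewrite lee_fin boxvol_ge0.
Qed.

Lemma box_content0 : box_content set0 = 0.
Proof.
rewrite /box_content; case: pselect => [e|_]; last by case: pselect.
exfalso; have [[a b] [/= ab E]] := e.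
suff : (set0 : set V) a by [].
by rewrite E => i; rewrite lexx ab.
Qed.

Lemma box_contentP A : box_content A != +oo ->
  exists c : V * V, [/\ box_le c.1 c.2, A `<=` box c.1 c.2 &
    box_content A = (boxvol c.1 c.2)%:E].
Proof.
rewrite /box_content; case: pselect => [e _|_].
  case: (cid e) => -[c d] /= [cd AE]; exists (c, d); split => //=.
  by move: AE => /= ->.
case: pselect => //= A0 _; exists ((0 : V)%R, (0 : V)%R); split => //=; first by rewrite A0.
by rewrite /boxvol big_ord_recl /= subrr mul0r.
Qed.

Lemma measurable_all (A : set (g_sigma_algebraType [set: set V])) :
  measurable A.
Proof. exact: sub_gen_smallest. Qed.

Lemma leb_outerE : @leb_outer R n = mu_ext box_content.
Proof.
apply/funext => A; apply/eqP; rewrite eq_le; apply/andP; split.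
  apply/le_ereal_inf_tmp => _ [B [_ AB] <-].
  have [[k kE]|nE] := pselect (exists k, box_content (B k) = +oo).
    rewrite (eseries_pinfty _ _ kE) ?leey// => m _.
    by rewrite -ltNye (lt_le_trans _ (box_content_ge0 _)).
  have /choice[c cP] : forall k, exists c : V * V,
      [/\ box_le c.1 c.2, B k `<=` box c.1 c.2 &
        box_content (B k) = (boxvol c.1 c.2)%:E].
    by move=> k; apply: box_contentP; apply/eqP => E; apply: nE; exists k.
  apply: ereal_inf_lbound; exists (fst \o c), (snd \o c); split.
  - by move=> k; have [+ _ _] := cP k.
  - apply: subset_trans AB _ => x [k _ Bx]; exists k => //=.
    by have [_ + _] := cP k; exact.
  - by apply: eq_eseriesr => k _; have [_ _ ->] := cP k.
apply/le_ereal_inf_tmp => _ [a [b [ab Aab ->]]].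
apply: ereal_inf_lbound; exists (fun k => box (a k) (b k)).
  by split => // i; exact: measurable_all.
by apply: eq_eseriesr => k _; rewrite box_contentE//; exact: ab.
Qed.

Lemma leb_outer0 : @leb_outer R n set0 = 0.
Proof. by rewrite leb_outerE (mu_ext0 box_content0 box_content_ge0). Qed.

Lemma leb_outer_ge0 A : 0 <= @leb_outer R n A.
Proof. by rewrite leb_outerE; exact: (mu_ext_ge0 box_content_ge0). Qed.

Lemma le_leb_outer : {homo @leb_outer R n : A B / A `<=` B >-> A <= B}.
Proof. by move=> A B AB; rewrite leb_outerE; exact: (le_mu_ext box_content AB). Qed.

Lemma leb_outer_sigma_subadditive : sigma_subadditive (@leb_outer R n).
Proof.
rewrite leb_outerE; exact: (mu_ext_sigma_subadditive box_content_ge0).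
Qed.

HB.instance Definition _ := isOuterMeasure.Build R V (@leb_outer R n)
  leb_outer0 leb_outer_ge0 le_leb_outer leb_outer_sigma_subadditive.

Lemma leb_box_le (a b : V) : box_le a b ->
  leb_outer (box a b) <= (boxvol a b)%:E.
Proof.
move=> ab; apply: ereal_inf_lbound.
(* After the first box the covering is continued by the single point [a], of volume 0 because there
   is at least one coordinate. *)
exists (fun=> a), (fun k => if k is 0%N then b else a); split.
- by case=> // i; exact: ab.
- by move=> x xab; exists 0%N.
- rewrite nneseries_recl//=; last first.
    by case=> [|k] _; rewrite lee_fin; apply: boxvol_ge0 => // i; exact: ab.
  rewrite eseries_cond/= eseries0 ?adde0// => -[|k]//= _ _.
  by rewrite /boxvol big_ord_recl /= subrr mul0r.
Qed.

End BoxContent.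

(** * Euclidean inner product and norm *)

Section Euclid.
Variables (R : realType) (n : nat).
Local Notation V := 'rV[R]_n.
Implicit Types (x y z : V) (a c : R).

Lemma dotpE x y : dotp x y = (x *m y^T) ord0 ord0.
Proof. by rewrite mxE; apply: eq_bigr => i _; rewrite mxE. Qed.

Lemma dotpC x y : dotp x y = dotp y x.
Proof. by apply: eq_bigr => i _; rewrite mulrC. Qed.

Lemma dotpDl x y z : dotp (x + y) z = dotp x z + dotp y z.
Proof. by rewrite -big_split; apply: eq_bigr => i _; rewrite mxE mulrDl. Qed.

Lemma dotpDr x y z : dotp x (y + z) = dotp x y + dotp x z.
Proof. by rewrite dotpC dotpDl !(dotpC x). Qed.

Lemma dotpZl a x y : dotp (a *: x) y = a * dotp x y.
Proof. by rewrite mulr_sumr; apply: eq_bigr => i _; rewrite mxE mulrA. Qed.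

Lemma dotpZr a x y : dotp x (a *: y) = a * dotp x y.
Proof. by rewrite dotpC dotpZl dotpC. Qed.

Lemma dotpNl x y : dotp (- x) y = - dotp x y.
Proof. by rewrite -scaleN1r dotpZl mulN1r. Qed.

Lemma dotpNr x y : dotp x (- y) = - dotp x y.
Proof. by rewrite dotpC dotpNl dotpC. Qed.

Lemma dotpBl x y z : dotp (x - y) z = dotp x z - dotp y z.
Proof. by rewrite dotpDl dotpNl. Qed.

Lemma dotpBr x y z : dotp x (y - z) = dotp x y - dotp x z.
Proof. by rewrite dotpDr dotpNr. Qed.

Lemma dotp0l x : dotp 0 x = 0.
Proof. by rewrite -(scale0r 0) dotpZl mul0r. Qed.

Lemma dotp0r x : dotp x 0 = 0.
Proof. by rewrite dotpC dotp0l. Qed.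

Lemma dotp_suml (I : Type) (r : seq I) (P : pred I) (F : I -> V) y :
  dotp (\sum_(i <- r | P i) F i) y = \sum_(i <- r | P i) dotp (F i) y.
Proof.
elim/big_ind2 : _ => //; first exact: dotp0l.
by move=> u a v b <- <-; rewrite dotpDl.
Qed.

Lemma dotp_sumr (I : Type) (r : seq I) (P : pred I) (F : I -> V) y :
  dotp y (\sum_(i <- r | P i) F i) = \sum_(i <- r | P i) dotp y (F i).
Proof. by rewrite dotpC dotp_suml; apply: eq_bigr => i _; rewrite dotpC. Qed.

Lemma dotp_ge0 x : 0 <= dotp x x.
Proof. by apply: sumr_ge0 => i _; rewrite -expr2 sqr_ge0. Qed.

Lemma dotp_eq0 x : (dotp x x == 0) = (x == 0).
Proof.
apply/idP/eqP => [|->]; last by rewrite dotp0l.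
rewrite psumr_eq0; last by move=> i _; rewrite -expr2 sqr_ge0.
move=> /allP H; apply/rowP => i; rewrite mxE; apply/eqP.
by have := H i (mem_index_enum _); rewrite /= mulf_eq0 orbb.
Qed.

Lemma dotp_inj x y : (forall z, dotp x z = dotp y z) -> x = y.
Proof.
move=> H; apply/eqP; rewrite -subr_eq0 -dotp_eq0.
by rewrite {1}dotpBl H subrr.
Qed.

Lemma enorm_ge0 x : 0 <= enorm x. Proof. exact: sqrtr_ge0. Qed.

Lemma sqr_enorm x : enorm x ^+ 2 = dotp x x.
Proof. by rewrite sqr_sqrtr// dotp_ge0. Qed.

Lemma enorm_eq0 x : (enorm x == 0) = (x == 0).
Proof. by rewrite -dotp_eq0 -sqr_enorm sqrf_eq0. Qed.

Lemma enorm0 : enorm (0 : V) = 0.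
Proof. by apply/eqP; rewrite enorm_eq0. Qed.

Lemma enorm_gt0 x : (0 < enorm x) = (x != 0).
Proof. by rewrite lt0r enorm_eq0 enorm_ge0 andbT. Qed.

Lemma enormZ a x : enorm (a *: x) = `|a| * enorm x.
Proof.
by rewrite /enorm dotpZl dotpZr mulrA -expr2 sqrtrM ?sqr_ge0// sqrtr_sqr.
Qed.

Lemma enormN x : enorm (- x) = enorm x.
Proof. by rewrite -scaleN1r enormZ normrN1 mul1r. Qed.

Lemma enormBC x y : enorm (x - y) = enorm (y - x).
Proof. by rewrite -enormN opprB. Qed.

Lemma dotp_le x y : dotp x y <= enorm x * enorm y.
Proof.
have [->|x0] := eqVneq x 0; first by rewrite dotp0l mulr_ge0 ?enorm_ge0.
have [->|y0] := eqVneq y 0; first by rewrite dotp0r mulr_ge0 ?enorm_ge0.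
have xp : 0 < enorm x by rewrite enorm_gt0.
have yp : 0 < enorm y by rewrite enorm_gt0.
have := dotp_ge0 (enorm y *: x - enorm x *: y).
rewrite dotpBl !dotpBr !dotpZl !dotpZr -!sqr_enorm (dotpC y x) => H.
have : 0 <= (enorm x * enorm y) * (enorm x * enorm y - dotp x y) by lra.
by rewrite pmulr_rge0 ?mulr_gt0// subr_ge0.
Qed.

Lemma CauchySchwarz x y : `|dotp x y| <= enorm x * enorm y.
Proof.
rewrite ler_norml dotp_le andbT lerNl -dotpNl.
by rewrite (le_trans (dotp_le _ _))// enormN.
Qed.

Lemma enormD x y : enorm (x + y) <= enorm x + enorm y.
Proof.
rewrite -(ler_pXn2r (_ : (0 < 2)%N))// ?nnegrE ?addr_ge0 ?enorm_ge0//.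
rewrite sqrrD !sqr_enorm dotpDl !dotpDr (dotpC y x).
by have := dotp_le x y; lra.
Qed.

Lemma enormB x y : enorm (x - y) <= enorm x + enorm y.
Proof. by rewrite (le_trans (enormD _ _))// enormN. Qed.

Lemma enorm_dist x y z : enorm (x - z) <= enorm (x - y) + enorm (y - z).
Proof. by rewrite (le_trans _ (enormD _ _))// addrA subrK. Qed.

Lemma ler_dist_enorm x y : `|enorm x - enorm y| <= enorm (x - y).
Proof.
have H (u v : V) : enorm u - enorm v <= enorm (u - v).
  by have := enormD (u - v) v; rewrite subrK -lerBlDr.
by rewrite ler_norml H andbT lerNl opprB enormBC H.
Qed.

Lemma enorm_sum (I : Type) (r : seq I) (P : pred I) (F : I -> V) :
  enorm (\sum_(i <- r | P i) F i) <= \sum_(i <- r | P i) enorm (F i).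
Proof.
elim/big_rec2 : _ => [|i y x _ h]; first by rewrite enorm0.
by rewrite (le_trans (enormD _ _))// lerD2l.
Qed.

Lemma ler_coord_enorm x i : `|x ord0 i| <= enorm x.
Proof.
rewrite -(ler_pXn2r (_ : (0 < 2)%N))// ?nnegrE ?normr_ge0 ?enorm_ge0//.
rewrite sqr_enorm real_normK ?num_real// /dotp (bigD1 i)//= -expr2 lerDl.
by apply: sumr_ge0 => k _; rewrite -expr2 sqr_ge0.
Qed.

Lemma enorm_le_coord x c : 0 <= c -> (forall i, `|x ord0 i| <= c) ->
  enorm x <= n%:R * c.
Proof.
move=> c0 xc.
have [n0|n0] := posnP n.
  rewrite (_ : x = 0) ?enorm0 ?mulr_ge0 ?ler0n//.
  by apply/rowP => i; have /lt0n_neq0/eqP/(_ n0) := leq_ltn_trans (leq0n i) (ltn_ord i).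
rewrite -(ler_pXn2r (_ : (0 < 2)%N))// ?nnegrE ?mulr_ge0 ?enorm_ge0//.
rewrite sqr_enorm; apply: (@le_trans _ _ (\sum_(i < n) c ^+ 2)).
  apply: ler_sum => i _; rewrite -expr2 -[X in X <= _]real_normK ?num_real//.
  by rewrite ler_pXn2r ?nnegrE ?normr_ge0.
rewrite sumr_const card_ord -[leLHS]mulr_natl exprMn.
apply: ler_wpM2r; first exact: sqr_ge0.
by rewrite -natrX ler_nat -[leqLHS]muln1 expnS expn1 leq_mul2l n0 orbT.
Qed.

Lemma norm_le_enorm x : `|x| <= enorm x.
Proof.
rewrite [leLHS]/Num.norm/= mx_normrE; apply/bigmax_leP; split=> [|[i j] _] /=.
  exact: enorm_ge0.
by rewrite (ord1 i) ler_coord_enorm.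
Qed.

Lemma coord_le_norm x i : `|x ord0 i| <= `|x|.
Proof.
rewrite [leRHS]/Num.norm/= mx_normrE.
by apply/bigmax_geP; right => /=; exists (ord0, i).
Qed.

Lemma enorm_le_norm x : enorm x <= n%:R * `|x|.
Proof. by apply: enorm_le_coord => // i; exact: coord_le_norm. Qed.

(** The topology on row vectors is that of the sup norm; this is the passage to Euclidean balls.
    Dividing by [n.+1] keeps the radius positive in dimension 0 as well. *)
Lemma enorm_nbhs x (A : set V) :
  nbhs x A <-> exists2 e : R, 0 < e & forall y, enorm (y - x) < e -> A y.
Proof.
split=> [/nbhs_normP [e /= e0 eA]|[e e0 eA]].
  exists e => // y yx; apply: eA; rewrite /= distrC.
  exact: le_lt_trans (norm_le_enorm _) yx.
apply/nbhs_ballP; exists (e / n.+1%:R); first by rewrite /= divr_gt0.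
move=> y; rewrite mx_norm_ball /= => yx; apply: eA; rewrite enormBC (le_lt_trans (enorm_le_norm _))//.
rewrite ltr_pdivlMr// in yx; apply: le_lt_trans yx.
by rewrite mulrC ler_wpM2l// ler_nat.
Qed.

Lemma enorm_continuous : continuous (@enorm R n).
Proof.
move=> x A /nbhs_normP [e /= e0 eA]; apply/enorm_nbhs; exists e => // y yx.
by apply: eA; rewrite /= (le_lt_trans (ler_dist_enorm _ _))// enormBC.
Qed.

End Euclid.

Section EuclidMap.
Variables (R : realType) (n : nat).
Local Notation V := 'rV[R]_n.

Lemma dotp_mulmxl m (A : 'M[R]_(n, m)) (x : V) (y : 'rV[R]_m) :
  dotp (x *m A) y = dotp x (y *m A^T).
Proof. by rewrite !dotpE trmx_mul trmxK mulmxA. Qed.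

Lemma lipschitz_continuous m (f : V -> 'rV[R]_m) (k : R) :
  (forall x y, enorm (f x - f y) <= k * enorm (x - y)) -> continuous f.
Proof.
move=> fk x A /enorm_nbhs [e e0 eA]; apply/enorm_nbhs.
exists (e / (`|k| + 1)); first by rewrite divr_gt0// ltr_wpDl.
move=> y; rewrite ltr_pdivlMr ?ltr_wpDl// => yx; apply: eA.
apply: le_lt_trans (fk _ _) _; apply: le_lt_trans yx.
rewrite mulrC ler_wpM2l ?enorm_ge0// (le_trans (ler_norm _))//.
by rewrite lerDl.
Qed.

End EuclidMap.

Section LimitLemmas.
Variable R : realType.

(** Error terms are written as polynomials in a parameter, so that letting the parameter decrease to
    0 becomes evaluation at 0. *)
Lemma horner_ge_lim (p : {poly R}) (c d : R) : 0 < d ->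
  (forall t, 0 < t < d -> c <= p.[t]) -> c <= p.[0].
Proof.
move=> d0 H; apply/ler_addgt0Pr => e e0.
have /cvgr_dist_lt/(_ e e0) := @continuous_horner R p 0.
move=> /nbhs_ballP [r /= r0 rP].
have [mr md] : Num.min r d / 2 < r /\ Num.min r d / 2 < d.
  by rewrite !ltr_pdivrMr//; split; rewrite gt_min; apply/orP; [left|right]; lra.
have m0 : 0 < Num.min r d / 2 by rewrite divr_gt0// lt_min r0.
have cp : c <= p.[Num.min r d / 2] by apply: H; rewrite m0 md.
apply: (le_trans cp); rewrite -lerBlDl; apply/ltW; apply: le_lt_trans (ler_norm _) _.
by rewrite distrC; apply: rP; rewrite /ball/= sub0r normrN gtr0_norm.
Qed.

Lemma lee_horner_lim (p : {poly R}) (x : \bar R) (d : R) : 0 < d ->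
  (forall t, 0 < t < d -> (x <= (p.[t])%:E)%E) -> (x <= (p.[0])%:E)%E.
Proof.
move=> d0; case: x => [c| |] H; last exact: leNye.
- by rewrite lee_fin; apply: (horner_ge_lim d0) => t /H; rewrite lee_fin.
- have /H : 0 < d / 2 < d by rewrite divr_gt0// ltr_pdivrMr//; lra.
  by rewrite leye_eq.
Qed.

End LimitLemmas.

Section OuterMeasureFinite.
Variables (R : realType) (T : Type) (mu : {outer_measure set T -> \bar R}).

Lemma outer_measure_bigU (I : Type) (r : seq I) (P : pred I) (F : I -> set T) :
  (mu (\big[setU/set0]_(i <- r | P i) F i) <= \sum_(i <- r | P i) mu (F i))%E.
Proof.
elim/big_rec2 : _ => [|i y x _ h]; first by rewrite outer_measure0.
by rewrite (le_trans (outer_measureU2 _ _ _))// leeD2l.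
Qed.

End OuterMeasureFinite.

Section LebImage.
Variables (R : realType) (n' m' : nat).
Local Notation n := n'.+1.
Local Notation m := m'.+1.
Local Notation V := 'rV[R]_n.
Variables (f : V -> 'rV[R]_m) (E : set V).
Local Open Scope ereal_scope.

(** The volume of the image of the part of [A] inside [E] is an outer measure in [A]; estimates of
    images thus reduce to small cubes by the covering argument below. *)
Definition leb_image (A : set V) : \bar R := leb_outer (f @` (E `&` A)).

Lemma leb_image0 : leb_image set0 = 0.
Proof. by rewrite /leb_image setI0 image_set0 outer_measure0. Qed.

Lemma leb_image_ge0 A : 0 <= leb_image A.
Proof. exact: outer_measure_ge0. Qed.

Lemma le_leb_image : {homo leb_image : A B / A `<=` B >-> A <= B}.
Proof. by move=> A B AB; apply: le_outer_measure; apply: image_subset; exact: setIS. Qed.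

Lemma leb_image_sigma_subadditive : sigma_subadditive leb_image.
Proof.
move=> F; rewrite /leb_image setI_bigcupr image_bigcup.
exact: outer_measure_sigma_subadditive.
Qed.

HB.instance Definition _ := isOuterMeasure.Build R V leb_image
  leb_image0 leb_image_ge0 le_leb_image leb_image_sigma_subadditive.

End LebImage.

Section CubeCover.
Variables (R : realType) (n' : nat).
Local Notation n := n'.+1.
Local Notation V := 'rV[R]_n.
Variable mu : {outer_measure set V -> \bar R}.

Definition cube (c : V) (s : R) : set V := box c (c + const_mx s).

(** A grid of cubes of side [t] covers the box and has total volume at most the product of the sides
    enlarged by [t]; then [t] tends to 0. *)
Lemma outer_box_le (k rho : R) (a b : V) : 0 <= k -> 0 < rho -> box_le a b ->
  (forall c s, 0 < s <= rho -> (mu (cube c s) <= (k * s ^+ n)%:E)%E) ->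
  (mu (box a b) <= (k * boxvol a b)%:E)%E.
Proof.
move=> k0 rho0 ab H.
pose p : {poly R} := k%:P * \prod_i ((b ord0 i - a ord0 i)%:P + 'X).
have pE t : p.[t] = k * \prod_i (b ord0 i - a ord0 i + t).
  by rewrite hornerM hornerC horner_prod; congr (_ * _); apply: eq_bigr => i _; rewrite !hornerE.
have -> : k * boxvol a b = p.[0].
  by rewrite pE; congr (_ * _); apply: eq_bigr => i _; rewrite addr0.
apply: (lee_horner_lim rho0) => t /andP[t0 trho].
pose w i := (b ord0 i - a ord0 i) / t.
have w0 i : 0 <= w i by rewrite divr_ge0 ?(ltW t0)// subr_ge0.
pose N i := (Num.truncn (w i)).+1.
pose M := \max_i N i.
(* Multi-indices of the grid cubes. All axes share the index type ['I_M.+1], and the family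
   predicate cuts the i-th axis down to [N i] values. *)
pose P (g : {dffun forall i : 'I_n, 'I_M.+1}) := g \in family (fun i => [pred x : 'I_M.+1 | (x < N i)%N]).
pose F (g : {dffun forall i : 'I_n, 'I_M.+1}) := cube (\row_i (a ord0 i + t * (g i)%:R)) t.
have sub : box a b `<=` \big[setU/set0]_(g in P) F g.
  move=> x xab; rewrite -bigcup_pred.
  pose q i := Num.truncn ((x ord0 i - a ord0 i) / t).
  have xa i : 0 <= (x ord0 i - a ord0 i) / t.
    by rewrite divr_ge0 ?(ltW t0)// subr_ge0; have /andP[] := xab i.
  have qN i : (q i < N i)%N.
    rewrite ltnS; apply: le_truncn; rewrite ler_pM2r ?invr_gt0// lerB//.
    by have /andP[] := xab i.
  have qM i : (q i < M.+1)%N.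
    by rewrite (leq_trans (qN i))// (leq_trans _ (leqnSn _))// /M (bigD1 i)//= leq_maxl.
  exists [ffun i => Ordinal (qM i)].
    by rewrite /= unfold_in; apply/familyP => i; rewrite ffunE inE /= qN.
  move=> i; rewrite !mxE ffunE /=; have /andP[q1 q2] := truncn_itv (xa i).
  rewrite -/(q i) ler_pdivlMr// in q1; rewrite -/(q i) ltr_pdivrMr// in q2.
  apply/andP; split; first by rewrite mulrC; lra.
  rewrite -natr1 in q2; rewrite mulrC; lra.
apply: le_trans (le_outer_measure mu _ _ sub) _.
apply: le_trans (outer_measure_bigU _ _ _ _) _.
apply: (@le_trans _ _ (\sum_(g in P) (k * t ^+ n)%:E)%E).
  by apply: lee_sum => g _; apply: H; rewrite t0 ltW.
rewrite sumEFin lee_fin sumr_const pE -mulr_natl mulrCA ler_wpM2l//.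
have -> : #|P| = (\prod_i N i)%N.
  rewrite /P card_family foldrE big_map big_enum /=; apply: eq_bigr => i _.
  have NM : (N i <= M.+1)%N by rewrite (leq_trans _ (leqnSn _))// /M (bigD1 i)//= leq_maxl.
  rewrite -sum1_card (eq_bigl (fun x : 'I_M.+1 => (x < N i)%N))//.
  by rewrite -(big_ord_widen _ (fun=> 1%N) NM) sum1_card card_ord.
have -> : t ^+ n = \prod_(i < n) t by rewrite prodr_const card_ord.
rewrite natr_prod -big_split /=.
apply: ler_prod => i _; rewrite mulr_ge0 ?(ltW t0)//=.
have := truncn_itv (w0 i) => /andP[+ _]; rewrite ler_pdivlMr// => h.
by rewrite /N -natr1 mulrDl mul1r lerD2r.
Qed.

Lemma outer_le_leb (k rho : R) (A : set V) : 0 <= k -> 0 < rho ->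
  (forall c s, 0 < s <= rho -> (mu (cube c s) <= (k * s ^+ n)%:E)%E) ->
  (mu A <= k%:E * leb_outer A)%E.
Proof.
move=> k0 rho0 H.
have main (a b : nat -> V) : (forall k, box_le (a k) (b k)) ->
   A `<=` \bigcup_k box (a k) (b k) ->
   (mu A <= k%:E * \sum_(0 <= i <oo) (boxvol (a i) (b i))%:E)%E.
  move=> ab Aab; apply: le_trans (le_outer_measure mu _ _ Aab) _.
  apply: le_trans (outer_measure_sigma_subadditive mu _) _.
  rewrite -nneseriesZl//; last first.
    by move=> i _; rewrite lee_fin boxvol_ge0.
  apply: lee_nneseries => [i *|i *]; first exact: outer_measure_ge0.
  by rewrite -EFinM; apply: (outer_box_le k0 rho0).
(* The factor [k = 0] is separated because division by [k] fails: then [mu] vanishes on the boxes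
   with sides from [-j] to [j], and these cover the whole space. *)
rewrite /leb_outer; move: k0; rewrite le_eqVlt => /orP[/eqP k0|k0].
  rewrite -k0 mul0e.
  have := @main (fun j => const_mx (- j%:R)) (fun j => const_mx j%:R).
  rewrite -k0 mul0e; apply.
    by move=> j i; rewrite !mxE; have := ler0n R j; lra.
  move=> x _; exists (Num.truncn `|x|).+1 => // i; rewrite !mxE -ler_norml.
  exact: le_trans (coord_le_norm _ _) (ltW (truncnS_gt _)).
rewrite muleC -lee_pdivrMr//; apply: le_ereal_inf_tmp => _ [a [b [ab Aab ->]]].
by rewrite lee_pdivrMr// muleC; apply: main.
Qed.

End CubeCover.

Section ImageCover.
Variables (R : realType) (n' m' : nat).
Local Notation V := 'rV[R]_n'.+1.

Lemma leb_image_le (f : V -> 'rV[R]_m'.+1) (E A : set V) (k rho : R) :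
  0 <= k -> 0 < rho ->
  (forall c s, 0 < s <= rho ->
    (leb_outer (f @` (E `&` cube c s)) <= (k * s ^+ n'.+1)%:E)%E) ->
  (leb_outer (f @` (E `&` A)) <= k%:E * leb_outer A)%E.
Proof. exact: (@outer_le_leb R n' (leb_image f E)). Qed.

Lemma leb_imageT_le (f : V -> 'rV[R]_m'.+1) (A : set V) (k rho : R) :
  0 <= k -> 0 < rho ->
  (forall c s, 0 < s <= rho ->
    (leb_outer (f @` cube c s) <= (k * s ^+ n'.+1)%:E)%E) ->
  (leb_outer (f @` A) <= k%:E * leb_outer A)%E.
Proof.
move=> k0 r0 H; have := @leb_image_le f setT A k rho k0 r0.
by rewrite setTI; apply => c s cs; rewrite setTI; exact: H.
Qed.

Lemma leb_cube_le (c : V) (s : R) : 0 <= s ->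
  (leb_outer (cube c s) <= (s ^+ n'.+1)%:E)%E.
Proof.
move=> s0; rewrite (le_trans (leb_box_le _))//.
  by move=> i; rewrite !mxE lerDl.
rewrite lee_fin /boxvol (eq_bigr (fun=> s)) ?prodr_const ?card_ord// => i _.
by rewrite !mxE addrAC subrr add0r.
Qed.

End ImageCover.

Section LinearImage.
Variables (R : realType) (n' : nat).
Local Notation n := n'.+1.
Local Notation V := 'rV[R]_n.
Implicit Types (T S : 'M[R]_n) (A : set V) (k l : R).

Definition dilates T k := forall A,
  (leb_outer (mulmxr T @` A) <= k%:E * leb_outer A)%E.

Lemma leb_shift_le (c : V) A : (leb_outer (+%R c @` A) <= leb_outer A)%E.
Proof.
rewrite -[leRHS]mul1e; apply: (@leb_imageT_le R n' n' _ _ 1 1 ler01 ltr01) => x s /andP[s0 _].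
rewrite mul1r; apply: le_trans (leb_cube_le (c + x) (ltW s0)).
by apply: le_outer_measure => _ [y xy <-] i; have := xy i; rewrite !mxE; lra.
Qed.

Lemma leb_shift (c : V) A : leb_outer (+%R c @` A) = leb_outer A.
Proof.
apply/eqP; rewrite eq_le leb_shift_le /=.
rewrite [leLHS](_ : _ = leb_outer (+%R (- c) @` (+%R c @` A))) ?leb_shift_le//.
congr leb_outer; apply/seteqP; split => [x Ax|_ [_ [x Ax <-] <-]].
  by exists (c + x); [exists x|rewrite addKr].
by rewrite addKr.
Qed.

(** The image of a cube of side [s] lies in a box whose i-th side is [s] times the absolute sum of
    column [i]; the corners [u] and [v] collect the negative and the positive parts of the columns.
    For diagonal and permutation matrices this crude factor is already the determinant. *)
Lemma dilates_colsum T : dilates T (\prod_i \sum_j `|T j i|).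
Proof.
move=> A.
have k0 : 0 <= \prod_i \sum_j `|T j i| by apply: prodr_ge0 => i _; exact: sumr_ge0.
apply: (@leb_imageT_le R n' n' _ _ _ 1 k0 ltr01) => c s /andP[s0 _].
pose u : V := c *m T - s *: \row_i \sum_j Num.max 0 (- T j i).
pose v : V := c *m T + s *: \row_i \sum_j Num.max 0 (T j i).
have uv : box_le u v.
  move=> i; rewrite !mxE lerD2l lerNl -subr_ge0 opprK addr_ge0//.
    by rewrite mulr_ge0 ?(ltW s0)// sumr_ge0// => j _; rewrite le_max lexx.
  by rewrite mulr_ge0 ?(ltW s0)// sumr_ge0// => j _; rewrite le_max lexx.
apply: (@le_trans _ _ (leb_outer (box u v))).
  apply: le_outer_measure => _ [y xy <-] i.
  have [z zP ->] : exists2 z : V, (forall i, 0 <= z ord0 i <= 1) & y = c + s *: z.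
    exists (s^-1 *: (y - c)); last by rewrite scalerA divff ?gt_eqF// scale1r addrC subrK.
    move=> j; have /andP[y1 y2] := xy j; move: y1 y2; rewrite !mxE => y1 y2.
    by rewrite mulrC ler_pdivlMr// ler_pdivrMr//; lra.
  rewrite /= mulmxDl -scalemxAl !mxE lerD2l -mulrN; apply/andP; split.
    rewrite ler_pM2l// -sumrN; apply: ler_sum => j _; have /andP[z0 z1] := zP j.
    have [t0|t0] := leP (T j i) 0.
      by rewrite max_r ?oppr_ge0// opprK -{1}(mul1r (T j i)) ler_wnM2r.
    by rewrite max_l ?oppr0 ?mulr_ge0 ?(ltW t0)// oppr_le0 ltW.
  rewrite lerD2l ler_pM2l//; apply: ler_sum => j _; have /andP[z0 z1] := zP j.
  have [t0|t0] := leP (T j i) 0.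
    by rewrite mulr_ge0_le0.
  by rewrite -[leRHS]mul1r ler_wpM2r// ltW.
rewrite (le_trans (leb_box_le uv))// lee_fin le_eqVlt; apply/orP; left; apply/eqP.
have -> : s ^+ n = \prod_(i < n) s by rewrite prodr_const card_ord.
rewrite -big_split /=; apply: eq_bigr => i _; rewrite !mxE.
have aux (x y z : R) : x + y - (x - z) = y + z by ring.
rewrite aux -mulrDr mulrC; congr (_ * _).
rewrite -big_split; apply: eq_bigr => j _ /=.
have [t0|t0] := leP (T j i) 0.
  by rewrite max_r ?oppr_ge0// ler0_norm// add0r.
by rewrite max_l ?oppr_le0 ?ltW// gtr0_norm// addr0.
Qed.

Lemma dilatesM T S k l : 0 <= l -> dilates T k -> dilates S l -> dilates (T *m S) (k * l).
Proof.
move=> l0 Tk Sl A.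
have -> : mulmxr (T *m S) @` A = mulmxr S @` (mulmxr T @` A).
  apply/seteqP; split => [_ [x Ax <-]|_ [_ [x Ax <-] <-]].
    by exists (x *m T); [exists x|rewrite /= mulmxA].
  by exists x => //=; rewrite mulmxA.
apply: le_trans (Sl _) _; rewrite mulrC EFinM -muleA.
by apply: lee_pmul => //; exact: outer_measure_ge0.
Qed.

Lemma dilates_diag (d : V) : dilates (diag_mx d) (\prod_i `|d ord0 i|).
Proof.
have := dilates_colsum (diag_mx d); congr dilates; apply: eq_bigr => i _.
rewrite (bigD1 i)//= !mxE eqxx mulr1n big1 ?addr0// => j ji.
by rewrite !mxE (negbTE ji) mulr0n normr0.
Qed.

Lemma dilates_perm (s : {perm 'I_n}) : dilates (perm_mx s) 1.
Proof.
have := dilates_colsum (perm_mx s); congr dilates; apply: big1 => i _.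
rewrite (bigD1 ((s^-1)%g i))//= !mxE permKV eqxx normr1 big1 ?addr0// => j ji.
rewrite !mxE; case: eqP => [E|_]; last by rewrite normr0.
by move: ji; rewrite -E permK eqxx.
Qed.

(* Conjugating by diag(t^e) scales the off-diagonal entries to 0 as t -> 0. *)
Lemma dilates_triangular T (e : 'I_n -> nat) :
  (forall i j, T i j != 0 -> (i == j) || (e i < e j)%N) ->
  dilates T (\prod_i `|T i i|).
Proof.
move=> Te A.
pose p : {poly R} := \prod_i \sum_j (`|T j i|%:P * 'X^(e i - e j)).
have p0 : p.[0] = \prod_i `|T i i|.
  rewrite horner_prod; apply: eq_bigr => i _; rewrite horner_sum (bigD1 i)//=.
  rewrite subnn expr0 mulr1 hornerC big1 ?addr0// => j ji.
  rewrite hornerM hornerC hornerXn; have [->|Tji] := eqVneq (T j i) 0.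
    by rewrite normr0 mul0r.
  by have := Te _ _ Tji; rewrite (negbTE ji)/= -subn_gt0 => h; rewrite expr0n gtn_eqF ?mulr0.
have key t : 0 < t -> dilates T p.[t].
  move=> t0.
  pose D1 : 'M[R]_n := diag_mx (\row_i t ^+ e i).
  pose D2 : 'M[R]_n := diag_mx (\row_i t ^- e i).
  pose S : 'M[R]_n := \matrix_(i, j) (T i j * t ^+ (e j - e i)).
  have TE : T = D1 *m S *m D2.
    apply/matrixP => i j; rewrite mul_mx_diag mul_diag_mx !mxE.
    have [->|Tij] := eqVneq (T i j) 0; first by rewrite mul0r mulr0 mul0r.
    have le : (e i <= e j)%N by have /orP[/eqP->//|/ltnW] := Te _ _ Tij.
    rewrite mulrCA -exprD subnKC// mulfK//.
    by rewrite expf_neq0// gt_eqF.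
  have pE : p.[t] = (\prod_i `|(\row_i t ^+ e i : V) ord0 i|) *
      (\prod_i \sum_j `|S j i|) * (\prod_i `|(\row_i t ^- e i : V) ord0 i|).
    rewrite -!big_split horner_prod; apply: eq_bigr => i _.
    rewrite !mxE /= mulrAC -normrM divff ?normr1 ?mul1r; last first.
      by rewrite expf_neq0// gt_eqF.
    rewrite horner_sum; apply: eq_bigr => j _.
    by rewrite hornerM hornerC hornerXn mxE normrM (ger0_norm (exprn_ge0 _ (ltW t0))).
  rewrite TE pE; apply: dilatesM; first by apply: prodr_ge0.
    apply: dilatesM; first by apply: prodr_ge0 => i _; exact: sumr_ge0.
      exact: dilates_diag.
    exact: dilates_colsum.
  exact: dilates_diag.
rewrite -p0; have pge0 : 0 <= p.[0] by rewrite p0; apply: prodr_ge0.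
apply: (@leb_imageT_le R n' n' _ _ _ 1 pge0 ltr01) => c s /andP[s0 _].
rewrite -[s ^+ n](hornerC _ 0) -hornerM; apply: (lee_horner_lim ltr01) => t /andP[t0 _].
apply: le_trans (key _ t0 _) _; rewrite hornerM hornerC EFinM.
apply: lee_pmul => //; last exact: leb_cube_le (ltW s0).
  rewrite lee_fin horner_prod; apply: prodr_ge0 => i _.
  rewrite horner_sum; apply: sumr_ge0 => j _.
  by rewrite hornerM hornerC hornerXn mulr_ge0// exprn_ge0// ltW.
exact: outer_measure_ge0.
Qed.

Lemma dilates_lower T : (forall i j : 'I_n, (i < j)%N -> T i j = 0) ->
  dilates T (\prod_i `|T i i|).
Proof.
move=> T0; apply: (@dilates_triangular _ (fun i => n - i)%N) => i j Tij.
have := ltn_ord i; have := ltn_ord j; case: (ltngtP i j) => [/T0 E|ij|/val_inj->].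
- by rewrite E eqxx in Tij.
- by move=> *; apply/orP; right; lia.
- by rewrite eqxx.
Qed.

Lemma dilates_upper T : (forall i j : 'I_n, (j < i)%N -> T i j = 0) ->
  dilates T (\prod_i `|T i i|).
Proof.
move=> T0; apply: (@dilates_triangular _ (fun i => i)%N) => i j Tij.
case: (ltngtP i j) => [ij|/T0 E|/val_inj->].
- by rewrite orbT.
- by rewrite E eqxx in Tij.
- by rewrite eqxx.
Qed.

(** The PLU factorisation leaves permutation and triangular matrices, whose factors are known; the
    diagonal of [L] consists of ones. *)
Theorem dilates_det T : dilates T `|\det T|.
Proof.
have := cormen_lup_correct T; have := cormen_lup_perm T.
have := @cormen_lup_lower _ _ T; have := @cormen_lup_upper _ _ T.
have := cormen_lup_detL T.
case: (cormen_lup T) => -[P L] U /= detL Uup Llow /is_perm_mxP[s ->] E.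
have TE : T = perm_mx (s^-1)%g *m (L *m U).
  rewrite [L *m U](_ : _ = perm_mx s *m T); last exact: esym E.
  by rewrite mulmxA -perm_mxM mulVg perm_mx1 mul1mx.
have detU : \det U = \prod_i U i i.
  rewrite -det_tr det_trig; first by apply: eq_bigr => i _; rewrite mxE.
  by apply/is_trig_mxP => i j ij; rewrite mxE Uup.
have -> : `|\det T| = 1 * ((\prod_i `|L i i|) * \prod_i `|U i i|).
  rewrite TE !det_mulmx detL det_perm mul1r normrM normr_sign mul1r.
  rewrite [X in _ = X * _]big1 ?mul1r ?detU ?normr_prod// => i _.
  by rewrite Llow// eqxx normr1.
rewrite TE; apply: dilatesM; first by rewrite mulr_ge0// prodr_ge0.
  exact: dilates_perm.
apply: dilatesM; first exact: prodr_ge0.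
  apply: dilates_lower => i j ij; rewrite Llow ?(ltnW ij)//.
  by rewrite -val_eqE/= ltn_eqF.
by apply: dilates_upper => i j ij; exact: Uup.
Qed.

(** The inequality for [T] and the one for its inverse together give equality. *)
Lemma leb_mulmx T A : T \in unitmx ->
  leb_outer (mulmxr T @` A) = (`|\det T|%:E * leb_outer A)%E.
Proof.
move=> Tu; apply/eqP; rewrite eq_le dilates_det /=.
have dT : 0 < `|\det T| by rewrite normr_gt0 -unitfE -unitmxE.
have := dilates_det (invmx T) (mulmxr T @` A).
have -> : mulmxr (invmx T) @` (mulmxr T @` A) = A.
  apply/seteqP; split => [_ [_ [x Ax <-] <-]|x Ax] /=; first by rewrite mulmxK.
  by exists (x *m T); [exists x|rewrite mulmxK].
rewrite det_inv normrV ?unitfE -?normr_gt0// => H.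
apply: (@le_trans _ _ (`|\det T|%:E * ((`|\det T|^-1)%:E * leb_outer (mulmxr T @` A)))%E).
  by rewrite lee_pmul2l// ?lte_fin.
by rewrite muleA -EFinM divff ?mul1e// gt_eqF.
Qed.

Lemma leb_scale (t : R) A : 0 < t ->
  leb_outer ( *:%R t @` A) = ((t ^+ n)%:E * leb_outer A)%E.
Proof.
move=> t0; have := @leb_mulmx t%:M A.
rewrite det_scalar unitmxE det_scalar unitfE expf_neq0 ?gt_eqF// => /(_ isT).
rewrite gtr0_norm ?exprn_gt0// => <-; congr leb_outer.
by apply: eq_imagel => x _; rewrite /= mul_mx_scalar.
Qed.

End LinearImage.

(** * Volume of boxes and outer regularity *)

Section OpenBoxes.
Variables (R : realType) (n' : nat).
Local Notation n := n'.+1.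
Local Notation V := 'rV[R]_n.
Implicit Types (A : set V).

Lemma horner_lim_le (p : {poly R}) (e : R) : 0 < e ->
  exists2 t : R, 0 < t & p.[t] <= p.[0] + e.
Proof.
move=> e0; apply: contrapT => H.
have : p.[0] + e <= p.[0].
  apply: (@horner_ge_lim R p _ 1 ltr01) => t /andP[t0 _].
  by rewrite leNgt; apply/negP => h; apply: H; exists t => //; exact: ltW.
by rewrite leNgt ltrDl e0.
Qed.

Lemma open_enormP A :
  open A <-> (forall x, A x -> exists2 e : R, 0 < e & forall y, enorm (y - x) < e -> A y).
Proof.
rewrite openE; split => H x Ax; first by apply/enorm_nbhs; exact: H.
by apply/enorm_nbhs; exact: H.
Qed.

Definition obox (a b : V) : set V :=
  [set x | forall i, a ord0 i < x ord0 i < b ord0 i].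

Lemma open_obox (a b : V) : open (obox a b).
Proof.
rewrite openE => x xab; rewrite /interior; 
apply: (@filter_forall _ _ (fun i (y : V) => is_true (a ord0 i < y ord0 i < b ord0 i)) (nbhs x)) => i.
have /andP[ax xb] := xab i.
apply/enorm_nbhs; exists (Num.min (x ord0 i - a ord0 i) (b ord0 i - x ord0 i)).
  by rewrite lt_min !subr_gt0 ax.
move=> y; rewrite lt_min => /andP[h1 h2].
have := ler_coord_enorm (y - x) i; rewrite !mxE ler_norml => /andP[h3 h4].
by apply/andP; split; lra.
Qed.

Lemma compact_box (a b : V) : compact (box a b).
Proof.
have -> : box a b = [set v : V | forall i, `[a ord0 i, b ord0 i]%classic (v ord0 i)].
  by apply/seteqP; split => x H i; have := H i; rewrite /= in_itv.
apply: (@rV_compact _ _ (fun i => `[a ord0 i, b ord0 i]%classic)) => i.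
exact: segment_compact.
Qed.

Lemma open_box_cover A (e : R) : (leb_outer A < +oo)%E -> 0 < e ->
  exists a b : nat -> V, [/\ forall k, box_le (a k) (b k),
    A `<=` \bigcup_k obox (a k) (b k) &
    (\sum_(0 <= k <oo) (boxvol (a k) (b k))%:E <= leb_outer A + e%:E)%E].
Proof.
move=> Afin e0.
have Afn : leb_outer A \is a fin_num by rewrite ge0_fin_numE// outer_measure_ge0.
have e20 : 0 < e / 2 by rewrite divr_gt0.
have [_ [a [b [ab Aab ->]]] H] := lb_ereal_inf_adherent e20 Afn.
(* Volume of the k-th box with each side extended by the variable at both ends. A small enough
   extension costs at most a geometric share of [e / 2]. *)
pose p k : {poly R} := \prod_i ((b k ord0 i - a k ord0 i)%:P + 2 *: 'X).
have pE k t : (p k).[t] = boxvol (a k - const_mx t) (b k + const_mx t).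
  rewrite horner_prod; apply: eq_bigr => i _; rewrite !hornerE !mxE; ring.
have /choice[t tP] : forall k, exists t : R, 0 < t /\
    (p k).[t] <= boxvol (a k) (b k) + e / 2 / (2 ^ k.+1)%:R.
  move=> k; have ek : 0 < e / 2 / (2 ^ k.+1)%:R by rewrite divr_gt0// ltr0n expn_gt0.
  have [t t0 pt] := horner_lim_le (p k) ek; exists t; split => //.
  apply: (le_trans pt); rewrite lerD2r pE le_eqVlt; apply/orP; left; apply/eqP.
  by congr boxvol; apply/rowP => i; rewrite !mxE ?subr0 ?addr0.
exists (fun k => a k - const_mx (t k)), (fun k => b k + const_mx (t k)).
split.
- move=> k i; have [t0 _] := tP k; have := ab k i; rewrite !mxE; lra.
- move=> x /Aab [k _ xk]; exists k => // i; have [t0 _] := tP k.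
  by have := xk i; rewrite !mxE; lra.
- apply: (@le_trans _ _ (\sum_(0 <= k <oo) ((boxvol (a k) (b k))%:E + (e / 2 / (2 ^ k.+1)%:R)%:E))%E).
    apply: lee_nneseries => k *; have [t0 pt] := tP k.
      rewrite lee_fin boxvol_ge0// => i; have := ab k i; rewrite !mxE; lra.
    by rewrite -EFinD lee_fin -pE.
  apply: le_trans (epsilon_trick _ _ (ltW e20)) _.
    by move=> k; rewrite lee_fin boxvol_ge0//; exact: ab.
  rewrite {2}(splitr e) EFinD addeA; apply: leeD2r; exact: ltW.
Qed.

Lemma leb_open_hull A (e : R) : (leb_outer A < +oo)%E -> 0 < e ->
  exists U, [/\ open U, A `<=` U & (leb_outer U <= leb_outer A + e%:E)%E].
Proof.
move=> Afin e0; have [a [b [ab Aab H]]] := open_box_cover Afin e0.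
exists (\bigcup_k obox (a k) (b k)); split => //.
  by apply: bigcup_open => k _; exact: open_obox.
apply: le_trans H; apply: ereal_inf_lbound; exists a, b; split => // x [k _ xk].
by exists k => // i; have /andP[/ltW -> /ltW ->] := xk i.
Qed.

Lemma count_interval_le (M : nat) (u v : R) : u <= v ->
  \sum_(x < M) ((u <= x%:R <= v)%R : nat)%:R <= v - u + 1 :> R.
Proof.
move=> uv.
(* The second bound carries the induction: once the last integer [M] lies in the interval, the
   previous ones number at most [M - u], and [M <= v]. *)
suff [//] : \sum_(x < M) ((u <= x%:R <= v)%R : nat)%:R <= v - u + 1 :> R /\
  \sum_(x < M) ((u <= x%:R <= v)%R : nat)%:R <= Num.max 0 (M%:R - u) :> R.
elim: M => [|M [IH1 IH2]]; first by rewrite big_ord0 le_max lexx; split => //; lra.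
rewrite big_ord_recr /=; case: (boolP (u <= M%:R <= v)) => [/andP[h1 h2]|_]; last first.
  rewrite addr0; split => //; apply: (le_trans IH2).
  by rewrite ge_max !le_max lexx /= -natr1; apply/orP; right; lra.
have {}IH2 : \sum_(x < M) ((u <= x%:R <= v)%R : nat)%:R <= M%:R - u :> R.
  by rewrite max_r ?subr_ge0// in IH2.
rewrite (_ : (true : nat)%:R = 1 :> R)//; split; first by lra.
by rewrite le_max; apply/orP; right; rewrite -[M.+1%:R]natr1; lra.
Qed.

(* Counting points of the lattice t Z^n inside the boxes, then t -> 0. *)
Lemma boxvol_finite_cover (a b : V) (I : eqType) (r : seq I) (c d : I -> V) :
  box_le a b -> (forall k, box_le (c k) (d k)) ->
  box a b `<=` [set x | exists2 k, k \in r & box (c k) (d k) x] ->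
  boxvol a b <= \sum_(k <- r) boxvol (c k) (d k).
Proof.
move=> ab cd cover.
pose p : {poly R} := \sum_(k <- r) \prod_i ((d k ord0 i - c k ord0 i)%:P + 'X).
have pE t : p.[t] = \sum_(k <- r) \prod_i (d k ord0 i - c k ord0 i + t).
  rewrite horner_sum; apply: eq_bigr => k _; rewrite horner_prod.
  by apply: eq_bigr => i _; rewrite !hornerE.
have -> : \sum_(k <- r) boxvol (c k) (d k) = p.[0].
  by rewrite pE; apply: eq_bigr => k _; apply: eq_bigr => i _; rewrite addr0.
apply: (horner_ge_lim ltr01) => t /andP[t0 _].
pose w i := (b ord0 i - a ord0 i) / t.
have w0 i : 0 <= w i by rewrite divr_ge0 ?(ltW t0)// subr_ge0.
pose N i := (Num.truncn (w i)).+1.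
pose M := \max_i N i.
have NM i : (N i <= M)%N by rewrite /M (bigD1 i)//= leq_maxl.
pose q i (x : 'I_M) : R := ((x < N i)%N : nat)%:R.
pose z k i (x : 'I_M) : R :=
  (((c k ord0 i - a ord0 i) / t <= x%:R <= (d k ord0 i - a ord0 i) / t)%R : nat)%:R.
have main : \prod_i \sum_(x < M) q i x <= \sum_(k <- r) \prod_i \sum_(x < M) z k i x.
  have E k : \prod_i \sum_(x < M) z k i x =
      \sum_(g : {ffun 'I_n -> 'I_M}) \prod_i z k i (g i) by rewrite bigA_distr_bigA.
  rewrite (eq_bigr _ (fun k _ => E k)) bigA_distr_bigA /=.
  rewrite exchange_big /=; apply: ler_sum => g _.
  have [/forallP gN|] := boolP [forall i, (g i < N i)%N]; last first.
    rewrite negb_forall => /existsP [i gi]; rewrite (bigD1 i)//= /q (negbTE gi) mul0r.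
    by apply: sumr_ge0 => k _; apply: prodr_ge0 => j _; rewrite /z; case: (_ <= _ <= _).
  pose x : V := \row_i (a ord0 i + t * (g i)%:R).
  have [|k kr xk] := cover x.
    move=> i; rewrite !mxE lerDl mulr_ge0 ?(ltW t0)//= -lerBrDl mulrC -ler_pdivlMr//.
    apply: le_trans (_ : (Num.truncn (w i))%:R <= _); first by rewrite ler_nat -ltnS; exact: gN.
    by have /andP[] := truncn_itv (w0 i).
  rewrite (big_rem k)//= ler_wpDr//.
    by apply: sumr_ge0 => j _; apply: prodr_ge0 => i _; rewrite /z; case: (_ <= _ <= _).
  apply: ler_prod => i _; rewrite /q gN ler01 /= /z.
  have /andP[] := xk i; rewrite !mxE => x1 x2.
  rewrite ler_pdivrMr// ler_pdivlMr//.
  by rewrite (_ : _ && _ = true)//; apply/andP; split; rewrite mulrC; lra.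
have tn0 : 0 < \prod_(i < n) t by rewrite prodr_gt0.
apply: (@le_trans _ _ ((\prod_(i < n) t) * \prod_i \sum_(x < M) q i x)).
  rewrite -big_split; apply: ler_prod => i _ /=; rewrite subr_ge0 ab /=.
  have -> : \sum_(x < M) q i x = (N i)%:R.
    rewrite -(natr_sum _ _ xpredT (fun x : 'I_M => ((x < N i)%N : nat))) -big_mkcond /=.
    by rewrite -(big_ord_widen _ (fun=> 1%N) (NM i)) sum1_card card_ord.
  rewrite mulrC -ler_pdivrMr// ltW//; exact: truncnS_gt.
apply: (@le_trans _ _ ((\prod_(i < n) t) * \sum_(k <- r) \prod_i \sum_(x < M) z k i x)).
  by rewrite ler_pM2l.
rewrite pE mulr_sumr; apply: ler_sum => k _; rewrite -big_split.
apply: ler_prod => i _ /=; apply/andP; split.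
  by rewrite mulr_ge0 ?(ltW t0)// sumr_ge0// => x _; rewrite /z; case: (_ <= _ <= _).
rewrite mulrC -ler_pdivlMr//.
apply: le_trans (count_interval_le _ _) _.
  by rewrite ler_pM2r ?invr_gt0// lerD2r; exact: cd.
rewrite le_eqVlt; apply/orP; left; apply/eqP; field; exact: lt0r_neq0.
Qed.

(** Compactness turns a covering by slightly enlarged open boxes into a finite one, to which lattice
    counting applies. *)
Lemma leb_box (a b : V) : box_le a b -> leb_outer (box a b) = (boxvol a b)%:E.
Proof.
move=> ab; apply/eqP; rewrite eq_le leb_box_le//=.
have fin : (leb_outer (box a b) < +oo)%E.
  by rewrite (le_lt_trans (leb_box_le ab))// ltry.
apply/lee_addgt0Pr => e e0.
have [c [d [cd Acd H]]] := open_box_cover fin e0.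
apply: le_trans H.
have := @compact_box a b; rewrite compact_cover => /(_ nat setT (fun k => obox (c k) (d k))).
case=> [k _|//|D _ Dcov]; first exact: open_obox.
have /(boxvol_finite_cover ab cd) : box a b `<=`
    [set x | exists2 k, k \in finmap.enum_fset D & box (c k) (d k) x].
  move=> x /Dcov [k kD xk]; exists k => // i; have /andP[/ltW -> /ltW ->] := xk i.
  by [].
rewrite -lee_fin => /le_trans; apply.
have D0 k : (0 <= (boxvol (c k) (d k))%:E)%E by rewrite lee_fin boxvol_ge0.
rewrite -sumEFin.
pose m := (\max_(k <- finmap.enum_fset D) k).+1.
apply: (@le_trans _ _ (\sum_(k < m) (boxvol (c k) (d k))%:E)%E).
  rewrite -(big_mkord xpredT (fun k => (boxvol (c k) (d k))%:E)).
  rewrite [leRHS](bigID (mem (finmap.enum_fset D)))/= -[leLHS]adde0.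
  apply: leeD; last by apply: sume_ge0.
  rewrite le_eqVlt; apply/orP; left; apply/eqP.
  rewrite -[RHS]big_filter; apply: perm_big; apply: uniq_perm => //.
  - exact: finmap.fset_uniq.
  - by rewrite filter_uniq// iota_uniq.
  - move=> k; rewrite mem_filter mem_index_iota /=.
    case: (boolP (k \in _)) => //= kD.
    by rewrite /m ltnS; apply/esym; apply: (leq_bigmax_seq k).
rewrite (nneseries_split 0 m)// add0n big_mkord leeDl//.
by apply: nneseries_ge0.
Qed.

Lemma leb_cube (c : V) (s : R) : 0 <= s -> leb_outer (cube c s) = (s ^+ n)%:E.
Proof.
move=> s0; rewrite leb_box; last by move=> i; rewrite !mxE lerDl.
rewrite /boxvol (eq_bigr (fun=> s)) ?prodr_const ?card_ord// => i _.
by rewrite !mxE addrAC subrr add0r.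
Qed.

End OpenBoxes.

(** * Borel sets, continuity and regularity of the outer measure *)

Section BorelLebesgue.
Variables (R : realType) (n' : nat).
Local Notation n := n'.+1.
Local Notation V := 'rV[R]_n.
Implicit Types (A B X : set V).
Local Notation leb := (@leb_outer R n).
Local Notation U := (caratheodory_type leb).

Definition halfspace (i : 'I_n) (c : R) : set V := [set x | x ord0 i <= c].

Definition upd (x : V) (i : 'I_n) (m : R) : V :=
  \row_k if k == i then m else x ord0 k.

Lemma boxvol_split (a b : V) (i : 'I_n) (m : R) :
  boxvol a (upd b i m) + boxvol (upd a i m) b = boxvol a b.
Proof.
rewrite /boxvol (bigD1 i)//= [X in _ + X](bigD1 i)//= [RHS](bigD1 i)//= !mxE eqxx.
rewrite [X in _ * X + _](eq_bigr (fun k => b ord0 k - a ord0 k)); last first.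
  by move=> k /negbTE ki; rewrite mxE ki.
rewrite [X in _ + _ * X](eq_bigr (fun k => b ord0 k - a ord0 k)); last first.
  by move=> k /negbTE ki; rewrite mxE ki.
by rewrite -mulrDl addrC addrA subrK.
Qed.

(** Each box of a covering is cut along the hyperplane and the two volumes add up. The value [m k]
    is [c] clamped to the i-th side, so that both halves are boxes even when the hyperplane misses
    the box. *)
Lemma caratheodory_halfspace i c : leb.-caratheodory (halfspace i c).
Proof.
apply: le_caratheodory_measurable => X.
rewrite /= [leRHS]/leb_outer; apply: le_ereal_inf_tmp => _ [a [b [ab Xab ->]]].
pose m k := Num.max (a k ord0 i) (Num.min (b k ord0 i) c).
have am k : a k ord0 i <= m k by rewrite le_max lexx.
have mb k : m k <= b k ord0 i by rewrite ge_max ab ge_min lexx.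
have le1 k : box_le (a k) (upd (b k) i (m k)).
  by move=> l; rewrite mxE; case: eqP => [->|_]; rewrite ?am ?ab.
have le2 k : box_le (upd (a k) i (m k)) (b k).
  by move=> l; rewrite mxE; case: eqP => [->|_]; rewrite ?mb ?ab.
apply: (@le_trans _ _ (\sum_(0 <= k <oo) (boxvol (a k) (upd (b k) i (m k)))%:E +
    \sum_(0 <= k <oo) (boxvol (upd (a k) i (m k)) (b k))%:E)%E); last first.
  rewrite -nneseriesD; last 2 first.
  - by move=> k *; rewrite lee_fin boxvol_ge0.
  - by move=> k *; rewrite lee_fin boxvol_ge0.
  rewrite le_eqVlt; apply/orP; left; apply/eqP; apply: eq_eseriesr => k _.
  by rewrite -EFinD boxvol_split.
apply: leeD; apply: ereal_inf_lbound.
  exists a, (fun k => upd (b k) i (m k)); split => //.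
  move=> x [/Xab [k _ xk] /= xc]; exists k => // l; rewrite mxE.
  have /andP[h1 h2] := xk l; rewrite h1 /=; case: eqP => // li.
  by rewrite le_max le_min -{2}li h2 li xc orbT.
exists (fun k => upd (a k) i (m k)), b; split => //.
move=> x [/Xab [k _ xk] /= /negP]; rewrite -ltNge => xc; exists k => // l; rewrite mxE.
have /andP[h1 h2] := xk l; rewrite h2 andbT; case: eqP => // li.
by rewrite ge_max -{1}li h1 ge_min li (ltW xc) orbT.
Qed.

(** An open set is a countable union of half-open boxes with rational corners, and these are
    intersections of half-spaces and complements of half-spaces. *)
Lemma caratheodory_open A : open A -> leb.-caratheodory A.
Proof.
move=> /open_enormP oA.
pose hb (p : 'rV[rat]_n * 'rV[rat]_n) : set V :=
  [set x | forall i, ratr (p.1 ord0 i) < x ord0 i <= ratr (p.2 ord0 i)].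
have mhb p : leb.-caratheodory (hb p).
  have -> : hb p = \big[setI/setT]_(i <- enum 'I_n)
     (halfspace i (ratr (p.2 ord0 i)) `&` ~` halfspace i (ratr (p.1 ord0 i))).
    rewrite -bigcap_seq; apply/seteqP; split => x H.
      move=> i _; have /andP[h1 h2] := H i; split => //=.
      by apply/negP; rewrite -ltNge.
    move=> i; have [|h1 /= /negP] := H i; first by rewrite /= mem_enum.
    by rewrite -ltNge => ->.
  elim/big_ind : _ => [|C D mC mD|i _].
  - by rewrite -setC0; apply/caratheodory_measurable_setC/caratheodory_measurable_set0.
  - exact: caratheodory_measurable_setI.
  - apply: caratheodory_measurable_setI; first exact: caratheodory_halfspace.
    by apply/caratheodory_measurable_setC/caratheodory_halfspace.
pose F k := if unpickle k is Some p then (if pselect (hb p `<=` A) then hb p else set0) else set0.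
have -> : A = \bigcup_k F k.
  apply/seteqP; split => [x Ax|x [k _]]; last first.
    rewrite /F; case: unpickle => [p|//]; case: pselect => [h|//]; exact: h.
  have [e e0 eA] := oA _ Ax.
  have d0 : 0 < e / n.+1%:R by rewrite divr_gt0.
  have /choice[q qP] : forall i, exists q : rat, x ord0 i - e / n.+1%:R < ratr q < x ord0 i.
    move=> i; have /rat_in_itvoo[q] : x ord0 i - e / n.+1%:R < x ord0 i by rewrite ltrBlDr ltrDl.
    by rewrite in_itv /= => ?; exists q.
  have /choice[r rP] : forall i, exists q : rat, x ord0 i < ratr q < x ord0 i + e / n.+1%:R.
    move=> i; have /rat_in_itvoo[r] : x ord0 i < x ord0 i + e / n.+1%:R by rewrite ltrDl.
    by rewrite in_itv /= => ?; exists r.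
  exists (pickle (\row_i q i, \row_i r i)) => //.
  rewrite /F pickleK; case: pselect => [h|nh] /=.
    move=> i; rewrite !mxE; have := qP i; have := rP i; lra.
  exfalso; apply: nh => y yh; apply: eA; apply: (@le_lt_trans _ _ (n%:R * (e / n.+1%:R))).
    apply: enorm_le_coord; first exact: ltW.
    move=> i; rewrite !mxE ler_norml; have := yh i; rewrite /= !mxE.
    by have := qP i; have := rP i; move: (e / _) => d; lra.
  by rewrite mulrCA -[ltRHS]mulr1 ltr_pM2l// ltr_pdivrMr// mul1r ltr_nat.
apply: caratheodory_measurable_bigcup => k; rewrite /F.
case: unpickle => [p|]; last exact: caratheodory_measurable_set0.
by case: pselect => h /=; [exact: mhb|exact: caratheodory_measurable_set0].
Qed.

Lemma caratheodory_borel A : borel A -> leb.-caratheodory A.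
Proof.
apply: (smallest_sub (C := sigma_algebra setT)); last exact: caratheodory_open.
split.
- exact: caratheodory_measurable_set0.
- by move=> B mB; rewrite setTD; exact: caratheodory_measurable_setC.
- by move=> F mF; exact: caratheodory_measurable_bigcup.
Qed.

(** On this space [leb_outer] is a measure, which makes continuity along monotone sequences
    available. *)
Definition borel_space := g_sigma_algebraType (@open V).

HB.instance Definition _ := Measurable.on borel_space.

Definition lebm (A : set borel_space) : \bar R := leb A.

Lemma lebm0 : lebm set0 = 0%E. Proof. exact: outer_measure0. Qed.

Lemma lebm_ge0 A : (0 <= lebm A)%E. Proof. exact: outer_measure_ge0. Qed.

Lemma lebm_semi_sigma_additive : semi_sigma_additive lebm.
Proof.
move=> F mF tF mUF.
apply: (@caratheodory_measure_sigma_additive R V leb F) => //.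
  by move=> i; apply: caratheodory_borel; exact: mF.
by apply: caratheodory_borel; exact: mUF.
Qed.

HB.instance Definition _ := isMeasure.Build _ borel_space R lebm
  lebm0 lebm_ge0 lebm_semi_sigma_additive.

Lemma leb_split A X : borel A -> (leb X = leb (X `&` A) + leb (X `&` ~` A))%E.
Proof. by move=> /caratheodory_borel; exact. Qed.

Lemma borel_open A : open A -> borel A.
Proof. by move=> oA; exact: sub_gen_smallest. Qed.

Lemma borelE A : borel A = measurable (A : set borel_space).
Proof. by []. Qed.

Lemma borelC A : borel A -> borel (~` A).
Proof. by rewrite !borelE; exact: measurableC. Qed.

Lemma borel_closed A : closed A -> borel A.
Proof. by move=> cA; rewrite -(setCK A); exact: (borelC (borel_open (closed_openC cA))). Qed.

Lemma borelI A B : borel A -> borel B -> borel (A `&` B).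
Proof. by rewrite !borelE; exact: measurableI. Qed.

Lemma borelD A B : borel A -> borel B -> borel (A `\` B).
Proof. by rewrite !borelE; exact: measurableD. Qed.

Lemma borel_bigcap (F : nat -> set V) : (forall k, borel (F k)) -> borel (\bigcap_k F k).
Proof. by move=> H; exact: (@bigcapT_measurable _ borel_space F H). Qed.

Lemma borel_bigcup (F : nat -> set V) : (forall k, borel (F k)) -> borel (\bigcup_k F k).
Proof. by move=> H; exact: (@bigcupT_measurable _ borel_space F H). Qed.

Lemma borel_hull A : (leb A < +oo)%E ->
  exists H, [/\ borel H, A `<=` H & leb H = leb A].
Proof.
move=> Afin.
have /choice[W OP] : forall k, exists W, [/\ open W, A `<=` W &
    (leb W <= leb A + (k.+1%:R^-1)%:E)%E].
  by move=> k; apply: leb_open_hull.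
exists (\bigcap_k W k); split.
- by apply: borel_bigcap => k; apply: borel_open; have [] := OP k.
- by move=> x Ax k _; have [_ + _] := OP k; exact.
- apply/eqP; rewrite eq_le; apply/andP; split; last first.
    by apply: le_outer_measure => x Ax k _; have [_ + _] := OP k; exact.
  apply/lee_addgt0Pr => e e0; have [_ _ H] := OP (Num.truncn (e^-1)).
  apply: (@le_trans _ _ (leb (W (Num.truncn (e^-1))))).
    by apply: le_outer_measure; apply: bigcap_inf.
  apply: (le_trans H); apply: leeD2l; rewrite lee_fin.
  rewrite -[leRHS]invrK lef_pV2 ?posrE ?invr_gt0//.
  exact/ltW/truncnS_gt.
Qed.

(** No measurability is assumed: each set is replaced by a Borel hull of equal measure, and
    intersecting all later hulls restores monotonicity. This is what allows decompositions by the
    radius on which an expansion is valid. *)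
Lemma leb_bigcup_nondecreasing (F : nat -> set V) (M : \bar R) :
  (forall i j, (i <= j)%N -> F i `<=` F j) ->
  (forall k, (leb (F k) <= M)%E) -> (leb (\bigcup_k F k) <= M)%E.
Proof.
move=> Fnd FM; have [->|Mfin] := eqVneq M +oo%E; first exact: leey.
have Ffin k : (leb (F k) < +oo)%E by rewrite (le_lt_trans (FM k))// ltey.
have /choice[H HP] := fun k => borel_hull (Ffin k).
pose C k : set borel_space := \bigcap_i H (k + i)%N.
have mC k : measurable (C k).
  by apply: borel_bigcap => i; have [] := HP (k + i)%N.
have FC k : F k `<=` C k.
  move=> x Fx i _; have [_ + _] := HP (k + i)%N; apply.
  by apply: Fnd Fx; exact: leq_addr.
have Cnd : {homo C : i j / (i <= j)%N >-> (i <= j)%O}.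
  move=> i j ij; apply/subsetPset => x Cx k _.
  by rewrite -(subnKC ij) -addnA; exact: Cx.
have cv := @nondecreasing_cvg_mu _ _ _ (lebm : {measure set borel_space -> \bar R})
  C mC (bigcupT_measurable _ mC) Cnd.
apply: (@le_trans _ _ (lebm (\bigcup_k C k))).
  by apply: le_outer_measure => x [k _ Fx]; exists k => //; exact: FC.
rewrite -(cvg_lim _ cv)//; apply: lime_le; first by apply/cvg_ex; eexists; exact: cv.
apply: nearW => k /=; apply: le_trans (FM k).
have [_ _ <-] := HP k; apply: le_outer_measure => x /(_ 0%N Logic.I).
by rewrite addn0.
Qed.

Lemma leb_bounded A (a b : V) : A `<=` box a b -> (leb A < +oo)%E.
Proof.
move=> Ab; have [ab|nab] := pselect (box_le a b).
  by rewrite (le_lt_trans (le_leb_outer Ab))// leb_box// ltry.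
rewrite (_ : A = set0) ?outer_measure0 ?ltry//.
apply/seteqP; split => // x /Ab xab; apply: nab => i.
by have /andP[h1 h2] := xab i; exact: le_trans h1 h2.
Qed.

Lemma closed_box (a b : V) : closed (box a b).
Proof. apply: compact_closed; [exact: norm_hausdorff|exact: compact_box]. Qed.

(** The compact set is the box minus an open set that covers, with small excess, the complement of
    [A] in the box. *)
Lemma leb_inner_regular A (a b : V) (e : R) : borel A -> A `<=` box a b -> 0 < e ->
  exists K, [/\ compact K, K `<=` A & (leb A <= leb K + e%:E)%E].
Proof.
move=> bA Aab e0.
have Dfin : (leb (box a b `\` A) < +oo)%E by apply: (@leb_bounded _ a b) => x [].
have [W [oO DO HO]] := leb_open_hull Dfin e0.
exists (box a b `&` ~` W).
have KA : box a b `&` ~` W `<=` A.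
  by move=> x [xb xO]; apply: contrapT => nA; apply: xO; apply: DO.
split => //.
  apply: subclosed_compact (@compact_box R n' a b) _; last by move=> x [].
  by apply: closedI; [exact: closed_box|exact: open_closedC].
rewrite (leb_split A (borel_closed (open_closedC oO))) setCK.
have AO : (leb (A `&` W) <= e%:E)%E.
  have Dn : leb (box a b `\` A) \is a fin_num by rewrite ge0_fin_numE// outer_measure_ge0.
  rewrite -(leeD2lE _ _ Dn); apply: le_trans HO.
  rewrite (leb_split W bA) [leRHS]addeC setIC; apply: leeD2r.
  by apply: le_outer_measure => x [xb nA]; split => //; apply: DO.
apply: leeD => //; apply: le_outer_measure => x [Ax nO]; split => //; exact: Aab.
Qed.

End BorelLebesgue.

(** * Nearest points and support functions *)

Section Projection.
Variables (R : realType) (n : nat).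
Local Notation V := 'rV[R]_n.
Implicit Types (K L : set V) (x y z : V).

(** Empty interior is allowed, so that segments, hulls of finitely many points, the origin and
    projections to a hyperplane are included. *)
Definition ccv K := [/\ compact K, convex_set_rV K & K !=set0].

Definition proj K x : V :=
  get [set y | K y /\ forall z, K z -> enorm (x - y) <= enorm (x - z)].

(** The outer normal at the nearest point, with length the distance to [K]; local parallel sets are
    preimages of cones under this map. *)
Definition psi K x : V := x - proj K x.

Lemma dotp_continuous x : continuous (dotp x : V -> R).
Proof.
move=> y A /nbhs_normP [e /= e0 eA]; apply/enorm_nbhs.
exists (e / (enorm x + 1)); first by rewrite divr_gt0// ltr_wpDl// enorm_ge0.
move=> z; rewrite ltr_pdivlMr ?ltr_wpDl ?enorm_ge0// => zy; apply: eA.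
rewrite /= -dotpBr; apply: le_lt_trans (CauchySchwarz _ _) _.
apply: le_lt_trans zy; rewrite enormBC mulrC ler_wpM2l ?enorm_ge0//.
by rewrite lerDl.
Qed.

Lemma projP K x : ccv K ->
  K (proj K x) /\ forall z, K z -> enorm (x - proj K x) <= enorm (x - z).
Proof.
move=> [cK _ K0].
suff /getPex[] : exists y, [set y | K y /\ forall z, K z -> enorm (x - y) <= enorm (x - z)] y by [].
have cf : {within K, continuous (fun y : V => enorm (x - y))}.
  apply: continuous_subspaceT => y; apply: (@continuous_comp _ _ _ (fun y : V => x - y)).
    apply: (@lipschitz_continuous R n n _ 1) => u v.
    by rewrite mul1r opprD opprK addrACA subrr add0r addrC enormBC.
  exact: enorm_continuous.
have [c /set_mem Kc cP] := EVT_min_rV K0 cK cf.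
by exists c; split => // z Kz; apply: cP; exact: mem_set.
Qed.

(** Moving from the nearest point a little towards [z] cannot shorten the distance to [x]; the
    first-order term in the step [t] gives the sign. *)
Lemma proj_var K x z : ccv K -> K z -> dotp (z - proj K x) (psi K x) <= 0.
Proof.
move=> cK Kz; have [Kp pmin] := projP x cK; have [_ cv _] := cK.
set p := proj K x in Kp pmin *.
have H (t : R) : 0 < t <= 1 -> 2 * dotp (z - p) (x - p) <= t * dotp (z - p) (z - p).
  move=> /andP[t0 t1].
  have := pmin _ (cv _ _ t Kz Kp _); rewrite t1 ltW// => /(_ isT).
  rewrite -(ler_pXn2r (_ : (0 < 2)%N))// ?nnegrE ?enorm_ge0// !sqr_enorm.
  have -> : x - (t *: z + (1 - t) *: p) = (x - p) - t *: (z - p).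
    by apply/rowP => i; rewrite !mxE; ring.
  move: (x - p) (z - p) => u v.
  rewrite [leRHS]dotpBl !dotpBr !dotpZl !dotpZr (dotpC u v) => h.
  by rewrite -(ler_pM2l t0); lra.
rewrite leNgt; apply/negP => d0.
have D0 : 0 < dotp (z - p) (z - p).
  rewrite lt0r dotp_ge0 andbT dotp_eq0; apply/eqP => E.
  by move: d0; rewrite /psi -/p E dotp0l ltxx.
set d := dotp (z - p) (psi K x) in d0; set D := dotp (z - p) (z - p) in D0 H.
have t01 : 0 < Num.min 1 (d / D) <= 1 by rewrite lt_min ltr01 divr_gt0//= ge_min lexx.
have := H _ t01; rewrite -/(psi K x) -/d => h.
have : Num.min 1 (d / D) * D <= d.
  by rewrite -ler_pdivlMr// ge_min lexx orbT.
lra.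
Qed.

Lemma proj_uniq K x y : ccv K -> K y ->
  (forall z, K z -> dotp (z - y) (x - y) <= 0) -> proj K x = y.
Proof.
move=> cK Ky H; have [Kp _] := projP x cK.
have h1 := H _ Kp; have h2 := proj_var x cK Ky.
apply/eqP; rewrite -subr_eq0 -dotp_eq0 eq_le dotp_ge0 andbT.
have -> : dotp (proj K x - y) (proj K x - y) =
   dotp (proj K x - y) (x - y) + dotp (y - proj K x) (psi K x).
  rewrite -[in X in _ = _ + X](opprB (proj K x) y) dotpNl -dotpBr; congr dotp.
  by apply/rowP => i; rewrite !mxE; ring.
by rewrite (le_trans (lerD h1 h2))// addr0.
Qed.

Lemma psiE K y z : ccv K -> K y -> (forall w, K w -> dotp w z <= dotp y z) ->
  psi K (y + z) = z /\ proj K (y + z) = y.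
Proof.
move=> cK Ky H; have E : proj K (y + z) = y.
  by apply: proj_uniq => // w Kw; rewrite addrAC subrr add0r dotpBl subr_le0 H.
by rewrite /psi E addrAC subrr add0r.
Qed.

Lemma psi_supp K x w : ccv K -> K w -> dotp w (psi K x) <= dotp (proj K x) (psi K x).
Proof. by move=> cK Kw; have := proj_var x cK Kw; rewrite dotpBl subr_le0. Qed.

Lemma psi_projK K x : x = proj K x + psi K x.
Proof. by rewrite /psi addrC subrK. Qed.

Lemma monotone_proj K x y : ccv K ->
  0 <= dotp (proj K x - proj K y) (psi K x - psi K y).
Proof.
move=> cK; have [Kx _] := projP x cK; have [Ky _] := projP y cK.
have h1 := psi_supp x cK Ky; have h2 := psi_supp y cK Kx.
rewrite dotpBl; have E z : dotp z (psi K x - psi K y) = dotp z (psi K x) - dotp z (psi K y) by exact: dotpBr.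
by rewrite !E; move: h1 h2; clear; lra.
Qed.

(** The increments of [proj] and [psi] have nonnegative inner product and add up to [x - y], so
    neither is longer than [x - y]. *)
Lemma psi_lip K x y : ccv K -> enorm (psi K x - psi K y) <= enorm (x - y).
Proof.
move=> cK; rewrite -(ler_pXn2r (_ : (0 < 2)%N))// ?nnegrE ?enorm_ge0// !sqr_enorm.
have -> : x - y = (proj K x - proj K y) + (psi K x - psi K y).
  by rewrite addrACA -opprD -!psi_projK.
have := dotp_ge0 (proj K x - proj K y); have := monotone_proj x y cK.
move: (proj K x - proj K y) (psi K x - psi K y) => a b.
rewrite dotpDl !dotpDr (dotpC b a); lra.
Qed.

Lemma psi_continuous K : ccv K -> continuous (psi K).
Proof.
by move=> cK; apply: (@lipschitz_continuous R n n _ 1) => x y; rewrite mul1r psi_lip.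
Qed.

Lemma psi_eq0 K x : ccv K -> psi K x = 0 <-> K x.
Proof.
move=> cK; split => [E|Kx].
  by have [Kp _] := projP x cK; rewrite (psi_projK K x) E addr0.
rewrite /psi (@proj_uniq K x x) ?subrr// => z _.
by rewrite dotp0r.
Qed.

Lemma distKE K x : ccv K -> distK K x = enorm (psi K x).
Proof.
move=> cK; have [Kp pmin] := projP x cK.
have lb : lbound [set enorm (x - y) | y in K] (enorm (psi K x)).
  by move=> _ [y Ky <-]; exact: pmin.
apply/eqP; rewrite eq_le; apply/andP; split.
  by apply: ge_inf; [exists (enorm (psi K x))|exists (proj K x)].
by apply: lb_le_inf => //; exists (enorm (psi K x)); exists (proj K x).
Qed.

Definition cone_le (r : R) (w : set V) : set V :=
  [set x | exists t : R, exists2 u, w u & 0 < t <= r /\ x = t *: u].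

(** A point of [K] realising the distance must be the projection, by [proj_var]; positivity of the
    distance matches the missing apex of the cone. *)
Lemma local_parallelE K (eps : R) w : ccv K -> w `<=` @sphere R n ->
  local_parallel K eps w = psi K @^-1` cone_le eps w.
Proof.
move=> cK ws; have [cptK cv K0] := cK.
apply/seteqP; split => x; rewrite /local_parallel /= distKE//.
  move=> [/andP[d0 de] [y Ky [dy wy]]].
  have [Kp pmin] := projP x cK.
  have E : proj K x = y.
    have pv := proj_var x cK Ky.
    apply/eqP; rewrite -subr_eq0 -dotp_eq0 eq_le dotp_ge0 andbT.
    have : dotp (x - y) (x - y) = dotp (psi K x) (psi K x) by rewrite -!sqr_enorm dy.
    have -> : x - y = psi K x - (y - proj K x).
      by rewrite /psi opprB addrA subrK.
    rewrite -[proj K x - y]opprB dotpNl dotpNr opprK.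
    move: (psi K x) (y - proj K x) pv => a b pv.
    rewrite dotpBl !dotpBr (dotpC a b); lra.
  rewrite -E -/(psi K x) in wy.
  exists (enorm (psi K x)), ((enorm (psi K x))^-1 *: psi K x) => //.
  by rewrite d0 de scalerA divff ?scale1r// gt_eqF.
move=> [t [u wu [/andP[t0 te] E]]].
have tE : enorm (psi K x) = t by rewrite E enormZ gtr0_norm// (ws _ wu) mulr1.
rewrite tE t0 te; split => //; exists (proj K x); first by have [] := projP x cK.
by rewrite -/(psi K x) tE E scalerA mulVf ?scale1r// gt_eqF.
Qed.

(** The variational inequality of each projection is tested at a point of its own body within [eta]
    of the projection onto the other body, and the two are added. So [psi] is Hölder continuous of
    exponent 1/2 in the Hausdorff distance. *)
Lemma psi_stable K L (eta : R) x : ccv K -> ccv L ->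
  (forall y, K y -> exists2 z, L z & enorm (y - z) <= eta) ->
  (forall y, L y -> exists2 z, K z & enorm (y - z) <= eta) ->
  enorm (psi K x - psi L x) ^+ 2 <= eta * (enorm (psi K x) + enorm (psi L x)).
Proof.
move=> cK cL KL LK; have [Kp _] := projP x cK; have [Lq _] := projP x cL.
have [p' Lp' pp'] := KL _ Kp; have [q' Kq' qq'] := LK _ Lq.
have h1 := proj_var x cK Kq'; have h2 := proj_var x cL Lp'.
rewrite sqr_enorm.
have -> : psi K x - psi L x = proj L x - proj K x.
  by apply/rowP => i; rewrite !mxE; ring.
have E : proj L x - proj K x = psi K x - psi L x.
  by apply/rowP => i; rewrite !mxE; ring.
rewrite {2}E dotpBr.
have e1 : dotp (proj L x - proj K x) (psi K x) <= eta * enorm (psi K x).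
  have -> : proj L x - proj K x = (proj L x - q') + (q' - proj K x).
    by rewrite addrA subrK.
  rewrite dotpDl; apply: (@le_trans _ _ (enorm (proj L x - q') * enorm (psi K x) + 0)).
    by rewrite lerD// dotp_le.
  by rewrite addr0 ler_wpM2r ?enorm_ge0.
have e2 : - dotp (proj L x - proj K x) (psi L x) <= eta * enorm (psi L x).
  rewrite -dotpNl opprB.
  have -> : proj K x - proj L x = (proj K x - p') + (p' - proj L x).
    by rewrite addrA subrK.
  rewrite dotpDl; apply: (@le_trans _ _ (enorm (proj K x - p') * enorm (psi L x) + 0)).
    by rewrite lerD// dotp_le.
  by rewrite addr0 ler_wpM2r ?enorm_ge0.
by rewrite mulrDr lerD.
Qed.

Lemma ccv_bounded K : ccv K -> exists2 r : R, 0 < r & forall y, K y -> enorm y <= r.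
Proof.
move=> [cK _ K0].
have cf : {within K, continuous (@enorm R n)}.
  by apply: continuous_subspaceT => y; exact: enorm_continuous.
have [c _ cP] := EVT_max_rV K0 cK cf.
exists (enorm c + 1); first by rewrite ltr_wpDl// enorm_ge0.
by move=> y Ky; rewrite (le_trans (cP y (mem_set Ky)))// lerDl.
Qed.

Lemma supp_funP K x : ccv K -> exists2 y, K y & supp_fun K x = dotp x y /\
  forall z, K z -> dotp x z <= supp_fun K x.
Proof.
move=> [cK _ K0].
have cf : {within K, continuous (dotp x : V -> R)}.
  by apply: continuous_subspaceT => y; exact: dotp_continuous.
have [c /set_mem Kc cP] := EVT_max_rV K0 cK cf.
have ub : ubound [set dotp x y | y in K] (dotp x c).
  by move=> _ [y Ky <-]; apply: cP; exact: mem_set.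
have E : supp_fun K x = dotp x c.
  apply/eqP; rewrite eq_le; apply/andP; split.
    by apply: ge_sup => //; exists (dotp x c); exists c.
  by apply: ub_le_sup; [exists (dotp x c)|exists c].
by exists c => //; split => // z Kz; rewrite E; apply: ub; exists z.
Qed.

Lemma supp_fun_ge K x y : ccv K -> K y -> dotp x y <= supp_fun K x.
Proof. by move=> cK; have [_ _ [_ H]] := supp_funP x cK; exact: H. Qed.

Lemma supp_fun_le K x c : ccv K -> (forall y, K y -> dotp x y <= c) -> supp_fun K x <= c.
Proof. by move=> cK H; have [y Ky [-> _]] := supp_funP x cK; exact: H. Qed.

Lemma supp_funD K x y : ccv K -> supp_fun K (x + y) <= supp_fun K x + supp_fun K y.
Proof.
move=> cK; apply: supp_fun_le => // z Kz.
by rewrite dotpDl lerD// supp_fun_ge.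
Qed.

Lemma supp_funZ K x t : ccv K -> 0 <= t -> supp_fun K (t *: x) = t * supp_fun K x.
Proof.
move=> cK t0; apply/eqP; rewrite eq_le; apply/andP; split.
  by apply: supp_fun_le => // y Ky; rewrite dotpZl ler_wpM2l// supp_fun_ge.
have [y Ky [-> _]] := supp_funP x cK.
by rewrite -dotpZl supp_fun_ge.
Qed.

Lemma supp_fun_cvx K x y : ccv K ->
  2 * supp_fun K x <= supp_fun K (x + y) + supp_fun K (x - y).
Proof.
move=> cK; rewrite -supp_funZ//; apply: le_trans (supp_funD _ _ cK).
by rewrite addrACA subrr addr0 scaler_nat mulr2n.
Qed.

Lemma supp_fun_bound K x r : ccv K -> (forall y, K y -> enorm y <= r) ->
  supp_fun K x <= r * enorm x.
Proof.
move=> cK Kr; apply: supp_fun_le => // y Ky.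
by rewrite (le_trans (dotp_le _ _))// mulrC ler_wpM2r ?enorm_ge0 ?Kr.
Qed.

Lemma supp_fun_continuous K : ccv K -> continuous (supp_fun K : V -> R).
Proof.
move=> cK; have [r r0 Kr] := ccv_bounded cK.
have lip x y : `|supp_fun K x - supp_fun K y| <= r * enorm (x - y).
  have H u v : supp_fun K u - supp_fun K v <= r * enorm (u - v).
    rewrite lerBlDr; have := supp_funD (u - v) v cK; rewrite subrK.
    by move=> /le_trans; apply; rewrite lerD2r supp_fun_bound.
  by rewrite ler_norml H andbT lerNl opprB enormBC H.
move=> y A /nbhs_normP [e /= e0 eA]; apply/enorm_nbhs.
exists (e / r); first by rewrite divr_gt0.
move=> z; rewrite ltr_pdivlMr// => zy; apply: eA.
by rewrite /= (le_lt_trans (lip _ _))// enormBC mulrC.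
Qed.

(** For a point outside [K], the direction [psi K x] would violate the hypothesis. *)
Lemma ccvP_supp K x : ccv K -> (forall z, dotp z x <= supp_fun K z) -> K x.
Proof.
move=> cK H; apply/(psi_eq0 x cK); apply/eqP; rewrite -dotp_eq0 eq_le dotp_ge0 andbT.
have [y Ky [E _]] := supp_funP (psi K x) cK.
have := H (psi K x); rewrite E => h1.
have := psi_supp x cK Ky; rewrite (dotpC y) => h2.
by rewrite {2}/psi dotpBr subr_le0 (dotpC _ (proj K x)); exact: le_trans h1 h2.
Qed.

End Projection.

(** * Images under maps with invertible derivative *)

Section DilationOfImages.
Variables (R : realType) (n' : nat).
Local Notation n := n'.+1.
Local Notation V := 'rV[R]_n.
Implicit Types (E : set V).

(* [G] is the inverse of the derivative of [f] at [x] along [E]; the estimate is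
   normalised on the source side so that no bound on [G] is needed. *)
Definition inverse_derivative E (f : V -> V) (x : V) (G : 'M[R]_n) :=
  forall e : R, 0 < e -> exists2 d : R, 0 < d & forall y, E y -> enorm (y - x) < d ->
    enorm ((f y - f x) *m G - (y - x)) <= e * enorm (y - x).

(** A one-sided change of variables for arbitrary sets. [E] is the increasing union of the sets
    [F k] where the estimate with error [e] holds up to distance [1 / (k + 1)]. There, a small cube
    of side [s] is mapped into an affine image, by the inverse of [G], of a cube of side
    [s (1 + 2 n e)]; then [e] tends to 0. *)
Lemma leb_image_inverse_derivative E (f : V -> V) (c : R) : 0 <= c ->
  (forall x, E x -> exists G : 'M[R]_n, [/\ G \in unitmx, 1 <= c * `|\det G| &
     inverse_derivative E f x G]) ->
  (leb_outer (f @` E) <= c%:E * leb_outer E)%E.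
Proof.
move=> c0 H.
have [->|/set0P[x0 Ex0]] := eqVneq E set0; first by rewrite image_set0 outer_measure0 mule_ge0// outer_measure_ge0.
have cp : 0 < c.
  rewrite lt0r c0 andbT; apply/eqP => cz.
  by have [G [_ + _]] := H _ Ex0; rewrite cz mul0r ler10.
have [->|Efin] := eqVneq (leb_outer E) +oo%E; first by rewrite gt0_muley ?leey// lte_fin.
have Efn : leb_outer E \is a fin_num by rewrite ge0_fin_numE ?outer_measure_ge0// ltey.
pose M := fine (leb_outer E).
have EM : leb_outer E = M%:E by rewrite fineK.
pose p : {poly R} := (c * M)%:P * (1 + (2 * n%:R) *: 'X) ^+ n.
have pE e : p.[e] = c * (1 + 2 * n%:R * e) ^+ n * M.
  by rewrite hornerM hornerC horner_exp !hornerE mulrAC.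
rewrite EM -EFinM -[c * M](_ : p.[0] = _); last by rewrite pE mulr0 addr0 expr1n mulr1.
apply: (lee_horner_lim ltr01) => e /andP[e0 _].
pose P k x := exists G : 'M[R]_n, [/\ G \in unitmx, 1 <= c * `|\det G| &
  forall y, E y -> enorm (y - x) < k.+1%:R^-1 ->
    enorm ((f y - f x) *m G - (y - x)) <= e * enorm (y - x)].
pose F k := [set x | E x /\ P k x].
have EF : E = \bigcup_k F k.
  apply/seteqP; split => [x Ex|x [k _ [//]]].
  have [G [Gu cG /(_ e e0) [d d0 dP]]] := H _ Ex.
  exists (Num.truncn d^-1) => //; split => //; exists G; split => // y Ey yx.
  apply: dP => //; apply: lt_trans yx _.
  by rewrite -[ltRHS]invrK ltf_pV2 ?posrE ?invr_gt0//; exact: truncnS_gt.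
rewrite {1}EF image_bigcup; apply: leb_bigcup_nondecreasing => [i j ij|k].
  apply: image_subset => x [Ex [G [Gu cG GP]]]; split => //; exists G; split => // y Ey yx.
  apply: GP => //; apply: lt_le_trans yx _.
  by rewrite lef_pV2 ?posrE// ler_nat.
have FE : F k `<=` E by move=> x [].
have k0 : 0 <= c * (1 + 2 * n%:R * e) ^+ n.
  by rewrite mulr_ge0// exprn_ge0// addr_ge0// !mulr_ge0// ltW.
have r0 : 0 < (2 * n%:R * k.+1%:R)^-1 :> R by rewrite invr_gt0 !mulr_gt0.
rewrite pE EFinM -EM -[F k]setIid.
apply: le_trans (@leb_image_le R n' n' f (F k) (F k) _ _ k0 r0 _) _; last first.
  by apply: lee_pmul => //; rewrite ?lee_fin ?outer_measure_ge0//; exact: le_outer_measure.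
move=> a s /andP[s0 sr].
have [->|/set0P[x [[Ex [G [Gu cG GP]]] xa]]] := eqVneq (F k `&` cube a s) set0.
  by rewrite image_set0 outer_measure0 lee_fin mulr_ge0// exprn_ge0// ltW.
pose b := a - x - const_mx (n%:R * e * s).
pose s' := s * (1 + 2 * n%:R * e).
have s'0 : 0 <= s' by rewrite mulr_ge0 ?(ltW s0)// addr_ge0// !mulr_ge0// ltW.
have sub : f @` (F k `&` cube a s) `<=` +%R (f x) @` (mulmxr (invmx G) @` cube b s').
  move=> _ [y [[Ey _] ya] <-]; exists ((f y - f x)); last by rewrite addrC subrK.
  exists ((f y - f x) *m G); last by rewrite /= mulmxK.
  have yx i : `|(y - x) ord0 i| <= s.
    have := ya i; have := xa i; rewrite !mxE ler_norml; lra.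
  have eyx := enorm_le_coord (ltW s0) yx.
  have /GP : enorm (y - x) < k.+1%:R^-1.
    apply: le_lt_trans eyx _.
    apply: (@le_lt_trans _ _ (n%:R * (2 * n%:R * k.+1%:R)^-1)).
      by rewrite ler_pM2l.
    have aux (N K : R) : 0 < N -> 0 < K -> N * (2 * N * K)^-1 = K^-1 / 2.
      by move=> N0 K0; field; rewrite !gt_eqF.
    rewrite aux//.
    by rewrite ltr_pdivrMr// ltr_pMr ?invr_gt0// ltr1n.
  move=> /(_ Ey) gy i.
  have := ler_coord_enorm ((f y - f x) *m G - (y - x)) i.
  move=> /le_trans/(_ gy) /le_trans/(_ (ler_wpM2l (ltW e0) eyx)).
  have := ya i; rewrite !mxE ler_norml /s'; set u := \sum_j _.
  have := ltW s0; have := ltW e0; have : (0 : R) <= n%:R by [].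
  move: (n%:R : R) => N N0 e00 s00; nra.
apply: le_trans (le_outer_measure _ _ _ sub) _ => /=.
rewrite leb_shift leb_mulmx ?unitmx_inv// leb_cube// -EFinM lee_fin.
rewrite /s' exprMn mulrCA [leRHS]mulrC; apply: ler_wpM2l; first by rewrite exprn_ge0// ltW.
apply: ler_wpM2r; first by rewrite exprn_ge0// addr_ge0// !mulr_ge0// ltW.
have G0 : 0 < `|\det G| by rewrite normr_gt0 -unitfE -unitmxE.
rewrite det_inv normrV ?unitfE -?normr_gt0//.
by rewrite -[leLHS]mul1r ler_pdivrMr.
Qed.

End DilationOfImages.

(** * Dilates, Minkowski sums and balls *)

Section MinkowskiOps.
Variables (R : realType) (n : nat).
Local Notation V := 'rV[R]_n.
Implicit Types (A B C K L : set V) (x y z : V).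

Definition scaleS (s : R) K : set V := *:%R s @` K.
Definition msum A B : set V := [set x | exists2 a, A a & exists2 b, B b & x = a + b].
Definition eball (r : R) : set V := [set x | enorm x <= r].

Lemma linear_continuous_rV m (P : 'M[R]_(n, m)) : continuous (mulmxr P : V -> 'rV[R]_m).
Proof.
apply: (@lipschitz_continuous R n m _ (\sum_i enorm (row i P))) => x y /=.
rewrite -mulmxBl mulr_suml.
rewrite [X in enorm X](_ : _ = \sum_i (x - y) ord0 i *: row i P) ?mulmx_sum_row//.
apply: (le_trans (enorm_sum _ _ _)); apply: ler_sum => i _.
by rewrite enormZ mulrC ler_wpM2l ?enorm_ge0// ler_coord_enorm.
Qed.

Lemma scale_continuous (s : R) : continuous ( *:%R s : V -> V).
Proof.
apply: (@lipschitz_continuous R n n _ `|s|) => x y.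
by rewrite -scalerBr enormZ.
Qed.

Lemma ccv_scale (s : R) K : ccv K -> ccv (scaleS s K).
Proof.
move=> [cK cvK [x Kx]]; split.
- apply: continuous_compact => //; apply: continuous_subspaceT; exact: scale_continuous.
- move=> _ _ t [a Ka <-] [b Kb <-] t01; exists (t *: a + (1 - t) *: b); first exact: cvK.
  by rewrite scalerDr !scalerA ![s * _]mulrC.
- by exists (s *: x); exists x.
Qed.

Lemma scaleS1 K : scaleS 1 K = K.
Proof.
apply/seteqP; split => [_ [x Kx <-]|x Kx]; first by rewrite scale1r.
by exists x; rewrite ?scale1r.
Qed.

Lemma scaleSA (s t : R) K : scaleS s (scaleS t K) = scaleS (s * t) K.
Proof.
apply/seteqP; split => [_ [_ [x Kx <-] <-]|_ [x Kx <-]].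
  by exists x; rewrite ?scalerA.
by exists (t *: x); [exists x|rewrite scalerA].
Qed.

Lemma psi_scale (s : R) K x : 0 < s -> ccv K ->
  psi (scaleS s K) (s *: x) = s *: psi K x.
Proof.
move=> s0 cK; have cS := ccv_scale s cK; have [Kp _] := projP x cK.
rewrite {1}(psi_projK K x) scalerDr.
apply: (proj1 (psiE cS _ _)); first by exists (proj K x).
move=> _ [w Kw <-]; rewrite !dotpZl ler_pM2l// !dotpZr ler_pM2l//.
exact: psi_supp.
Qed.

Lemma supp_scaleS (s : R) K x : 0 <= s -> ccv K ->
  supp_fun (scaleS s K) x = s * supp_fun K x.
Proof.
move=> s0 cK; apply/eqP; rewrite eq_le; apply/andP; split.
  apply: supp_fun_le => [|_ [y Ky <-]]; first exact: ccv_scale.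
  by rewrite dotpZr ler_wpM2l// supp_fun_ge.
have [y Ky [-> _]] := supp_funP x cK.
by rewrite -dotpZr supp_fun_ge//; [exact: ccv_scale|exists y].
Qed.

Lemma compact_msum A B : compact A -> compact B -> compact (msum A B).
Proof.
move=> cA cB; have -> : msum A B = (fun p : V * V => p.1 + p.2) @` (A `*` B).
  apply/seteqP; split => [_ [a Aa [b Bb ->]]|_ [[a b] [/= Aa Bb] <-]].
    by exists (a, b).
  by exists a => //; exists b.
apply: continuous_compact; last exact: compact_setX.
by apply: continuous_subspaceT => -[a b]; exact: add_continuous.
Qed.

Lemma ccv_msum A B : ccv A -> ccv B -> ccv (msum A B).
Proof.
move=> [cA vA [a Aa]] [cB vB [b Bb]]; split; first exact: compact_msum.
- move=> _ _ t [x Ax [y By ->]] [x' Ax' [y' By' ->]] t01.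
  exists (t *: x + (1 - t) *: x'); first exact: vA.
  exists (t *: y + (1 - t) *: y'); first exact: vB.
  by rewrite !scalerDr addrACA.
- by exists (a + b); exists a => //; exists b.
Qed.

Lemma supp_msum A B x : ccv A -> ccv B ->
  supp_fun (msum A B) x = supp_fun A x + supp_fun B x.
Proof.
move=> cA cB; have cAB := ccv_msum cA cB; apply/eqP; rewrite eq_le; apply/andP; split.
  apply: supp_fun_le => // _ [a Aa [b Bb ->]].
  by rewrite dotpDr lerD// supp_fun_ge.
have [a Aa [-> _]] := supp_funP x cA; have [b Bb [-> _]] := supp_funP x cB.
by rewrite -dotpDr supp_fun_ge//; exists a => //; exists b.
Qed.

Lemma msumA A B C : msum (msum A B) C = msum A (msum B C).
Proof.
apply/seteqP; split => [_ [_ [a Aa [b Bb ->]] [c Cc ->]]|_ [a Aa [_ [b Bb [c Cc ->]] ->]]].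
  by exists a => //; exists (b + c); [exists b => //; exists c|rewrite addrA].
by exists (a + b); [exists a => //; exists b|exists c => //; rewrite addrA].
Qed.

Lemma msumC A B : msum A B = msum B A.
Proof.
by apply/seteqP; split => [_ [a Aa [b Bb ->]]|_ [a Aa [b Bb ->]]];
  exists b => //; exists a => //; rewrite addrC.
Qed.

Lemma closed_eball r : closed (eball r).
Proof.
have -> : eball r = @enorm R n @^-1` [set t | t <= r] by [].
apply: closed_comp; last exact: closed_le.
by move=> x _; exact: enorm_continuous.
Qed.

Lemma eball_box r : eball r `<=` box (const_mx (- r)) (const_mx r).
Proof.
move=> x xr i; rewrite !mxE -ler_norml.
exact: le_trans (ler_coord_enorm _ _) xr.
Qed.

Lemma compact_eball r : compact (eball r).
Proof.
apply: (@subclosed_compact _ (eball r) (box (const_mx (- r)) (const_mx r)));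
  [exact: closed_eball| |exact: eball_box].
have -> : box (const_mx (- r)) (const_mx r) =
    [set v : V | forall i, `[- r, r]%classic (v ord0 i)].
  by apply/seteqP; split => x H i; have := H i; rewrite !mxE /= in_itv.
apply: (@rV_compact _ _ (fun=> `[- r, r]%classic)) => i.
exact: segment_compact.
Qed.

Lemma ccv_eball r : 0 <= r -> ccv (eball r).
Proof.
move=> r0; split; first exact: compact_eball.
  move=> x y t xr yr /andP[t0 t1]; rewrite /eball /=.
  apply: (le_trans (enormD _ _)); rewrite !enormZ !ger0_norm ?subr_ge0//.
  rewrite [leRHS](_ : r = t * r + (1 - t) * r); last by ring.
  by rewrite lerD// ler_wpM2l// subr_ge0.
by exists 0; rewrite /eball /= enorm0.
Qed.

Lemma supp_eball r x : 0 <= r -> supp_fun (eball r) x = r * enorm x.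
Proof.
move=> r0; have cB := ccv_eball r0; apply/eqP; rewrite eq_le; apply/andP; split.
  by apply: supp_fun_bound => // y.
have [->|x0] := eqVneq x 0; first by rewrite enorm0 mulr0 -[X in X <= _](dotp0l (0 : V)) supp_fun_ge// /eball/= enorm0.
have e0 : 0 < enorm x by rewrite enorm_gt0.
have -> : r * enorm x = dotp x ((r / enorm x) *: x).
  by rewrite dotpZr -sqr_enorm expr2 mulrA divfK// gt_eqF.
apply: supp_fun_ge => //; rewrite /eball /= enormZ ger0_norm ?divr_ge0 ?enorm_ge0//.
by rewrite divfK// gt_eqF.
Qed.

Lemma msum_eball K r : ccv K -> msum K (eball r) = [set x | enorm (psi K x) <= r].
Proof.
move=> cK; apply/seteqP; split => [_ [y Ky [z zr ->]]|x /= xr].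
  have [_ /(_ y Ky)] := projP (y + z) cK; rewrite /= -/(psi K _) => /le_trans; apply.
  by rewrite addrAC subrr add0r.
have [Kp _] := projP x cK.
by exists (proj K x) => //; exists (psi K x) => //; exact: psi_projK.
Qed.

End MinkowskiOps.

(** * Local Steiner formula *)

Section Sylvester.
Variables (F : comRingType) (m r : nat).

(** Sylvester's identity, from two triangular factorisations of one block matrix. *)
Lemma det_1_mulmxC (A : 'M[F]_(m, r)) (B : 'M[F]_(r, m)) :
  \det (1%:M + A *m B) = \det (1%:M + B *m A).
Proof.
pose X := block_mx 1%:M A (- B) 1%:M : 'M[F]_(m + r).
have X1 : X = block_mx 1%:M 0 (- B) 1%:M *m block_mx 1%:M A 0 (1%:M + B *m A).
  rewrite mulmx_block !mul1mx !mul0mx ?mulmx0 !mulmx1 !addr0 mulNmx.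
  by rewrite addrCA addNr addr0.
have X2 : X = block_mx 1%:M A 0 1%:M *m block_mx (1%:M + A *m B) 0 (- B) 1%:M.
  rewrite mulmx_block !mul1mx !mul0mx ?mulmx0 !mulmx1 !add0r mulmxN.
  by rewrite addrK.
have : \det X = \det X by [].
rewrite {1}X2 X1 !det_mulmx !det_ublock !det_lblock !det1 !mul1r !mulr1.
by [].
Qed.

End Sylvester.

Section StretchMatrix.
Variables (R : realType) (n k : nat) (Q : 'M[R]_(k, n)).

(** With [Pi] the orthogonal projection on the row space of [Q], written through the Gram matrix of
    a row basis, [T = 1 + (s - 1) Pi] scales that space by [s] and fixes its orthogonal complement.
    Sylvester's identity gives the determinant. *)
Lemma stretch_matrix (s : R) : exists T : 'M[R]_n,
  [/\ \det T = s ^+ \rank Q,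
      forall u : 'rV_k, (u *m Q) *m T = s *: (u *m Q) &
      forall z : 'rV_n, Q *m z^T = 0 -> z *m T = z].
Proof.
have [M Mf MQ] : exists2 M : 'M[R]_(\rank Q, n), row_free M & (M :=: Q)%MS.
  by exists (row_base Q); [exact: row_base_free|exact: eq_row_base].
pose G := M *m M^T.
have Gu : G \in unitmx.
  rewrite -row_free_unit -kermx_eq0; apply/rowV0P => v /sub_kermxP vG.
  have : dotp (v *m M) (v *m M) = 0.
    by rewrite dotpE trmx_mul mulmxA -(mulmxA v) vG mul0mx mxE.
  move/eqP; rewrite dotp_eq0 => /eqP vM.
  by apply: (row_free_inj Mf); rewrite mul0mx.
pose Pi := M^T *m invmx G *m M.
exists (1%:M + (s - 1) *: Pi); split.
- rewrite /Pi scalemxAl det_1_mulmxC.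
  rewrite -scalemxAr mulmxA mulmxV//.
  have -> : 1%:M + (s - 1) *: 1%:M = s%:M :> 'M[R]_(\rank Q, \rank Q).
    by rewrite -[RHS]scalemx1 scalerBl scale1r addrC subrK.
  by rewrite det_scalar.
- move=> u; have /submxP[v E] : (u *m Q <= M)%MS.
    by rewrite (submx_trans (submxMl _ _))// MQ.
  rewrite E mulmxDr mulmx1 -scalemxAr /Pi !mulmxA -(mulmxA v) -/G mulmxK//.
  by rewrite scalerBl scale1r addrC subrK.
- move=> z zQ; have /submxP[D E] : (M <= Q)%MS by rewrite MQ.
  have Mz : z *m M^T = 0.
    by rewrite -[z]trmxK -trmx_mul E -mulmxA zQ mulmx0 trmx0.
  by rewrite mulmxDr mulmx1 -scalemxAr /Pi !mulmxA Mz !mul0mx scaler0 addr0.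
Qed.

End StretchMatrix.

Section PartitionLeb.
Variables (R : realType) (n' : nat).
Local Notation n := n'.+1.
Local Notation V := 'rV[R]_n.

Lemma leb_partition (T : finType) (a : V -> T) (X : set V) :
  (forall t, borel [set x | a x = t]) ->
  leb_outer X = (\sum_t leb_outer (X `&` [set x | a x = t]))%E.
Proof.
move=> ba; have main (s : seq T) : uniq s ->
    leb_outer (X `&` [set x | a x \in s]) = (\sum_(t <- s) leb_outer (X `&` [set x | a x = t]))%E.
  elim: s => [_|t s IH /= /andP[ts us]].
    rewrite big_nil (_ : X `&` _ = set0) ?outer_measure0//.
    by apply/seteqP; split => // x [].
  rewrite big_cons (leb_split _ (ba t)) -IH//; congr (_ + _)%E; congr leb_outer.
    apply/seteqP; split => [x [[Xx _] E]|x [Xx E]]; first by split.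
    by split => //; split => //=; rewrite E in_cons eqxx.
  apply/seteqP; split => [x [[Xx]]|x [Xx xs]].
    by rewrite /= in_cons => /orP[/eqP E /(_ E)//|xs _]; split.
  split; first by split => //=; rewrite in_cons xs orbT.
  by move=> E; move: ts; rewrite -E xs.
rewrite -(main (index_enum T)) ?index_enum_uniq//; congr leb_outer.
by apply/seteqP; split => [x Xx|x []//]; split => //=; exact: mem_index_enum.
Qed.

Lemma borel_preimage (f : V -> V) (A : set V) : continuous f -> borel A -> borel (f @^-1` A).
Proof.
move=> cf; apply: (smallest_sub (C := sigma_algebra setT) (X := [set A | borel (f @^-1` A)])).
  split => /=.
  - by rewrite preimage_set0; exact: (@measurable0 _ (borel_space R n')).
  - by move=> B bB; rewrite setTD preimage_setC; exact: borelC.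
  - by move=> F bF; rewrite preimage_bigcup; exact: borel_bigcup.
by move=> B oB /=; apply: borel_open; exact: open_comp.
Qed.

End PartitionLeb.

Section PolytopeSteiner.
Variables (R : realType) (n' N : nat).
Local Notation n := n'.+1.
Local Notation V := 'rV[R]_n.
Variable P : 'M[R]_(N.+1, n).

Definition simplex : set 'rV[R]_N.+1 :=
  [set w | (forall i, 0 <= w ord0 i) /\ \sum_i w ord0 i = 1].

Definition hull : set V := mulmxr P @` simplex.

Lemma compact_simplex : compact simplex.
Proof.
have sub : simplex `<=` box 0 (const_mx 1).
  move=> w [w0 w1] i; rewrite !mxE w0 -w1 (bigD1 i)//= lerDl.
  by apply: sumr_ge0 => j _.
apply: (subclosed_compact _ (@compact_box R N _ _) sub).
have -> : simplex = box 0 (const_mx 1) `&` [set w | dotp (const_mx 1) w = 1].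
  apply/seteqP; split => w H.
    split; first exact: sub.
    have [_ H1] := H; rewrite /=; transitivity (\sum_i w ord0 i) => //.
    by apply: eq_bigr => i _; rewrite mxE mul1r.
  have [wb w1] := H; split.
    by move=> i; have := wb i; rewrite !mxE => /andP[].
  by transitivity (dotp (const_mx 1) w) => //; apply: eq_bigr => i _; rewrite mxE mul1r.
apply: closedI; first exact: closed_box.
have -> : [set w | dotp (const_mx 1) w = 1] = dotp (const_mx 1 : 'rV[R]_N.+1) @^-1` [set 1].
  by [].
apply: closed_comp; last exact: closed_eq.
by move=> x _; exact: dotp_continuous.
Qed.

Lemma ccv_hull : ccv hull.
Proof.
split.
- apply: continuous_compact; last exact: compact_simplex.
  by apply: continuous_subspaceT; exact: linear_continuous_rV.
- move=> _ _ t [v [v0 v1] <-] [w [w0 w1] <-] /andP[t0 t1].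
  exists (t *: v + (1 - t) *: w); last by rewrite /= mulmxDl -!scalemxAl.
  split => [i|]; first by rewrite !mxE addr_ge0// mulr_ge0// subr_ge0.
  under eq_bigr do rewrite !mxE.
  by rewrite big_split -!mulr_sumr /= v1 w1 !mulr1 addrC subrK.
- exists (delta_mx 0 0 *m P); exists (delta_mx 0 0) => //; split.
    by move=> i; rewrite mxE ler0n.
  rewrite (bigD1 0)//= !mxE !eqxx big1 ?addr0// => i i0.
  by rewrite mxE (negbTE i0) andbF.
Qed.

Lemma mem_hull i : hull (row i P).
Proof.
exists (delta_mx 0 i); last by rewrite /= -rowE.
split; first by move=> j; rewrite mxE ler0n.
rewrite (bigD1 i)//= !mxE !eqxx big1 ?addr0// => j ji.
by rewrite mxE (negbTE ji) andbF.
Qed.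

(** The rows lying on the face exposed by [z]. Its level sets split the space into finitely many
    strata, the relatively open normal cones of the faces. *)
Definition maxface (z : V) : {set 'I_N.+1} :=
  [set i | [forall k, dotp (row k P) z <= dotp (row i P) z]]%SET.

Lemma maxfaceP (z : V) i : reflect (forall k, dotp (row k P) z <= dotp (row i P) z)
  (i \in maxface z).
Proof. by rewrite inE; exact: forallP. Qed.

Lemma borel_maxface (t : {set 'I_N.+1}) : borel [set z | maxface z = t].
Proof.
have cl i k : borel [set z : V | dotp (row k P) z <= dotp (row i P) z].
  have -> : [set z : V | dotp (row k P) z <= dotp (row i P) z] =
     dotp (row k P - row i P) @^-1` [set x | x <= 0].
    by apply/seteqP; split => z /=; rewrite dotpBl subr_le0.
  apply: borel_closed; apply: closed_comp; last exact: closed_le.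
  by move=> x _; exact: dotp_continuous.
have fin (I : finType) (F : I -> set V) : (forall i, borel (F i)) ->
    borel [set x | forall i, F i x].
  move=> bF; have -> : [set x | forall i, F i x] = \bigcap_(i in setT) F i.
    by apply/seteqP; split => x H i //; exact: H.
  by apply: (@fin_bigcap_measurable _ (borel_space R n')) => // i _; exact: bF.
have bi i : borel [set z : V | i \in maxface z].
  have -> : [set z : V | i \in maxface z] = [set z | forall k, dotp (row k P) z <= dotp (row i P) z].
    by apply/seteqP; split => z /= /maxfaceP.
  by apply: (fin _ (fun k => [set z : V | dotp (row k P) z <= dotp (row i P) z])).
have -> : [set z | maxface z = t] =
   [set z | forall i, [set z : V | (i \in maxface z) = (i \in t)] z].
  by apply/seteqP; split => z /= => [-> //|H]; apply/setP.
apply: (fin _ (fun i => [set z : V | (i \in maxface z) = (i \in t)])) => i.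
case: (boolP (i \in t)) => _; first exact: (bi i).
rewrite (_ : [set _ | _] = ~` [set z : V | i \in maxface z]); first exact: borelC.
by apply/seteqP; split => z /=; [move=> ->|move=> /negP/negbTE].
Qed.

(** Over normals in one stratum, the points are sums of a point of the dilated face and a normal.
    Dilating the polytope stretches the directions of the face by [s] and leaves the normals alone,
    and the two are orthogonal; hence the factor [s ^+ d] with [d] the dimension of the face. *)
Lemma piece_dilation (t : {set 'I_N.+1}) : exists2 d, (d <= n)%N & forall (s : R) C, 0 < s ->
  leb_outer (psi (scaleS s hull) @^-1` (C `&` [set z | maxface z = t])) =
  ((s ^+ d)%:E * leb_outer (psi hull @^-1` (C `&` [set z | maxface z = t])))%E.
Proof.
have [t0|/finset.set0Pn[i0 it]] := eqVneq t finset.set0.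
  exists 0%N => // s C s0; rewrite [X in psi (scaleS s _) @^-1` X](_ : _ = set0); last first.
    apply/seteqP; split => // z [_ /= E].
    have [i _ iP] : exists2 i, true & forall k, dotp (row k P) z <= dotp (row i P) z.
      have [//|i _ iP] := @arg_maxP _ _ 'I_N.+1 ord0 xpredT (fun i => dotp (row i P) z).
      by exists i => // k; exact: iP.
    have : i \in maxface z by apply/maxfaceP.
    by rewrite E t0 inE.
  rewrite [X in psi hull @^-1` X](_ : _ = set0); last first.
    apply/seteqP; split => // z [_ /= E].
    have [//|i _ iP] := @arg_maxP _ _ 'I_N.+1 ord0 xpredT (fun i => dotp (row i P) z).
    have : i \in maxface z by apply/maxfaceP => k; exact: iP.
    by rewrite E t0 inE.
  by rewrite !preimage_set0 outer_measure0 mule0.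
(* Differences of the face points to the base point [P i0], with zero rows elsewhere, so that the
   rank is the dimension of the face. *)
pose Q : 'M[R]_(N.+1, n) := \matrix_(i, j) if i \in t then P i j - P i0 j else 0.
exists (\rank Q); first exact: rank_leq_col.
pose spx := [set w : 'rV[R]_N.+1 | simplex w /\ forall i, i \notin t -> w ord0 i = 0].
have wPQ w : spx w -> w *m P = row i0 P + w *m Q.
  move=> [[w0 w1] wt]; apply/rowP => j; rewrite !mxE.
  rewrite -[P i0 j]mul1r -w1 mulr_suml -big_split; apply: eq_bigr => i _ /=.
  rewrite mxE; case: (boolP (i \in t)) => [_|/wt ->]; first by rewrite -mulrDr addrC subrK.
  by rewrite !mul0r addr0.
pose piece s C : set V := [set x | exists2 w, spx w & exists2 z,
   (C z /\ maxface z = t) & x = s *: (w *m P) + z].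
have pieceE s C : 0 < s -> psi (scaleS s hull) @^-1` (C `&` [set z | maxface z = t]) = piece s C.
  move=> s0; have cS := ccv_scale s ccv_hull.
  apply/seteqP; split => x.
    rewrite /preimage /=; set z := psi _ x => -[Cz zt].
    have [[y [w sw wy] yp] _] := projP x cS.
    exists w; last first.
      by exists z => //; rewrite -/(mulmxr P w) wy yp; exact: psi_projK.
    split => // i it'.
    have mx k : dotp (row k P) z <= dotp (row i0 P) z.
      by apply/maxfaceP: k; rewrite zt.
    have h : dotp (row i0 P) z <= dotp (w *m P) z.
      have hh : scaleS s hull (s *: row i0 P) by exists (row i0 P) => //; exact: mem_hull.
      have := psi_supp x cS hh; rewrite -/z -yp -wy !dotpZl ler_pM2l//.
    have [w0 w1] := sw.
    have wz : dotp (w *m P) z = \sum_k w ord0 k * dotp (row k P) z.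
      by rewrite mulmx_sum_row dotp_suml; apply: eq_bigr => k _; rewrite dotpZl.
    have : \sum_k w ord0 k * (dotp (row i0 P) z - dotp (row k P) z) == 0.
      rewrite eq_le; apply/andP; split; last first.
        by apply: sumr_ge0 => k _; rewrite mulr_ge0// subr_ge0.
      under eq_bigr do rewrite mulrBr.
      by rewrite sumrB -mulr_suml w1 mul1r -wz subr_le0.
    rewrite psumr_eq0; last by move=> k _; rewrite mulr_ge0// subr_ge0.
    move=> /allP /(_ i (mem_index_enum _)) /=; rewrite mulf_eq0 => /orP[/eqP//|].
    rewrite subr_eq0 => /eqP E; exfalso; move/negP: it'; apply.
    by rewrite -zt; apply/maxfaceP => k; rewrite -E.
  move=> [w [[w0 w1] wt] [z [Cz zt] ->]].
  have hw : hull (w *m P) by exists w.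
  rewrite /preimage /= (proj1 (psiE cS _ _))//; first by exists (w *m P).
  move=> _ [_ [v [v0 v1] <-] <-]; rewrite !dotpZl ler_pM2l//= !mulmx_sum_row !dotp_suml.
  have mx k : dotp (row k P) z <= dotp (row i0 P) z.
    by apply/maxfaceP: k; rewrite zt.
  apply: (@le_trans _ _ (\sum_i v ord0 i * dotp (row i0 P) z)).
    by apply: ler_sum => i _; rewrite dotpZl ler_wpM2l.
  rewrite -mulr_suml v1 -w1 mulr_suml; apply: ler_sum => i _; rewrite dotpZl.
  have [it'|/wt ->] := boolP (i \in t); last by rewrite !mul0r.
  by rewrite ler_wpM2l//; apply/maxfaceP: (i0); rewrite zt.
move=> s C s0; rewrite pieceE//.
have := pieceE 1 C ltr01; rewrite scaleS1 => ->.
have [T [detT QT zT]] := stretch_matrix Q s.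
have Tu : T \in unitmx by rewrite unitmxE detT unitfE expf_neq0// gt_eqF.
have -> : piece s C = +%R (s *: row i0 P) @` (mulmxr T @` (+%R (- row i0 P) @` piece 1 C)).
  have Qz z : maxface z = t -> Q *m z^T = 0.
    move=> zt; apply/colP => i; rewrite !mxE.
    have [it'|it'] := boolP (i \in t); last first.
      by apply: big1 => j _; rewrite !mxE (negbTE it') mul0r.
    have : dotp (row i P) z = dotp (row i0 P) z.
      apply/eqP; rewrite eq_le; apply/andP; split.
        by apply/maxfaceP: (i); rewrite zt.
      by apply/maxfaceP: (i0); rewrite zt.
    move/eqP; rewrite -subr_eq0 -dotpBl => /eqP E.
    transitivity (dotp (row i P - row i0 P) z); last exact: E.
    by rewrite /dotp; apply: eq_bigr => j _; rewrite !mxE it'.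
  have comp w z : spx w -> maxface z = t ->
      s *: row i0 P + (- row i0 P + (1 *: (w *m P) + z)) *m T = s *: (w *m P) + z.
    move=> sw zt; rewrite scale1r wPQ// !addrA addNr add0r mulmxDl QT zT ?Qz//.
    by rewrite addrA scalerDr.
  apply/seteqP; split => [x [w sw [z [Cz zt] ->]]|].
    exists ((- row i0 P + (1 *: (w *m P) + z)) *m T); last exact: comp.
    exists (- row i0 P + (1 *: (w *m P) + z)) => //.
    exists (1 *: (w *m P) + z) => //; exists w => //; exists z => //.
  move=> _ [_ [_ [_ [w sw [z [Cz zt] ->]] <-] <-] <-].
  exists w => //; exists z => //; exact: comp.
by rewrite leb_shift leb_mulmx// leb_shift detT ger0_norm// exprn_ge0// ltW.
Qed.

End PolytopeSteiner.

Section VandermondeNodes.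
Variables (R : realType) (n : nat).

(** Row [m] extracts the coefficient of degree [m] of a polynomial of degree at most [n] from its
    values at 1, ..., n + 1: the inverse Vandermonde matrix at these nodes. *)
Definition lagrange : 'M[R]_n.+1 :=
  invmx (Vandermonde n.+1 (\row_(k < n.+1) (k.+1%:R : R)))^T.

Lemma lagrangeP (m d : 'I_n.+1) :
  \sum_k lagrange m k * k.+1%:R ^+ d = (m == d)%:R.
Proof.
pose W := Vandermonde n.+1 (\row_(k < n.+1) (k.+1%:R : R)).
have Wu : W^T \in unitmx.
  rewrite unitmx_tr unitmxE det_Vandermonde unitfE.
  apply/prodf_neq0 => i _; apply/prodf_neq0 => j ij.
  by rewrite !mxE subr_eq0 eqr_nat eqSS gtn_eqF.
have : (lagrange *m W^T) m d = (m == d)%:R by rewrite mulVmx// mxE.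
by rewrite mxE => <-; apply: eq_bigr => k _; rewrite !mxE.
Qed.

Lemma lagrange_coef (a : 'I_n.+1 -> R) (m : 'I_n.+1) :
  \sum_k lagrange m k * (\sum_(d < n.+1) k.+1%:R ^+ d * a d) = a m.
Proof.
under eq_bigr do rewrite mulr_sumr.
rewrite exchange_big /= (bigD1 m)//= [X in _ + X]big1 ?addr0.
  under eq_bigr do rewrite mulrA.
  by rewrite -mulr_suml lagrangeP eqxx mul1r.
move=> d dm; under eq_bigr do rewrite mulrA.
by rewrite -mulr_suml lagrangeP eq_sym (negbTE dm) mul0r.
Qed.

End VandermondeNodes.

Lemma exists_pos_lb (R : realType) (m : nat) (f : 'I_m -> R) : (forall k, 0 < f k) ->
  exists2 e : R, 0 < e <= 1 & forall k, e <= f k.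
Proof.
move=> f0; exists (\big[Num.min/1]_k f k); last by move=> k; exact: bigmin_le_cond.
apply/andP; split; last exact: bigmin_le_id.
by elim/big_ind : _ => // x y x0 y0; rewrite lt_min x0.
Qed.

(** * Volumes of sets with prescribed normal vectors *)

Section ParallelVolume.
Variables (R : realType) (n' : nat).
Local Notation n := n'.+1.
Local Notation V := 'rV[R]_n.
Implicit Types (K L C D : set V) (s t r : R).

Definition bnd C := exists r, C `<=` @eball R n r.

Lemma bnd_sub C D : C `<=` D -> bnd D -> bnd C.
Proof. by move=> CD [r Dr]; exists r => x /CD/Dr. Qed.

Lemma bnd_leb_fin C : bnd C -> (leb_outer C < +oo)%E.
Proof.
move=> [r Cr]; apply: (@leb_bounded _ _ _ (const_mx (- r)) (const_mx r)).
by move=> x /Cr; exact: eball_box.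
Qed.

Lemma bnd_lebE C : bnd C -> leb_outer C = (fine (leb_outer C))%:E.
Proof. by move=> bC; rewrite fineK// ge0_fin_numE ?outer_measure_ge0// bnd_leb_fin. Qed.

Lemma ccv_bnd K : ccv K -> bnd K.
Proof. by move=> /ccv_bounded [r _ Kr]; exists r. Qed.

Lemma bnd_psi K C : ccv K -> bnd C -> bnd (psi K @^-1` C).
Proof.
move=> cK [r Cr]; have [k k0 Kk] := ccv_bounded cK; exists (k + r) => x /Cr xr.
rewrite /eball /= (psi_projK K x) (le_trans (enormD _ _))// lerD//.
by apply: Kk; have [] := projP x cK.
Qed.

(** The body is dilated while the set of normal vectors stays fixed, which makes sense when [C] is
    not a cone. *)
Definition mu K s C : R := fine (leb_outer (psi (scaleS s K) @^-1` C)).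

Lemma muE K s C : ccv K -> bnd C ->
  leb_outer (psi (scaleS s K) @^-1` C) = (mu K s C)%:E.
Proof. by move=> cK bC; apply: bnd_lebE; apply: bnd_psi => //; exact: ccv_scale. Qed.

Lemma mu_ge0 K s C : 0 <= mu K s C.
Proof. exact/fine_ge0/outer_measure_ge0. Qed.

Lemma mu_le K s C D : ccv K -> bnd D -> C `<=` D -> mu K s C <= mu K s D.
Proof.
move=> cK bD CD; rewrite -lee_fin -!muE//; last exact: bnd_sub CD bD.
by apply: le_outer_measure; exact: preimage_subset.
Qed.

Lemma borel_psi K C : ccv K -> borel C -> borel (psi K @^-1` C).
Proof. by move=> cK; apply: borel_preimage; exact: psi_continuous. Qed.

Lemma mu_split K s C D : ccv K -> bnd C -> borel D ->
  mu K s C = mu K s (C `&` D) + mu K s (C `&` ~` D).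
Proof.
move=> cK bC bD; apply: EFin_inj; rewrite EFinD -!muE//.
- exact: (leb_split (psi (scaleS s K) @^-1` C) (borel_psi (ccv_scale s cK) bD)).
- by apply: bnd_sub bC => x [].
- by apply: bnd_sub bC => x [].
Qed.

Lemma mu0 K s : mu K s set0 = 0.
Proof. by rewrite /mu preimage_set0 outer_measure0. Qed.

Definition steiner_pos K := forall (m : nat) (c s : 'I_m -> R), (forall k, 0 < s k) ->
  (forall d, (d <= n)%N -> 0 <= \sum_k c k * s k ^+ d) ->
  forall C, borel C -> bnd C -> 0 <= \sum_k c k * mu K (s k) C.

Lemma hull_steiner_pos N (P : 'M[R]_(N.+1, n)) : steiner_pos (hull P).
Proof.
move=> m c s s0 cs C bC bdC; have cH := ccv_hull P.
have /choice[d dP] : forall t : {set 'I_N.+1}, exists d, (d <= n)%N /\ forall (s : R) C, 0 < s ->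
    leb_outer (psi (scaleS s (hull P)) @^-1` (C `&` [set z | maxface P z = t])) =
    ((s ^+ d)%:E * leb_outer (psi (hull P) @^-1` (C `&` [set z | maxface P z = t])))%E.
  by move=> t; have [d dn H] := piece_dilation P t; exists d.
pose b (t : {set 'I_N.+1}) := fine (leb_outer (psi (hull P) @^-1` (C `&` [set z | maxface P z = t]))).
have b0 (t : {set 'I_N.+1}) : 0 <= b t by exact/fine_ge0/outer_measure_ge0.
have E k : mu (hull P) (s k) C = \sum_t s k ^+ d t * b t.
  apply: EFin_inj; rewrite -muE// -sumEFin.
  rewrite (@leb_partition _ _ {set 'I_N.+1} (fun x => maxface P (psi (scaleS (s k) (hull P)) x))).
    apply: eq_bigr => t _; have [_ dt] := dP t.
    rewrite EFinM /b -bnd_lebE; first by rewrite -dt.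
    by apply: bnd_psi => //; apply: bnd_sub bdC => x [].
  move=> t; apply: (borel_psi (ccv_scale (s k) cH) (C := [set z | maxface P z = t])).
  exact: borel_maxface.
under eq_bigr do rewrite E mulr_sumr.
rewrite exchange_big; apply: sumr_ge0 => t _ /=.
under eq_bigr do rewrite mulrA.
by rewrite -mulr_suml mulr_ge0// cs//; have [] := dP t.
Qed.

Lemma hull_approx K eta : ccv K -> 0 < eta -> exists N (P : 'M[R]_(N.+1, n)),
  hull P `<=` K /\ forall y, K y -> exists2 z, hull P z & enorm (y - z) <= eta.
Proof.
move=> cK eta0; have [cptK _ [x0 Kx0]] := cK.
move: (cptK); rewrite compact_cover => /(_ V K (fun x => [set y | enorm (y - x) < eta])).
case=> [x Kx|x Kx|D DK Dcov].
- apply/open_enormP => y /= yx; exists (eta - enorm (y - x)); first by rewrite subr_gt0.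
  by move=> z zy; rewrite (le_lt_trans (enorm_dist _ y _))// -ltrBrDr.
- by exists x => //=; rewrite subrr enorm0.
pose s := x0 :: finmap.enum_fset D.
exists (size s).-1, (\matrix_(i < (size s).-1.+1) nth x0 s i).
set P := (\matrix_(_ < _) _).
have rP i : row i P = nth x0 s i by rewrite rowK.
have sK x : x \in s -> K x.
  by rewrite in_cons => /orP[/eqP-> //|xD]; apply/set_mem/DK.
split.
  move=> _ [w [w0 w1] <-] /=; apply: (ccvP_supp cK) => z.
  rewrite mulmx_sum_row dotp_sumr -[leRHS]mul1r -w1 mulr_suml.
  apply: ler_sum => i _; rewrite dotpZr ler_wpM2l// supp_fun_ge//.
  by rewrite rP; apply: sK; apply: mem_nth; exact: ltn_ord.
move=> y Ky; have [x xD yx] := Dcov y Ky.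
exists x; last exact: ltW.
have xs : x \in s by rewrite in_cons xD orbT.
have si : (index x s < (size s).-1.+1)%N by rewrite prednK ?index_mem.
by rewrite -(nth_index x0 xs) -(rP (Ordinal si)); exact: mem_hull.
Qed.

Lemma enorm_psi_le K L (eta : R) x : ccv K -> ccv L ->
  (forall y, K y -> exists2 z, L z & enorm (y - z) <= eta) ->
  enorm (psi L x) <= enorm (psi K x) + eta.
Proof.
move=> cK cL KL; have [Kp _] := projP x cK; have [z Lz pz] := KL _ Kp.
have [_ /(_ z Lz) h] := projP x cL; apply: le_trans h _.
by rewrite (le_trans (enorm_dist _ (proj K x) _))// lerD2l.
Qed.

Lemma psi_close K L (eta e r : R) x : ccv K -> ccv L -> 0 < e ->
  (forall y, K y -> exists2 z, L z & enorm (y - z) <= eta) ->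
  (forall y, L y -> exists2 z, K z & enorm (y - z) <= eta) ->
  eta <= 1 -> eta * (2 * r + 1) <= e ^+ 2 ->
  enorm (psi K x) <= r -> enorm (psi K x - psi L x) <= e.
Proof.
move=> cK cL e0 KL LK eta1 etae xr; have eta0 : 0 <= eta.
  have [_ _ [y Ky]] := cK; have [z _ h] := KL _ Ky.
  exact: le_trans (enorm_ge0 _) h.
rewrite -(ler_pXn2r (_ : (0 < 2)%N))// ?nnegrE ?enorm_ge0 ?(ltW e0)//.
apply: le_trans (psi_stable x cK cL KL LK) _; apply: le_trans etae.
rewrite ler_wpM2l//; have := enorm_psi_le x cK cL KL; lra.
Qed.

Lemma hausdorff_scale K L (eta s : R) : 0 <= s ->
  (forall y, K y -> exists2 z, L z & enorm (y - z) <= eta) ->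
  (forall y, scaleS s K y -> exists2 z, scaleS s L z & enorm (y - z) <= s * eta).
Proof.
move=> s0 KL _ [y Ky <-]; have [z Lz yz] := KL _ Ky.
exists (s *: z); first by exists z.
by rewrite -scalerBr enormZ ger0_norm// ler_wpM2l.
Qed.

(** Continuity from above: the closed neighbourhoods of a compact set decrease to it and have
    preimages of finite volume. *)
Lemma mu_upper K s C (d : R) : ccv K -> compact C -> 0 < d ->
  exists2 e0 : R, 0 < e0 & forall e, e <= e0 -> mu K s (msum C (@eball R n e)) <= mu K s C + d.
Proof.
move=> cK cC d0; have cS := ccv_scale s cK.
pose E (j : nat) := msum C (@eball R n j.+1%:R^-1).
have cE j : compact (E j) by apply: compact_msum => //; exact: compact_eball.
have bC : bnd C.
  have [M [_ MC]] := compact_bounded cC; exists (n%:R * (M + 1)) => x Cx.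
  by rewrite /eball /= (le_trans (enorm_le_norm _))// ler_wpM2l// MC// ltrDl.
have bE e : bnd (msum C (@eball R n e)).
  have [r Cr] := bC; exists (r + e) => _ [a Ca [b be ->]].
  by rewrite /eball /= (le_trans (enormD _ _))// lerD//; exact: Cr.
have clE j : closed (E j) by apply: compact_closed; [exact: norm_hausdorff|exact: cE].
pose F j : set (borel_space R n') := psi (scaleS s K) @^-1` E j.
have mF j : measurable (F j) by apply: borel_psi => //; exact: borel_closed.
have Fnd : {homo F : i j / (i <= j)%N >-> (j <= i)%O}.
  move=> i j ij; apply/subsetPset; apply: preimage_subset => _ [a Ca [b be ->]].
  exists a => //; exists b => //; apply: le_trans be _.
  by rewrite lef_pV2 ?posrE// ler_nat.
have capE : \bigcap_j F j = psi (scaleS s K) @^-1` C.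
  apply/seteqP; split => x; last first.
    move=> Cx j _; exists (psi (scaleS s K) x) => //; exists 0; last by rewrite addr0.
    by rewrite /eball /= enorm0 invr_ge0.
  move=> Fx; have : closure C (psi (scaleS s K) x).
    move=> B /enorm_nbhs [e e0 eB].
    have [a Ca [b be E0]] := Fx (Num.truncn e^-1) Logic.I.
    exists a; split => //; apply: eB; rewrite E0 opprD addNKr enormN.
    apply: le_lt_trans be _; rewrite -[ltRHS]invrK ltf_pV2 ?posrE ?invr_gt0//.
    exact: truncnS_gt.
  by apply: compact_closed; [exact: norm_hausdorff|].
have F0 : (lebm (F 0%N) < +oo)%E by apply: bnd_leb_fin; apply: (bnd_psi cS); exact: bE.
have := @nonincreasing_cvg_mu _ _ _ (@lebm R n' : {measure set (borel_space R n') -> \bar R})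
  F F0 mF (bigcapT_measurable mF) Fnd.
rewrite capE => cv.
have {}cv : (fun j => lebm (F j)) @ \oo --> (mu K s C)%:E by rewrite -(muE s cK bC).
move/fine_cvgP : cv => [_ /cvgrPdist_lt /(_ d d0) [j0 _ H]].
exists (j0.+1%:R^-1); first by rewrite invr_gt0.
move=> e ee0; have /= h := H j0 (leqnn _).
apply: (@le_trans _ _ (mu K s (E j0))).
  apply: mu_le => //; first exact: bE.
  move=> _ [a Ca [b be ->]]; exists a => //; exists b => //.
  exact: le_trans be ee0.
rewrite -lerBlDl; apply/ltW; apply: le_lt_trans h; rewrite distrC.
exact: ler_norm.
Qed.

(** For compact [C], the volumes for [K] and for an approximating polytope are compared at the cost
    of a neighbourhood of [C]: the negative coefficients are estimated by enlarging [C] once and the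
    positive ones by enlarging it twice, after which [mu_upper] removes the enlargement. Inner
    regularity passes to Borel sets. *)
Theorem ccv_steiner_pos K : ccv K -> steiner_pos K.
Proof.
move=> cK m c s s0 cs.
pose cp k := Num.max 0 (c k); pose cn k := Num.max 0 (- c k).
have cpn k : c k = cp k - cn k.
  rewrite /cp /cn; have [h|h] := leP 0 (c k).
    by rewrite max_l ?oppr_le0// subr0.
  by rewrite max_r ?oppr_ge0 ?ltW// opprK add0r.
have cp0 k : 0 <= cp k by rewrite le_max lexx.
have cn0 k : 0 <= cn k by rewrite le_max lexx.
pose S := 1 + \sum_k s k; have sS k : s k <= S.
  rewrite /S (bigD1 k)//= addrCA lerDl addr_ge0// sumr_ge0// => j _; exact: ltW.
have S0 : 0 < S by rewrite ltr_wpDr// sumr_ge0// => j _; exact: ltW.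
have posC C : compact C -> bnd C -> 0 <= \sum_k c k * mu K (s k) C.
  move=> cC bC; have [r Cr] := bC.
  have -> : \sum_k c k * mu K (s k) C =
     \sum_k cp k * mu K (s k) C - \sum_k cn k * mu K (s k) C.
    by rewrite -sumrB; apply: eq_bigr => k _; rewrite cpn mulrBl.
  rewrite subr_ge0; apply/ler_addgt0Pr => d d0.
  pose A := 1 + \sum_k cp k; have A0 : 0 < A by rewrite ltr_wpDr// sumr_ge0.
  have /choice[e1 e1P] : forall k, exists e : R, 0 < e /\
      forall e', e' <= e -> mu K (s k) (msum C (@eball R n e')) <= mu K (s k) C + d / A.
    move=> k; have dA : 0 < d / A by rewrite divr_gt0.
    by have [e e0 H] := mu_upper (s k) cK cC dA; exists e.
  have [e /andP[e0 e1le] eP] : exists2 e : R, 0 < e <= 1 & forall k, e <= e1 k / 2.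
    by apply: exists_pos_lb => k; have [? _] := e1P k; rewrite divr_gt0.
  pose r' := `|r| + 1; have r'0 : 0 < r' by rewrite ltr_wpDl.
  have r'p : 0 < 2 * r' + 1 by rewrite addr_gt0// mulr_gt0.
  (* Chosen so that at every scale [s k <= S] the stability estimate keeps the two normal maps
     within [e] on the relevant bounded set. *)
  pose eta := Num.min 1 (e ^+ 2 / (2 * r' + 1)) / S.
  have eta0 : 0 < eta by rewrite divr_gt0// lt_min ltr01 divr_gt0// exprn_gt0.
  have etaS k : s k * eta <= Num.min 1 (e ^+ 2 / (2 * r' + 1)).
    rewrite /eta mulrCA -[leRHS]mulr1 ler_wpM2l//.
      by rewrite le_min ler01 divr_ge0 ?(ltW r'p)// sqr_ge0.
    by rewrite ler_pdivrMr// mul1r.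
  have eta1 k : s k * eta <= 1 by rewrite (le_trans (etaS k))// ge_min lexx.
  have eta2 k : s k * eta * (2 * r' + 1) <= e ^+ 2.
    by rewrite -ler_pdivlMr// (le_trans (etaS k))// ge_min lexx orbT.
  have [N [P [PK KP]]] := hull_approx cK eta0.
  have {}PK y : hull P y -> exists2 z, K z & enorm (y - z) <= eta.
    by move=> /PK Ky; exists y => //; rewrite subrr enorm0 ltW.
  have cP := ccv_hull P.
  have clo1 k x : enorm (psi (scaleS (s k) K) x) <= r' ->
      enorm (psi (scaleS (s k) K) x - psi (scaleS (s k) (hull P)) x) <= e.
    apply: (@psi_close _ _ (s k * eta) e r' x) => //; try exact: ccv_scale.
    - exact: (hausdorff_scale (ltW (s0 k)) KP).
    - exact: (hausdorff_scale (ltW (s0 k)) PK).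
  have clo2 k x : enorm (psi (scaleS (s k) (hull P)) x) <= r' ->
      enorm (psi (scaleS (s k) (hull P)) x - psi (scaleS (s k) K) x) <= e.
    apply: (@psi_close _ _ (s k * eta) e r' x) => //; try exact: ccv_scale.
    - exact: (hausdorff_scale (ltW (s0 k)) PK).
    - exact: (hausdorff_scale (ltW (s0 k)) KP).
  pose Ce := msum C (@eball R n e).
  have cCe : compact Ce by apply: compact_msum => //; exact: compact_eball.
  have bCe : bnd Ce.
    exists r' => _ [a /Cr Ca [b be ->]]; rewrite /eball /= (le_trans (enormD _ _))// lerD//.
      exact: le_trans Ca (ler_norm _).
    exact: le_trans be e1le.
  have borCe : borel Ce by apply: borel_closed; apply: compact_closed => //; exact: norm_hausdorff.
  have step1 : \sum_k cn k * mu K (s k) C <= \sum_k cn k * mu (hull P) (s k) Ce.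
    apply: ler_sum => k _; rewrite ler_wpM2l// -lee_fin -!muE//.
    apply: le_outer_measure => x Cx; exists (psi (scaleS (s k) K) x) => //.
    exists (psi (scaleS (s k) (hull P)) x - psi (scaleS (s k) K) x); last by rewrite addrC subrK.
    rewrite /eball /= enormBC; apply: clo1; apply: le_trans (Cr _ Cx) _.
    by rewrite (le_trans (ler_norm _))// lerDl.
  have step2 : \sum_k cn k * mu (hull P) (s k) Ce <= \sum_k cp k * mu (hull P) (s k) Ce.
    rewrite -subr_ge0 -sumrB.
    have := hull_steiner_pos P s0 cs borCe bCe.
    by congr (_ <= _); apply: eq_bigr => k _; rewrite cpn mulrBl.
  have step3 : \sum_k cp k * mu (hull P) (s k) Ce <= \sum_k cp k * (mu K (s k) C + d / A).
    apply: ler_sum => k _; rewrite ler_wpM2l//.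
    have [_ e1k] := e1P k; apply: le_trans (e1k (e + e) _); last first.
      by rewrite [leRHS]splitr lerD.
    have bE : bnd (msum C (@eball R n (e + e))).
      exists (r + (e + e)) => _ [a /Cr Ca [b be ->]].
      by rewrite /eball /= (le_trans (enormD _ _))// lerD.
    rewrite -lee_fin -!muE//; apply: le_outer_measure => x.
    move=> [a Ca [b be E]]; exists a => //.
    exists (b + (psi (scaleS (s k) K) x - psi (scaleS (s k) (hull P)) x)); last first.
      by rewrite addrA -E addrC subrK.
    rewrite /eball /= (le_trans (enormD _ _))// lerD// enormBC; apply: clo2.
    rewrite E (le_trans (enormD _ _))// lerD//; last exact: le_trans be e1le.
    exact: le_trans (Cr _ Ca) (ler_norm _).
  apply: le_trans step1 (le_trans step2 (le_trans step3 _)).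
  under eq_bigr do rewrite mulrDr.
  rewrite big_split /= lerD2l -mulr_suml mulrA ler_pdivrMr// mulrC ler_pM2l//.
  by rewrite /A lerDr.
move=> C bC bdC; rewrite -oppr_le0; apply/ler_addgt0Pr => d d0; rewrite add0r.
pose A := 1 + \sum_k `|c k|; have A0 : 0 < A by rewrite ltr_wpDr// sumr_ge0.
(* Compact parts of the preimages are pushed forward by the normal maps; the union [G] of the images
   is one compact subset of [C] that serves all scales. *)
have /choice[F FP] : forall k, exists F, [/\ compact F, F `<=` psi (scaleS (s k) K) @^-1` C &
    (leb_outer (psi (scaleS (s k) K) @^-1` C) <= leb_outer F + (d / A)%:E)%E].
  move=> k; have cS := ccv_scale (s k) cK.
  have [r Pr] := bnd_psi cS bdC.
  apply: (leb_inner_regular (borel_psi cS bC) (b := const_mx r) (a := const_mx (- r))).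
    by move=> x /Pr; exact: eball_box.
  by rewrite divr_gt0.
pose G : set V := \big[setU/set0]_k (psi (scaleS (s k) K) @` F k).
have cG : compact G.
  rewrite /G; elim/big_ind : _ => [|X Y cX cY|k _]; first exact: compact0.
    exact: compactU.
  apply: continuous_compact; last by have [] := FP k.
  by apply: continuous_subspaceT; apply: psi_continuous; exact: ccv_scale.
have GC : G `<=` C.
  rewrite /G; elim/big_ind : _ => [//|X Y hX hY x [/hX//|/hY//]|k _ _ [x Fx <-]].
  by have [_ FC _] := FP k; exact: FC.
have bG := bnd_sub GC bdC.
have key k : `|mu K (s k) C - mu K (s k) G| <= d / A.
  have le1 := mu_le (s k) cK bdC GC.
  rewrite ger0_norm ?subr_ge0// lerBlDl -lee_fin EFinD -!muE//.
  have [_ _ /le_trans] := FP k; apply; apply: leeD2r; apply: le_outer_measure => x Fx.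
  rewrite /preimage /= /G -bigcup_seq; exists k; first by rewrite /= mem_index_enum.
  by exists x.
have := posC G cG bG; rewrite -subr_ge0 => G0.
rewrite -sumrN -[leRHS]addr0; apply: (@le_trans _ _ (\sum_k `|c k| * (d / A) - \sum_k c k * mu K (s k) G)).
  rewrite -sumrB; apply: ler_sum => k _; rewrite -subr_ge0.
  have h : `|c k * (mu K (s k) C - mu K (s k) G)| <= `|c k| * (d / A).
    by rewrite normrM ler_wpM2l.
  move: h; rewrite ler_norml => /andP[h _]; move: h; rewrite mulrBr; lra.
apply: lerD; last by rewrite oppr_le0; exact: posC.
by rewrite -mulr_suml mulrA ler_pdivrMr// mulrC ler_pM2l// /A lerDr.
Qed.

End ParallelVolume.

(** * Coefficients of the Steiner polynomial and area measures *)

Section SupportMeasures.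
Variables (R : realType) (n' : nat).
Local Notation n := n'.+1.
Local Notation V := 'rV[R]_n.
Implicit Types (K L C D w : set V) (s t r : R) (m : 'I_n.+1).

(** The candidate for the coefficient of [s^m], defined by interpolation before polynomiality is
    known. Up to normalisation it yields [S_m] on cones over sets of directions. *)
Definition Sig K m C : R := \sum_(k < n.+1) lagrange R n m k * mu K k.+1%:R C.

Lemma Sig_ge0 K m C : ccv K -> borel C -> bnd C -> 0 <= Sig K m C.
Proof.
move=> cK bC bdC.
apply: (ccv_steiner_pos cK (s := fun k : 'I_n.+1 => k.+1%:R)) => // d dn.
have dn' : (d < n.+1)%N by rewrite ltnS.
by have /= -> := lagrangeP R m (Ordinal dn'); rewrite ler0n.
Qed.

(** The interpolation remainder is a combination of volumes whose weights annihilate all monomials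
    up to degree [n]. Positivity applies to it and to its negative, so it vanishes. *)
Lemma steiner_formula K s C : ccv K -> borel C -> bnd C -> 0 < s ->
  mu K s C = \sum_(m < n.+1) s ^+ m * Sig K m C.
Proof.
move=> cK bC bdC s0.
have E (c0 : R) : (forall d, (d <= n)%N ->
    0 <= c0 * (s ^+ d - \sum_(k < n.+1) (\sum_(m < n.+1) s ^+ m * lagrange R n m k) * k.+1%:R ^+ d)) ->
    0 <= c0 * (mu K s C - \sum_(m < n.+1) s ^+ m * Sig K m C).
  move=> H.
  (* Index 0 carries the scale [s], the others the nodes 1, ..., n + 1; [c0] will be 1 or -1. *)
  pose c (i : 'I_n.+2) := if unlift ord0 i is Some k
    then - c0 * (\sum_(m < n.+1) s ^+ m * lagrange R n m k) else c0.
  pose ss (i : 'I_n.+2) := if unlift ord0 i is Some k then k.+1%:R else s.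
  have comb (F : R -> R) : \sum_i c i * F (ss i) =
      c0 * (F s - \sum_(k < n.+1) (\sum_(m < n.+1) s ^+ m * lagrange R n m k) * F k.+1%:R).
    rewrite big_ord_recl /c /ss unlift_none mulrBr; congr (_ + _).
    rewrite mulr_sumr -sumrN; apply: eq_bigr => k _.
    by rewrite liftK !mulNr mulrA.
  have -> : \sum_(m < n.+1) s ^+ m * Sig K m C =
      \sum_(k < n.+1) (\sum_(m < n.+1) s ^+ m * lagrange R n m k) * mu K k.+1%:R C.
    under [RHS]eq_bigr do rewrite mulr_suml.
    rewrite exchange_big; apply: eq_bigr => m _ /=; rewrite /Sig mulr_sumr.
    by apply: eq_bigr => k _; rewrite mulrA.
  rewrite -(comb (fun x => mu K x C)).
  apply: (ccv_steiner_pos cK (c := c) (s := ss)) => //.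
    by move=> i; rewrite /ss; case: (unlift _ _).
  by move=> d dn; rewrite (comb (fun x => x ^+ d)); exact: H.
have Z d : (d <= n)%N ->
    s ^+ d - \sum_(k < n.+1) (\sum_(m < n.+1) s ^+ m * lagrange R n m k) * k.+1%:R ^+ d = 0.
  move=> dn; have dn' : (d < n.+1)%N by rewrite ltnS.
  apply/eqP; rewrite subr_eq0; apply/eqP.
  under eq_bigr do rewrite mulr_suml.
  rewrite exchange_big (bigD1 (Ordinal dn'))//= [X in _ + X]big1 ?addr0.
    under eq_bigr do rewrite -mulrA.
    by rewrite -mulr_sumr (lagrangeP R (Ordinal dn') (Ordinal dn')) eqxx mulr1.
  move=> m md; under eq_bigr do rewrite -mulrA.
  by rewrite -mulr_sumr (lagrangeP R m (Ordinal dn')) (negbTE md) mulr0.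
have {}E c0 : 0 <= c0 * (mu K s C - \sum_(m < n.+1) s ^+ m * Sig K m C).
  by apply: E => d dn; rewrite Z// mulr0.
apply/eqP; rewrite -subr_eq0 eq_le; apply/andP; split.
  by rewrite -oppr_ge0 -mulN1r; exact: E.
by rewrite -[leRHS]mul1r; exact: E.
Qed.

Lemma Sig_uniq K C (b : 'I_n.+1 -> R) m :
  (forall s, 0 < s -> mu K s C = \sum_(d < n.+1) s ^+ d * b d) -> Sig K m C = b m.
Proof.
move=> H; rewrite -(lagrange_coef b m) /Sig; apply: eq_bigr => k _.
by rewrite H.
Qed.

Lemma Sig_split K m C D : ccv K -> bnd C -> borel D ->
  Sig K m C = Sig K m (C `&` D) + Sig K m (C `&` ~` D).
Proof.
move=> cK bC bD; rewrite /Sig -big_split /=; apply: eq_bigr => k _.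
by rewrite -mulrDr; congr (_ * _); exact: mu_split.
Qed.

Lemma Sig0 K m : Sig K m set0 = 0.
Proof. by rewrite /Sig big1// => k _; rewrite mu0 mulr0. Qed.

Lemma Sig_le K m C D : ccv K -> bnd D -> borel C -> borel D -> C `<=` D ->
  Sig K m C <= Sig K m D.
Proof.
move=> cK bdD bC bD CD; rewrite (Sig_split m cK bdD bC).
have -> : D `&` C = C by apply/setIidr.
rewrite lerDl Sig_ge0//; first by apply: borelI => //; exact: borelC.
by apply: bnd_sub bdD => x [].
Qed.

Lemma mu_scale K s t C : ccv K -> 0 < s -> 0 < t -> bnd C ->
  mu K s (scaleS t C) = t ^+ n * mu K (s / t) C.
Proof.
move=> cK s0 t0 bC.
have st : scaleS s K = scaleS t (scaleS (s / t) K).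
  by rewrite scaleSA mulrC divfK// gt_eqF.
have cst := ccv_scale (s / t) cK.
rewrite /mu -[t ^+ n]/(fine (t ^+ n)%:E) -fineM//; last first.
  by rewrite muE.
rewrite -leb_scale//; congr (fine (leb_outer _)).
have tK (x : V) : t *: (t^-1 *: x) = x by rewrite scalerA divff ?scale1r// gt_eqF.
apply/seteqP; split => x.
  rewrite /preimage /= st -{1}(tK x) psi_scale// => -[z Cz E].
  exists (t^-1 *: x) => //; rewrite /preimage /=.
  suff -> : psi (scaleS (s / t) K) (t^-1 *: x) = z by [].
  by apply: (scalerI (lt0r_neq0 t0)); rewrite -E.
move=> [y Cy <-]; rewrite /preimage /= st psi_scale//.
by exists (psi (scaleS (s / t) K) y).
Qed.

Lemma bnd_scale t C : bnd C -> bnd (scaleS t C).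
Proof.
move=> [r Cr]; exists (`|t| * r) => _ [x Cx <-].
by rewrite /eball /= enormZ ler_wpM2l// Cr.
Qed.

Lemma borel_scale t C : 0 < t -> borel C -> borel (scaleS t C).
Proof.
move=> t0 bC; have -> : scaleS t C = *:%R t^-1 @^-1` C.
  apply/seteqP; split => [_ [x Cx <-]|x Cx]; rewrite /preimage /=.
    by rewrite scalerA mulVf ?scale1r// gt_eqF.
  by exists (t^-1 *: x) => //; rewrite scalerA divff ?scale1r// gt_eqF.
by apply: borel_preimage => //; exact: scale_continuous.
Qed.

Lemma Sig_scale K m t C : ccv K -> 0 < t -> borel C -> bnd C ->
  Sig K m (scaleS t C) = t ^+ (n - m) * Sig K m C.
Proof.
move=> cK t0 bC bdC.
apply: (@Sig_uniq _ _ (fun d : 'I_n.+1 => t ^+ (n - d) * Sig K d C)) => s s0.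
rewrite mu_scale// steiner_formula ?divr_gt0// mulr_sumr; apply: eq_bigr => d _.
rewrite !mulrA; congr (_ * _); have dn : (d <= n)%N by rewrite -ltnS ltn_ord.
rewrite expr_div_n -{1}(subnK dn) exprD.
by field; rewrite expf_neq0// gt_eqF.
Qed.

Lemma borel_eball r : borel (@eball R n r).
Proof. by apply: borel_closed; exact: closed_eball. Qed.

Lemma bnd_eball r : bnd (@eball R n r).
Proof. by exists r. Qed.

Lemma compact_set0p : compact [set (0 : V)].
Proof. exact: compact_set1. Qed.

Lemma borel_set0p : borel [set (0 : V)].
Proof.
by apply: borel_closed; apply: compact_closed; [exact: norm_hausdorff|exact: compact_set0p].
Qed.

(** The top coefficient is invariant under scaling of [C], so a punctured ball may be shrunk at
    will, and the volumes over small punctured balls tend to 0. Thus this coefficient, the volume of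
    the body itself, sits at the origin. *)
Lemma Sig_n_eq0 K C : ccv K -> borel C -> bnd C -> ~ C 0 -> Sig K ord_max C = 0.
Proof.
move=> cK bC bdC C0.
have key r : 0 < r -> Sig K ord_max (@eball R n r `&` ~` [set 0]) <= 0.
  move=> r0; apply/ler_addgt0Pr => d d0; rewrite add0r.
  pose A := 1 + \sum_(k < n.+1) `|lagrange R n ord_max k|.
  have A0 : 0 < A by rewrite ltr_wpDr// sumr_ge0.
  have dA : 0 < d / A by rewrite divr_gt0.
  have /choice[e1 e1P] : forall k : 'I_n.+1, exists e : R, 0 < e /\
      forall e', e' <= e -> mu K k.+1%:R (msum [set 0] (@eball R n e')) <=
        mu K k.+1%:R [set 0] + d / A.
    move=> k; have [e e0 H] := mu_upper k.+1%:R cK compact_set0p dA.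
    by exists e.
  have [e /andP[e0 e1le] eP] := exists_pos_lb (fun k => proj1 (e1P k)).
  have -> : @eball R n r `&` ~` [set 0] = scaleS (r / e) (@eball R n e `&` ~` [set 0]).
    have re : 0 < r / e by rewrite divr_gt0.
    apply/seteqP; split => [x [xr x0]|_ [x [xe x0] <-]].
      exists ((r / e)^-1 *: x); last by rewrite scalerA divff ?scale1r// gt_eqF.
      split.
        rewrite /eball /= enormZ gtr0_norm ?invr_gt0// mulrC ler_pdivrMr// mulrC divfK ?gt_eqF//.
      move=> /= /eqP; rewrite scaler_eq0 invr_eq0 (gt_eqF re)/= => /eqP; exact: x0.
    split.
      rewrite /eball /= enormZ gtr0_norm// mulrAC ler_pdivrMr// ler_pM2l//.
    by move=> /= /eqP; rewrite scaler_eq0 (gt_eqF re)/= => /eqP; exact: x0.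
  rewrite Sig_scale ?divr_gt0//; last 2 first.
  - by apply: borelI; [exact: borel_eball|apply: borelC; exact: borel_set0p].
  - by apply: bnd_sub (bnd_eball e) => x [].
  rewrite subnn expr0 mul1r /Sig.
  apply: (@le_trans _ _ (\sum_(k < n.+1) `|lagrange R n ord_max k| * (d / A))); last first.
    by rewrite -mulr_suml mulrA ler_pdivrMr// mulrC ler_pM2l// /A lerDr.
  apply: ler_sum => k _; apply: (le_trans (ler_norm _)).
  rewrite normrM ler_wpM2l// ger0_norm ?mu_ge0//.
  have [_ /(_ _ (eP k))] := e1P k.
  have -> : msum [set 0] (@eball R n e) = @eball R n e.
    apply/seteqP; split => [_ [_ -> [b be ->]]|x xe]; first by rewrite add0r.
    by exists 0 => //; exists x => //; rewrite add0r.
  rewrite (mu_split _ cK (bnd_eball e) borel_set0p).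
  have -> : @eball R n e `&` [set 0] = [set 0].
    by apply/setIidr => _ ->; rewrite /eball /= enorm0 ltW.
  by rewrite lerD2l.
have [r Cr] := bdC.
apply/eqP; rewrite eq_le Sig_ge0// andbT.
have r0 : 0 < `|r| + 1 by rewrite ltr_wpDl.
apply: le_trans (key _ r0); apply: Sig_le => //.
- by apply: bnd_sub (bnd_eball (`|r| + 1)) => x [].
- by apply: borelI; [exact: borel_eball|apply: borelC; exact: borel_set0p].
- move=> x Cx; split; last by move=> E; apply: C0; rewrite -E.
  rewrite /eball /= (le_trans (Cr _ Cx))// (le_trans (ler_norm _))// lerDl//.
Qed.

Lemma cone_leE t w : 0 < t -> cone_le t w = scaleS t (cone01 w).
Proof.
move=> t0; apply/seteqP; split => [_ [a [u wu [/andP[a0 at_] ->]]]|_ [_ [a [u wu [/andP[a0 a1] ->]] <-]]].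
  exists ((a / t) *: u); last by rewrite scalerA mulrC divfK// gt_eqF.
  exists (a / t), u => //; split => //.
  by rewrite divr_gt0//= ler_pdivrMr// mul1r.
exists (t * a), u => //; rewrite scalerA; split => //.
by rewrite mulr_gt0//= -[leRHS]mulr1 ler_pM2l.
Qed.

Lemma cone01E w : w `<=` @sphere R n ->
  cone01 w = [set z | z != 0 /\ w ((enorm z)^-1 *: z)] `&` @eball R n 1.
Proof.
move=> ws; apply/seteqP; split => [_ [t [u wu [/andP[t0 t1] ->]]]|z [[z0 wz] z1]].
  have eu : enorm u = 1 := ws _ wu.
  have et : enorm (t *: u) = t by rewrite enormZ gtr0_norm// eu mulr1.
  split; last by rewrite /eball /= et.
  rewrite /= -enorm_eq0 et gt_eqF// scalerA mulVf ?gt_eqF// scale1r; split => //.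
exists (enorm z), ((enorm z)^-1 *: z) => //.
by rewrite enorm_gt0 z0 z1 scalerA divff ?scale1r// gt_eqF// enorm_gt0.
Qed.

Lemma borel_cone01 w : w `<=` @sphere R n -> borel w -> borel (cone01 w).
Proof.
move=> ws bw; rewrite cone01E//; apply: borelI; last exact: borel_eball.
have : [set W : set V | borel [set z : V | z != 0 /\ W ((enorm z)^-1 *: z)]] w => //.
have nz : borel [set z : V | z != 0].
  rewrite (_ : [set z | _] = ~` [set 0]); first by apply: borelC; exact: borel_set0p.
  by apply/seteqP; split => z /= /eqP.
move: w bw {ws}; apply: smallest_sub.
  split => /=.
  - rewrite (_ : [set z | _] = set0); last by apply/seteqP; split => // z [].
    by rewrite -(setCK set0); apply: borelC; rewrite setC0; apply: borel_open; exact: openT.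
  - move=> W bW.
    rewrite (_ : [set z | _] = [set z : V | z != 0] `\` [set z : V | z != 0 /\ W ((enorm z)^-1 *: z)]).
      exact: borelD.
    apply/seteqP; split => [z [z0 [_ nW]]|z [z0 nW]]; split => //.
      by move=> [_ /nW].
    by split => // Wz; apply: nW.
  - move=> F bF.
    rewrite (_ : [set z | _] = \bigcup_k [set z : V | z != 0 /\ F k ((enorm z)^-1 *: z)]).
      exact: borel_bigcup.
    apply/seteqP; split => [z [z0 [k _ h]]|z [k _ [z0 h]]]; first by exists k.
    by split => //; exists k.
move=> W /open_enormP oW /=; apply: borel_open; apply/open_enormP => z [z0 Wz].
have [e e0 eW] := oW _ Wz.
have ez : 0 < enorm z by rewrite enorm_gt0.
exists (Num.min (enorm z) (e / 2 * enorm z)); first by rewrite lt_min ez mulr_gt0// divr_gt0.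
move=> y; rewrite lt_min => /andP[y1 y2].
have y0 : y != 0 by apply/eqP => E; move: y1; rewrite E sub0r enormN ltxx.
have ey : 0 < enorm y by rewrite enorm_gt0.
split => //; apply: eW.
have -> : (enorm y)^-1 *: y - (enorm z)^-1 *: z =
   (enorm z)^-1 *: (y - z) + ((enorm y)^-1 - (enorm z)^-1) *: y.
  by apply/rowP => i; rewrite !mxE; ring.
apply: le_lt_trans (enormD _ _) _; rewrite !enormZ gtr0_norm ?invr_gt0//.
have -> : `|(enorm y)^-1 - (enorm z)^-1| * enorm y = (enorm z)^-1 * `|enorm z - enorm y|.
  rewrite -[X in _ * X = _]gtr0_norm// -[X in _ = X * _]gtr0_norm ?invr_gt0// -!normrM.
  congr (`|_|); field; rewrite !gt_eqF//.
have := ler_dist_enorm z y; rewrite enormBC => h.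
rewrite -mulrDr mulrC ltr_pdivrMr//.
by apply: le_lt_trans (lerD (lexx _) h) _; lra.
Qed.

Lemma bnd_cone01 w : w `<=` @sphere R n -> bnd (cone01 w).
Proof. by move=> ws; rewrite cone01E//; apply: bnd_sub (bnd_eball 1) => x []. Qed.

Lemma cone01_nz w : w `<=` @sphere R n -> ~ cone01 w 0.
Proof. by move=> ws; rewrite cone01E// => -[[/eqP]]. Qed.

Definition area_measure K (m : nat) w : R :=
  n%:R / 'C(n, m)%:R * Sig K (inord m) (cone01 w).

(** The hypothesis [area_abs_cont] speaks of every family satisfying the Steiner formula, and this
    exhibits one. The parameter [eps] becomes the dilation factor [1 / eps], and the term of order
    [n] drops because the cone misses the origin. *)
Theorem area_measures_exist K : ccv K -> area_measures K (area_measure K).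
Proof.
move=> cK w bw ws eps e0.
rewrite local_parallelE// cone_leE// -[K in psi K]scaleS1.
have bC := borel_cone01 ws bw; have bdC := bnd_cone01 ws.
rewrite muE//; last exact: bnd_scale.
congr (_%:E); rewrite mu_scale// steiner_formula ?divr_gt0//.
rewrite big_ord_recr /= Sig_n_eq0//; last exact: cone01_nz.
rewrite mulr0 addr0 !mulr_sumr; apply: eq_bigr => m _.
rewrite /area_measure (_ : inord m = widen_ord (leqnSn n) m); last first.
  by apply: val_inj; rewrite /= inordK// ltnS ltnW.
set x := Sig _ _ _; have -> : eps ^+ (n - m) = eps ^+ n * (1 / eps) ^+ m.
  have -> : eps ^+ n = eps ^+ (n - m) * eps ^+ m by rewrite -exprD subnK// ltnW.
  by rewrite expr_div_n expr1n mul1r mulfK// expf_neq0// gt_eqF.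
move: (eps ^+ n) ((1 / eps) ^+ m) => a b.
have C0 : 'C(n, m)%:R != 0 :> R by rewrite pnatr_eq0 -lt0n bin_gt0 ltnW.
have n0 : n%:R != 0 :> R by rewrite pnatr_eq0.
move: C0 n0; move: ('C(n, m)%:R : R) (n%:R : R) => c N C0 n0.
by field; rewrite C0 n0.
Qed.

End SupportMeasures.

(** * Curvature at points of second-order differentiability *)

Section PSD.
Variable R : realType.

Definition psd m (M : 'M[R]_m) := M^T = M /\ forall v : 'rV[R]_m, 0 <= (v *m M *m v^T) ord0 ord0.

Import complex.

(** Factor over the complex numbers and split an eigenvector into real and imaginary parts. *)
Lemma psd_char_poly m (M : 'M[R]_m) : psd M ->
  exists2 l : seq R, all (fun x => 0 <= x) l & char_poly M = \prod_(x <- l) ('X - x%:P).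
Proof.
move=> [sM pM].
pose f := real_complex R.
have [r rE] := closed_field_poly_normal (map_poly f (char_poly M)).
have mon : lead_coef (map_poly f (char_poly M)) = 1.
  by apply/eqP; rewrite -monicE map_monic char_poly_monic.
rewrite mon scale1r in rE.
have roots z : z \in r -> exists2 x : R, 0 <= x & z = f x.
  move=> zr; have : root (char_poly (map_mx f M)) z.
    by rewrite -map_char_poly rE root_prod_XsubC.
  rewrite -eigenvalue_root_char => /eigenvalueP [v vz v0].
  pose a : 'rV[R]_m := \row_i complex.Re (v ord0 i).
  pose b : 'rV[R]_m := \row_i complex.Im (v ord0 i).
  case: z zr vz => x y zr vz.
  have vE : forall i, v ord0 i = Complex (a ord0 i) (b ord0 i).
    by move=> i; rewrite !mxE; case: (v ord0 i).
  have E i : Complex ((a *m M) ord0 i) ((b *m M) ord0 i) =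
      Complex (x * a ord0 i - y * b ord0 i) (x * b ord0 i + y * a ord0 i).
    have := congr1 (fun u : 'rV_m => u ord0 i) vz; rewrite !mxE vE.
    set lhs := \sum_j _; suff -> : lhs = Complex (\sum_j a ord0 j * M j i) (\sum_j b ord0 j * M j i).
      by move=> -> /=.
    rewrite /lhs; elim/big_ind3 : _ => // [c1 c2 c3 d1 d2 d3 -> ->//|j _].
    by rewrite vE [map_mx f M j i]mxE; apply/eqP; rewrite eq_complex; apply/andP; split; apply/eqP => /=; ring.
  have aM : a *m M = x *: a - y *: b.
    by apply/rowP => i; rewrite !mxE; have [] := E i; rewrite !mxE.
  have bM : b *m M = x *: b + y *: a.
    by apply/rowP => i; rewrite !mxE; have [] := E i; rewrite !mxE.
  (* Symmetry tested on the real and imaginary parts gives [y (|a|^2 + |b|^2) = 0], so the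
     eigenvalue is real. *)
  have sym : dotp (a *m M) b = dotp a (b *m M) by rewrite dotp_mulmxl sM.
  rewrite aM bM dotpBl dotpDr !dotpZl !dotpZr in sym.
  have pos : 0 < dotp a a + dotp b b.
    rewrite lt0r addr_ge0 ?dotp_ge0// andbT paddr_eq0 ?dotp_ge0// !dotp_eq0.
    apply/negP => /andP[/eqP a0 /eqP b0]; move/negP: v0; apply.
    by apply/eqP/rowP => i; rewrite vE a0 b0 !mxE.
  have y0 : y = 0.
    have : y * (dotp a a + dotp b b) = 0 by lra.
    by move/eqP; rewrite mulf_eq0 (gt_eqF pos) orbF => /eqP.
  have pa := pM a; have pb := pM b.
  rewrite -dotpE aM y0 scale0r subr0 dotpZl in pa.
  rewrite -dotpE bM y0 scale0r addr0 dotpZl in pb.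
  exists x; last by rewrite y0.
  by rewrite -(pmulr_lge0 x pos) mulrDr addr_ge0.
exists (map (@complex.Re R) r).
  by apply/allP => _ /mapP[z zr ->]; have [x x0 ->] := roots _ zr.
apply: (@map_poly_inj _ _ f); rewrite rE rmorph_prod big_map.
apply: eq_big_seq => z /roots [x _ ->].
by rewrite rmorphB /= map_polyX map_polyC.
Qed.

Lemma prodr_const_size (l : seq R) (c : R) : \prod_(x <- l) c = c ^+ size l.
Proof. by elim: l => [|x l IH]; rewrite ?big_nil// big_cons IH exprS. Qed.

(** The generating polynomial of the elementary symmetric functions of [l]; for the eigenvalues of
    [A], its value at [1 / t] is [det (1 + A / t)]. *)
Definition esymp (l : seq R) : {poly R} := \prod_(x <- l) (1 + x *: 'X).

Lemma size_esymp l : (size (esymp l) <= (size l).+1)%N.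
Proof.
elim: l => [|x l IH]; first by rewrite /esymp big_nil size_poly1.
rewrite /esymp big_cons; apply: leq_trans (size_polyMleq _ _) _.
rewrite -/(esymp l).
have h : (size ((1 + x *: 'X)%R : {poly R}) <= 2)%N.
  apply: leq_trans (size_polyD _ _) _; rewrite size_poly1 geq_max /=.
  by apply: leq_trans (size_scale_leq _ _) _; rewrite size_polyX.
by move: h IH => /=; lia.
Qed.

Lemma esymp_cons x l i :
  (esymp (x :: l))`_i = (esymp l)`_i + (if i is k.+1 then x * (esymp l)`_k else 0).
Proof.
rewrite /esymp big_cons mulrDl mul1r coefD; congr (_ + _).
rewrite -scalerAl coefZ mulrC coefXM; case: i => [|k] /=; first by rewrite mul0r.
by rewrite mulrC.
Qed.

Lemma esymp_ge0 l i : all (fun x => 0 <= x) l -> 0 <= (esymp l)`_i.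
Proof.
elim: l i => [|x l IH] i /=.
  by rewrite /esymp big_nil coef1 ler0n.
move=> /andP[x0 l0]; rewrite esymp_cons addr_ge0 ?IH//.
by case: i => // k; rewrite mulr_ge0// IH.
Qed.

Lemma coef_prod_XsubC_esymp l j : (j <= size l)%N ->
  (-1) ^+ j * (\prod_(x <- l) ('X - x%:P))`_(size l - j) = (esymp l)`_j.
Proof.
elim: l j => [|x l IH] j /=.
  by rewrite leqn0 => /eqP->; rewrite /esymp !big_nil expr0 mul1r.
move=> jl; rewrite esymp_cons big_cons mulrBl coefB coefXM coefCM.
case: j jl => [_|j jl].
  rewrite subn0 /= addr0 -(IH 0%N)// subn0 mulrBr.
  rewrite [X in _ - _ * (_ * X)]nth_default ?mulr0 ?subr0//.
  by rewrite size_prod_XsubC.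
rewrite subSS; have [E|nE] := eqVneq j (size l).
  rewrite -E subnn eqxx sub0r /= [X in X + _]nth_default; last by rewrite E size_esymp.
  rewrite add0r -IH ?E// subnn exprS; ring.
have jl' : (j < size l)%N by rewrite ltn_neqAle nE.
rewrite subn_eq0 leqNgt jl' /= -IH// -(IH j)// 1?ltnW// subnS exprS; ring.
Qed.

Lemma esymp_perm l l' : perm_eq l l' -> esymp l = esymp l'.
Proof. exact: perm_big. Qed.

Lemma horner_esymp l t : (esymp l).[t] = \prod_(x <- l) (1 + t * x).
Proof.
rewrite horner_prod; apply: eq_bigr => x _.
by rewrite !hornerE mulrC.
Qed.

Lemma esymp_cat_ge l l' : all (fun x => 0 <= x) l -> all (fun x => 0 <= x) l' ->
  \prod_(x <- l) x <= (esymp (l ++ l'))`_(size l).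
Proof.
elim: l => [_ l0|x l IH /= /andP[x0 l0] l0'].
  rewrite big_nil /= -[X in X <= _](_ : (esymp [::])`_0 = 1); last by rewrite /esymp big_nil coef1.
  elim: l' l0 => // x l' IH /= /andP[x0 l0].
  by rewrite (esymp_cons x) addr0 IH.
rewrite big_cons esymp_cons /= ler_wpDl//; last by rewrite ler_wpM2l// IH.
by apply: esymp_ge0; rewrite all_cat l0.
Qed.

Lemma esymp_zeros l l' : all (fun x => x == 0) l' -> esymp (l ++ l') = esymp l.
Proof.
move=> z; rewrite /esymp big_cat /= [X in _ * X]big_seq [X in _ * X]big1 ?mulr1//.
by move=> x /(allP z) /eqP ->; rewrite scale0r addr0.
Qed.

Lemma lead_esymp l : (esymp l)`_(size l) = \prod_(x <- l) x.
Proof.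
elim: l => [|x l IH]; first by rewrite /esymp !big_nil coef1.
rewrite /= esymp_cons big_cons IH nth_default ?add0r//.
exact: size_esymp.
Qed.

(* [t] is the inverse of the [j]-th largest root. *)
Lemma esymp_dominant l j : all (fun x => 0 <= x) l -> (0 < j <= size l)%N ->
  0 < (esymp l)`_j -> exists2 t : R, 0 < t & (esymp l).[t] <= 2 ^+ size l * (esymp l)`_j * t ^+ j.
Proof.
move=> l0 /andP[j0 jl].
pose s := sort (fun x y : R => y <= x) l.
have ps : perm_eq s l by apply: permEl; exact: perm_sort.
rewrite -(esymp_perm ps) -(perm_size ps).
have {}l0 : all (fun x => 0 <= x) s by rewrite (perm_all _ ps).
have {}jl : (j <= size s)%N by rewrite (perm_size ps).
have ss : sorted (fun x y : R => y <= x) s by apply: sort_sorted => x y; exact: le_total.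
pose m := nth 0 s j.-1.
have tr : transitive (fun x y : R => y <= x) by move=> x y z /= h1 h2; exact: le_trans h2 h1.
have rf : reflexive (fun x y : R => y <= x) by move=> x /=.
have nthm a b : (a <= b)%N -> (b < size s)%N -> nth 0 s b <= nth 0 s a.
  move=> ab bs; apply: (sorted_leq_nth tr rf 0 ss) => //; rewrite inE//.
  exact: leq_ltn_trans ab bs.
have jm : (j.-1 < size s)%N by rewrite prednK.
have ta x : x \in take j s -> m <= x.
  move=> xt; case: (elimT (nthP 0) xt) => i; rewrite size_take_min (minn_idPl jl) => ij <-.
  by rewrite nth_take//; apply: nthm => //; rewrite -ltnS prednK.
have td x : x \in drop j s -> x <= m.
  move=> xt; case: (elimT (nthP 0) xt) => i; rewrite size_drop => ij <-; rewrite nth_drop; apply: nthm.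
    by rewrite (leq_trans (leq_pred _))// leq_addr.
  by rewrite -ltn_subRL.
have [ta0 td0] : all (fun x => 0 <= x) (take j s) /\ all (fun x => 0 <= x) (drop j s).
  by move: l0; rewrite -{1}(cat_take_drop j s) all_cat => /andP.
have szt : size (take j s) = j by rewrite size_take_min (minn_idPl jl).
move=> ej.
have m0 : 0 < m.
  rewrite lt0r; apply/andP; split; last by apply: (allP l0); exact: mem_nth.
  apply/eqP => mz; move: ej; rewrite -{1}(cat_take_drop j s) esymp_zeros; last first.
    by apply/allP => x xd; rewrite eq_le (allP td0)// andbT -mz td.
  rewrite -{2}szt lead_esymp (big_rem m) /=; last first.
    rewrite -(cat_take_drop j.-1 (take j s)) mem_cat; apply/orP; right.
    apply/(nthP 0); exists 0%N; first by rewrite size_drop szt subn_gt0 prednK.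
    by rewrite nth_drop addn0 nth_take// prednK.
  by rewrite mz mul0r ltxx.
exists m^-1; first by rewrite invr_gt0.
rewrite horner_esymp -{1}(cat_take_drop j s) big_cat /=.
have h1 : \prod_(x <- take j s) (1 + m^-1 * x) <= 2 ^+ j * m^-1 ^+ j * \prod_(x <- take j s) x.
  have -> : 2 ^+ j * m^-1 ^+ j = \prod_(x <- take j s) (2 / m).
    by rewrite prodr_const_size szt exprMn.
  rewrite -big_split /= big_seq [leRHS]big_seq; apply: ler_prod => x xt.
  have x0 : 0 <= x := allP ta0 _ xt.
  rewrite addr_ge0 ?mulr_ge0 ?invr_ge0 ?(ltW m0)//=.
  have : 1 <= m^-1 * x by rewrite mulrC ler_pdivlMr// mul1r ta.
  by rewrite -mulrA; lra.
have h2 : \prod_(x <- drop j s) (1 + m^-1 * x) <= 2 ^+ (size s - j).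
  rewrite -size_drop -prodr_const_size.
  rewrite big_seq [leRHS]big_seq; apply: ler_prod => x xt.
  have x0 : 0 <= x := allP td0 _ xt.
  rewrite addr_ge0 ?mulr_ge0 ?invr_ge0 ?(ltW m0)//=.
  have : m^-1 * x <= 1 by rewrite mulrC ler_pdivrMr// mul1r td.
  by lra.
have p0 : 0 <= \prod_(x <- take j s) (1 + m^-1 * x).
  rewrite big_seq; apply: prodr_ge0 => x /(allP ta0) x0.
  by rewrite addr_ge0// mulr_ge0// invr_ge0 ltW.
have p0' : 0 <= \prod_(x <- drop j s) (1 + m^-1 * x).
  rewrite big_seq; apply: prodr_ge0 => x /(allP td0) x0.
  by rewrite addr_ge0// mulr_ge0// invr_ge0 ltW.
apply: le_trans (ler_pM p0 p0' h1 h2) _.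
rewrite [leLHS](_ : _ = (2 ^+ j * 2 ^+ (size s - j)) * \prod_(x <- take j s) x * m^-1 ^+ j); last by ring.
rewrite -exprD subnKC//; apply: ler_wpM2r; first by rewrite exprn_ge0// invr_ge0 ltW.
apply: ler_wpM2l; first by rewrite exprn_ge0.
by rewrite -{2}szt -{2}(cat_take_drop j s); apply: esymp_cat_ge.
Qed.

Lemma psd_det m (M : 'M[R]_m) : psd M -> exists l : seq R,
  [/\ all (fun x => 0 <= x) l, size l = m,
      forall t, \det (1%:M + t *: M) = (esymp l).[t] &
      forall j, (j <= m)%N -> (-1) ^+ j * (char_poly M)`_(m - j) = (esymp l)`_j].
Proof.
move=> pM; have [l l0 E] := psd_char_poly pM.
have sl : size l = m.
  by have := size_char_poly M; rewrite E size_prod_XsubC => -[].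
exists l; split => //; last by move=> j jm; rewrite E -{1}sl coef_prod_XsubC_esymp// sl.
have detE x : \det (x%:M - M) = \prod_(y <- l) (x - y).
  have : (char_poly M).[x] = \prod_(y <- l) (x - y).
    by rewrite E horner_prod; apply: eq_bigr => y _; rewrite !hornerE.
  move=> <-; rewrite /char_poly -horner_evalE -det_map_mx; congr (\det _).
  apply/matrixP => i k; rewrite !mxE /= horner_evalE !hornerE.
  by case: (i == k); rewrite ?hornerE ?mulr1n ?mulr0n ?hornerX ?horner0.
move=> t; have [->|t0] := eqVneq t 0.
  rewrite scale0r addr0 det1 horner_esymp big1// => x _.
  by rewrite mul0r addr0.
have -> : 1%:M + t *: M = (- t) *: ((- t^-1)%:M - M).
  by rewrite scalerBr scale_scalar_mx mulrNN divff// scaleNr opprK.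
rewrite detZ detE horner_esymp -sl -prodr_const_size.
rewrite -big_split; apply: eq_bigr => x _ /=.
by rewrite mulrBr mulrNN divff// mulNr opprK.
Qed.

End PSD.

Section HessianOfSupport.
Variables (R : realType) (n' : nat).
Local Notation n := n'.+1.
Local Notation V := 'rV[R]_n.
Implicit Types (K : set V) (A : 'M[R]_n) (u v w x y z : V) (e t : R).

Lemma psi_supp_fun K x : ccv K -> dotp (psi K x) (proj K x) = supp_fun K (psi K x).
Proof.
move=> cK; have [Kp _] := projP x cK; apply/eqP; rewrite eq_le supp_fun_ge//=.
by apply: supp_fun_le => // y Ky; rewrite dotpC (dotpC _ (proj K x)) psi_supp.
Qed.

Definition mxnorm1 m (A : 'M[R]_(n, m)) : R := \sum_i enorm (row i A).

Lemma enorm_mulmx_le m (A : 'M[R]_(n, m)) x : enorm (x *m A) <= mxnorm1 A * enorm x.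
Proof.
rewrite mulmx_sum_row mulr_suml; apply: (le_trans (enorm_sum _ _ _)).
by apply: ler_sum => i _; rewrite enormZ mulrC ler_wpM2l ?enorm_ge0// ler_coord_enorm.
Qed.

Definition second_order K u A (g : V) := forall e, 0 < e -> exists2 d : R, 0 < d &
  forall y, enorm y < d -> `| supp_fun K (u + y) - supp_fun K u - dotp g y
     - 2^-1 * (y *m A *m y^T) ord0 ord0 | <= e * enorm y ^+ 2.

(** Points of [K] supporting in direction [v] are subgradients of [h_K] at [v], and a second-order
    expansion of a convex function at [u] forces a first-order expansion of all its subgradients
    near [u]. The subgradient inequality is tested in the direction of the error vector [gg]. *)
Lemma support_point_expansion K u A g : ccv K -> A^T = A -> second_order K u A g ->
  forall e, 0 < e -> exists2 d : R, 0 < d & forall v, enorm (v - u) < d ->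
    forall y, K y -> dotp v y = supp_fun K v ->
    enorm (y - g - (v - u) *m A) <= e * enorm (v - u).
Proof.
move=> cK sA H e e0.
pose alpha := mxnorm1 A; have al0 : 0 <= alpha by apply: sumr_ge0 => i _; exact: enorm_ge0.
(* The test increment has length [k |v - u|]: its quadratic term is then at most
   [e k |v - u|^2 / 2], and so is the Taylor error with [eta = e k / 10]. Dividing by [k |v - u|]
   leaves [e |v - u|]. *)
pose k := Num.min 1 (e / (alpha + 1)).
have k0 : 0 < k by rewrite lt_min ltr01 divr_gt0// ltr_wpDl.
have k1 : k <= 1 by rewrite ge_min lexx.
have ka : alpha * k <= e.
  apply: (@le_trans _ _ ((alpha + 1) * k)); first by rewrite ler_wpM2r ?(ltW k0)// lerDl.
  by rewrite mulrC -ler_pdivlMr ?ltr_wpDl// ge_min lexx orbT.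
pose eta := e * k / 10; have eta0 : 0 < eta by rewrite divr_gt0// mulr_gt0.
have [d d0 dH] := H eta eta0.
exists (d / 2); first by rewrite divr_gt0.
move=> v vd y Ky vy; have [a aE] : exists a : V, a = v - u by exists (v - u).
rewrite -aE in vd *.
have [gg ggE] : exists gg : V, gg = y - g - a *m A by exists (y - g - a *m A).
rewrite -ggE.
have key w : enorm a < d -> enorm (a + w) < d ->
    dotp gg w <= 2^-1 * alpha * enorm w ^+ 2 + eta * ((enorm a + enorm w) ^+ 2 + enorm a ^+ 2).
  move=> ad awd; have h1 := dH _ ad; have h2 := dH _ awd.
  have h3 := supp_fun_ge (v + w) cK Ky; rewrite dotpDl vy in h3.
  have E1 : u + a = v by rewrite aE addrC subrK.
  have E2 : u + (a + w) = v + w by rewrite addrA E1.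
  rewrite E1 in h1; rewrite E2 in h2.
  have qE : ((a + w) *m A *m (a + w)^T) ord0 ord0 = (a *m A *m a^T) ord0 ord0 +
      2 * dotp (a *m A) w + dotp (w *m A) w.
    rewrite -!dotpE mulmxDl dotpDl !dotpDr.
    have -> : dotp (w *m A) a = dotp (a *m A) w by rewrite dotp_mulmxl sA dotpC.
    ring.
  rewrite qE dotpDr in h2.
  have q3 : dotp (w *m A) w <= alpha * enorm w ^+ 2.
    apply: (le_trans (dotp_le _ _)); rewrite expr2 mulrA ler_wpM2r ?enorm_ge0//.
    exact: enorm_mulmx_le.
  have n2 : enorm (a + w) ^+ 2 <= (enorm a + enorm w) ^+ 2.
    by rewrite ler_pXn2r ?nnegrE ?addr_ge0 ?enorm_ge0// enormD.
  have n3 : eta * enorm (a + w) ^+ 2 <= eta * (enorm a + enorm w) ^+ 2 by rewrite ler_pM2l.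
  rewrite ggE !dotpBl (dotpC y w).
  move: h1 h2; rewrite !ler_norml => /andP[h1 _] /andP[_ h2].
  rewrite mulrDr; lra.
have [->|gg0] := eqVneq gg 0; first by rewrite enorm0 mulr_ge0 ?enorm_ge0 ?(ltW e0).
have G0 : 0 < enorm gg by rewrite enorm_gt0.
have keyt t : 0 < t -> enorm a + t < d ->
    t * enorm gg <= 2^-1 * alpha * t ^+ 2 + eta * ((enorm a + t) ^+ 2 + enorm a ^+ 2).
  move=> t0 atd; pose w := (t / enorm gg) *: gg.
  have ew : enorm w = t.
    by rewrite enormZ gtr0_norm ?divr_gt0// divfK// gt_eqF.
  have := key w; rewrite ew dotpZr -sqr_enorm expr2 mulrA divfK ?gt_eqF//.
  apply; first by apply: le_lt_trans atd; rewrite lerDl ltW.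
  by apply: le_lt_trans (enormD _ _) _; rewrite ew.
(* At [v = u] itself, increments tending to 0 show that [g] is the only support point. *)
have [a0|a0] := eqVneq a 0.
  have : enorm gg <= ((2^-1 * alpha + eta) *: 'X : {poly R}).[0].
    apply: (horner_ge_lim d0) => t /andP[t0 td].
    have := keyt t t0; rewrite a0 enorm0 add0r => /(_ td).
    rewrite expr0n/= addr0 => h.
    by rewrite !hornerE -(ler_pM2l t0); lra.
  by rewrite !hornerE leNgt G0.
have r0 : 0 < enorm a by rewrite enorm_gt0.
have h := keyt (k * enorm a) (mulr_gt0 k0 r0).
have : enorm a + k * enorm a < d.
  by apply: (@le_lt_trans _ _ (enorm a + enorm a)); [rewrite lerD2l -[leRHS]mul1r ler_pM2r|lra].
move=> /h {}h; rewrite -(ler_pM2l (mulr_gt0 k0 r0)); apply: (le_trans h).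
move: ka; rewrite /eta; move: (enorm a) r0 k0 k1 al0 e0 => r r0 k0 k1 al0 e0 ka.
have h1 : 2^-1 * alpha * (k * r) ^+ 2 <= 2^-1 * (e * k * r ^+ 2).
  rewrite exprMn -mulrA ler_pM2l// mulrA ler_wpM2r ?sqr_ge0// expr2 mulrA.
  by rewrite ler_wpM2r// ltW.
have h2 : (r + k * r) ^+ 2 + r ^+ 2 <= 5 * r ^+ 2.
  have : (r + k * r) ^+ 2 <= (2 * r) ^+ 2.
    rewrite ler_pXn2r ?nnegrE//; last by rewrite mulr_ge0// ltW.
      have : k * r <= 1 * r by rewrite ler_pM2r. lra.
    by rewrite addr_ge0 ?mulr_ge0 ?ltW.
  rewrite exprMn; lra.
have h3 : e * k / 10 * ((r + k * r) ^+ 2 + r ^+ 2) <= 2^-1 * (e * k * r ^+ 2).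
  apply: (@le_trans _ _ (e * k / 10 * (5 * r ^+ 2))).
    by rewrite ler_wpM2l// divr_ge0// mulr_ge0 ?ltW.
  by rewrite le_eqVlt; apply/orP; left; apply/eqP; field.
apply: (le_trans (lerD h1 h3)).
by rewrite le_eqVlt; apply/orP; left; apply/eqP; field.
Qed.

Lemma hessian_psd K u A g : ccv K -> A^T = A -> second_order K u A g -> psd A.
Proof.
move=> cK sA H; split => // v.
have [->|v0] := eqVneq v 0; first by rewrite mul0mx mul0mx mxE.
have ev : 0 < enorm v by rewrite enorm_gt0.
apply/ler_addgt0Pr => e e0.
have e2 : 0 < e / enorm v ^+ 2 / 2 by rewrite !divr_gt0// exprn_gt0.
have [d d0 dH] := H _ e2.
pose s := d / 2 / enorm v; have s0 : 0 < s by rewrite !divr_gt0.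
have sd : enorm (s *: v) < d.
  rewrite enormZ gtr0_norm// divfK ?gt_eqF//; lra.
have := dH _ sd; have := dH (- (s *: v)); rewrite enormN => /(_ sd).
have q1 : (- (s *: v) *m A *m (- (s *: v))^T) ord0 ord0 = s ^+ 2 * (v *m A *m v^T) ord0 ord0.
  by rewrite -!dotpE mulNmx -scalemxAl dotpNl dotpNr dotpZl dotpZr; ring.
have q2 : (s *: v *m A *m (s *: v)^T) ord0 ord0 = s ^+ 2 * (v *m A *m v^T) ord0 ord0.
  by rewrite -!dotpE -scalemxAl dotpZl dotpZr; ring.
rewrite q1 q2 dotpNr !ler_norml => /andP[_ h1] /andP[_ h2].
have cvx := supp_fun_cvx u (s *: v) cK.
have E : e / enorm v ^+ 2 / 2 * enorm (s *: v) ^+ 2 = s ^+ 2 * (e / 2).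
  by rewrite enormZ gtr0_norm//; field; rewrite gt_eqF.
rewrite E in h1 h2.
have : 0 <= s ^+ 2 * ((v *m A *m v^T) ord0 ord0 + e) by lra.
by rewrite pmulr_rge0// exprn_gt0.
Qed.

(** [h_K] is linear along the ray through [u], so the quadratic form vanishes at [u]. A zero of a
    semidefinite form lies in its kernel, since otherwise a linear term would make the form
    negative. *)
Lemma hessian_kernel K u A g : ccv K -> A^T = A -> second_order K u A g -> u *m A = 0.
Proof.
move=> cK sA H; have [_ pA] := hessian_psd cK sA H.
have q0 : (u *m A *m u^T) ord0 ord0 = 0.
  apply/eqP; rewrite eq_le pA andbT; apply/ler_addgt0Pr => e e0; rewrite add0r.
  have e2 : 0 < e / (enorm u ^+ 2 + 1) / 2 by rewrite !divr_gt0// ltr_wpDl// sqr_ge0.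
  have [d d0 dH] := H _ e2.
  pose s := Num.min 1 (d / (enorm u + 1)) / 2.
  have s0 : 0 < s by rewrite divr_gt0// lt_min ltr01 divr_gt0// ltr_wpDl ?enorm_ge0.
  have s1 : s < 1.
    by rewrite ltr_pdivrMr// gt_min; apply/orP; left; lra.
  have sd : enorm (s *: u) < d.
    rewrite enormZ gtr0_norm//; apply: (@le_lt_trans _ _ (s * (enorm u + 1))).
      by rewrite ler_pM2l// lerDl.
    rewrite -ltr_pdivlMr ?ltr_wpDl ?enorm_ge0// ltr_pdivrMr// gt_min; apply/orP; right.
    by rewrite ltr_pMr ?ltr1n// divr_gt0// ltr_wpDl ?enorm_ge0.
  have := dH _ sd; have := dH (- (s *: u)); rewrite enormN => /(_ sd).
  have q1 : (- (s *: u) *m A *m (- (s *: u))^T) ord0 ord0 = s ^+ 2 * (u *m A *m u^T) ord0 ord0.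
    by rewrite -!dotpE mulNmx -scalemxAl dotpNl dotpNr dotpZl dotpZr; ring.
  have q2 : (s *: u *m A *m (s *: u)^T) ord0 ord0 = s ^+ 2 * (u *m A *m u^T) ord0 ord0.
    by rewrite -!dotpE -scalemxAl dotpZl dotpZr; ring.
  have E1 : supp_fun K (u + s *: u) = (1 + s) * supp_fun K u.
    by rewrite -{1}[u]scale1r -scalerDl supp_funZ// addr_ge0// ltW.
  have E2 : supp_fun K (u - s *: u) = (1 - s) * supp_fun K u.
    by rewrite -{1}[u]scale1r -scalerBl supp_funZ// subr_ge0 ltW.
  rewrite q1 q2 E1 E2 dotpNr !ler_norml => /andP[h1 _] /andP[h2 _].
  have E : e / (enorm u ^+ 2 + 1) / 2 * enorm (s *: u) ^+ 2 <= s ^+ 2 * (e / 2).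
    rewrite enormZ gtr0_norm// exprMn mulrCA ler_pM2l ?exprn_gt0// mulrAC ler_pM2r ?invr_gt0//.
    rewrite mulrAC ler_pdivrMr ?ltr_wpDl ?sqr_ge0//.
    by rewrite ler_pM2l// lerDl.
  have : 0 <= s ^+ 2 * (e - (u *m A *m u^T) ord0 ord0) by lra.
  by rewrite pmulr_rge0 ?exprn_gt0// subr_ge0.
apply: dotp_inj => v; rewrite dotp0l.
have q (s : R) : 0 <= (v *m A *m v^T) ord0 ord0 + 2 * s * dotp (u *m A) v.
  have := pA (v + s *: u).
  rewrite -!dotpE mulmxDl dotpDl !dotpDr -scalemxAl !dotpZl !dotpZr.
  have -> : dotp (v *m A) u = dotp (u *m A) v by rewrite dotp_mulmxl sA dotpC.
  have -> : dotp (u *m A) u = 0 by rewrite dotpE.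
  by rewrite !mulr0 addr0 -addrA; congr (_ <= _ + _); ring.
apply/eqP; apply/negP => /negP nz.
have := q (- ((v *m A *m v^T) ord0 ord0 + 1) / (2 * dotp (u *m A) v)).
set Q := (v *m A *m v^T) ord0 ord0; set c := dotp (u *m A) v in nz *.
rewrite (_ : Q + _ = -1); first by rewrite ler0N1.
by field.
Qed.

(** A point is the sum of its projection and its normal vector, and the projection is a support
    point in the direction [psi / t]. Hence increments of [x] are those of [psi] multiplied by
    [1 + A / t], up to an error relative to the increment of [psi]. *)
Lemma psi_expansion K u A g t e : ccv K -> A^T = A -> second_order K u A g -> 0 < t -> 0 < e ->
  exists2 d : R, 0 < d & forall x x', psi K x = t *: u -> enorm (psi K x' - t *: u) < d ->
    enorm ((x' - x) - (psi K x' - psi K x) *m (1%:M + t^-1 *: A))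
      <= e * enorm (psi K x' - psi K x).
Proof.
move=> cK sA H t0 e0.
have [d d0 dH] := support_point_expansion cK sA H (mulr_gt0 e0 t0).
have sup x v : psi K x = t *: v -> dotp v (proj K x) = supp_fun K v.
  move=> E; apply: (mulfI (lt0r_neq0 t0)); rewrite -supp_funZ ?(ltW t0)//.
  by rewrite -dotpZl -E psi_supp_fun.
exists (d * t); first by rewrite mulr_gt0.
move=> x x' xu xd.
have [Kp _] := projP x cK; have [Kp' _] := projP x' cK.
have gE : proj K x = g.
  have := dH u; rewrite subrr enorm0 => /(_ d0 _ Kp (sup _ _ xu)).
  rewrite mul0mx subr0 mulr0 => h; apply/eqP; rewrite -subr_eq0 -enorm_eq0.
  by rewrite eq_le h enorm_ge0.
pose v := t^-1 *: psi K x'.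
have xv : psi K x' = t *: v by rewrite scalerA divff ?scale1r// gt_eqF.
have vu : v - u = t^-1 *: (psi K x' - psi K x).
  by rewrite scalerBr xu -/v scalerA mulVf ?scale1r// gt_eqF.
have vd : enorm (v - u) < d.
  by rewrite vu enormZ gtr0_norm ?invr_gt0// mulrC ltr_pdivrMr// xu.
have := dH v vd _ Kp' (sup _ _ xv).
rewrite vu enormZ gtr0_norm ?invr_gt0// -mulrA mulVKf ?gt_eqF//.
congr (enorm _ <= _).
rewrite mulmxDr mulmx1 -scalemxAl -scalemxAr.
have -> : proj K x' = x' - psi K x' by rewrite /psi subKr.
have -> : g = x - psi K x by rewrite -gE /psi subKr.
set a := (_ *m A); move: (t^-1 *: a) => a'; clear.
move: (psi K x) (psi K x') => b c.
by apply/rowP => i; rewrite !mxE; ring.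
Qed.

Lemma enorm_1_psd A x : psd A -> enorm x <= enorm (x *m (1%:M + A)).
Proof.
move=> [_ pA]; rewrite -(ler_pXn2r (_ : (0 < 2)%N))// ?nnegrE ?enorm_ge0// !sqr_enorm.
rewrite mulmxDr mulmx1 dotpDl !dotpDr.
have := pA x; rewrite -dotpE => h; have := dotp_ge0 (x *m A).
rewrite (dotpC x (x *m A)); lra.
Qed.

Lemma unit_1_psd A : psd A -> 1%:M + A \in unitmx.
Proof.
move=> pA; rewrite -row_free_unit -kermx_eq0; apply/rowV0P => v /sub_kermxP vG.
have := enorm_1_psd v pA; rewrite vG enorm0 => h.
by apply/eqP; rewrite -enorm_eq0 eq_le h enorm_ge0.
Qed.

Lemma psd_scale A t : 0 <= t -> psd A -> psd (t *: A).
Proof.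
move=> t0 [sA pA]; split; first by rewrite linearZ /= sA.
by move=> v; rewrite -scalemxAr -scalemxAl mxE mulr_ge0.
Qed.

End HessianOfSupport.

Section Orthogonal.
Variables (R : realType) (n : nat).
Local Notation V := 'rV[R]_n.
Implicit Types (x y z u v w : V) (O : 'M[R]_n).

Lemma mulmx_tr_dotp x y : x *m y^T = (dotp x y)%:M.
Proof. by rewrite [LHS]mx11_scalar dotpE. Qed.

Lemma dotp_orthogonal O x y : O *m O^T = 1%:M -> dotp (x *m O) (y *m O) = dotp x y.
Proof. by move=> oO; rewrite dotp_mulmxl -mulmxA oO mulmx1. Qed.

Lemma enorm_orthogonal O x : O *m O^T = 1%:M -> enorm (x *m O) = enorm x.
Proof. by move=> oO; rewrite /enorm dotp_orthogonal. Qed.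

(** The reflection exchanging [u] and [v]; used to give an orthogonal matrix a prescribed row
    without changing rows orthogonal to [u - v]. *)
Lemma householder u v : enorm u = enorm v -> exists O,
  [/\ O *m O^T = 1%:M, u *m O = v & forall z, dotp z (u - v) = 0 -> z *m O = z].
Proof.
move=> uv; have [<-|nuv] := eqVneq u v.
  by exists 1%:M; rewrite trmx1 !mulmx1; split => // z _; rewrite mulmx1.
have [w wE] : exists w, w = u - v by exists (u - v).
have w0 : dotp w w != 0 by rewrite dotp_eq0 wE subr_eq0.
pose c := 2 / dotp w w; pose O : 'M[R]_n := 1%:M - c *: (w^T *m w).
have xO x : x *m O = x - (c * dotp x w) *: w.
  rewrite mulmxBr mulmx1 -scalemxAr mulmxA mulmx_tr_dotp mul_scalar_mx scalerA //.
have OT : O^T = O.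
  by rewrite /O linearB /= trmx1 linearZ /= trmx_mul trmxK.
exists O; split.
- apply/row_matrixP => i; rewrite OT row_mul xO row1; set y := row i O.
  have -> : y = delta_mx 0 i - (c * dotp (delta_mx 0 i) w) *: w by rewrite -xO -rowE.
  rewrite dotpBl dotpZl; apply/rowP => k; rewrite !mxE /c; field; exact: w0.
- rewrite xO; have uwE : dotp w w = 2 * dotp u w.
    have := congr1 (fun a => a ^+ 2) uv; rewrite /= !sqr_enorm wE => h.
    by rewrite !dotpBr !dotpBl h (dotpC v u); ring.
  rewrite /c uwE (_ : _ * _ = 1); last by field; move: w0; rewrite uwE mulf_eq0 negb_or => /andP[].
  by rewrite scale1r wE opprB addrC subrK.
- by move=> z zw; rewrite xO wE zw mulr0 scale0r subr0.
Qed.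

End Orthogonal.

Section CurvatureAtAPoint.
Variables (R : realType) (n' : nat).
Local Notation n := n'.+1.
Local Notation V := 'rV[R]_n.
Implicit Types (K w : set V) (u x : V).

Lemma orthonormal_complement u : enorm u = 1 -> exists E : 'M[R]_(n', n),
  [/\ E *m E^T = 1%:M, E *m u^T = 0 & E^T *m E + u^T *m u = 1%:M].
Proof.
move=> u1; have e1 : enorm (delta_mx ord0 ord0 : V) = enorm u.
  rewrite u1; apply/eqP; rewrite -sqrp_eq1 ?enorm_ge0// sqr_enorm dotpE trmx_delta.
  by rewrite mul_delta_mx mxE !eqxx.
have [Q [oQ eQ _]] := householder e1.
have QQ : Q^T *m Q = 1%:M by exact: mulmx1C.
pose E := dsubmx (Q : 'M[R]_(1 + n', n)).
have QE : Q = col_mx u E :> 'M[R]_(1 + n', n).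
  rewrite -[LHS](@vsubmxK _ 1 n' n); congr (@col_mx _ 1 n' n _ _); rewrite -eQ -rowE.
  by apply/rowP => i; rewrite !mxE; congr (Q _ _); apply: val_inj.
have {}oQ : (col_mx u E : 'M[R]_(1 + n', n)) *m (col_mx u E)^T = 1%:M by rewrite -QE.
have {}QQ : (col_mx u E)^T *m (col_mx u E : 'M[R]_(1 + n', n)) = 1%:M by rewrite -QE.
exists E; move: oQ QQ; rewrite tr_col_mx mul_col_row mul_row_col.
rewrite (scalar_mx_block 1 n' 1) => /eq_block_mx[_ _ h1 h2] h3.
by rewrite addrC.
Qed.

Lemma esymp_ge_term (l : seq R) j (t : R) : all (fun a => 0 <= a) l -> 0 <= t ->
  (esymp l)`_j * t ^+ j <= (esymp l).[t].
Proof.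
move=> l0 t0; have [jl|jl] := ltnP j (size (esymp l)).
  rewrite horner_coef (bigD1 (Ordinal jl))//= lerDl sumr_ge0// => i _.
  by rewrite mulr_ge0 ?esymp_ge0 ?exprn_ge0.
by rewrite nth_default// mul0r horner_esymp big_seq prodr_ge0// => x /(allP l0) x0; rewrite addr_ge0// mulr_ge0.
Qed.

Lemma esymp_mono (l : seq R) (t t' : R) : all (fun a => 0 <= a) l -> 0 <= t <= t' ->
  (esymp l).[t] <= (esymp l).[t'].
Proof.
move=> l0 /andP[t0 tt]; rewrite !horner_esymp big_seq [leRHS]big_seq.
apply: ler_prod => x /(allP l0) x0; rewrite addr_ge0 ?mulr_ge0//=.
by rewrite lerD2l ler_wpM2r.
Qed.

(** [s_j] sees the Hessian on the complement of [u], while the volume estimates use the determinant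
    in the whole space. As [u] lies in the kernel of [A], Sylvester's identity equates the two
    determinants. *)
Lemma sj_at_det K j u s : ccv K -> enorm u = 1 -> (j <= n')%N -> sj_at K j u s ->
  exists A g l, [/\ A^T = A, second_order K u A g, psd A,
    [/\ all (fun a => 0 <= a) l, size l = n' & forall t, \det (1%:M + t *: A) = (esymp l).[t]]
    & (esymp l)`_j = 'C(n', j)%:R * s].
Proof.
move=> cK u1 jn [A [[sA [g so]] sE]].
have [E [EE Eu EEu]] := orthonormal_complement u1.
have pA := hessian_psd cK sA so; have uA := hessian_kernel cK sA so.
have pE : psd (E *m A *m E^T).
  split; first by rewrite !trmx_mul trmxK sA mulmxA.
  by move=> v; rewrite !mulmxA -(mulmxA _ E^T) -trmx_mul; exact: pA.2.
have [l [l0 sl detl coefl]] := psd_det pE.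
have AE : A = A *m E^T *m E.
  rewrite -mulmxA -[LHS]mulmx1 -EEu mulmxDr [X in _ + X]mulmxA.
  have -> : A *m u^T = 0 by rewrite -[A *m _]trmxK trmx_mul trmxK sA uA trmx0.
  by rewrite mul0mx addr0.
exists A, g, l; split => //.
  split => // t; rewrite -detl {1}AE scalemxAl det_1_mulmxC.
  by rewrite -scalemxAr mulmxA.
rewrite (sE E)// /norm_elem_sym coefl// mulVKf//.
by rewrite pnatr_eq0 -lt0n bin_gt0.
Qed.

Lemma psi_surj K z : ccv K -> exists x, psi K x = z.
Proof.
move=> cK; have [y Ky [Ez yz]] := supp_funP z cK; exists (y + z).
suff H x : K x -> dotp x z <= dotp y z by have [] := psiE cK Ky H.
by move=> Kx; rewrite dotpC (dotpC y) -Ez yz.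
Qed.

Lemma psi_inverse_derivative K u A g t x E : ccv K -> A^T = A -> second_order K u A g ->
  0 < t -> psi K x = t *: u -> inverse_derivative E (psi K) x (1%:M + t^-1 *: A).
Proof.
move=> cK sA so t0 xu e e0; have [d d0 dH] := psi_expansion cK sA so t0 e0.
exists d => // y _ yx.
have /(dH x y xu) h : enorm (psi K y - t *: u) < d.
  by rewrite -xu; exact: le_lt_trans (psi_lip _ _ cK) yx.
rewrite [leLHS]enormBC (le_trans h)// ler_pM2l//; exact: psi_lip.
Qed.

Lemma sph_ae_leb0 (P : V -> Prop) : sph_ae P ->
  leb_outer (cone01 [set u | @sphere R n u /\ ~ P u]) = 0%E.
Proof.
rewrite /sph_ae /sph_outer => /eqP; rewrite mule_eq0 => /orP[|/eqP//].
by rewrite eqe pnatr_eq0.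
Qed.

Lemma leb_cone_ae (P : V -> Prop) w : sph_ae P -> w `<=` @sphere R n ->
  (leb_outer (cone01 w) <= leb_outer (cone01 (w `&` P)))%E.
Proof.
move=> /sph_ae_leb0 P0 ws.
have : cone01 w `<=` cone01 (w `&` P) `|` cone01 [set u | @sphere R n u /\ ~ P u].
  move=> _ [t [u wu [t01 ->]]]; have [Pu|Pu] := pselect (P u).
    by left; exists t, u.
  by right; exists t, u => //; split => //; exact: ws.
move=> /le_leb_outer /le_trans; apply.
by rewrite -[X in (_ <= X)%E]adde0 -[X in (_ <= _ + X)%E]P0; exact: outer_measureU2.
Qed.

(** The normal map sends the good part of the local parallel set onto the cone. Its inverse
    derivative has determinant at least the j-th term, that is [C(n', j) D / t^j], and
    [t <= eps]. *)
Lemma parallel_lower K j w D eps : ccv K -> (j <= n')%N -> w `<=` @sphere R n ->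
  0 < D -> 0 < eps -> sph_ae (fun u => w u -> exists2 s, sj_at K j u s & D <= s) ->
  (('C(n', j)%:R * D * eps ^+ (n - j))%:E * leb_outer (cone01 w) <=
   leb_outer (psi K @^-1` cone_le eps w))%E.
Proof.
move=> cK jn ws D0 e0 ae; set P := (fun u => _) in ae.
have C0 : 0 < 'C(n', j)%:R :> R by rewrite ltr0n bin_gt0.
have en0 : 0 < eps ^+ j by rewrite exprn_gt0.
have := leb_cone_ae ae ws; set w' := w `&` P => hw.
pose E := psi K @^-1` cone_le eps w'.
have imE : psi K @` E = cone_le eps w'.
  apply/seteqP; split => [_ [x Ex <-]//|z wz].
  by have [x xz] := psi_surj z cK; exists x => //; rewrite /E /preimage /= xz.
pose c := eps ^+ j / ('C(n', j)%:R * D).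
have c0 : 0 < c by rewrite divr_gt0// mulr_gt0.
have key : (leb_outer (psi K @` E) <= c%:E * leb_outer E)%E.
  apply: leb_image_inverse_derivative; first exact: ltW.
  move=> x [t [u [wu Pu] [/andP[t0 te] xu]]].
  have [s sju sD] := Pu wu.
  have [A [g [l [sA so pA [l0 sl detl] lj]]]] := sj_at_det cK (ws _ wu) jn sju.
  have ti0 : 0 <= t^-1 by rewrite invr_ge0 ltW.
  exists (1%:M + t^-1 *: A); split.
  - by apply: unit_1_psd; exact: psd_scale.
  - rewrite detl; apply: le_trans (ler_wpM2l (ltW c0) (ler_norm _)).
    apply: le_trans (ler_wpM2l (ltW c0) (esymp_ge_term j l0 ti0)).
    have tj0 : 0 < t ^+ j by rewrite exprn_gt0.
    have -> : c * ((esymp l)`_j * t^-1 ^+ j) = (s / D) * (eps ^+ j / t ^+ j).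
      by rewrite lj exprVn /c; field; rewrite !gt_eqF.
    apply: mulr_ege1; first by rewrite ler_pdivlMr// mul1r.
    by rewrite ler_pdivlMr// mul1r lerXn2r// nnegrE ltW.
  - exact: (psi_inverse_derivative _ cK sA so t0 xu).
have EE : (leb_outer E <= leb_outer (psi K @^-1` cone_le eps w))%E.
  by apply: le_leb_outer => x [t [u [wu _] h]]; exists t, u.
apply: (@le_trans _ _ (leb_outer E)) EE.
apply: (@le_trans _ _ (('C(n', j)%:R * D * eps ^+ (n - j))%:E * leb_outer (cone01 w'))%E).
  by apply: lee_wpmul2l => //; rewrite lee_fin !mulr_ge0 ?exprn_ge0 ?ltW.
move: key; rewrite imE cone_leE// leb_scale//.
have -> : eps ^+ n = eps ^+ (n - j) * eps ^+ j by rewrite -exprD subnK// (leq_trans jn).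
move=> key; have ci0 : (0 <= (c^-1)%:E)%E by rewrite lee_fin invr_ge0 ltW.
have := lee_wpmul2l ci0 key; rewrite muleA -EFinM muleA -EFinM mulVf ?gt_eqF// mul1e.
move=> /(le_trans _); apply; rewrite le_eqVlt; apply/orP; left; apply/eqP; congr (_%:E * _)%E.
by rewrite /c; field; rewrite !gt_eqF.
Qed.

End CurvatureAtAPoint.

(** * Upper bounds on area measures from curvature *)

Section CurvatureUpperBound.
Variables (R : realType) (n' : nat).
Local Notation n := n'.+1.
Local Notation V := 'rV[R]_n.
Implicit Types (K C D v w W : set V) (u x y : V) (t a b : R).

Definition annulus a b w : set V :=
  [set x | exists t : R, exists2 u, w u & a <= t <= b /\ x = t *: u].

Lemma annulus_sub_cone a b w : 0 < a -> annulus a b w `<=` cone_le b w.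
Proof.
by move=> a0 _ [t [u wu [/andP[at_ tb] ->]]]; exists t, u => //; rewrite (lt_le_trans a0).
Qed.

Lemma cone_leD_annulus a b w : cone_le b w `&` ~` cone_le a w `<=` annulus a b w.
Proof.
move=> _ [[t [u wu [/andP[t0 tb] ->]]] h]; exists t, u => //; split => //.
rewrite tb andbT leNgt; apply/negP => ta; apply: h.
by exists t, u => //; rewrite t0 ltW.
Qed.

Lemma projB C x y : proj C x - proj C y = (x - y) - (psi C x - psi C y).
Proof.
rewrite /psi; move: (proj C x) (proj C y) => p q.
by apply/rowP => i; rewrite !mxE; ring.
Qed.

Lemma proj_eball a x : 0 < a -> a <= enorm x -> proj (@eball R n a) x = (a / enorm x) *: x.
Proof.
move=> a0 ax; have x0 : 0 < enorm x by exact: lt_le_trans ax.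
apply: proj_uniq.
- exact/ccv_eball/ltW.
- by rewrite /eball /= enormZ gtr0_norm ?divr_gt0// divfK// gt_eqF.
move=> z za; have -> : x - (a / enorm x) *: x = (1 - a / enorm x) *: x by rewrite scalerBl scale1r.
rewrite dotpZr dotpBl dotpZl -sqr_enorm.
rewrite mulr_ge0_le0//; first by rewrite subr_ge0 ler_pdivrMr// mul1r.
rewrite subr_le0 expr2 mulrA divfK ?gt_eqF// (le_trans (dotp_le _ _))// ler_wpM2r ?enorm_ge0//.
Qed.

(** The points of the closed shell outside [U] form a compact set, and removing their directions
    from the sphere leaves [W]. The direction is taken through the projection on the ball of radius
    [a], which is Lipschitz on the whole space. *)
Lemma annulus_open_hull K a b v (U : set V) : ccv K -> 0 < a -> v `<=` @sphere R n -> open U ->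
  psi K @^-1` annulus a b v `<=` U ->
  exists W, [/\ borel W, v `<=` W, W `<=` @sphere R n & psi K @^-1` annulus a b W `<=` U].
Proof.
move=> cK a0 vs oU vU; pose f x := a^-1 *: proj (@eball R n a) (psi K x).
have cb : ccv (@eball R n a) by exact/ccv_eball/ltW.
have cf : continuous f.
  apply: (@lipschitz_continuous R n n f (2 / a)) => x y.
  rewrite -scalerBr enormZ gtr0_norm ?invr_gt0// mulrAC [X in _ <= X]mulrC ler_pM2l ?invr_gt0//.
  have -> : proj (@eball R n a) (psi K x) - proj (@eball R n a) (psi K y) =
      (psi K x - psi K y) - (psi (@eball R n a) (psi K x) - psi (@eball R n a) (psi K y)).
    exact: projB.
  apply: (le_trans (enormB _ _)); have h1 := psi_lip x y cK.
  have h2 := psi_lip (psi K x) (psi K y) cb; lra.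
have fE t u x : @sphere R n u -> a <= t -> psi K x = t *: u -> f x = u.
  move=> us at_ xu; have t0 : 0 < t by exact: lt_le_trans at_.
  have eu : enorm (psi K x) = t by rewrite xu enormZ gtr0_norm// us mulr1.
  rewrite /f proj_eball// ?eu// xu !scalerA.
  by rewrite (_ : _ * _ = 1) ?scale1r//; field; rewrite !gt_eqF.
pose Z := ~` U `&` (psi K @^-1` (@eball R n b `&` [set z | a <= enorm z])).
have cpsi := psi_continuous cK.
have cZ : compact Z.
  have clZ : closed Z.
    apply: closedI; first exact: open_closedC.
    apply: preimage_closed => //; apply: closedI; first exact: closed_eball.
    rewrite (_ : [set z | _] = @enorm R n @^-1` [set s | a <= s])//.
    by apply: preimage_closed; [move=> x _; exact: enorm_continuous|exact: closed_ge].
  have [r rP] := bnd_psi cK (@bnd_eball R n' b).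
  have Zr : Z `<=` @eball R n r by move=> x [_ [xb _]]; exact: rP.
  apply: (subclosed_compact clZ (@compact_eball R n r)) => //.
have cfZ : compact (f @` Z) by apply: continuous_compact => //; exact: continuous_subspaceT.
exists (@sphere R n `&` ~` (f @` Z)); split.
- apply: borelI.
    apply: borel_closed; rewrite (_ : @sphere R n = @enorm R n @^-1` [set 1]); last first.
      by apply/seteqP; split.
    by apply: preimage_closed; [move=> x _; exact: enorm_continuous|exact: closed_eq].
  by apply: borelC; apply: borel_closed; apply: compact_closed => //; exact: norm_hausdorff.
- move=> u vu; split; [exact: vs|move=> [x [nU [xb xa]] fx]].
  apply: nU; apply: vU; exists (enorm (psi K x)), u => //; split; first exact/andP.
  have x0 : 0 < enorm (psi K x) by exact: lt_le_trans xa.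
  rewrite -fx /f proj_eball// !scalerA (_ : _ * _ = 1) ?scale1r//.
  by field; rewrite !gt_eqF.
- by move=> u [].
- move=> x [t [u [us nfZ] [/andP[at_ tb] xu]]]; apply: contrapT => nU.
  apply: nfZ; exists x; last exact: fE xu.
  have eu : enorm (psi K x) = t by rewrite xu enormZ gtr0_norm ?us ?mulr1// (lt_le_trans a0).
  by split => //; rewrite /preimage /= /eball /= eu.
Qed.

Lemma psi_set0p x : psi [set (0 : V)] x = x.
Proof.
have c0 : ccv [set (0 : V)].
  by split; [exact: compact_set1|move=> _ _ t -> -> _; rewrite !scaler0 addr0|exists 0].
by rewrite /psi; have [-> _] := projP x c0; rewrite subr0.
Qed.

Lemma cone01I v w : v `<=` @sphere R n -> w `<=` @sphere R n ->
  cone01 v `&` cone01 w = cone01 (v `&` w).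
Proof.
move=> vs ws; rewrite !cone01E//; last by move=> x [/vs].
by apply/seteqP; split => x [[] //= [? ?]]; tauto.
Qed.

Lemma cone01D v w : v `<=` @sphere R n -> w `<=` @sphere R n ->
  cone01 v `&` ~` cone01 w = cone01 (v `\` w).
Proof.
move=> vs ws; rewrite !cone01E//; last by move=> x [/vs].
apply/seteqP; split => x.
  by move=> [[[x0 vx] xb] nw]; split => //; split => //; split => // wx; exact: nw.
by move=> [[x0 [vx nwx]] xb]; split => // -[[_ wx] _]; exact: nwx.
Qed.

(** Spherical measure divided by [n]. *)
Definition sg w : R := fine (leb_outer (cone01 w)).

Lemma sgE w : w `<=` @sphere R n -> leb_outer (cone01 w) = (sg w)%:E.
Proof. by move=> ws; apply: bnd_lebE; exact: bnd_cone01. Qed.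

Lemma sg_le v w : w `<=` @sphere R n -> v `<=` w -> sg v <= sg w.
Proof.
move=> ws vw; rewrite -lee_fin -!sgE//; last exact: subset_trans ws.
by apply: le_leb_outer => x [t [u vu h]]; exists t, u => //; exact: vw.
Qed.

Lemma sg_split v w : w `<=` @sphere R n -> v `<=` @sphere R n -> borel v ->
  sg w = sg (w `&` v) + sg (w `\` v).
Proof.
move=> ws vs bv; apply: EFin_inj; rewrite EFinD -!sgE//; last 2 first.
- by move=> x [/ws].
- by move=> x [/ws].
by rewrite -cone01I// -cone01D// -leb_split//; exact: borel_cone01.
Qed.

Lemma Sig_cone_split K (m : 'I_n.+1) v w : ccv K -> w `<=` @sphere R n -> v `<=` @sphere R n ->
  borel v -> Sig K m (cone01 w) = Sig K m (cone01 (w `&` v)) + Sig K m (cone01 (w `\` v)).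
Proof.
move=> cK ws vs bv; rewrite -cone01I// -cone01D//; apply: Sig_split => //.
  exact: bnd_cone01.
exact: borel_cone01.
Qed.

(** A Borel hull inside the sphere. The shell lemma is applied to the body [{0}], whose normal map
    is the identity; the inner cone omitted by the shell contributes the factor [e ^+ n], which is
    negligible. *)
Lemma sph_hull v : v `<=` @sphere R n ->
  exists W, [/\ borel W, v `<=` W, W `<=` @sphere R n & sg W = sg v].
Proof.
move=> vs; pose S := sg (@sphere R n).
have c0 : ccv [set (0 : V)].
  by split; [exact: compact_set1|move=> _ _ t -> -> _; rewrite !scaler0 addr0|exists 0].
have /choice[W WP] : forall k : nat, exists W, [/\ borel W, v `<=` W, W `<=` @sphere R n &
    sg W <= sg v + k.+1%:R^-1 * (1 + S)].
  move=> k; set e := k.+1%:R^-1; have e0 : 0 < e by rewrite invr_gt0.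
  have e1 : e <= 1 by rewrite invf_le1 ?ler1n.
  have fin : (leb_outer (cone01 v) < +oo)%E by rewrite sgE// ltry.
  have [U [oU vU leU]] := leb_open_hull fin e0.
  have [|W [bW vW Ws WU]] := @annulus_open_hull [set 0] e 1 v U c0 e0 vs oU.
    by move=> x; rewrite /preimage /= psi_set0p => /(annulus_sub_cone e0)/vU.
  exists W; split => //.
  have h : cone01 W `<=` U `|` scaleS e (cone01 W).
    rewrite -cone_leE// => x cx; have [ex|nex] := pselect (cone_le e W x); first by right.
    by left; apply: WU; rewrite /preimage /= psi_set0p; apply: cone_leD_annulus.
  have h1 : (leb_outer (cone01 W) <= leb_outer U + leb_outer ( *:%R e @` cone01 W))%E.
    exact: le_trans (le_leb_outer h) (outer_measureU2 _ _ _).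
  rewrite leb_scale// sgE// -EFinM in h1.
  have : ((sg W)%:E <= (sg v + e + e ^+ n * sg W)%:E)%E.
    by apply: (le_trans h1); rewrite EFinD; apply: leeD2r; rewrite EFinD -sgE.
  rewrite lee_fin => /le_trans; apply; rewrite -addrA lerD2l mulrDr mulr1 lerD2l.
  have en : e ^+ n <= e by rewrite exprS ler_piMr ?(ltW e0)// exprn_ile1// ?(ltW e0).
  by apply: ler_pM => //; [rewrite exprn_ge0// ltW|rewrite fine_ge0// outer_measure_ge0|exact: sg_le].
have bI : borel (\bigcap_k W k) by apply: borel_bigcap => k; have [] := WP k.
have sI : \bigcap_k W k `<=` @sphere R n by move=> x /(_ 0%N I); have [_ _ h _] := WP 0%N; exact: h.
exists (\bigcap_k W k); split => //; first by move=> x vx k _; have [_ h _ _] := WP k; exact: h.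
apply/eqP; rewrite eq_le; apply/andP; split; last first.
  by apply: sg_le => // x vx k _; have [_ h _ _] := WP k; exact: h.
apply/ler_addgt0Pr => e e0.
have S0 : 0 <= S by rewrite fine_ge0// outer_measure_ge0.
have S1 : 0 < 1 + S by rewrite ltr_wpDr.
have [k ke] : exists k : nat, (1 + S) / e <= k.+1%:R.
  exists (Num.truncn ((1 + S) / e)); exact/ltW/truncnS_gt.
have [_ _ Ws Wk] := WP k.
apply: (@le_trans _ _ (sg (W k))); first by apply: sg_le => // x /(_ k I).
apply: (le_trans Wk); rewrite lerD2l mulrC ler_pdivrMr// mulrC -ler_pdivrMr//.
Qed.

Lemma Sig_increasing K (m : 'I_n.+1) (F : nat -> set V) D e : ccv K -> bnd D -> borel D ->
  (forall i j, (i <= j)%N -> F i `<=` F j) -> (forall i, borel (F i)) -> \bigcup_i F i = D ->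
  0 < e -> exists N, Sig K m D <= Sig K m (F N) + e.
Proof.
move=> cK bdD bD incF bF FD e0.
have FsD i : F i `<=` D by rewrite -FD => x Fx; exists i.
pose A := 1 + \sum_(k < n.+1) `|lagrange R n m k|.
have A0 : 0 < A by rewrite ltr_wpDr// sumr_ge0.
have eA : 0 < e / A by rewrite divr_gt0.
have /choice[N NP] : forall k : 'I_n.+1, exists N, mu K k.+1%:R D <= mu K k.+1%:R (F N) + e / A.
  move=> k; apply: contrapT => /forallNP H.
  have : (leb_outer (\bigcup_i (psi (scaleS k.+1%:R K) @^-1` F i)) <= (mu K k.+1%:R D - e / A)%:E)%E.
    apply: leb_bigcup_nondecreasing => [i j ij x|i]; first exact: incF.
    rewrite muE//; last exact: bnd_sub (FsD i) bdD.
    by have /negP := H i; rewrite -ltNge lee_fin => h; rewrite lerBrDr ltW.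
  by rewrite -preimage_bigcup FD muE// lee_fin lerBrDr gerDl leNgt eA.
pose M := \max_k N k; exists M.
rewrite /Sig -lerBlDl -sumrB; apply: (@le_trans _ _ (\sum_(k < n.+1) `|lagrange R n m k| * (e / A))).
  apply: ler_sum => k _; rewrite -mulrBr; apply: (le_trans (ler_norm _)).
  rewrite normrM ler_wpM2l// ger0_norm; last by rewrite subr_ge0; apply: mu_le.
  rewrite lerBlDl; apply: (le_trans (NP k)); rewrite lerD2r; apply: mu_le => //.
    exact: bnd_sub (FsD M) bdD.
  by apply: incF; exact: (leq_bigmax k).
rewrite -mulr_suml mulrA ler_pdivrMr// mulrC ler_pM2l// /A; lra.
Qed.

End CurvatureUpperBound.

Section UpperCurvatureMeasure.
Variables (R : realType) (n' : nat).
Local Notation n := n'.+1.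
Local Notation V := 'rV[R]_n.
Implicit Types (K C D v w W : set V) (u x y : V) (t a b : R).

(** A section of the normal map covers the preimage, because over the shell the expansion makes the
    map injective. The derivative of the section is [1 + A / t], with determinant at most [Q]. *)
Lemma leb_psi_preimage_annulus K v e Q : ccv K -> 0 < e -> 0 < Q ->
  (forall u, v u -> exists A g, [/\ A^T = A, second_order K u A g, psd A &
     forall t, e <= t -> \det (1%:M + t^-1 *: A) <= Q]) ->
  (leb_outer (psi K @^-1` annulus e (2 * e) v) <= Q%:E * leb_outer (annulus e (2 * e) v))%E.
Proof.
move=> cK e0 Q0 H; set E := annulus _ _ _.
have /choice[f fP] : forall z, exists x, psi K x = z by move=> z; exact: psi_surj.
have uniq x x' : E (psi K x) -> psi K x' = psi K x -> x' = x.
  move=> [t [u vu [/andP[et _] xu]]] xx'; have t0 : 0 < t by exact: lt_le_trans et.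
  have [A [g [sA so _ _]]] := H u vu.
  have [d d0 /(_ x x' xu)] := psi_expansion cK sA so t0 (@ltr01 R).
  rewrite xx' xu !subrr enorm0 mul0mx subr0 mulr0 => /(_ d0) h.
  by apply/eqP; rewrite -subr_eq0 -enorm_eq0 eq_le h enorm_ge0.
apply: (@le_trans _ _ (leb_outer (f @` E))).
  apply: le_leb_outer => x Ex; exists (psi K x) => //.
  by apply: uniq => //; rewrite fP.
apply: leb_image_inverse_derivative; first exact: ltW.
move=> z [t [u vu [/andP[et tb] zE]]]; have t0 : 0 < t by exact: lt_le_trans et.
have [A [g [sA so pA detA]]] := H u vu.
pose G := 1%:M + t^-1 *: A.
have ptA : psd (t^-1 *: A) by apply: psd_scale => //; rewrite invr_ge0 ltW.
have uG : G \in unitmx by exact: unit_1_psd.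
have dG : \det G <= Q by exact: detA.
exists (invmx G); split; first by rewrite unitmx_inv.
  have dG0 : 0 < `|\det G| by rewrite normr_gt0 -unitfE -unitmxE.
  rewrite det_inv normrV ?unitfE -?normr_gt0// ler_pdivlMr// mul1r.
  have [l [l0 _ detl _]] := psd_det ptA.
  rewrite ger0_norm// /G -[t^-1 *: A]scale1r detl horner_esymp big_seq prodr_ge0// => y /(allP l0) y0.
  by rewrite mul1r addr_ge0.
move=> e' e'0; have [d d0 dH] := psi_expansion cK sA so t0 e'0.
exists d => // z' _ zz'.
have fz : psi K (f z) = t *: u by rewrite fP.
have := dH (f z) (f z') fz; rewrite !fP -zE => /(_ zz'); apply: le_trans.
apply: (le_trans (enorm_1_psd _ ptA)); rewrite -/G mulmxBl -mulmxA mulVmx// mulmx1.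
by [].
Qed.

Lemma Sig_le_mu K (m : 'I_n.+1) C : ccv K -> borel C -> bnd C ->
  Sig K m C <= fine (leb_outer (psi K @^-1` C)).
Proof.
move=> cK bC bdC; have := steiner_formula cK bC bdC ltr01.
rewrite /mu scaleS1 => ->; rewrite (bigD1 m)//= expr1n mul1r lerDl sumr_ge0// => i _.
by rewrite expr1n mul1r Sig_ge0.
Qed.

(** The bound on the shell between heights [e] and [2 e] controls the whole cone: by homogeneity the
    shell has mass [(2^(n-j) - 1) e^(n-j)] times that of the unit cone, and [2^(n-j) >= 2]. The set
    [v] may fail to be measurable, hence the Borel set [W] around it. *)
Lemma Sig_le_local K (j : 'I_n.+1) v e Q d : ccv K -> (j < n)%N -> 0 < e -> 0 < Q -> 0 < d ->
  v `<=` @sphere R n ->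
  (forall u, v u -> exists A g, [/\ A^T = A, second_order K u A g, psd A &
     forall t, e <= t -> \det (1%:M + t^-1 *: A) <= Q]) ->
  exists W, [/\ borel W, v `<=` W, W `<=` @sphere R n &
    e ^+ (n - j) * Sig K j (cone01 W) <= Q * (2 * e) ^+ n * sg v + d].
Proof.
move=> cK jn e0 Q0 d0 vs H.
have e20 : 0 < 2 * e by rewrite mulr_gt0.
have le1 := leb_psi_preimage_annulus cK e0 Q0 H.
have le2 : (leb_outer (annulus e (2 * e) v) <= ((2 * e) ^+ n * sg v)%:E)%E.
  apply: le_trans (le_leb_outer (annulus_sub_cone e0)) _.
  by rewrite cone_leE// leb_scale// sgE.
have le3 : (leb_outer (psi K @^-1` annulus e (2 * e) v) <= (Q * (2 * e) ^+ n * sg v)%:E)%E.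
  apply: (le_trans le1); rewrite -mulrA EFinM; apply: lee_wpmul2l => //.
  by rewrite lee_fin ltW.
have fin : (leb_outer (psi K @^-1` annulus e (2 * e) v) < +oo)%E.
  by apply: (le_lt_trans le3); rewrite ltry.
have [U [oU vU leU]] := leb_open_hull fin d0.
have [W [bW vW Ws WU]] := annulus_open_hull cK e0 vs oU vU.
exists W; split => //.
have bdW := bnd_cone01 Ws; have bcW := borel_cone01 Ws bW.
pose C := cone_le (2 * e) W `&` ~` cone_le e W.
have CE : C = scaleS (2 * e) (cone01 W) `&` ~` scaleS e (cone01 W).
  by rewrite /C !cone_leE.
have bC : borel C.
  by rewrite CE; apply: borelI; [|apply: borelC]; apply: borel_scale.
have bdC : bnd C.
  by rewrite CE; apply: (@bnd_sub _ _ _ (scaleS (2 * e) (cone01 W))); [move=> x []|exact: bnd_scale].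
have h1 : Sig K j C <= Q * (2 * e) ^+ n * sg v + d.
  apply: (le_trans (Sig_le_mu j cK bC bdC)).
  have : (leb_outer (psi K @^-1` C) <= (Q * (2 * e) ^+ n * sg v + d)%:E)%E.
    apply: (@le_trans _ _ (leb_outer U)).
      by apply: le_leb_outer => x Cx; apply: WU; exact: cone_leD_annulus.
    by apply: (le_trans leU); rewrite EFinD; apply: leeD2r.
  by rewrite (bnd_lebE (bnd_psi cK bdC)) lee_fin.
apply: le_trans h1.
have be : borel (scaleS e (cone01 W)) by exact: borel_scale.
have := Sig_split j cK (bnd_scale (2 * e) bdW) be; rewrite -CE.
have -> : scaleS (2 * e) (cone01 W) `&` scaleS e (cone01 W) = scaleS e (cone01 W).
  apply/setIidr; rewrite -!cone_leE// => _ [t [u wu [/andP[t0 te] ->]]].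
  have ee : e <= 2 * e by lra.
  by exists t, u => //; rewrite t0 (le_trans te ee).
rewrite !Sig_scale// => h; have -> : Sig K j C = (2 * e) ^+ (n - j) * Sig K j (cone01 W) - e ^+ (n - j) * Sig K j (cone01 W) by lra.
rewrite exprMn; have := Sig_ge0 j cK bcW bdW; move: (Sig K j (cone01 W)) => s s0.
have h2 : 2 <= 2 ^+ (n - j) :> R by rewrite -[leLHS]expr1 ler_weXn2l ?ler1n// subn_gt0.
have : 0 <= (2 ^+ (n - j) - 2) * (e ^+ (n - j) * s).
  by rewrite mulr_ge0 ?subr_ge0// mulr_ge0// exprn_ge0// ltW.
lra.
Qed.

Lemma Sig_null K (j : 'I_n.+1) W : ccv K -> (j < n)%N -> area_abs_cont K j ->
  borel W -> W `<=` @sphere R n -> sg W = 0 -> Sig K j (cone01 W) = 0.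
Proof.
move=> cK jn ac bW Ws W0.
have := ac _ (area_measures_exist cK) W bW Ws.
rewrite /sph_outer sgE// W0 mule0 => /(_ erefl) /eqP; rewrite /area_measure.
rewrite (_ : inord j = j); last by apply: val_inj; rewrite /= inordK.
rewrite !mulf_eq0 invr_eq0 !pnatr_eq0 /= => /orP[|/eqP//].
by rewrite eqn0Ngt bin_gt0 -ltnS ltn_ord.
Qed.

(** No single height suits all directions, as the Hessians are unbounded. Directions are sorted by a
    rational height that works for them; at each height the powers of the height cancel, and the
    pieces are added by continuity from below. *)
Theorem Sig_le_curvature K (j : 'I_n.+1) w (D : R) : ccv K -> (0 < j < n)%N -> area_abs_cont K j ->
  borel w -> w `<=` @sphere R n -> 0 < D ->
  sph_ae (fun u => w u -> exists2 s, sj_at K j u s & 0 < s <= D) ->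
  Sig K j (cone01 w) <= 2 ^+ (n' + j + n) * 'C(n', j)%:R * D * sg w.
Proof.
move=> cK /andP[j0 jn] ac bw ws D0 ae.
have jn' : (j <= n')%N by rewrite -ltnS.
have C0 : 0 < 'C(n', j)%:R :> R by rewrite ltr0n bin_gt0.
(* Enumerates the rationals; the default 0 gives an empty class [good i]. *)
pose eps (i : nat) : R := if unpickle i is Some q then ratr (q : rat) else 0.
(* The bound of [esymp_dominant] at [tau <= 2 / eps i]. The factor [eps^-j] makes [Q (2 eps)^n] a
   multiple of [eps^(n-j)]. *)
pose Q i := 2 ^+ n' * ('C(n', j)%:R * D) * 2 ^+ j * (eps i)^-1 ^+ j.
have Q0 i : 0 < eps i -> 0 < Q i by move=> ?; rewrite !mulr_gt0 ?exprn_gt0 ?invr_gt0.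
pose good i u := w u /\ 0 < eps i /\ exists A g, [/\ A^T = A, second_order K u A g, psd A &
   forall t, eps i <= t -> \det (1%:M + t^-1 *: A) <= Q i].
have goods i : good i `<=` @sphere R n by move=> u [/ws].
have [H HP] := choice (fun i => sph_hull (goods i)).
pose c := 2 ^+ (n' + j + n) * 'C(n', j)%:R * D; rewrite -/c.
have c0 : 0 < c by rewrite !mulr_gt0 ?exprn_gt0.
have piece i P : borel P -> P `<=` w -> P `<=` H i -> Sig K j (cone01 P) <= c * sg P.
  move=> bP Pw PH; have Ps := subset_trans Pw ws.
  have [e0|e0] := ltP 0 (eps i); last first.
    have [_ _ Hs HE] := HP i.
    have sP : sg P = 0.
      apply/eqP; rewrite eq_le fine_ge0 ?outer_measure_ge0// andbT.
      apply: (le_trans (sg_le Hs PH)); rewrite HE (_ : good i = set0).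
        by rewrite /sg (_ : cone01 set0 = set0) ?leb_outer0// -subset0 => x [t [u []]].
      by rewrite -subset0 => u [_ [e1 _]]; have := lt_le_trans e1 e0; rewrite ltxx.
    by rewrite (Sig_null cK jn ac bP Ps sP) sP mulr0.
  apply/ler_addgt0Pr => d d0.
  have de : 0 < d * eps i ^+ (n - j) by rewrite mulr_gt0// exprn_gt0.
  have vs : good i `&` P `<=` @sphere R n by move=> u [_ /Ps].
  have [|W [bW vW Ws SW]] := Sig_le_local cK jn e0 (Q0 i e0) de vs.
    by move=> u [[_ [_ h]] _].
  rewrite (Sig_cone_split j cK Ps Ws bW) (_ : Sig K j (cone01 (P `\` W)) = 0) ?addr0.
    apply: (@le_trans _ _ (Sig K j (cone01 W))).
      apply: Sig_le => //; [exact: bnd_cone01|apply: borel_cone01 => //|exact: borel_cone01|].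
      - by move=> u [/Ps].
      - exact: borelI.
      - by move=> x [t [u [Pu Wu] h]]; exists t, u.
    have en0 : 0 < eps i ^+ (n - j) by rewrite exprn_gt0.
    rewrite -(ler_pM2l en0); apply: (le_trans SW).
    rewrite mulrDr [X in _ <= _ + X]mulrC lerD2r.
    have -> : Q i * (2 * eps i) ^+ n = eps i ^+ (n - j) * c.
      rewrite /Q /c exprMn exprVn !exprD.
      have -> : eps i ^+ n = eps i ^+ (n - j) * eps i ^+ j by rewrite -exprD subnK// ltnW.
      by field; rewrite expf_neq0// gt_eqF.
    rewrite -mulrA !ler_pM2l//; apply: sg_le => //; by move=> u [].
  apply: Sig_null => //; first exact: borelD.
    by move=> u [/Ps].
  (* The part of [P] outside [W] misses [good i], yet lies in a hull of the same measure, so it is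
     null. *)
  have [bH gH Hs HE] := HP i.
  have PWs : P `\` W `<=` @sphere R n by move=> u [/Ps].
  have := sg_split Hs PWs (borelD bP bW).
  have -> : H i `&` (P `\` W) = P `\` W by apply/setIidr => u [/PH].
  have : sg (good i) <= sg (H i `\` (P `\` W)).
    apply: sg_le; first by move=> u [/Hs].
    by move=> u gu; split; [exact: gH|move=> [Pu]; apply; exact: vW].
  have : 0 <= sg (P `\` W) by rewrite fine_ge0// outer_measure_ge0.
  rewrite HE; lra.
pose U N := \bigcup_(i in [set i | (i < N)%N]) H i.
have bU N : borel (U N).
  rewrite /U bigcup_mkcond; apply: borel_bigcup => i.
  by case: ifP => _; [have [] := HP i|apply: borel_open; exact: open0].
have Us N : U N `<=` @sphere R n by move=> u [i _]; have [_ _ h _] := HP i; exact: h.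
have fin N : Sig K j (cone01 (w `&` U N)) <= c * sg (w `&` U N).
  elim: N => [|N IH].
    rewrite (_ : w `&` U 0%N = set0); last by rewrite -subset0 => u [_ []].
    rewrite (_ : cone01 set0 = set0); last by rewrite -subset0 => x [t [u []]].
    by rewrite Sig0 mulr_ge0 ?(ltW c0)// fine_ge0// outer_measure_ge0.
  have wUs : w `&` U N.+1 `<=` @sphere R n by move=> u [/ws].
  rewrite (Sig_cone_split j cK wUs (Us N) (bU N)) (sg_split wUs (Us N) (bU N)) mulrDr.
  have -> : w `&` U N.+1 `&` U N = w `&` U N.
    apply/seteqP; split => u; first by move=> [[]].
    by move=> [wu [i iN Hu]]; split; [split => //; exists i => //=; exact: ltnW|exists i].
  apply: lerD => //; apply: (piece N).
  - by apply: borelD => //; apply: borelI.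
  - by move=> u [[]].
  - move=> u [[wu [i /= iN Hu]] nU]; move: iN; rewrite ltnS leq_eqVlt => /orP[/eqP<-//|iN].
    by case: nU; exists i.
pose UU := \bigcup_i H i.
have bUU : borel UU by apply: borel_bigcup => i; have [] := HP i.
have UUs : UU `<=` @sphere R n by move=> u [i _]; have [_ _ h _] := HP i; exact: h.
(* Outside all the hulls only exceptional directions remain: every other direction belongs to the
   class of some rational height. *)
rewrite (Sig_cone_split j cK ws UUs bUU) (_ : Sig K j (cone01 (w `\` UU)) = 0) ?addr0; last first.
  apply: Sig_null => //; [exact: borelD|by move=> u [/ws]|].
  apply/eqP; rewrite eq_le fine_ge0 ?outer_measure_ge0// andbT.
  rewrite -lee_fin -sgE//; last by move=> u [/ws].
  rewrite -[X in (_ <= X)%E](sph_ae_leb0 ae); apply: le_leb_outer => x [t [u [wu nU] h]].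
  exists t, u => //; split => [|good_u]; first exact: ws.
  have [s sju /andP[s0 sD]] := good_u wu; apply: nU.
  have [A [g [l [sA so pA [l0 sl detl] lj]]]] := sj_at_det cK (ws _ wu) jn' sju.
  have [||tau tau0 htau] := @esymp_dominant R l j l0; first by rewrite sl j0.
    by rewrite lj mulr_gt0.
  (* The dominant height [1 / tau] is rounded up to a rational by a factor below 2, which accounts
     for the [2 ^+ j] in [Q]. *)
  have [q] : exists q : rat, ratr q \in `]tau^-1, (2 / tau)[.
    by apply: rat_in_itvoo; rewrite -[X in X < _]mul1r ltr_pM2r ?invr_gt0// ltr1n.
  rewrite in_itv /= => /andP[q1 q2].
  have q0 : 0 < ratr q :> R by apply: lt_trans q1; rewrite invr_gt0.
  have eq_ : eps (pickle q) = ratr q by rewrite /eps pickleK.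
  exists (pickle q) => //; have [_ gH _ _] := HP (pickle q); apply: gH.
  split => //; rewrite eq_; split => //; exists A, g; split => // y yq.
  have y0 : 0 < y by exact: lt_le_trans yq.
  have tq : (ratr q)^-1 <= tau by rewrite invf_ple ?posrE// ltW.
  have tq2 : tau <= 2 * (ratr q)^-1.
    by rewrite ler_pdivlMr// mulrC -ler_pdivlMr// ltW.
  rewrite detl; apply: (@le_trans _ _ (esymp l).[tau]).
    apply: esymp_mono => //; rewrite invr_ge0 (ltW y0)/=; apply: le_trans tq.
    by rewrite lef_pV2 ?posrE.
  apply: (le_trans htau); rewrite /Q eq_ sl lj.
  rewrite -[X in _ <= X]mulrA; apply: ler_pM; rewrite ?mulr_ge0 ?exprn_ge0 ?(ltW s0) ?(ltW tau0)//.
    by rewrite !ler_pM2l// exprn_gt0.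
  by rewrite -exprMn lerXn2r// nnegrE ?(ltW tau0)// mulr_ge0// invr_ge0 ltW.
apply: (@le_trans _ _ (c * sg (w `&` UU))); last first.
  by rewrite ler_pM2l//; apply: sg_le => // u [].
apply/ler_addgt0Pr => d d0.
have wUUs : w `&` UU `<=` @sphere R n by move=> u [/ws].
have inc i k : (i <= k)%N -> cone01 (w `&` U i) `<=` cone01 (w `&` U k).
  move=> ik x [t [u [wu [a /= ai Hu]] h]]; exists t, u => //; split => //.
  by exists a => //=; exact: leq_trans ai ik.
have bcU i : borel (cone01 (w `&` U i)).
  by apply: borel_cone01; [move=> u [/ws]|exact: borelI].
have cU : \bigcup_i cone01 (w `&` U i) = cone01 (w `&` UU).
  apply/seteqP; split => x.
    by move=> [N _ [t [u [wu [a _ Hu]] h]]]; exists t, u => //; split => //; exists a.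
  move=> [t [u [wu [a _ Hu]] h]]; exists a.+1 => //; exists t, u => //; split => //.
  by exists a => /=.
have bcUU := borel_cone01 wUUs (borelI bw bUU).
have [N leN] := Sig_increasing j cK (bnd_cone01 wUUs) bcUU inc bcU cU d0.
apply: (le_trans leN); rewrite lerD2r (le_trans (fin N))// ler_pM2l//; apply: sg_le => //.
by move=> u [wu [a _ Hu]]; split => //; exists a.
Qed.

End UpperCurvatureMeasure.

(** * Zonotopes and monotonicity of the total masses *)

Section AdditiveFunction.
Variables (R : realType).

(** Nonnegativity makes [g] monotone; comparing [k a] with its integer part bounds [k] times the
    deviation from linearity by [g 1], for every [k]. *)
Lemma additive_linear (g : R -> R) : (forall a, 0 <= a -> 0 <= g a) ->
  (forall a b, 0 <= a -> 0 <= b -> g (a + b) = g a + g b) ->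
  forall a, 0 <= a -> g a = a * g 1.
Proof.
move=> g0 gD a a0.
have mono x y : 0 <= x -> x <= y -> g x <= g y.
  move=> x0 xy; rewrite -(subrK x y) addrC gD ?subr_ge0// lerDl g0// subr_ge0//.
have gN k x : 0 <= x -> g (k%:R * x) = k%:R * g x.
  move=> x0; elim: k => [|k IH].
    have : g (0 + 0) = g 0 + g 0 by apply: gD.
    by rewrite addr0 !mul0r; lra.
  by rewrite -natr1 !mulrDl !mul1r gD ?IH// mulr_ge0.
have g1 : 0 <= g 1 by exact: g0.
have key k : k%:R * `|g a - a * g 1| <= g 1.
  have ka : 0 <= k%:R * a by rewrite mulr_ge0.
  have h := truncn_itv ka; move/andP: h => [h1 h2].
  have l1 := mono _ _ (ler0n _ _) h1; have l2 := mono _ _ ka (ltW h2).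
  rewrite gN// -[X in g X]mulr1 gN// in l1; rewrite gN// -[X in _ <= g X]mulr1 gN// -natr1 in l2.
  set T : R := (Num.truncn (k%:R * a))%:R in h1 h2 l1 l2.
  have e1 : T * g 1 <= k%:R * a * g 1 by rewrite ler_wpM2r.
  have e2 : k%:R * a * g 1 <= (T + 1) * g 1 by rewrite ler_wpM2r// ltW// natr1.
  rewrite -[k%:R in leLHS]ger0_norm// -normrM ler_norml mulrBr; lra.
apply/eqP; rewrite -subr_eq0 -normr_eq0; apply/negP => /negP nz.
have d0 : 0 < `|g a - a * g 1| by rewrite lt_neqAle eq_sym nz normr_ge0.
have := key (Num.truncn (g 1 / `|g a - a * g 1|)).+1.
by rewrite -ler_pdivlMr// leNgt truncnS_gt.
Qed.

End AdditiveFunction.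

Section ZonotopeSums.
Variables (R : realType) (n' : nat).
Local Notation n := n'.+1.
Local Notation V := 'rV[R]_n.
Implicit Types (K L C : set V) (v x : V) (a b t : R).

Definition vol C : R := fine (leb_outer C).

Lemma volE C : bnd C -> leb_outer C = (vol C)%:E.
Proof. exact: bnd_lebE. Qed.

Lemma vol_ge0 C : 0 <= vol C.
Proof. by rewrite fine_ge0// outer_measure_ge0. Qed.

Lemma vol_le C D : bnd D -> C `<=` D -> vol C <= vol D.
Proof.
move=> bD CD; rewrite -lee_fin -!volE//; last exact: bnd_sub bD.
exact: le_leb_outer.
Qed.

Definition seg a v : set V := [set x | exists2 b, `|b| <= a & x = b *: v].

Lemma ccv_seg a v : 0 <= a -> ccv (seg a v).
Proof.
move=> a0; split.
- have -> : seg a v = (fun b => b *: v) @` `[- a, a]%classic.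
    apply/seteqP; split => [x [b ba ->]|x [b /= ba <-]].
      by exists b => //=; rewrite in_itv /= -ler_norml.
    by exists b => //; rewrite ler_norml; move: ba; rewrite in_itv.
  apply: continuous_compact; last exact: segment_compact.
  by apply: continuous_subspaceT => x; exact: scalel_continuous.
- move=> _ _ t [b ba ->] [c ca ->] /andP[t0 t1].
  exists (t * b + (1 - t) * c); last by rewrite !scalerA -scalerDl.
  move: ba ca; rewrite !ler_norml => /andP[b1 b2] /andP[c1 c2].
  have t1' : 0 <= 1 - t by rewrite subr_ge0.
  have := ler_wpM2l t0 b1; have := ler_wpM2l t0 b2.
  have := ler_wpM2l t1' c1; have := ler_wpM2l t1' c2.
  move=> *; apply/andP; split; lra.
- by exists 0, 0; rewrite ?normr0// scale0r.
Qed.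

Lemma supp_seg a v x : 0 <= a -> supp_fun (seg a v) x = a * `|dotp v x|.
Proof.
move=> a0; have cs := ccv_seg v a0; apply/eqP; rewrite eq_le; apply/andP; split.
  apply: supp_fun_le => // _ [b ba ->]; rewrite dotpZr dotpC.
  by apply: (le_trans (ler_norm _)); rewrite normrM ler_wpM2r.
have [s s1 sE] : exists2 s : R, `|s| <= 1 & `|dotp v x| = s * dotp v x.
  by have [h|h] := ger0P (dotp v x); [exists 1|exists (-1)]; rewrite ?normrN ?normr1 ?mul1r ?mulN1r.
have : seg a v ((a * s) *: v).
  by exists (a * s) => //; rewrite normrM (ger0_norm a0) -[leRHS]mulr1 ler_wpM2l.
by move=> /(supp_fun_ge x cs); rewrite dotpZr (dotpC x) sE mulrA.
Qed.

Lemma vol_shift c C : vol (+%R c @` C) = vol C.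
Proof. by rewrite /vol leb_shift. Qed.

(** The sum with the long segment is the union of translates of the two shorter sums, meeting in a
    translate of [K]. *)
Lemma vol_seg_additive K v a b : ccv K -> 0 <= a -> 0 <= b ->
  vol (msum K (seg (a + b) v)) + vol K = vol (msum K (seg a v)) + vol (msum K (seg b v)).
Proof.
move=> cK a0 b0; have cT t : 0 <= t -> ccv (msum K (seg t v)).
  by move=> t0; apply: ccv_msum => //; exact: ccv_seg.
have shiftP c C x : (+%R c @` C) x <-> C (x - c).
  split => [[y Cy <-]|Cx]; first by rewrite addrAC subrr add0r.
  by exists (x - c) => //; rewrite addrC subrK.
pose D := +%R (- b *: v) @` msum K (seg a v).
pose F := +%R (a *: v) @` msum K (seg b v).
have cD : compact D.
  apply: continuous_compact; last by have [] := cT a a0.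
  by apply: continuous_subspaceT => x; apply: (continuousD (@cst_continuous _ _ _ _)).
have bD : borel D by apply: borel_closed; apply: compact_closed => //; exact: norm_hausdorff.
have DP x : D x <-> exists2 k, K k & exists2 c, - (a + b) <= c <= a - b & x = k + c *: v.
  rewrite /D shiftP; split => [[k Kk [_ [c ca ->] E]]|[k Kk [c /andP[c1 c2] ->]]].
    exists k => //; exists (c - b); last first.
      by rewrite scalerBl addrA -E scaleNr opprK addrK.
    by move: ca; rewrite ler_norml => /andP[? ?]; apply/andP; split; lra.
  exists k => //; exists ((c + b) *: v); last by rewrite scaleNr opprK scalerDl addrA.
  by exists (c + b) => //; rewrite ler_norml; apply/andP; split; lra.
have FP x : F x <-> exists2 k, K k & exists2 c, a - b <= c <= a + b & x = k + c *: v.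
  rewrite /F shiftP; split => [[k Kk [_ [c cb ->] E]]|[k Kk [c /andP[c1 c2] ->]]].
    exists k => //; exists (c + a); last first.
      by rewrite scalerDl addrA -E subrK.
    by move: cb; rewrite ler_norml => /andP[? ?]; apply/andP; split; lra.
  exists k => //; exists ((c - a) *: v); last by rewrite scalerBl addrA.
  by exists (c - a) => //; rewrite ler_norml; apply/andP; split; lra.
pose T := msum K (seg (a + b) v).
have TP x : T x <-> exists2 k, K k & exists2 c, - (a + b) <= c <= a + b & x = k + c *: v.
  split => [[k Kk [_ [c ca ->] ->]]|[k Kk [c ca ->]]].
    by exists k => //; exists c => //; rewrite -ler_norml.
  by exists k => //; exists (c *: v) => //; exists c => //; rewrite ler_norml.
have ab0 : 0 <= a + b by rewrite addr_ge0.
have TD : T `&` D = D.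
  apply/setIidr => x /DP[k Kk [c /andP[c1 c2] ->]]; apply/TP.
  by exists k => //; exists c => //; apply/andP; split; lra.
have TF : T `&` ~` D = F `&` ~` D.
  apply/seteqP; split => x [].
    move=> /TP[k Kk [c /andP[c1 c2] xE]] nD; split => //; apply/FP.
    exists k => //; exists c => //; rewrite c2 andbT leNgt; apply/negP => cab.
    by apply: nD; apply/DP; exists k => //; exists c => //; rewrite c1 ltW.
  move=> /FP[k Kk [c /andP[c1 c2] xE]] nD; split => //; apply/TP.
  by exists k => //; exists c => //; rewrite c2 andbT; lra.
have FD : F `&` D = +%R ((a - b) *: v) @` K.
  apply/seteqP; split => x.
    move=> [/FP[k Kk [c /andP[c1 c2] xE]] /DP[k' Kk' [c' /andP[c1' c2'] xE']]].
    apply/shiftP; have [_ vK _] := cK.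
    have kE : k = x - c *: v by rewrite xE addrK.
    have kE' : k' = x - c' *: v by rewrite xE' addrK.
    have [cc|cc] := eqVneq c c'.
      have cE : a - b = c by apply/eqP; rewrite eq_le c1 cc c2'.
      by rewrite cE xE addrK.
    have cc0 : 0 < c - c' by rewrite subr_gt0 lt_neqAle eq_sym cc (le_trans c2').
    pose s := (a - b - c') / (c - c').
    have -> : x - (a - b) *: v = s *: k + (1 - s) *: k'.
      rewrite kE kE'; apply/rowP => i; rewrite !mxE /s; field; exact: lt0r_neq0.
    apply: vK => //; rewrite divr_ge0 ?(ltW cc0)//; last lra.
    by rewrite ler_pdivrMr// mul1r; lra.
  move=> /shiftP Kx; split; [apply/FP|apply/DP]; exists (x - (a - b) *: v) => //;
    exists (a - b); rewrite ?subrK//; apply/andP; split; lra.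
have bdT : bnd T by apply: ccv_bnd; exact: cT.
have bdF : bnd F.
  by apply: bnd_sub bdT => x /FP[k Kk [c /andP[c1 c2] ->]]; apply/TP; exists k => //; exists c => //; apply/andP; split; lra.
have bdFD : bnd (F `&` ~` D) by apply: bnd_sub bdF => x [].
have bdD : bnd D by rewrite -TD; apply: bnd_sub bdT => x [].
have h1 : vol T = vol D + vol (F `&` ~` D).
  by apply: EFin_inj; rewrite EFinD -!volE// (leb_split T bD) TD TF.
have h2 : vol F = vol K + vol (F `&` ~` D).
  rewrite -[vol K](vol_shift ((a - b) *: v)) -FD.
  by apply: EFin_inj; rewrite EFinD -!volE// ?(leb_split F bD)//; apply: bnd_sub bdF => x [].
have h3 : vol D = vol (msum K (seg a v)) by rewrite vol_shift.
have h4 : vol F = vol (msum K (seg b v)) by rewrite vol_shift.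
by rewrite -h3 -h4 -/T h1 h2; lra.
Qed.

Lemma vol_seg_affine K v a : ccv K -> 0 <= a ->
  vol (msum K (seg a v)) = vol K + a * (vol (msum K (seg 1 v)) - vol K).
Proof.
move=> cK a0; pose g t := vol (msum K (seg t v)) - vol K.
have g0 t : 0 <= t -> 0 <= g t.
  move=> t0; rewrite subr_ge0; apply: vol_le.
    by apply: ccv_bnd; apply: ccv_msum => //; exact: ccv_seg.
  by move=> x Kx; exists x => //; exists 0; rewrite ?addr0//; exists 0; rewrite ?normr0// scale0r.
have gD s t : 0 <= s -> 0 <= t -> g (s + t) = g s + g t.
  by move=> s0 t0; have := vol_seg_additive v cK s0 t0; rewrite /g; lra.
by have := additive_linear g0 gD a0; rewrite /g; lra.
Qed.

End ZonotopeSums.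

Section ZonotopePolynomial.
Variables (R : realType) (n' : nat).
Local Notation n := n'.+1.
Local Notation V := 'rV[R]_n.
Implicit Types (K L C : set V) (v x : V) (a b t : R) (vs : seq V).

Fixpoint zsum vs t K : set V :=
  if vs is v :: vs' then zsum vs' t (msum K (seg t v)) else K.

Lemma ccv_zsum vs t K : 0 <= t -> ccv K -> ccv (zsum vs t K).
Proof.
move=> t0; elim: vs K => //= v vs IH K cK; apply: IH.
by apply: ccv_msum => //; exact: ccv_seg.
Qed.

Lemma zsum_msum vs t K C : zsum vs t (msum K C) = msum (zsum vs t K) C.
Proof.
by elim: vs K => //= v vs IH K; rewrite msumA (msumC C) -msumA IH.
Qed.

Lemma supp_zsum vs t K x : 0 <= t -> ccv K ->
  supp_fun (zsum vs t K) x = supp_fun K x + t * \sum_(v <- vs) `|dotp v x|.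
Proof.
move=> t0; elim: vs K => [|v vs IH] K cK /=; first by rewrite big_nil mulr0 addr0.
rewrite IH; last by apply: ccv_msum => //; exact: ccv_seg.
by rewrite supp_msum ?supp_seg ?big_cons//; [ring|exact: ccv_seg].
Qed.

Lemma vol_eball_le r : 0 <= r -> vol (@eball R n r) <= (2 * r) ^+ n.
Proof.
move=> r0; rewrite -lee_fin -volE; last exact: bnd_eball.
apply: (le_trans (le_leb_outer (@eball_box R n r))).
rewrite leb_box; last by move=> i; rewrite !mxE; lra.
rewrite lee_fin /boxvol; under eq_bigr do rewrite !mxE.
by rewrite big_const_ord iter_mulr_1 le_eqVlt; apply/orP; left; apply/eqP; congr (_ ^+ _); ring.
Qed.

Lemma zsum_bound vs K r t : 0 <= t -> (forall x, K x -> enorm x <= r) ->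
  forall x, zsum vs t K x -> enorm x <= r + t * \sum_(v <- vs) enorm v.
Proof.
move=> t0; elim: vs K r => [|v vs IH] K r Kr x /=.
  by rewrite big_nil mulr0 addr0; exact: Kr.
rewrite big_cons mulrDr addrA; apply: IH => _ [y Ky [_ [b bt ->] ->]].
apply: (le_trans (enormD _ _)); apply: lerD; first exact: Kr.
by rewrite enormZ ler_wpM2r// enorm_ge0.
Qed.

(** The coefficients are, up to binomial factors, mixed volumes of [K] with the zonotope. Adding a
    segment changes each old coefficient affinely, with slope [d m K], and the new coefficients are
    sums of old coefficients and slopes. Monotonicity of the slope follows from that of the
    coefficient by letting the segment grow. *)
Lemma zsum_polynomial vs : exists q : nat -> set V -> R,
  [/\ forall K t, ccv K -> 0 <= t -> vol (zsum vs t K) = \sum_(m < n.+1) t ^+ m * q m K,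
      forall m K, ccv K -> 0 <= q m K &
      forall m K L, ccv K -> ccv L -> K `<=` L -> q m K <= q m L].
Proof.
elim: vs => [|v vs [q [qE q0 qm]]].
  exists (fun m K => if m is 0%N then vol K else 0); split => [K t cK t0|[|m] K cK|[|m] K L cK cL KL] //=.
  - by rewrite big_ord_recl expr0 mul1r big1 ?addr0// => i _; rewrite mulr0.
  - exact: vol_ge0.
  - by apply: vol_le => //; exact: ccv_bnd.
have cs K a : ccv K -> 0 <= a -> ccv (msum K (seg a v)).
  by move=> cK a0; apply: ccv_msum => //; exact: ccv_seg.
pose d m K := q m (msum K (seg 1 v)) - q m K.
have qL (m : 'I_n.+1) K : ccv K -> q m K = \sum_k lagrange R n m k * vol (zsum vs k.+1%:R K).
  move=> cK; rewrite -(lagrange_coef (fun i : 'I_n.+1 => q i K) m).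
  by apply: eq_bigr => k _; rewrite qE.
have aff (m : 'I_n.+1) K a : ccv K -> 0 <= a -> q m (msum K (seg a v)) = q m K + a * d m K.
  move=> cK a0; rewrite /d !qL//; last 2 first.
    by apply: cs.
    by apply: cs.
  rewrite -sumrB mulr_sumr -big_split /=; apply: eq_bigr => k _.
  rewrite !zsum_msum vol_seg_affine//; [ring|exact: ccv_zsum].
have subs K : K `<=` msum K (seg 1 v).
  by move=> x Kx; exists x => //; exists 0; rewrite ?addr0//; exists 0; rewrite ?normr0// scale0r.
have d0 m K : ccv K -> 0 <= d m K.
  by move=> cK; rewrite subr_ge0; apply: qm => //; apply: cs.
have dm (m : 'I_n.+1) K L : ccv K -> ccv L -> K `<=` L -> d m K <= d m L.
  move=> cK cL KL; rewrite leNgt; apply/negP => dlt.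
  have e0 : 0 < d m K - d m L by rewrite subr_gt0.
  (* A segment so long that a violation of the slopes would overturn the order of the coefficients
     by 1. *)
  pose a := (q m L - q m K + 1) / (d m K - d m L).
  have a0 : 0 <= a.
    by rewrite divr_ge0 ?(ltW e0)// addr_ge0// subr_ge0; apply: qm.
  have : q m (msum K (seg a v)) <= q m (msum L (seg a v)).
    apply: qm; [exact: cs|exact: cs|].
    by move=> _ [x Kx [y sy ->]]; exists x; [exact: KL|exists y].
  rewrite !aff//; have : a * (d m K - d m L) = q m L - q m K + 1 by rewrite divfK// gt_eqF.
  rewrite mulrBr; lra.
pose q' m K := q m K + (if m is i.+1 then d i K else 0).
have E K t : ccv K -> 0 <= t -> vol (zsum (v :: vs) t K) =
    \sum_(m < n.+1) t ^+ m * q' m K + t ^+ n.+1 * d n K.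
  move=> cK t0; rewrite /= qE//; last exact: cs.
  have -> : \sum_(m < n.+1) t ^+ m * q m (msum K (seg t v)) =
      \sum_(m < n.+1) t ^+ m * q m K + \sum_(m < n.+1) t ^+ m.+1 * d m K.
    by rewrite -big_split /=; apply: eq_bigr => m _; rewrite aff// exprSr; ring.
  have -> : \sum_(m < n.+1) t ^+ m * q' m K =
      \sum_(m < n.+1) t ^+ m * q m K + \sum_(m < n) t ^+ m.+1 * d m K.
    under eq_bigr do rewrite mulrDr; rewrite big_split /=; congr (_ + _).
    by rewrite big_ord_recl /= mulr0 add0r.
  by rewrite -addrA; congr (_ + _); rewrite big_ord_recr.
have q'0 m K : ccv K -> 0 <= q' m K.
  by move=> cK; apply: addr_ge0; [exact: q0|case: m => // m; exact: d0].
(* Degree [n + 1] cannot occur, since the volume grows at most like [t^n]. *)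
have dn0 K : ccv K -> d n K = 0.
  move=> cK; apply/eqP; rewrite eq_le d0// andbT.
  have [r r0 Kr] := ccv_bounded cK.
  pose s := r + \sum_(v <- v :: vs) enorm v.
  have s0 : 0 < s by rewrite ltr_wpDr// sumr_ge0// => i _; exact: enorm_ge0.
  have B t : 1 <= t -> t * d n K <= (2 * s) ^+ n.
    move=> t1; have t0 : 0 < t by exact: lt_le_trans t1.
    have h1 : t ^+ n.+1 * d n K <= vol (zsum (v :: vs) t K).
      by rewrite E ?(ltW t0)// lerDr sumr_ge0// => m _; rewrite mulr_ge0 ?exprn_ge0 ?(ltW t0)// q'0.
    have h2 : vol (zsum (v :: vs) t K) <= (2 * (t * s)) ^+ n.
      apply: le_trans (vol_eball_le (mulr_ge0 (ltW t0) (ltW s0))).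
      apply: vol_le; first exact: bnd_eball.
      move=> x /(zsum_bound (ltW t0) Kr) h; apply: (le_trans h).
      by rewrite /s mulrDr lerD2r ler_peMl// ltW.
    have := le_trans h1 h2; rewrite mulrCA exprMn exprSr -mulrA ler_pM2l ?exprn_gt0//.
  rewrite leNgt; apply/negP => dp.
  have S0 : 0 <= (2 * s) ^+ n by rewrite exprn_ge0// mulr_ge0// ltW.
  have := B (1 + (2 * s) ^+ n / d n K); move: ((2 * s) ^+ n) S0 => S S0.
  have -> : (1 + S / d n K) * d n K = d n K + S by rewrite mulrDl divfK ?gt_eqF// mul1r.
  by rewrite lerDl divr_ge0 ?(ltW dp)// gerDr leNgt dp => /(_ isT).
exists (fun m K => if (m <= n)%N then q' m K else 0); split => [K t cK t0|m K cK|m K L cK cL KL].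
- rewrite E// dn0// mulr0 addr0; apply: eq_bigr => m _.
  by rewrite -ltnS ltn_ord.
- by case: ifP => // _; exact: q'0.
- case: ifP => // mn; apply: lerD; first exact: qm.
  case: m mn => // m mn; have mn' : (m < n.+1)%N by rewrite ltnW.
  exact: (dm (Ordinal mn')).
Qed.

End ZonotopePolynomial.

Section BallZonotope.
Variables (R : realType) (n' : nat).
Local Notation n := n'.+1.
Local Notation V := 'rV[R]_n.
Implicit Types (K L C : set V) (u v x : V) (d e : R) (vs : seq V).

Lemma borel_code (I : finType) (F : I -> V -> bool) (t : {set I}) :
  (forall i, borel [set x | F i x]) -> borel [set x | [set i | F i x]%SET = t].
Proof.
move=> bF; have -> : [set x | [set i | F i x]%SET = t] =
    \bigcap_(i in setT) [set x | F i x = (i \in t)].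
  apply/seteqP; split => x /=; first by move=> <- i _; rewrite /= inE.
  by move=> H; apply/setP => i; rewrite inE; exact: H.
apply: (@fin_bigcap_measurable _ (borel_space R n')) => // i _.
change (borel [set x | F i x = (i \in t)]); case: (i \in t); first exact: bF.
rewrite (_ : [set x | _] = ~` [set x | F i x]); first by apply: borelC; exact: bF.
by apply/seteqP; split => x /=; case: (F i x).
Qed.

Lemma ball_net d : 0 < d -> exists (N : nat) (p : 'I_N -> V),
  forall x, enorm x <= 1 -> exists i, enorm (x - p i) <= d.
Proof.
move=> d0; have := @compact_eball R n 1; rewrite compact_cover.
move=> /(_ V (@eball R n 1) (fun x => [set y | enorm (y - x) < d])).
case=> [x Kx|x Kx|D DK Dcov].
- apply/open_enormP => y /= yx; exists (d - enorm (y - x)); first by rewrite subr_gt0.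
  by move=> z zy; rewrite (le_lt_trans (enorm_dist _ y _))// -ltrBrDr.
- by exists x => //=; rewrite subrr enorm0.
pose s := finmap.enum_fset D; exists (size s), (fun i => nth 0 s i).
move=> x /Dcov[y yD yx]; have ys : (index y s < size s)%N by rewrite index_mem.
by exists (Ordinal ys) => /=; rewrite nth_index//; exact: ltW.
Qed.

Lemma norm_dotp_close u v v' e : enorm u = 1 -> enorm (v - v') <= e ->
  `| `|dotp v u| - `|dotp v' u| | <= e.
Proof.
move=> u1 vv; apply: (le_trans (ler_dist_dist _ _)); rewrite -dotpBl.
by apply: (le_trans (CauchySchwarz _ _)); rewrite u1 mulr1.
Qed.

Lemma ball_fine_partition d : 0 < d -> exists (T : finType) (a : V -> T) (w : T -> V),
  (forall t, borel [set x | a x = t]) /\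
  (forall x, enorm x <= 1 -> enorm (x - w (a x)) <= d).
Proof.
move=> d0; have d20 : 0 < d / 2 by rewrite divr_gt0.
have [N [p pN]] := ball_net d20.
pose a x := [set i : 'I_N | enorm (x - p i) <= d / 2]%SET.
pose w (t : {set 'I_N}) := if [pick i in t] is Some i then p i else 0.
exists {set 'I_N}, a, w; split => [t|x x1].
  apply: borel_code => i; rewrite (_ : [set x | _] = +%R (- p i) @^-1` @eball R n (d / 2)).
    apply: borel_preimage; last exact: borel_eball.
    by move=> x; apply: (continuousD (@cst_continuous _ _ _ _)).
  by apply/seteqP; split => x; rewrite /preimage /eball /= addrC.
have [i xi] := pN x x1; rewrite /w; case: pickP => [k|/(_ i)]; rewrite inE.
  by move=> /le_trans; apply; lra.
by rewrite xi.
Qed.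

Lemma mem_orthogonal_image (Q : 'M[R]_n) C x : Q *m Q^T = 1%:M ->
  (mulmxr Q @` C) x <-> C (x *m Q^T).
Proof.
move=> oQ; have QQ : Q^T *m Q = 1%:M by exact: mulmx1C.
split => [[y Cy <-]|Cx]; first by rewrite /= -mulmxA oQ mulmx1.
by exists (x *m Q^T) => //=; rewrite -mulmxA QQ mulmx1.
Qed.

Lemma vol_orthogonal (Q : 'M[R]_n) C : Q *m Q^T = 1%:M -> vol (mulmxr Q @` C) = vol C.
Proof.
move=> oQ; rewrite /vol leb_mulmx; last by have [] := mulmx1_unit oQ.
have : `|\det Q| ^+ 2 = 1.
  by rewrite expr2 -{2}det_tr -normrM -det_mulmx oQ det1 normr1.
by move/eqP; rewrite sqrf_eq1 => /orP[/eqP->|/eqP h]; [rewrite mul1e|have := normr_ge0 (\det Q); rewrite h oppr_ge0 ler10].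
Qed.

Lemma vol_partition (T : finType) (a : V -> T) C : bnd C ->
  (forall t, borel [set x | a x = t]) -> vol C = \sum_t vol (C `&` [set x | a x = t]).
Proof.
move=> bC ba; apply: EFin_inj; rewrite -volE// (leb_partition C ba) -sumEFin.
by apply: eq_bigr => t _; rewrite volE//; apply: bnd_sub bC => x [].
Qed.

(** A Riemann sum for the integral of [|<x, u>|] over the unit ball, which depends on [u] only
    through its length. *)
Definition hmass (T : finType) (a : V -> T) (w : T -> V) u : R :=
  \sum_t vol (@eball R n 1 `&` [set x | a x = t]) * `|dotp (w t) u|.

(* Both sums are refined over the common refinement of the partition and of its image under the
   orthogonal map carrying [u] to [u']. *)
Lemma hmass_rotation (T : finType) (a : V -> T) (w : T -> V) d u u' :
  (forall t, borel [set x | a x = t]) ->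
  (forall x, enorm x <= 1 -> enorm (x - w (a x)) <= d) ->
  enorm u = 1 -> enorm u' = 1 ->
  `|hmass a w u - hmass a w u'| <= 2 * d * vol (@eball R n 1).
Proof.
move=> ba wd u1 u1'; have uu : enorm u = enorm u' by rewrite u1.
have [Q [oQ uQ _]] := householder uu.
have QQ : Q^T *m Q = 1%:M by exact: mulmx1C.
pose B := @eball R n 1; pose A t := [set x | a x = t]; pose A' t := [set x : V | a (x *m Q^T) = t].
have oQT : Q^T *m (Q^T)^T = 1%:M by rewrite trmxK.
have bB : bnd B by exact: bnd_eball.
have bI C : bnd (B `&` C) by apply: bnd_sub bB => x [].
have ba' t : borel (A' t).
  by apply: (@borel_preimage R n' (mulmxr Q^T) (A t)); [exact: (@linear_continuous_rV R n n Q^T)|exact: ba].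
have imB C : mulmxr Q @` (B `&` C) = B `&` [set x | C (x *m Q^T)].
  apply/seteqP; split => x.
    by move=> /(mem_orthogonal_image _ _ oQ)[xB xC]; split => //; move: xB; rewrite /B /eball /= enorm_orthogonal.
  by move=> [xB xC]; apply/(mem_orthogonal_image _ _ oQ); split => //; rewrite /B /eball /= enorm_orthogonal.
pose l t s := vol (B `&` A' t `&` A s).
have lt_ t : vol (B `&` A t) = \sum_s l t s.
  by rewrite -(vol_orthogonal _ oQ) imB (vol_partition (bI _) ba).
have ls s : vol (B `&` A s) = \sum_t l t s.
  rewrite (vol_partition (bI _) ba'); apply: eq_bigr => t _; rewrite /l.
  by congr vol; rewrite setIAC.
have lB : vol B = \sum_t \sum_s l t s.
  by rewrite (vol_partition bB ba); apply: eq_bigr => t _; exact: lt_.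
rewrite /hmass -/B.
have -> : \sum_t vol (B `&` A t) * `|dotp (w t) u| = \sum_t \sum_s l t s * `|dotp (w t *m Q) u'|.
  by apply: eq_bigr => t _; rewrite lt_ mulr_suml -uQ dotp_orthogonal.
have -> : \sum_t vol (B `&` A t) * `|dotp (w t) u'| = \sum_t \sum_s l t s * `|dotp (w s) u'|.
  by rewrite exchange_big; apply: eq_bigr => t _; rewrite ls mulr_suml.
rewrite -sumrB lB mulr_sumr; apply: (le_trans (ler_norm_sum _ _ _)).
apply: ler_sum => t _; rewrite -sumrB mulr_sumr; apply: (le_trans (ler_norm_sum _ _ _)).
apply: ler_sum => s _; rewrite -mulrBr normrM ger0_norm ?vol_ge0// mulrC.
have [[x [[xB xt] xs]]|/set0P/negP/negPn/eqP E] := pselect (B `&` A' t `&` A s !=set0); last first.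
  by rewrite /l E /vol outer_measure0 /= !mulr0.
rewrite ler_wpM2r ?vol_ge0//; apply: norm_dotp_close => //.
have h1 := wd _ xB; rewrite xs in h1.
have xB' : enorm (x *m Q^T) <= 1 by rewrite enorm_orthogonal.
have h2 := wd _ xB'; rewrite xt in h2.
have h3 : enorm (x - w t *m Q) <= d.
  by rewrite -[x in leLHS]mulmx1 -QQ mulmxA -mulmxBl enorm_orthogonal.
apply: (le_trans (enorm_dist _ x _)); rewrite enormBC; lra.
Qed.

Lemma hmass_lower (T : finType) (a : V -> T) (w : T -> V) d u :
  (forall t, borel [set x | a x = t]) ->
  (forall x, enorm x <= 1 -> enorm (x - w (a x)) <= d) ->
  u = delta_mx ord0 ord0 -> d <= (4 * n%:R)^-1 ->
  (2 * n%:R)^-1 ^+ n * (4 * n%:R)^-1 <= hmass a w u.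
Proof.
move=> ba wd uE dn; set N : R := n%:R in dn *.
have N0 : 0 < N by rewrite ltr0n.
(* On this box in the ball the first coordinate is at least [1 / (2 n)], and the mesh
   [d <= 1 / (4 n)] takes away at most half of it. *)
pose D : set V := box (const_mx (2 * N)^-1) (const_mx N^-1).
have DB : D `<=` @eball R n 1.
  move=> x xD; rewrite /eball /=; apply: (@le_trans _ _ (N * N^-1)); last by rewrite divff// gt_eqF.
  apply: enorm_le_coord; first by rewrite invr_ge0 ltW.
  move=> i; have := xD i; rewrite !mxE => /andP[x1 x2]; rewrite ger0_norm//.
  by apply: le_trans x1; rewrite invr_ge0 mulr_ge0// ltW.
have bD : bnd D by exists 1.
have N2 : (2 * N)^-1 = N^-1 - (2 * N)^-1 by field; exact: lt0r_neq0.
have volD : vol D = (2 * N)^-1 ^+ n.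
  apply: EFin_inj; rewrite -volE// leb_box.
    congr (_%:E); rewrite /boxvol; under eq_bigr do rewrite !mxE -N2.
    by rewrite big_const_ord iter_mulr_1.
  by move=> i; rewrite !mxE -subr_ge0 -N2 invr_ge0 mulr_ge0// ltW.
rewrite -volD (vol_partition bD ba) mulr_suml /hmass; apply: ler_sum => t _.
have [[x [xD xt]]|/set0P/negP/negPn/eqP E] := pselect (D `&` [set x | a x = t] !=set0); last first.
  by rewrite E /vol outer_measure0 /= mul0r mulr_ge0// vol_ge0.
apply: ler_pM; rewrite ?vol_ge0//.
- by rewrite invr_ge0 mulr_ge0// ltW.
- apply: vol_le; last by move=> y [/DB].
  by exists 1 => y [].
have dx y : dotp y u = y ord0 ord0.
  by rewrite uE dotpE trmx_delta -colE mxE.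
rewrite dx; apply: le_trans (ler_norm _).
have := wd x (DB x xD); rewrite xt => h.
have := le_trans (ler_coord_enorm (x - w t) ord0) h; rewrite !mxE ler_norml => /andP[_ h2].
have := xD ord0; rewrite !mxE => /andP[h3 _].
have h4 : (2 * N)^-1 = 2 * (4 * N)^-1 by field; exact: lt0r_neq0.
move: dn h2 h3; rewrite h4; move: ((4 * N)^-1) => c; lra.
Qed.

(** The sum [hmass] is the support function of a zonotope and nearly rotation invariant. It is
    normalised by its value at one unit vector; the explicit lower bound [m0] on that value turns
    the rotation error into a relative one. *)
Lemma ball_zonotope e : 0 < e -> exists vs, forall u,
  (1 - e) * enorm u <= \sum_(v <- vs) `|dotp v u| <= (1 + e) * enorm u.
Proof.
move=> e0; set N : R := n%:R; have N0 : 0 < N by rewrite ltr0n.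
pose m0 := (2 * N)^-1 ^+ n * (4 * N)^-1.
have m00 : 0 < m0 by rewrite mulr_gt0 ?exprn_gt0 ?invr_gt0 ?mulr_gt0.
pose vB := vol (@eball R n 1); have vB0 : 0 <= vB by exact: vol_ge0.
pose d := Num.min (4 * N)^-1 (e * m0 / (2 * vB + 1)).
have v1 : 0 < 2 * vB + 1 by rewrite ltr_wpDl// mulr_ge0.
have d0 : 0 < d.
  rewrite lt_min invr_gt0 mulr_gt0//=; apply: divr_gt0 => //; exact: mulr_gt0.
have d1 : d <= (4 * N)^-1 by rewrite ge_min lexx.
have d2 : 2 * d * vB <= e * m0.
  apply: (@le_trans _ _ (d * (2 * vB + 1))).
    by rewrite mulrDr mulr1 mulrCA mulrA lerDl ltW.
  by rewrite -ler_pdivlMr// ge_min lexx orbT.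
have [T [a [w [ba wd]]]] := ball_fine_partition d0.
pose e1 : V := delta_mx ord0 ord0.
have e11 : enorm e1 = 1.
  apply/eqP; rewrite -sqrp_eq1 ?enorm_ge0// sqr_enorm dotpE trmx_delta.
  by rewrite mul_delta_mx mxE !eqxx.
pose m := hmass a w e1.
have mm0 : m0 <= m by exact: hmass_lower wd erefl d1.
have m_gt0 : 0 < m by exact: lt_le_trans mm0.
exists [seq (vol (@eball R n 1 `&` [set x | a x = t]) / m) *: w t | t <- index_enum T].
move=> u; rewrite big_map.
have -> : \sum_(t <- index_enum T) `|dotp ((vol (@eball R n 1 `&` [set x | a x = t]) / m) *: w t) u| =
    hmass a w u / m.
  rewrite /hmass mulr_suml; apply: eq_bigr => t _.
  rewrite dotpZl normrM ger0_norm ?divr_ge0 ?vol_ge0 ?(ltW m_gt0)//; ring.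
have [->|u0] := eqVneq u 0.
  rewrite enorm0 !mulr0 /hmass big1 ?mul0r ?lexx// => t _.
  by rewrite dotp0r normr0 mulr0.
have eu0 : 0 < enorm u by rewrite enorm_gt0.
pose u' := (enorm u)^-1 *: u.
have u'1 : enorm u' = 1 by rewrite enormZ gtr0_norm ?invr_gt0// mulVf// gt_eqF.
have hE : hmass a w u = enorm u * hmass a w u'.
  rewrite /hmass mulr_sumr; apply: eq_bigr => t _.
  rewrite dotpZr normrM gtr0_norm ?invr_gt0// mulrCA; congr (_ * _).
  by rewrite mulrA divff ?mul1r// gt_eqF.
have := hmass_rotation ba wd u'1 e11; rewrite -/m => /le_trans/(_ d2).
rewrite ler_norml hE => /andP[h1 h2].
have em : e * m0 <= e * m by rewrite ler_pM2l.
by rewrite ler_pdivlMr// ler_pdivrMr// -!mulrA ![_ * (enorm u * _)]mulrCA !ler_pM2l// !(mulrDl, mulrBl); lra.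
Qed.

End BallZonotope.

Section SigMonotone.
Variables (R : realType) (n' : nat).
Local Notation n := n'.+1.
Local Notation V := 'rV[R]_n.
Implicit Types (K L C : set V) (u v x : V) (t e : R) (vs : seq V) (m : 'I_n.+1).

Lemma scaleS_eball t r : 0 < t -> scaleS t (@eball R n r) = eball (t * r).
Proof.
move=> t0; apply/seteqP; split => [_ [x xr <-]|x xr].
  by rewrite /eball /= enormZ gtr0_norm// ler_pM2l.
exists (t^-1 *: x); last by rewrite scalerA divff ?scale1r// gt_eqF.
by rewrite /eball /= enormZ gtr0_norm ?invr_gt0// ler_pdivrMl.
Qed.

(** Up to a constant factor, the m-th intrinsic volume of [K]. *)
Definition Tm K m : R := Sig K m (@eball R n 1).

Lemma Tm_ge0 K m : ccv K -> 0 <= Tm K m.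
Proof. by move=> cK; apply: Sig_ge0 => //; [exact: borel_eball|exact: bnd_eball]. Qed.

Lemma vol_scale_msum_eball K s t : ccv K -> 0 < s -> 0 < t ->
  vol (msum (scaleS s K) (@eball R n t)) = \sum_(m < n.+1) s ^+ m * t ^+ (n - m) * Tm K m.
Proof.
move=> cK s0 t0; rewrite msum_eball; last exact: ccv_scale.
transitivity (mu K s (@eball R n t)); first by [].
rewrite steiner_formula//; [|exact: borel_eball|exact: bnd_eball].
apply: eq_bigr => m _; rewrite -mulrA; congr (_ * _).
rewrite -[t in LHS]mulr1 -scaleS_eball// Sig_scale//; [exact: borel_eball|exact: bnd_eball].
Qed.

Lemma vol_msum_eball K t : ccv K -> 0 < t ->
  vol (msum K (@eball R n t)) = \sum_(i < n.+1) t ^+ i * Tm K (rev_ord i).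
Proof.
move=> cK t0; rewrite -[K in LHS]scaleS1 vol_scale_msum_eball//.
rewrite (reindex_inj rev_ord_inj) /=; apply: eq_bigr => i _.
by rewrite expr1n mul1r subSS subKn// -ltnS.
Qed.

Lemma expr_gap (d : nat) e : 0 <= e <= 1 -> (1 + e) ^+ d - (1 - e) ^+ d <= d%:R * 2 ^+ d * e.
Proof.
move=> /andP[e0 e1]; elim: d => [|d IH]; first by rewrite !expr0 subrr !mul0r.
have f1 : 0 <= 1 - e by rewrite subr_ge0.
have h1 : (1 - e) ^+ d <= 1 by apply: exprn_ile1 => //; lra.
have h2 : 0 <= (1 - e) ^+ d by rewrite exprn_ge0.
have h3 : (1 - e) ^+ d <= (1 + e) ^+ d.
  by apply: lerXn2r; rewrite ?nnegrE//; lra.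
rewrite ![_ ^+ d.+1]exprS.
have -> : (1 + e) * (1 + e) ^+ d - (1 - e) * (1 - e) ^+ d =
    (1 + e) * ((1 + e) ^+ d - (1 - e) ^+ d) + 2 * e * (1 - e) ^+ d by ring.
have h4 : (1 + e) * ((1 + e) ^+ d - (1 - e) ^+ d) <= 2 * ((1 + e) ^+ d - (1 - e) ^+ d).
  by rewrite ler_wpM2r ?subr_ge0//; lra.
have h6 : 1 <= 2 ^+ d :> R by rewrite exprn_ege1// ler1n.
have h5 : 2 * e * (1 - e) ^+ d <= 2 * e * 2 ^+ d.
  by rewrite ler_wpM2l ?mulr_ge0//; exact: le_trans h6.
rewrite -[d.+1%:R]natr1; apply: (le_trans (lerD h4 h5)); move: IH; move: (2 ^+ d) (d%:R) => p q IH.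
have -> : (q + 1) * (2 * p) * e = 2 * (q * p * e) + 2 * e * p by ring.
by rewrite lerD2r ler_pM2l.
Qed.

(** Coefficients for sums with a zonotope are monotone in [K]. Replacing the ball by a zonotope
    between the balls of radii [1 - e] and [1 + e] changes all interpolated volumes by [O(e)], hence
    also the coefficients. *)
Lemma Tm_mono K L m : ccv K -> ccv L -> K `<=` L -> Tm K m <= Tm L m.
Proof.
move=> cK cL KL.
pose W K t := vol (msum K (@eball R n t)).
pose A K := \sum_(k < n.+1) `|lagrange R n (rev_ord m) k| * (n%:R * 2 ^+ n * W K k.+1%:R).
have A0 C : 0 <= A C.
  by apply: sumr_ge0 => k _; rewrite !mulr_ge0 ?exprn_ge0 ?vol_ge0.
have gap C t e : ccv C -> 0 < t -> 0 <= e < 1 ->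
    W C ((1 + e) * t) - W C ((1 - e) * t) <= n%:R * 2 ^+ n * e * W C t.
  move=> cC t0 /andP[e0 e1].
  rewrite /W !vol_msum_eball// ?mulr_gt0//; [|lra|lra].
  rewrite -sumrB mulr_sumr; apply: ler_sum => i _.
  have h0 : 0 <= t ^+ i * Tm C (rev_ord i).
    by rewrite mulr_ge0 ?Tm_ge0// exprn_ge0// ltW.
  have -> : ((1 + e) * t) ^+ i * Tm C (rev_ord i) - ((1 - e) * t) ^+ i * Tm C (rev_ord i) =
      ((1 + e) ^+ i - (1 - e) ^+ i) * (t ^+ i * Tm C (rev_ord i)) by rewrite !exprMn; ring.
  apply: ler_wpM2r => //.
  have e01 : 0 <= e <= 1 by rewrite e0 ltW.
  apply: (le_trans (expr_gap i e01)); rewrite ler_wpM2r//.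
  have i_n : (i <= n)%N by rewrite -ltnS.
  by apply: ler_pM; rewrite ?exprn_ge0// ?ler_nat// ler_weXn2l ?ler1n.
have TmE C : ccv C -> Tm C m = \sum_(k < n.+1) lagrange R n (rev_ord m) k * W C k.+1%:R.
  move=> cC; rewrite -{1}[m]rev_ordK -(lagrange_coef (fun i => Tm C (rev_ord i))).
  by apply: eq_bigr => k _; rewrite /W vol_msum_eball.
have close e : 0 < e < 1 -> exists q : set V -> R,
    (forall C, ccv C -> `|q C - Tm C m| <= e * A C) /\ q K <= q L.
  move=> /andP[e0 e1]; have [vs vsP] := ball_zonotope n' e0.
  have [q [qE q0 qm]] := zsum_polynomial vs.
  exists (q (rev_ord m)); split; last exact: qm.
  move=> C cC.
  have qL : q (rev_ord m) C = \sum_k lagrange R n (rev_ord m) k * vol (zsum vs k.+1%:R C).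
    rewrite -(lagrange_coef (fun i : 'I_n.+1 => q i C) (rev_ord m)).
    by apply: eq_bigr => k _; rewrite qE.
  rewrite qL TmE// -sumrB /A mulr_sumr; apply: (le_trans (ler_norm_sum _ _ _)).
  apply: ler_sum => k _; rewrite -mulrBr normrM mulrCA ler_wpM2l//.
  have t0 : 0 < k.+1%:R :> R by [].
  move: (k.+1%:R) t0 => t t0.
  have e01 : 0 <= e < 1 by rewrite ltW.
  have cz : ccv (zsum vs t C) by apply: ccv_zsum => //; exact: ltW.
  have cb s : 0 <= s -> ccv (msum C (@eball R n s)) by move=> s0; apply: ccv_msum => //; exact: ccv_eball.
  have f1 : 0 <= (1 - e) * t by rewrite mulr_ge0 ?(ltW t0)//; lra.
  have f2 : 0 <= (1 + e) * t by rewrite mulr_ge0 ?(ltW t0)//; lra.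
  have suppb s x : 0 <= s -> supp_fun (msum C (@eball R n s)) x = supp_fun C x + s * enorm x.
    by move=> s0; rewrite supp_msum ?supp_eball//; exact: ccv_eball.
  have sub X Y : ccv X -> ccv Y -> (forall x, supp_fun X x <= supp_fun Y x) -> vol X <= vol Y.
    move=> cX cY h; apply: vol_le; first exact: ccv_bnd.
    by move=> x Xx; apply: (ccvP_supp cY) => z; apply: le_trans (h z); exact: supp_fun_ge.
  have l1 : W C ((1 - e) * t) <= vol (zsum vs t C).
    apply: sub => // [|x]; first exact: cb.
    rewrite suppb// supp_zsum ?(ltW t0)// lerD2l mulrAC mulrC ler_pM2l//.
    by have /andP[] := vsP x.
  have l2 : vol (zsum vs t C) <= W C ((1 + e) * t).
    apply: sub => // [|x]; first exact: cb.
    rewrite suppb// supp_zsum ?(ltW t0)// lerD2l [leRHS]mulrAC [leRHS]mulrC ler_pM2l//.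
    by have /andP[] := vsP x.
  have l3 : W C ((1 - e) * t) <= W C t.
    apply: sub => // [||x]; [exact: cb|by apply: cb; exact: ltW|].
    rewrite !suppb ?(ltW t0)// lerD2l ler_wpM2r ?enorm_ge0// ler_piMl ?(ltW t0)//; lra.
  have l4 : W C t <= W C ((1 + e) * t).
    apply: sub => // [||x]; [by apply: cb; exact: ltW|exact: cb|].
    rewrite !suppb ?(ltW t0)// lerD2l ler_wpM2r ?enorm_ge0// ler_peMl ?(ltW t0)//; lra.
  have := gap C t e cC t0 e01; rewrite -/(W C t) => g.
  rewrite mulrCA mulrA in g *.
  by rewrite ler_norml; apply/andP; split; lra.
apply/ler_addgt0Pr => d d0.
pose e := Num.min (1 / 2) (d / (A K + A L + 1)).
have AA : 0 < A K + A L + 1 by rewrite ltr_wpDl// addr_ge0.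
have e0 : 0 < e by rewrite lt_min divr_gt0//= divr_gt0.
have e1 : e < 1 by rewrite gt_min; apply/orP; left; lra.
have ed : e * (A K + A L) <= d.
  apply: (@le_trans _ _ (e * (A K + A L + 1))); first by rewrite ler_pM2l// lerDl.
  by rewrite -ler_pdivlMr// ge_min lexx orbT.
have [|q [qP qKL]] := close e; first by rewrite e0.
move: ed (qP K cK) (qP L cL) qKL; move: (q K) (q L) (Tm K m) (Tm L m) (A K) (A L) => qK qL tK tL aK aL.
by clear; rewrite !ler_norml mulrDr => ? /andP[? _] /andP[_ ?] ?; lra.
Qed.

End SigMonotone.

(** * Greedy frames *)

Section GreedyFrame.
Variables (R : realType) (n : nat).
Local Notation V := 'rV[R]_n.
Implicit Types (K : set V) (x y z : V) (Q : 'M[R]_n) (b : 'I_n -> R).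

Lemma dotp_row Q y i : dotp y (row i Q) = (y *m Q^T) ord0 i.
Proof. by rewrite mxE; apply: eq_bigr => k _; rewrite !mxE. Qed.

Lemma parseval Q y : Q *m Q^T = 1%:M -> dotp y y = \sum_i dotp y (row i Q) ^+ 2.
Proof.
move=> oQ; have oQT : Q^T *m (Q^T)^T = 1%:M by rewrite trmxK; exact: mulmx1C.
rewrite -(dotp_orthogonal y y oQT); apply: eq_bigr => i _.
by rewrite dotp_row expr2.
Qed.

(** For orthogonal [Q], the squared distance of [y] to the span of the first [k] rows. *)
Definition residue Q (k : nat) y : R := \sum_(i < n | (k <= i)%N) dotp y (row i Q) ^+ 2.

Lemma residueE Q k y : Q *m Q^T = 1%:M ->
  residue Q k y = dotp y y - \sum_(i < n | (i < k)%N) dotp y (row i Q) ^+ 2.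
Proof.
move=> oQ; rewrite (parseval y oQ) (bigID (fun i : 'I_n => (i < k)%N)) /= [X in X - _]addrC addrK.
by apply: eq_bigl => i; rewrite -leqNgt.
Qed.

Lemma residue_rows Q Q' k y : Q *m Q^T = 1%:M -> Q' *m Q'^T = 1%:M ->
  (forall i : 'I_n, (i < k)%N -> row i Q' = row i Q) -> residue Q' k y = residue Q k y.
Proof.
move=> oQ oQ' h; rewrite !residueE//; congr (_ - _).
by apply: eq_bigr => i ik; rewrite h.
Qed.

(** Take a point of [K] farthest from the span of the first [k] rows and reflect so that row [k]
    points along its residual. The residual has no coordinates below [k], so the earlier rows stay
    fixed. *)
Lemma greedy_step K Q (k : 'I_n) : ccv K -> Q *m Q^T = 1%:M ->
  exists Q' (b : R) x, [/\ Q' *m Q'^T = 1%:M, forall i : 'I_n, (i < k)%N -> row i Q' = row i Q,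
    K x /\ dotp x (row k Q') = b, 0 <= b & forall y, K y -> residue Q' k y <= b ^+ 2].
Proof.
move=> cK oQ; have [cptK _ K0] := cK.
pose M := Q^T *m diag_mx (\row_(i < n) ((k <= i)%N)%:R).
have yM y i : (y *m M) ord0 i = if (k <= i)%N then dotp y (row i Q) else 0.
  rewrite mulmxA mul_mx_diag !mxE dotp_row; case: (k <= i)%N; by rewrite ?mulr1 ?mulr0// !mxE.
have resE y : residue Q k y = enorm (y *m M) ^+ 2.
  rewrite sqr_enorm /residue /dotp big_mkcond; apply: eq_bigr => i _.
  by rewrite yM; case: ifP => _; rewrite ?mulr0// expr2.
have cf : {within K, continuous (fun y => enorm (y *m M))}.
  apply: continuous_subspaceT => y; apply: continuous_comp; last exact: enorm_continuous.
  by have := @linear_continuous_rV R n n M y; rewrite /mulmxr.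
have [x /set_mem Kx xP] := EVT_max_rV K0 cptK cf.
pose c := x *m M; pose b := enorm c.
have b0 : 0 <= b by exact: enorm_ge0.
have xmax y : K y -> residue Q k y <= b ^+ 2.
  move=> Ky; rewrite resE ler_pXn2r ?nnegrE ?enorm_ge0//.
  by apply: xP; exact: mem_set.
have [bz|bz] := eqVneq b 0.
  exists Q, 0, x; split => //; last by move=> y /xmax; rewrite bz.
  split => //; apply/eqP; rewrite -sqrf_eq0 eq_le sqr_ge0 andbT.
  have := xmax x Kx; rewrite bz expr0n /= /residue (bigD1 k)//= => h.
  by apply: le_trans h; rewrite lerDl sumr_ge0// => i _; exact: sqr_ge0.
have ek : enorm (delta_mx ord0 k : V) = 1.
  apply/eqP; rewrite -sqrp_eq1 ?enorm_ge0// sqr_enorm dotpE trmx_delta.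
  by rewrite mul_delta_mx mxE !eqxx.
have eb : enorm (b *: delta_mx ord0 k : V) = enorm c by rewrite enormZ ek mulr1 ger0_norm.
have [W [oW uW fW]] := householder eb.
have oQ' : (W *m Q) *m (W *m Q)^T = 1%:M.
  by rewrite trmx_mul mulmxA -(mulmxA W) oQ mulmx1.
have rows (i : 'I_n) : (i < k)%N -> row i (W *m Q) = row i Q.
  move=> ik; rewrite row_mul [row i Q]rowE (_ : row i W = delta_mx 0 i)// rowE fW//.
  have dd y : dotp (delta_mx ord0 i) y = y ord0 i by rewrite dotpC dotpE trmx_delta -colE mxE.
  rewrite dotpBr dotpZr !dd mxE eqxx /= (_ : (i == k) = false) ?mulr0 ?sub0r; last first.
    by apply/eqP => E; move: ik; rewrite E ltnn.
  by rewrite -[c ord0 i]/((x *m M) ord0 i) yM leqNgt ik oppr0.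
exists (W *m Q), b, x; split => //; last first.
  by move=> y Ky; rewrite (residue_rows _ oQ oQ' rows); exact: xmax.
split => //; apply: (mulfI bz).
rewrite -dotpZr row_mul rowE scalemxAl scalemxAl uW -expr2.
have -> : dotp x (c *m Q) = dotp (x *m Q^T) c by rewrite dotp_mulmxl trmxK.
rewrite /b sqr_enorm.
apply: eq_bigr => i _; rewrite -[c ord0 i]/((x *m M) ord0 i) yM.
by case: ifP => _; rewrite ?mulr0// -dotp_row.
Qed.

(** The first [k0] rows are prescribed and the others greedy: none for the upper bound, the
    direction of least width for the lower bound. The points [x i] attaining the widths [b i] have
    no component along later rows, so they form a triangular system. *)
Definition greedy_frame K (k0 : nat) Q b (x : 'I_n -> V) :=
  [/\ Q *m Q^T = 1%:M,
      forall i : 'I_n, (k0 <= i)%N -> [/\ K (x i), dotp (x i) (row i Q) = b i & 0 <= b i],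
      forall i l : 'I_n, (k0 <= i < l)%N -> dotp (x i) (row l Q) = 0,
      forall (i : 'I_n) y, (k0 <= i)%N -> K y -> `|dotp y (row i Q)| <= b i &
      forall i l : 'I_n, (k0 <= i <= l)%N -> b l <= b i].

Theorem greedy_frame_exists K (k0 : nat) Q0 : ccv K -> Q0 *m Q0^T = 1%:M ->
  exists Q b (x : 'I_n -> V), greedy_frame K k0 Q b x /\ forall i : 'I_n, (i < k0)%N -> row i Q = row i Q0.
Proof.
move=> cK oQ0.
have step k : (k <= n)%N -> exists Q b (x : 'I_n -> V), [/\ Q *m Q^T = 1%:M,
    forall i : 'I_n, (i < k0)%N -> row i Q = row i Q0 &
    forall i : 'I_n, (k0 <= i < k)%N -> [/\ K (x i), dotp (x i) (row i Q) = b i, 0 <= b i &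
      forall y, K y -> residue Q i y <= b i ^+ 2]].
  elim: k => [|k IH] kn.
    by exists Q0, (fun=> 0), (fun=> 0); split => // i; rewrite ltn0 andbF.
  have [Q [b [x [oQ h0 hk]]]] := IH (ltnW kn).
  have [kk0|k0k] := ltnP k k0.
    exists Q, b, x; split => // i /andP[i0 ik].
    by move: (leq_trans kk0 i0); rewrite ltnNge -ltnS ik.
  have [Q' [b' [x' [oQ' rows [Kx' xb'] b'0 res]]]] := greedy_step (Ordinal kn) cK oQ.
  exists Q', (fun i => if i == Ordinal kn then b' else b i),
    (fun i => if i == Ordinal kn then x' else x i); split => //.
    by move=> i i0; rewrite rows ?h0//= (leq_trans i0).
  move=> i /andP[i0]; rewrite ltnS leq_eqVlt => /orP[ik|ik].
    have -> : i = Ordinal kn by apply: val_inj; exact/eqP.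
    by rewrite eqxx.
  have /negbTE -> : i != Ordinal kn by apply/eqP => E; move: ik; rewrite E /= ltnn.
  have [|Kx xb bi ri] := hk i; first by rewrite i0.
  rewrite rows//; split => // y Ky; rewrite (@residue_rows Q)//; first exact: ri.
  by move=> l li; rewrite rows//=; exact: ltn_trans ik.
have [Q [b [x [oQ h0 h]]]] := step n (leqnn n).
have hb (i : 'I_n) : (k0 <= i)%N -> [/\ K (x i), dotp (x i) (row i Q) = b i, 0 <= b i &
      forall y, K y -> residue Q i y <= b i ^+ 2].
  by move=> i0; apply: h; rewrite i0 ltn_ord.
have res2 (i l : 'I_n) y : (i < l)%N ->
    dotp y (row i Q) ^+ 2 + dotp y (row l Q) ^+ 2 <= residue Q i y.
  move=> il; rewrite /residue (bigD1 i)//= (bigD1 l) /=; last first.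
    by rewrite ltnW//=; apply/eqP => E; move: il; rewrite E ltnn.
  by rewrite addrA lerDl sumr_ge0// => ? _; exact: sqr_ge0.
have res1 (i l : 'I_n) y : (i <= l)%N -> dotp y (row l Q) ^+ 2 <= residue Q i y.
  by move=> il; rewrite /residue (bigD1 l)//= lerDl sumr_ge0// => ? _; exact: sqr_ge0.
exists Q, b, x; split => //; split => //.
- by move=> i /hb[].
- move=> i l /andP[i0 il]; have [Kx xb _ ri] := hb i i0.
  have := le_trans (res2 i l (x i) il) (ri _ Kx); rewrite xb gerDl => h1.
  by apply/eqP; rewrite -sqrf_eq0 eq_le h1 sqr_ge0.
- move=> i y i0 Ky; have [_ _ bi ri] := hb i i0.
  by rewrite -(ler_pXn2r (_ : (0 < 2)%N))// ?nnegrE// real_normK ?num_real// (le_trans (res1 i i y _))// ri.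
- move=> i l /andP[i0 il]; have [_ _ bi ri] := hb i i0.
  have [Kx xb bl _] := hb l (leq_trans i0 il).
  by rewrite -(ler_pXn2r (_ : (0 < 2)%N))// ?nnegrE// -xb (le_trans (res1 i l _ il))// ri.
Qed.

End GreedyFrame.

Section FrameBox.
Variables (R : realType) (n' : nat).
Local Notation n := n'.+1.
Local Notation V := 'rV[R]_n.
Implicit Types (K : set V) (x y z : V) (Q : 'M[R]_n) (b : 'I_n -> R).

Lemma linear_growth_le0 (a S : R) : (forall s, 1 <= s -> s * a <= S) -> a <= 0.
Proof.
move=> H; rewrite leNgt; apply/negP => a0.
have := H (1 + `|S| / a); rewrite lerDl divr_ge0 ?(ltW a0)// => /(_ isT).
have -> : (1 + `|S| / a) * a = a + `|S| by field; exact: lt0r_neq0.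
have := ler_norm S; lra.
Qed.

Lemma bnd_box (a b : V) : bnd (box a b).
Proof.
exists (n%:R * \sum_i (`|a ord0 i| + `|b ord0 i|)) => x xab; rewrite /eball /=.
apply: enorm_le_coord => [|i]; first by apply: sumr_ge0 => i _; rewrite addr_ge0.
rewrite (bigD1 i)//=; have /andP[h1 h2] := xab i.
have : 0 <= \sum_(k < n | k != i) (`|a ord0 k| + `|b ord0 k|).
  by apply: sumr_ge0 => k _; rewrite addr_ge0.
have := ler_norm (b ord0 i); have := ler_norm (- a ord0 i); rewrite normrN.
by have := normr_ge0 (a ord0 i); have := normr_ge0 (b ord0 i); rewrite ler_norml; lra.
Qed.

Definition framebox Q b : set V := [set x | forall i, `|dotp x (row i Q)| <= b i].

Lemma frameboxE Q b : Q *m Q^T = 1%:M ->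
  framebox Q b = mulmxr Q @` box (- \row_i b i) (\row_i b i).
Proof.
move=> oQ; apply/seteqP; split => x.
  move=> xb; apply/(mem_orthogonal_image _ _ oQ) => i.
  by have := xb i; rewrite dotp_row ler_norml !mxE.
move=> /(mem_orthogonal_image _ _ oQ) xb i.
by have := xb i; rewrite dotp_row ler_norml !mxE.
Qed.

Lemma bnd_framebox Q b : Q *m Q^T = 1%:M -> bnd (framebox Q b).
Proof.
move=> oQ; exists (Num.sqrt (\sum_i b i ^+ 2)) => x xb; rewrite /eball /= /enorm.
rewrite (parseval x oQ); apply: ler_wsqrtr; apply: ler_sum => i _.
rewrite -real_normK ?num_real//; apply: lerXn2r; rewrite ?nnegrE ?normr_ge0 ?xb//.
exact: le_trans (normr_ge0 _) (xb i).
Qed.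

Lemma vol_framebox Q b : Q *m Q^T = 1%:M -> (forall i, 0 <= b i) ->
  vol (framebox Q b) = \prod_i (2 * b i).
Proof.
move=> oQ b0; rewrite frameboxE// vol_orthogonal//.
apply: EFin_inj; rewrite -volE; last exact: bnd_box.
rewrite leb_box; last by move=> i; rewrite !mxE; have := b0 i; lra.
by congr (_%:E); rewrite /boxvol; apply: eq_bigr => i _; rewrite !mxE; ring.
Qed.

(** [K] contains the zonotope [D] of the segments along [x i / n], for [i] in [J]. The volume of
    [s D + B] is bounded below by a parallelepiped and above by a box, both of order [s^|J|]; so
    [Tm D] vanishes above degree [|J|], and its coefficient of that degree is at least the one of
    the parallelepiped. *)
Lemma Tm_lower K Q (J : {set 'I_n}) (x : 'I_n -> V) b : ccv K -> origin_symmetric K ->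
  Q *m Q^T = 1%:M ->
  (forall i, i \in J -> [/\ K (x i), dotp (x i) (row i Q) = b i & 0 <= b i]) ->
  (forall i l : 'I_n, i \in J -> (i < l)%N || (l \notin J) -> dotp (x i) (row l Q) = 0) ->
  2 ^+ n / n%:R ^+ n * \prod_(i in J) b i <= Tm K (inord #|J|).
Proof.
move=> cK symK oQ xb xtri.
have N0 : 0 < n%:R :> R by rewrite ltr0n.
have rowQ i l : dotp (row i Q) (row l Q) = (i == l)%:R.
  have := congr1 (fun M : 'M[R]_n => M i l) oQ; rewrite !mxE => <-.
  by apply: eq_bigr => k _; rewrite !mxE.
have [[i0 iJ bi0]|bpos] := pselect (exists2 i, i \in J & b i = 0).
  by rewrite (bigD1 i0)//= bi0 mul0r mulr0; exact: Tm_ge0.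
have {}bpos i : i \in J -> 0 < b i.
  move=> iJ; have [_ _ b0] := xb i iJ; rewrite lt_neqAle b0 andbT eq_sym.
  by apply/eqP => bi; apply: bpos; exists i.
pose Y i := n%:R^-1 *: x i.
pose vs := [seq Y i | i <- enum J].
pose D : set V := zsum vs 1 [set 0].
have c0 : ccv [set (0 : V)].
  by split; [exact: compact_set1|move=> _ _ t -> -> _; rewrite !scaler0 addr0|exists 0].
have s0 z : supp_fun [set (0 : V)] z = 0.
  apply/eqP; rewrite eq_le; apply/andP; split.
    by apply: supp_fun_le => // _ ->; rewrite dotp0r.
  by have := @supp_fun_ge _ _ [set (0 : V)] z 0 c0 erefl; rewrite dotp0r.
have cD : ccv D by apply: ccv_zsum.
have suppD z : supp_fun D z = \sum_(i in J) n%:R^-1 * `|dotp (x i) z|.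
  rewrite supp_zsum// s0 add0r mul1r /vs big_map big_enum /=; apply: eq_bigr => i _.
  by rewrite dotpZl normrM ger0_norm// invr_ge0 ltW.
have hK0 z : 0 <= supp_fun K z.
  have [_ _ [y Ky]] := cK; have := supp_fun_ge z cK Ky; have := supp_fun_ge z cK (symK _ Ky).
  rewrite dotpNr; lra.
have habs z y : K y -> `|dotp y z| <= supp_fun K z.
  move=> Ky; rewrite ler_norml; have := supp_fun_ge z cK Ky; have := supp_fun_ge z cK (symK _ Ky).
  rewrite dotpNr (dotpC z) => h1 h2; apply/andP; split; lra.
have DK : D `<=` K.
  move=> y Dy; apply: (ccvP_supp cK) => z; apply: (le_trans (supp_fun_ge z cD Dy)).
  rewrite suppD; apply: (@le_trans _ _ (\sum_(i < n) n%:R^-1 * supp_fun K z)).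
    rewrite big_mkcond; apply: ler_sum => i _; case: ifP => [iJ|_].
      by rewrite ler_pM2l ?invr_gt0//; apply: habs; have [] := xb i iJ.
    by rewrite mulr_ge0// invr_ge0 ltW.
  by rewrite sumr_const card_ord -[X in X <= _]mulr_natl mulrA divff ?mul1r// gt_eqF.
apply: le_trans (Tm_mono _ cD cK DK).
have cardJ : (#|J| <= n)%N by rewrite -[X in (_ <= X)%N]card_ord max_card.
set c := _ / _; have c_gt0 : 0 < c by rewrite divr_gt0// exprn_gt0.
pose P := \prod_(i in J) b i.
have P0 : 0 < P by apply: prodr_gt0 => i; exact: bpos.
pose p s := vol (msum (scaleS s D) (@eball R n 1)).
have pE s : 1 <= s -> p s = \sum_(m < n.+1) s ^+ m * Tm D m.
  move=> s1; rewrite /p vol_scale_msum_eball//; last exact: lt_le_trans s1.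
  by apply: eq_bigr => m _; rewrite expr1n mulr1.
have cDs s : 0 < s -> ccv (msum (scaleS s D) (@eball R n 1)).
  by move=> s_gt0; apply: ccv_msum; [exact: ccv_scale|exact: ccv_eball].
have suppDs s z : 0 < s -> supp_fun (msum (scaleS s D) (@eball R n 1)) z =
    s * supp_fun D z + enorm z.
  move=> s_gt0; rewrite supp_msum ?supp_eball ?supp_scaleS ?mul1r ?(ltW s_gt0)//.
    exact: ccv_scale.
  exact: ccv_eball.
have lower s : 1 <= s -> c * P * s ^+ #|J| <= p s.
  move=> s1; have s_gt0 : 0 < s by exact: lt_le_trans s1.
  (* Edges of the parallelepiped. In the frame [Q] the matrix is triangular; the factor [1 / n]
     keeps the combination of the remaining frame vectors inside the unit ball. *)
  pose Z : 'M[R]_n := \matrix_(i < n) (n%:R^-1 *: (if i \in J then s *: x i else row i Q)).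
  have ZQ i l : (Z *m Q^T) i l = n%:R^-1 * (if i \in J then s * dotp (x i) (row l Q) else (i == l)%:R).
    have -> : (Z *m Q^T) i l = (row i Z *m Q^T) ord0 l by rewrite -row_mul [RHS]mxE.
    by rewrite -dotp_row rowK dotpZl; case: ifP => _; rewrite ?dotpZl ?rowQ.
  have detZ : \det (Z *m Q^T) = n%:R ^- n * (s ^+ #|J| * P).
    rewrite det_trig; last first.
      apply/is_trig_mxP => i l il; rewrite ZQ; case: ifP => iJ.
        by rewrite xtri ?il// !mulr0.
      by rewrite (_ : (i == l) = false) ?mulr0//; apply/eqP => E; move: il; rewrite E ltnn.
    under eq_bigr do rewrite ZQ eqxx.
    rewrite big_split /= prodr_const card_ord exprVn; congr (_ * _).
    rewrite (bigID (mem J)) /= [X in _ * X]big1 ?mulr1; last by move=> i /negbTE ->.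
    rewrite (eq_bigr (fun i => s * b i)); last by move=> i iJ; rewrite iJ; have [_ -> _] := xb i iJ.
    by rewrite big_split /= prodr_const.
  have dZ0 : 0 < \det (Z *m Q^T).
    by rewrite detZ mulr_gt0 ?invr_gt0 ?exprn_gt0// mulr_gt0 ?exprn_gt0.
  have dQ : `|\det Q| = 1.
    have : `|\det Q| ^+ 2 = 1.
      by rewrite expr2 -{2}det_tr -normrM -det_mulmx oQ det1 normr1.
    move/eqP; rewrite sqrf_eq1 => /orP[/eqP->//|/eqP h].
    by have := normr_ge0 (\det Q); rewrite h oppr_ge0 ler10.
  have dZ : `|\det Z| = n%:R ^- n * (s ^+ #|J| * P).
    rewrite -detZ -[RHS]gtr0_norm// det_mulmx det_tr normrM dQ mulr1 //.
  have uZ : Z \in unitmx.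
    rewrite unitmxE unitfE -normr_eq0 dZ gt_eqF// mulr_gt0 ?invr_gt0 ?exprn_gt0//.
    by rewrite mulr_gt0 ?exprn_gt0.
  pose U : set V := box (const_mx (-1)) (const_mx 1).
  have sub : mulmxr Z @` U `<=` msum (scaleS s D) (@eball R n 1).
    move=> _ [w wU <-]; apply: (ccvP_supp (cDs s s_gt0)) => z; rewrite suppDs// /= mulmx_sum_row.
    rewrite dotp_sumr (bigID (mem J)) /=; apply: lerD.
      rewrite suppD mulr_sumr; apply: ler_sum => i iJ.
      rewrite rowK iJ !dotpZr (dotpC z); have := wU i; rewrite !mxE -ler_norml => w1.
      apply: (le_trans (ler_norm _)); rewrite !normrM [X in _ * (X * _)]ger0_norm ?invr_ge0 ?(ltW N0)//.
      rewrite (gtr0_norm s_gt0) mulrCA (mulrCA s) ler_pM2l ?invr_gt0//.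
      by rewrite -[leRHS]mul1r ler_wpM2r// mulr_ge0// ltW.
    apply: (@le_trans _ _ (\sum_(i < n | i \notin J) n%:R^-1 * enorm z)).
      apply: ler_sum => i /negbTE iJ; rewrite rowK iJ !dotpZr.
      have := wU i; rewrite !mxE -ler_norml => w1.
      apply: (le_trans (ler_norm _)); rewrite !normrM [X in _ * (X * _)]ger0_norm ?invr_ge0 ?(ltW N0)//.
      rewrite mulrCA ler_pM2l ?invr_gt0// -[leRHS]mul1r ler_pM//.
      apply: (le_trans (CauchySchwarz _ _)); rewrite /enorm rowQ eqxx sqrtr1 mulr1 //.
    apply: (@le_trans _ _ (\sum_(i < n) n%:R^-1 * enorm z)).
      rewrite big_mkcond; apply: ler_sum => i _; case: ifP => // _.
      by rewrite mulr_ge0 ?enorm_ge0// invr_ge0 ltW.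
    by rewrite sumr_const card_ord -[X in X <= _]mulr_natl mulrA divff ?mul1r// gt_eqF.
  have volU : vol (mulmxr Z @` U) = c * P * s ^+ #|J|.
    rewrite /vol leb_mulmx// leb_box; last by move=> i; rewrite !mxE; lra.
    rewrite /= dZ /boxvol; under [X in _ * X]eq_bigr do rewrite !mxE.
    rewrite prodr_const card_ord /c opprK; ring.
  by rewrite -volU; apply: vol_le => //; apply: ccv_bnd; exact: cDs.
pose rho := \sum_i enorm (x i).
have rho0 : 0 <= rho by apply: sumr_ge0 => i _; exact: enorm_ge0.
pose S := (2 * (rho + 1)) ^+ n.
have upper s : 1 <= s -> p s <= S * s ^+ #|J|.
  move=> s1; have s_gt0 : 0 < s by exact: lt_le_trans s1.
  pose b' i := if i \in J then s * (rho + 1) else rho + 1.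
  have b'0 i : 0 <= b' i by rewrite /b'; case: ifP => _; rewrite ?mulr_ge0 ?addr_ge0// ltW.
  have sub : msum (scaleS s D) (@eball R n 1) `<=` framebox Q b'.
    have hle y l : msum (scaleS s D) (@eball R n 1) y -> dotp (row l Q) y <= b' l.
      move=> yD; apply: (le_trans (supp_fun_ge _ (cDs s s_gt0) yD)); rewrite suppDs//.
      rewrite suppD /enorm rowQ eqxx sqrtr1 /b'; case: ifP => lJ.
        rewrite [leRHS]mulrDr mulr1; apply: lerD => //; rewrite ler_pM2l// /rho big_mkcond.
        apply: ler_sum => i _; case: ifP => _; last exact: enorm_ge0.
        rewrite -[leRHS]mul1r; apply: ler_pM; rewrite ?invr_ge0 ?(ltW N0) ?normr_ge0//.
          by rewrite invf_le1// ler1n.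
        by apply: (le_trans (CauchySchwarz _ _)); rewrite /enorm rowQ eqxx sqrtr1 mulr1.
      rewrite big1 ?mulr0 ?add0r ?lerDr// => i iJ.
      by rewrite xtri ?lJ ?orbT// normr0 mulr0.
    move=> y yD l; rewrite ler_norml dotpC hle// andbT lerNl -dotpNr.
    apply: hle; move: yD => [_ [u Du <-] [v vB ->]].
    have symD : D (- u).
      apply: (ccvP_supp cD) => z; rewrite dotpNr -dotpNl.
      apply: (le_trans (supp_fun_ge _ cD Du)); rewrite !suppD.
      by apply: ler_sum => i _; rewrite dotpNr normrN.
    by exists (s *: - u); [exists (- u)|exists (- v); rewrite ?opprD ?scalerN//; rewrite /eball /= enormN].
  apply: (@le_trans _ _ (vol (framebox Q b'))); first by apply: vol_le => //; exact: bnd_framebox.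
  rewrite vol_framebox// /b' (bigID (mem J)) /=.
  rewrite (eq_bigr (fun=> s * (2 * (rho + 1)))); last by move=> i ->; ring.
  rewrite [X in _ * X](eq_bigr (fun=> 2 * (rho + 1))); last by move=> i /negbTE ->.
  rewrite !prodr_const exprMn -mulrA -exprD mulrC.
  have -> : (#|J| + #|[predC J]| = n)%N by rewrite cardC card_ord.
  by [].
(* A term of higher degree would outgrow the upper bound as [s] increases. *)
have Tz (m : 'I_n.+1) : (#|J| < m)%N -> Tm D m = 0.
  move=> Jm; apply/eqP; rewrite eq_le Tm_ge0// andbT; apply: (@linear_growth_le0 _ S) => s s1.
  have s_gt0 : 0 < s by exact: lt_le_trans s1.
  have sJ : 0 < s ^+ #|J| by rewrite exprn_gt0.
  have h1 : s ^+ m * Tm D m <= p s.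
    rewrite pE// (bigD1 m)//= lerDl sumr_ge0// => i _.
    by rewrite mulr_ge0 ?Tm_ge0// exprn_ge0// ltW.
  have := le_trans h1 (upper s s1); rewrite [S * _]mulrC => h2.
  rewrite -(ler_pM2l sJ); apply: le_trans h2; rewrite mulrA -exprSr.
  by rewrite ler_wpM2r ?Tm_ge0// ler_weXn2l.
have J' : (#|J| < n.+1)%N by rewrite ltnS.
pose mJ := Ordinal J'; have -> : inord #|J| = mJ :> 'I_n.+1 by apply: val_inj; rewrite /= inordK.
rewrite -subr_le0; apply: (@linear_growth_le0 _ (\sum_(m < n.+1) Tm D m)) => s s1.
have s_gt0 : 0 < s by exact: lt_le_trans s1.
have := lower s s1; rewrite pE// (bigD1 mJ)//= => h.
case: (posnP #|J|) => [Jz|Jp].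
  rewrite mulrBr -/P; have T0 : \sum_(i < n.+1 | i != mJ) s ^+ i * Tm D i = 0.
    rewrite big1// => i iJ; rewrite Tz ?mulr0// Jz lt0n; apply: contra iJ => /eqP i0.
    by apply/eqP/val_inj; rewrite /= Jz.
  move: h; rewrite T0 addr0 Jz !expr0 mulr1 mul1r => h.
  apply: (@le_trans _ _ 0); last by apply: sumr_ge0 => i _; exact: Tm_ge0.
  by rewrite -mulrBr pmulr_rle0// subr_le0.
have sJ : 0 < s ^+ #|J|.-1 by rewrite exprn_gt0.
rewrite -(ler_pM2l sJ) mulrA -exprSr prednK// mulrBr lerBlDr mulrC -/P (le_trans h)//.
rewrite addrC lerD2r mulr_sumr [leRHS](bigD1 mJ)//=.
rewrite -[leLHS]add0r; apply: lerD; first by rewrite mulr_ge0 ?Tm_ge0// ltW.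
apply: ler_sum => i iJ; have [Ji|iJ'] := ltnP #|J| i; first by rewrite Tz// !mulr0.
rewrite ler_wpM2r ?Tm_ge0// ler_weXn2l// -ltnS prednK// ltn_neqAle iJ' andbT.
by apply: contra iJ => /eqP E; apply/eqP/val_inj.
Qed.

End FrameBox.

(** * Upper bound *)

Section TranslationTrick.
Variables (R : realType) (n' : nat).
Local Notation n := n'.+1.
Local Notation V := 'rV[R]_n.
Implicit Types (K w : set V) (x y z u q : V) (Q : 'M[R]_n) (b : 'I_n -> R) (j : 'I_n.+1).

Lemma nat_growth_le0 (a S : R) : (forall m : nat, m%:R * a <= S) -> a <= 0.
Proof.
move=> H; rewrite leNgt; apply/negP => a0.
by have := H (Num.truncn (S / a)).+1; rewrite -ler_pdivlMr// leNgt truncnS_gt.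
Qed.

Lemma closed_sphere : closed (@sphere R n).
Proof.
rewrite (_ : @sphere R n = @enorm R n @^-1` [set 1]); last by apply/seteqP; split.
by apply: preimage_closed; [move=> x _; exact: enorm_continuous|exact: closed_eq].
Qed.

Lemma dotp_rows Q (i l : 'I_n) : Q *m Q^T = 1%:M -> dotp (row i Q) (row l Q) = (i == l)%:R.
Proof.
move=> oQ; have := congr1 (fun M : 'M[R]_n => M i l) oQ; rewrite !mxE => <-.
by apply: eq_bigr => k _; rewrite !mxE.
Qed.

Lemma enorm_row Q (i : 'I_n) : Q *m Q^T = 1%:M -> enorm (row i Q) = 1.
Proof. by move=> oQ; rewrite /enorm dotp_rows// eqxx sqrtr1. Qed.

Definition cap q : set V := @sphere R n `&` [set u | 1 / 2 <= dotp q u].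

Lemma borel_cap q : borel (cap q).
Proof.
apply: borel_closed; apply: closedI; first exact: closed_sphere.
rewrite (_ : [set u | _] = dotp q @^-1` [set s | 1 / 2 <= s])//.
by apply: preimage_closed; [move=> x _; exact: dotp_continuous|exact: closed_ge].
Qed.

Lemma cap_sphere q : cap q `<=` @sphere R n. Proof. by move=> x []. Qed.

(** The body lies behind the supporting hyperplane with normal [u], and a translation by [t q] moves
    the point away from that hyperplane by at least [t / 2]. *)
Lemma psi_escape K q x t e : ccv K -> 0 <= t -> cone_le e (cap q) (psi K x) ->
  enorm (psi K x) + t / 2 <= enorm (psi K (x + t *: q)).
Proof.
move=> cK t0 [a [u [u1 qu] [/andP[a0 ae] xu]]].
have eu : enorm u = 1 := u1.
have ea : enorm (psi K x) = a by rewrite xu enormZ gtr0_norm// eu mulr1.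
have [Kp _] := projP x cK; have [Kp' _] := projP (x + t *: q) cK.
have h1 : dotp (proj K (x + t *: q)) u <= dotp (proj K x) u.
  by have := psi_supp x cK Kp'; rewrite xu !dotpZr ler_pM2l.
have h2 : dotp (psi K (x + t *: q)) u <= enorm (psi K (x + t *: q)).
  by rewrite -[leRHS]mulr1 -eu dotp_le.
apply: le_trans h2; rewrite ea /psi dotpBl dotpDl dotpZl.
have h3 : dotp x u = dotp (proj K x) u + a.
  by rewrite {1}(psi_projK K x) dotpDl xu dotpZl -sqr_enorm eu expr1n mulr1.
have h4 : t * (1 / 2) <= t * dotp q u by rewrite ler_wpM2l.
lra.
Qed.

Lemma vol_shift_disjoint (N : set V) v (m : nat) : borel N -> bnd N ->
  (forall x k, (0 < k)%N -> N x -> ~ N (x + k%:R *: v)) ->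
  vol [set x | exists2 i : nat, (i < m)%N & N (x - i%:R *: v)] = m%:R * vol N.
Proof.
move=> bN bdN disj; elim: m => [|m IH].
  rewrite mul0r (_ : [set x | _] = set0) ?/vol ?outer_measure0//.
  by rewrite -subset0 => x [].
pose F m := [set x | exists2 i : nat, (i < m)%N & N (x - i%:R *: v)]; rewrite -/(F m.+1).
pose S := [set x | N (x - m%:R *: v)].
have bS : borel S.
  apply: (@borel_preimage R n' (fun x => x - m%:R *: v)) => //.
  by move=> x; apply: (continuousB _ (@cst_continuous _ _ _ _)) => //; exact: id_continuous.
have bdF : bnd (F m.+1).
  have [r Nr] := bdN; exists (r + m%:R * enorm v) => x [i im Nx].
  rewrite /eball /= -[x](subrK (i%:R *: v)) (le_trans (enormD _ _))// lerD//; first exact: Nr.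
  by rewrite enormZ normr_nat ler_wpM2r ?enorm_ge0// ler_nat -ltnS.
have FS : F m.+1 `&` S = S by apply/setIidr => x Sx; exists m.
have FnS : F m.+1 `&` ~` S = F m.
  apply/seteqP; split => x.
    move=> [[i]]; rewrite ltnS leq_eqVlt => /orP[/eqP-> Nx nS|im Nx _]; first by case: nS.
    by exists i.
  move=> [i im Nx]; split; first by exists i => //; exact: ltnW.
  move=> Sx; have := @disj (x - m%:R *: v) (m - i)%N; rewrite subn_gt0 => /(_ im Sx); apply.
  by rewrite natrB ?(ltnW im)// scalerBl addrA subrK.
have volS : vol S = vol N.
  rewrite -[RHS](vol_shift (m%:R *: v)); congr vol; apply/seteqP; split => x.
    by move=> Sx; exists (x - m%:R *: v) => //; rewrite addrC subrK.
  by move=> [y Ny <-]; rewrite /S /= addrAC subrr add0r.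
have : vol (F m.+1) = vol S + vol (F m).
  apply: EFin_inj; rewrite EFinD -!volE//.
  - by rewrite (leb_split _ bS) FS FnS.
  - by rewrite -FnS; apply: bnd_sub bdF => x [].
  - by rewrite -FS; apply: bnd_sub bdF => x [].
by move=> ->; rewrite volS IH -natr1; ring.
Qed.

(** Translates by multiples of [2 e q] are disjoint, because a translated point has distance above
    [e]. Packing [m] of them into a box that grows with [m] in the direction of [q] alone, and
    dividing by [m], removes the width in that direction. *)
Lemma vol_slab K Q b (i1 : 'I_n) e : ccv K -> Q *m Q^T = 1%:M -> 0 < e ->
  (forall y i, K y -> `|dotp y (row i Q)| <= b i) ->
  vol (psi K @^-1` cone_le e (cap (row i1 Q))) <=
    2 ^+ n.+1 * e * \prod_(i | i != i1) (b i + e).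
Proof.
move=> cK oQ e0 Kb; set q := row i1 Q; set N := _ @^-1` _.
have q1 l : `|dotp q (row l Q)| <= (l == i1)%:R by rewrite dotp_rows// eq_sym normr_nat.
have row1 l := enorm_row l oQ.
have bC : borel (cone_le e (cap q)).
  by rewrite cone_leE//; apply: borel_scale => //; apply: borel_cone01 (borel_cap q); exact: cap_sphere.
have bdC : bnd (cone_le e (cap q)).
  by rewrite cone_leE//; apply: bnd_scale; apply: bnd_cone01; exact: cap_sphere.
have bN : borel N by exact: borel_psi.
have bdN : bnd N by exact: bnd_psi.
have Ne x : N x -> 0 < enorm (psi K x) <= e.
  by move=> [a [u [u1 _] [a0 ->]]]; have a1 := andP a0; rewrite enormZ gtr0_norm ?(u1 : enorm u = 1) ?mulr1//; case: a1.
pose v := (2 * e) *: q.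
have disj x k : (0 < k)%N -> N x -> ~ N (x + k%:R *: v).
  move=> k0 Nx /Ne/andP[_ h]; have /andP[x0 _] := Ne x Nx.
  have ke0 : 0 <= k%:R * (2 * e) by rewrite !mulr_ge0// ltW.
  have := psi_escape cK ke0 Nx; rewrite -scalerA -/v => h2.
  have k1 : 1 <= k%:R :> R by rewrite ler1n.
  have : e <= k%:R * (2 * e) / 2 by rewrite mulrA mulrAC mulfK// ler_peMl// ltW.
  by move: (le_trans h2 h) x0; clear; lra.
have b0 i : 0 <= b i by have [_ _ [y Ky]] := cK; exact: le_trans (normr_ge0 _) (Kb y i Ky).
set P := \prod_(i | i != i1) (b i + e).
have P0 : 0 <= P by apply: prodr_ge0 => i _; rewrite addr_ge0// ltW.
rewrite -subr_le0; apply: (@nat_growth_le0 _ (2 ^+ n * (b i1 + e) * P)) => m.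
rewrite mulrBr -(vol_shift_disjoint m bN bdN disj) lerBlDr.
pose b' i := b i + e + (if i == i1 then m%:R * (2 * e) else 0).
have b'0 i : 0 <= b' i.
  by rewrite !addr_ge0 ?(ltW e0)//; case: ifP => // _; rewrite !mulr_ge0// ltW.
apply: (@le_trans _ _ (vol (framebox Q b'))).
  apply: vol_le; first exact: bnd_framebox.
  move=> x [k km Nx] l; rewrite -[x](subrK (k%:R *: v)) dotpDl.
  apply: (le_trans (ler_normD _ _)); apply: lerD.
    rewrite (psi_projK K (x - k%:R *: v)) dotpDl; apply: (le_trans (ler_normD _ _)); apply: lerD.
      by apply: Kb; have [] := projP (x - k%:R *: v) cK.
    by apply: (le_trans (CauchySchwarz _ _)); rewrite row1 mulr1; have /andP[] := Ne _ Nx.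
  rewrite /v !dotpZl !normrM !normr_nat (gtr0_norm e0).
  apply: (@le_trans _ _ (k%:R * (2 * e * (l == i1)%:R))).
    by rewrite ler_wpM2l// ler_wpM2l ?q1// mulr_ge0// ltW.
  case: (l == i1); rewrite ?mulr0// mulr1 ler_wpM2r ?mulr_ge0 ?(ltW e0)// ler_nat ltnW//.
rewrite vol_framebox// big_split /= prodr_const card_ord (bigD1 i1)//=.
rewrite (eq_bigr (fun i => b i + e)); last by move=> i /negbTE ii; rewrite /b' ii addr0.
rewrite -/P /b' eqxx exprS le_eqVlt; apply/orP; left; apply/eqP.
by rewrite ![2 ^+ n.+1]exprS ![2 ^+ n]exprS; ring.
Qed.

Lemma enorm_le_sum x : enorm x <= \sum_i `|x ord0 i|.
Proof.
have {1}-> : x = \sum_i x ord0 i *: delta_mx ord0 i by exact: row_sum_delta.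
apply: (le_trans (enorm_sum _ _ _)); apply: ler_sum => i _; rewrite enormZ.
rewrite (_ : enorm _ = 1) ?mulr1//; apply/eqP; rewrite -sqrp_eq1 ?enorm_ge0// sqr_enorm dotpE.
by rewrite trmx_delta mul_delta_mx mxE !eqxx.
Qed.

Lemma sg_cap_ge Q i1 : Q *m Q^T = 1%:M -> (4 * n%:R)^-1 ^+ n <= sg (cap (row i1 Q)).
Proof.
move=> oQ; set N : R := n%:R; have N0 : 0 < N by rewrite ltr0n.
have [d dE] : exists d : R, d = (4 * N)^-1 by exists (4 * N)^-1.
have Nd : N * d = 1 / 4 by rewrite dE; field; exact: lt0r_neq0.
rewrite -dE.
pose a : V := \row_i (if i == i1 then 1 / 4 else - d).
pose c : V := \row_i (if i == i1 then 1 / 2 else d).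
have N4 : 0 < d by rewrite dE invr_gt0 mulr_gt0.
have N41 : d <= 1 / 4.
  by rewrite dE div1r lef_pV2 ?posrE ?mulr_gt0// ler_peMr// ler1n.
have ac : box_le a c by move=> i; rewrite !mxE; case: ifP => _; lra.
have sub : mulmxr Q @` box a c `<=` cone01 (cap (row i1 Q)).
  move=> x /(mem_orthogonal_image _ _ oQ) xb.
  have x1 : 1 / 4 <= dotp x (row i1 Q) <= 1 / 2.
    by have := xb i1; rewrite dotp_row !mxE eqxx.
  have ex : enorm x <= dotp x (row i1 Q) + 1 / 4.
    have oQT : Q^T *m (Q^T)^T = 1%:M by rewrite trmxK; exact: mulmx1C.
    rewrite -(enorm_orthogonal x oQT); apply: (le_trans (enorm_le_sum _)).
    rewrite (bigD1 i1)//= -dotp_row; apply: lerD; first by rewrite ger0_norm//; lra.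
    apply: (@le_trans _ _ (\sum_(i < n) d)).
      rewrite big_mkcond; apply: ler_sum => i _; case: ifP => [/negbTE ii|_]; last exact: ltW.
      by have := xb i; rewrite !mxE ii ler_norml.
    by rewrite sumr_const card_ord -[X in X <= _]mulr_natl Nd.
  have x0 : 0 < enorm x.
    rewrite enorm_gt0; apply/eqP => E; move: x1; rewrite E dotp0l; lra.
  exists (enorm x), ((enorm x)^-1 *: x); last first.
    by rewrite x0 scalerA divff ?scale1r ?gt_eqF//; split => //; lra.
  split; first by rewrite /sphere /= enormZ gtr0_norm ?invr_gt0// mulVf// gt_eqF.
  rewrite /= dotpZr [X in _ <= X]mulrC ler_pdivlMr// dotpC; lra.
have -> : d ^+ n = \prod_(i < n) d by rewrite prodr_const card_ord.
apply: (@le_trans _ _ (vol (mulmxr Q @` box a c))).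
  rewrite vol_orthogonal// /vol leb_box//= /boxvol; apply: ler_prod => i _.
  by rewrite (ltW N4) !mxE; case: ifP => _; lra.
by apply: vol_le => //; apply: bnd_cone01; exact: cap_sphere.
Qed.

(** The curvature bound puts at least a multiple of [D e^(n - |J|)] into the parallel set over the
    cap, and [vol_slab] allows [e] times the product of the [b i + e]. As [e] separates the widths
    in [J] from the others, that product is at most [2^(n-1) e^(n-1-|J|)] times the product over
    [J], and the powers of [e] cancel. *)
Lemma curvature_product_lower K Q b (i1 : 'I_n) (J : {set 'I_n}) D e : ccv K -> Q *m Q^T = 1%:M ->
  (forall y i, K y -> `|dotp y (row i Q)| <= b i) ->
  0 < D -> 0 < e -> (#|J| <= n')%N -> i1 \notin J ->
  (forall i, i \in J -> e <= b i) -> (forall i, i != i1 -> i \notin J -> b i <= e) ->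
  sph_ae (fun u => exists2 s, sj_at K #|J| u s & D <= s) ->
  D * (4 * n%:R)^-1 ^+ n <= 2 ^+ (n + n) * \prod_(i in J) b i.
Proof.
move=> cK oQ Kb D0 e0 Jn iJ bJ bnJ ae.
have ae' : sph_ae (fun u => cap (row i1 Q) u -> exists2 s, sj_at K #|J| u s & D <= s).
  rewrite /sph_ae; apply/eqP; rewrite eq_le -{1}ae; apply/andP; split.
    apply: lee_wpmul2l => //; apply: le_leb_outer => x [t [u [us h] h']].
    by exists t, u => //; split => // h2; apply: h => _; exact: h2.
  by apply: mule_ge0 => //; exact: outer_measure_ge0.
have h1 := parallel_lower cK Jn (@cap_sphere (row i1 Q)) D0 e0 ae'.
have bdC : bnd (cone_le e (cap (row i1 Q))).
  by rewrite cone_leE//; apply: bnd_scale; apply: bnd_cone01; exact: cap_sphere.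
rewrite sgE ?(volE (bnd_psi cK bdC)) in h1; last exact: cap_sphere.
move: h1; rewrite -EFinM lee_fin => h1.
have := le_trans h1 (vol_slab i1 cK oQ e0 Kb) => {}h1.
have C1 : 1 <= 'C(n', #|J|)%:R :> R by rewrite ler1n bin_gt0.
have ej : 0 < e ^+ (n - #|J|) by rewrite exprn_gt0.
have b0 i : 0 <= b i by have [_ _ [y Ky]] := cK; exact: le_trans (normr_ge0 _) (Kb y i Ky).
have h2 : D * e ^+ (n - #|J|) * (4 * n%:R)^-1 ^+ n <= 2 ^+ n.+1 * e * \prod_(i | i != i1) (b i + e).
  apply: le_trans h1; apply: ler_pM; rewrite ?mulr_ge0 ?exprn_ge0 ?invr_ge0 ?mulr_ge0 ?(ltW D0) ?(ltW e0)//.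
    by rewrite ler_wpM2r ?(ltW ej)// ler_peMl// ltW.
  exact: sg_cap_ge.
have h3 : \prod_(i | i != i1) (b i + e) <= 2 ^+ n' * (e ^+ (n' - #|J|) * \prod_(i in J) b i).
  have card1 : #|[pred i : 'I_n | i != i1]| = n'.
    transitivity #|predC1 i1|; first by apply: eq_card => i; rewrite !inE.
    by rewrite cardC1 card_ord.
  have -> : e ^+ (n' - #|J|) * \prod_(i in J) b i = \prod_(i | i != i1) (if i \in J then b i else e).
    rewrite [RHS](bigID (mem J)) /= mulrC; congr (_ * _).
      rewrite [RHS](eq_bigr b); last by move=> i /andP[_ ->].
      apply: eq_bigl => i; case: (boolP (i \in J)) => [iJ'|]; rewrite ?andbF// andbT.
      by apply/esym/eqP => E; move: iJ; rewrite -E iJ'.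
    rewrite (eq_bigr (fun=> e)); last by move=> i /andP[_ /negbTE ->].
    rewrite prodr_const; congr (_ ^+ _).
    have cE : (#|J| + #|[pred i : 'I_n | (i != i1) && (i \notin J)]|)%N = n'.
      rewrite -[RHS]card1 -[RHS](cardID (mem J)); congr (_ + _)%N; apply: eq_card => i; rewrite !inE.
      - case: (boolP (i \in J)) => [iJ'|]; rewrite ?andbF//.
        by apply/esym; rewrite andbT; apply/eqP => E; move: iJ; rewrite -E iJ'.
      - by rewrite andbC.
    by rewrite -[X in (X - _)%N]cE addKn; apply: eq_card => i; rewrite !inE.
  have -> : 2 ^+ n' = \prod_(i | i != i1) (2 : R) by rewrite prodr_const card1.
  rewrite -big_split /=; apply: ler_prod => i ii1; rewrite addr_ge0 ?(ltW e0)//=.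
  case: (boolP (i \in J)) => iJ'; first by have := bJ i iJ'; lra.
  by have := bnJ i ii1 iJ'; lra.
have e2 : e ^+ (n - #|J|) = e * e ^+ (n' - #|J|) by rewrite subSn// exprS.
have h4 : 0 < e * e ^+ (n' - #|J|) by rewrite -e2.
rewrite -(ler_pM2l h4) -e2 mulrA [_ * D]mulrC (le_trans h2)//.
apply: (le_trans (ler_wpM2l _ h3)); first by rewrite mulr_ge0 ?exprn_ge0 ?ltW.
rewrite e2 exprD !exprS le_eqVlt; apply/orP; left; apply/eqP; ring.
Qed.

End TranslationTrick.

Section UpperBound.
Variables (R : realType) (n' : nat).
Local Notation n := n'.+1.
Local Notation V := 'rV[R]_n.
Implicit Types (K w : set V) (x y z u q : V) (Q : 'M[R]_n) (j : 'I_n.+1) (p M a rho : R).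

(** The function [g] is replaced by the two-sided bound it implies. The radius [r] is qualitative:
    it keeps [h_K] positive and makes the number of layers finite, and enters no constant. *)
Definition solution K (j : nat) p M :=
  [/\ ccv K, origin_symmetric K, (exists2 r : R, 0 < r & forall u, @sphere R n u -> r <= supp_fun K u),
      area_abs_cont K j &
      sph_ae (fun u => exists2 s, sj_at K j u s &
        (expR M)^-1 <= supp_fun K u `^ (1 - p) * s <= expR M)].

Lemma sph_ae_imply (P P' : V -> Prop) : (forall u, @sphere R n u -> P u -> P' u) ->
  sph_ae P -> sph_ae P'.
Proof.
move=> PP ae; rewrite /sph_ae; apply/eqP; rewrite eq_le -{1}ae; apply/andP; split.
  apply: lee_wpmul2l => //; apply: le_leb_outer => x [t [u [us h] h']].
  by exists t, u => //; split => // h2; apply: h; exact: PP.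
by apply: mule_ge0 => //; exact: outer_measure_ge0.
Qed.

(** Scaling by 2 fixes the origin but multiplies the mass by [2^(n-m)]. *)
Lemma Sig_origin K (m : 'I_n.+1) : ccv K -> (m < n)%N -> Sig K m [set 0] = 0.
Proof.
move=> cK mn; have b0 : bnd [set (0 : V)] by exists 0 => x ->; rewrite /eball /= enorm0.
have := Sig_scale m cK (@ltr0Sn R 1) (@borel_set0p R n') b0.
have -> : scaleS 2 [set (0 : V)] = [set 0].
  apply/seteqP; split => [_ [_ -> <-]|_ ->]; first by rewrite scaler0.
  by exists 0; rewrite ?scaler0.
have : 2 <= 2 ^+ (n - m) :> R by rewrite -[leLHS]expr1 ler_weXn2l ?ler1n// subn_gt0.
move: (2 ^+ (n - m)) (Sig K m _) => c s c2 E.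
have : (c - 1) * s = 0 by lra.
by move/eqP; rewrite mulf_eq0 => /orP[/eqP h|/eqP//]; lra.
Qed.

Lemma Tm_sphere K (m : 'I_n.+1) : ccv K -> (m < n)%N -> Tm K m = Sig K m (cone01 (@sphere R n)).
Proof.
move=> cK mn; rewrite /Tm (Sig_split m cK (@bnd_eball R n' 1) (@borel_set0p R n')).
have -> : @eball R n 1 `&` [set 0] = [set 0].
  by apply/setIidr => x ->; rewrite /eball /= enorm0.
rewrite Sig_origin// add0r; congr Sig; rewrite cone01E//.
apply/seteqP; split => x.
  move=> [x1 x0]; split => //; have x0' : x != 0 by apply/eqP.
  split => //; rewrite /sphere /= enormZ gtr0_norm ?invr_gt0 ?enorm_gt0// mulVf// enorm_eq0 //.
by move=> [[/eqP x0 _] x1]; split.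
Qed.

Definition curv_const (j : nat) M : R := 2 ^+ (n' + j + n) * 'C(n', j)%:R * expR M.

Lemma solution_upper K j p M w a : solution K j p M -> (0 < j < n)%N -> borel w ->
  w `<=` @sphere R n -> 0 <= 1 - p -> 0 < a -> (forall u, w u -> a <= supp_fun K u) ->
  Sig K j (cone01 w) <= curv_const j M / a `^ (1 - p) * sg w.
Proof.
move=> [cK symK [r r0 hr] ac ae] jn bw ws q0 a0 wa.
have ap : 0 < a `^ (1 - p) by exact: powR_gt0.
have D0 : 0 < expR M / a `^ (1 - p) by rewrite divr_gt0// expR_gt0.
have ae' : sph_ae (fun u => w u -> exists2 s, sj_at K j u s & 0 < s <= expR M / a `^ (1 - p)).
  apply: sph_ae_imply ae => u us [s sj /andP[h1 h2]] wu; exists s => //.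
  have hu : 0 < supp_fun K u by apply: lt_le_trans (hr u us).
  have hp : 0 < supp_fun K u `^ (1 - p) by exact: powR_gt0.
  have s0 : 0 < s.
    rewrite -(pmulr_rgt0 _ hp); apply: lt_le_trans h1; by rewrite invr_gt0 expR_gt0.
  rewrite s0 ler_pdivlMr//= mulrC; apply: le_trans h2; rewrite ler_wpM2r ?(ltW s0)//.
  by apply: ge0_ler_powR => //; rewrite ?nnegrE ?(ltW a0) ?(ltW hu)//; exact: wa.
apply: (le_trans (Sig_le_curvature cK jn ac bw ws D0 ae')).
by rewrite /curv_const !mulrA.
Qed.

Lemma borel_supp_le K a : ccv K -> borel [set u | supp_fun K u <= a].
Proof.
move=> cK; apply: borel_closed; rewrite (_ : [set u | _] = supp_fun K @^-1` [set s | s <= a])//.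
by apply: preimage_closed; [move=> x _; exact: supp_fun_continuous|exact: closed_le].
Qed.

(* The layers [rho 4^-(k+1) < h <= rho 4^-k] contribute a geometric series. *)
Lemma layer_bound K j p M w rho A : solution K j p M -> (0 < j < n)%N -> borel w ->
  w `<=` @sphere R n -> 0 <= p -> p < 1 -> 0 < rho -> sg w <= A ->
  (forall k : nat, sg (w `&` [set u | supp_fun K u <= rho / 4 ^+ k]) <= A / 8 ^+ k) ->
  Sig K j (cone01 w) <= 9 * curv_const j M * A / rho `^ (1 - p).
Proof.
move=> sol jn bw ws p0 p1 rho0 wA layerA; have [cK _ [r r0 hr] _ _] := sol.
have q0 : 0 <= 1 - p by rewrite subr_ge0 ltW.
have cc0 : 0 < curv_const j M.
  by rewrite !mulr_gt0 ?exprn_gt0 ?expR_gt0// ltr0n bin_gt0; case/andP: jn.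
have A0 : 0 <= A by apply: le_trans wA; rewrite fine_ge0// outer_measure_ge0.
have rq : 0 < rho `^ (1 - p) by exact: powR_gt0.
pose c := curv_const j M * A / rho `^ (1 - p).
have c0 : 0 <= c by rewrite !mulr_ge0 ?(ltW cc0)// invr_ge0 ltW.
pose L k := w `&` [set u | supp_fun K u <= rho / 4 ^+ k].
have bL k : borel (L k) by apply: borelI => //; exact: borel_supp_le.
have Ls k : L k `<=` @sphere R n by move=> u [/ws].
(* Induction on the number of layers down to a level that [h_K] never reaches. Layer [k] costs at
   most [4 c / 2^k]: the density gains at most [4^(k+1)], the measure loses [8^k]. *)
have main d : forall k, (forall u, @sphere R n u -> rho / 4 ^+ (k + d) < supp_fun K u) ->
    Sig K j (cone01 (L k)) <= c * 8 / 2 ^+ k.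
  elim: d => [|d IH] k hk.
    rewrite (_ : L k = set0); last first.
      rewrite -subset0 => u [wu /= hu]; have := hk u (ws _ wu).
      by rewrite addn0 ltNge hu.
    rewrite (_ : cone01 set0 = set0); last by rewrite -subset0 => x [t [u []]].
    by rewrite Sig0 divr_ge0 ?exprn_ge0// mulr_ge0.
  have IHk : Sig K j (cone01 (L k.+1)) <= c * 8 / 2 ^+ k.+1.
    by apply: IH => u us; rewrite addSnnS; exact: hk.
  rewrite (Sig_cone_split j cK (Ls k) (Ls k.+1) (bL k.+1)).
  have -> : L k `&` L k.+1 = L k.+1.
    apply/setIidr => u [wu hu]; split => //=; apply: (le_trans hu).
    by rewrite ler_pM2l// lef_pV2 ?posrE ?exprn_gt0// ler_weXn2l ?ler1n.
  have a0 : 0 < rho / 4 ^+ k.+1 by rewrite divr_gt0// exprn_gt0.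
  have h1 : Sig K j (cone01 (L k `\` L k.+1)) <= curv_const j M / (rho / 4 ^+ k.+1) `^ (1 - p) * sg (L k `\` L k.+1).
    apply: (solution_upper sol) => //.
    - by apply: borelD.
    - by move=> u [[/ws]].
    - by move=> u [[wu _] nu]; rewrite leNgt; apply/negP => hu; apply: nu; split => //=; exact: ltW.
  have h2 : sg (L k `\` L k.+1) <= A / 8 ^+ k.
    by apply: le_trans (layerA k); apply: sg_le; [exact: Ls|move=> u []].
  have f0 : 0 < 4 ^- k.+1 :> R by rewrite invr_gt0 exprn_gt0.
  have h3 : rho `^ (1 - p) / 4 ^+ k.+1 <= (rho / 4 ^+ k.+1) `^ (1 - p).
    rewrite powRM ?(ltW rho0) ?(ltW f0)// ler_pM2l//; apply: ger1_powR; last by rewrite gerBl.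
    by rewrite f0 invf_le1 ?exprn_gt0// exprn_ege1// ler1n.
  have h4 : Sig K j (cone01 (L k `\` L k.+1)) <= c * 4 / 2 ^+ k.
    apply: (le_trans h1); have -> : c * 4 / 2 ^+ k =
        curv_const j M / (rho `^ (1 - p) / 4 ^+ k.+1) * (A / 8 ^+ k).
      have e8 : 8 ^+ k = 4 ^+ k * 2 ^+ k :> R by rewrite -exprMn; congr (_ ^+ _); ring.
      have x0 : 4 ^+ k != 0 :> R by rewrite expf_neq0.
      have y0 : 2 ^+ k != 0 :> R by rewrite expf_neq0.
      rewrite /c e8 exprS; move: (4 ^+ k) (2 ^+ k) (rho `^ (1 - p)) (lt0r_neq0 rq) x0 y0 => x y z z0 x0 y0.
      by field; rewrite x0 y0 z0.
    apply: ler_pM => //.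
    - by rewrite divr_ge0 ?(ltW cc0)// powR_ge0.
    - by rewrite fine_ge0// outer_measure_ge0.
    - by rewrite ler_pM2l// lef_pV2 ?posrE ?divr_gt0 ?exprn_gt0 ?powR_gt0.
  apply: (le_trans (lerD IHk h4)); rewrite exprS le_eqVlt; apply/orP; left; apply/eqP.
  by field; rewrite expf_neq0.
have [N hN] : exists N : nat, forall u, @sphere R n u -> rho / 4 ^+ N < supp_fun K u.
  exists (Num.truncn (rho / r)).+1 => u us; apply: lt_le_trans (hr u us).
  rewrite ltr_pdivrMr ?exprn_gt0// mulrC -ltr_pdivrMr//; apply: (lt_le_trans (truncnS_gt _)).
  rewrite -natrX ler_nat ltnW// ltn_expl//.
have L0 := main N 0%N hN; rewrite expr0 divr1 in L0.
rewrite (Sig_cone_split j cK ws (Ls 0%N) (bL 0%N)).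
have -> : w `&` L 0%N = L 0%N by apply/setIidr => u [].
have h1 : Sig K j (cone01 (w `\` L 0%N)) <= curv_const j M / rho `^ (1 - p) * sg (w `\` L 0%N).
  apply: (solution_upper sol) => //; first exact: borelD.
    by move=> u [/ws].
  move=> u [wu nu]; rewrite leNgt; apply/negP => hu; apply: nu; split => //=.
  by rewrite expr0 divr1 ltW.
have h2 : Sig K j (cone01 (w `\` L 0%N)) <= c.
  apply: (le_trans h1); rewrite /c mulrAC ler_wpM2r ?invr_ge0 ?(ltW rq)// ler_pM2l//.
  by apply: le_trans wA; apply: sg_le => // u [].
apply: (le_trans (lerD L0 h2)); rewrite /c le_eqVlt; apply/orP; left; apply/eqP; ring.
Qed.

Lemma card_ord_range (a b : nat) : (b < n)%N -> #|[set i : 'I_n | (a < i <= b)%N]%SET| = (b - a)%N.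
Proof.
move=> bn; rewrite -sum1_card (eq_bigl (fun i : 'I_n => (a < i)%N && (i < b.+1)%N)); last first.
  by move=> i; rewrite !inE.
rewrite -(big_mkord (fun i => (a < i)%N && (i < b.+1)%N) (fun=> 1%N)).
rewrite -(@big_nat_widen _ _ _ 0 b.+1 n (fun i => (a < i)%N))// -(@big_nat_widenl _ _ _ a.+1 0 b.+1 xpredT)//.
by rewrite sum_nat_const_nat muln1 subSS.
Qed.

End UpperBound.

Section UpperBoundTheorem.
Variables (R : realType) (n' : nat).
Local Notation n := n'.+1.
Local Notation V := 'rV[R]_n.
Implicit Types (K w : set V) (x y z u q : V) (Q : 'M[R]_n) (p M a rho : R).

Lemma solution_lower K (j : nat) p M B : solution K j p M -> 0 <= 1 - p -> 0 < B ->
  (forall u, @sphere R n u -> supp_fun K u <= B) ->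
  sph_ae (fun u => exists2 s, sj_at K j u s & (expR M)^-1 / B `^ (1 - p) <= s).
Proof.
move=> [cK symK [r r0 hr] ac ae] q0 B0 hB; apply: sph_ae_imply ae => u us [s sj /andP[h1 _]].
exists s => //; have hu : 0 < supp_fun K u by apply: lt_le_trans (hr u us).
have hp : 0 < supp_fun K u `^ (1 - p) by exact: powR_gt0.
have Bp : 0 < B `^ (1 - p) by exact: powR_gt0.
have s0 : 0 < s.
  rewrite -(pmulr_rgt0 _ hp); apply: lt_le_trans h1; by rewrite invr_gt0 expR_gt0.
rewrite ler_pdivrMr// (le_trans h1)// mulrC ler_pM2l//.
by apply: ge0_ler_powR => //; rewrite ?nnegrE ?(ltW B0) ?(ltW hu)//; exact: hB.
Qed.

Lemma frame_width_pos K (j : nat) p M Q (b : 'I_n -> R) (i : 'I_n) : solution K j p M ->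
  Q *m Q^T = 1%:M -> (forall y, K y -> `|dotp y (row i Q)| <= b i) ->
  exists2 r : R, 0 < r & r <= b i /\ forall u, @sphere R n u -> r <= supp_fun K u.
Proof.
move=> [cK symK [r r0 hr] ac ae] oQ Kb; exists r => //; split => //.
have q1 : @sphere R n (row i Q) by exact: enorm_row.
apply: (le_trans (hr _ q1)); apply: supp_fun_le => // y Ky.
by rewrite dotpC; apply: le_trans (Kb y Ky); exact: ler_norm.
Qed.

Lemma sg_le_framebox w Q (b : 'I_n -> R) : w `<=` @sphere R n -> Q *m Q^T = 1%:M ->
  (forall i, 0 <= b i) -> (forall u i, w u -> `|dotp u (row i Q)| <= b i) ->
  sg w <= \prod_i (2 * b i).
Proof.
move=> ws oQ b0 wb; rewrite -(vol_framebox oQ)//; apply: vol_le; first exact: bnd_framebox.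
move=> x [t [u wu [/andP[t0 t1] ->]]] i; rewrite dotpZl normrM (gtr0_norm t0).
by apply: (le_trans _ (wb u i wu)); rewrite ler_piMl.
Qed.

Definition ord_range (a b : nat) : {set 'I_n} := [set i : 'I_n | (a < i <= b)%N]%SET.

Definition ord_prefix (b : nat) : {set 'I_n} := [set i : 'I_n | (i < b)%N]%SET.

Lemma prefix_range (j : nat) (jn : (j < n)%N) :
  (Ordinal jn |: ord_prefix j)%SET = (ord0 |: ord_range 0 j)%SET.
Proof. by apply/setP => i; rewrite !inE -!val_eqE /=; move: (val i) => k; lia. Qed.

Lemma ord0_notin_range (b : nat) : ord0 \notin ord_range 0 b.
Proof. by rewrite inE. Qed.

Lemma notin_prefix (j : nat) (jn : (j < n)%N) : Ordinal jn \notin ord_prefix j.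
Proof. by rewrite inE ltnn. Qed.

Lemma card_ord_prefix (j : nat) : (j < n)%N -> #|ord_prefix j| = j.
Proof.
move=> jn; have := congr1 (fun A : {set 'I_n} => #|A|) (prefix_range jn).
rewrite /= !cardsU1 ord0_notin_range notin_prefix card_ord_range// subn0 => /eqP.
by rewrite eqn_add2l => /eqP.
Qed.

Lemma prod_prefix_range (j : nat) (jn : (j < n)%N) (b : 'I_n -> R) :
  (\prod_(i in ord_prefix j) b i) * b (Ordinal jn) = b ord0 * \prod_(i in ord_range 0 j) b i.
Proof.
rewrite mulrC -(big_setU1 _ (notin_prefix jn)) prefix_range big_setU1//.
exact: ord0_notin_range.
Qed.

Lemma notin_range_gt (a b : nat) (i : 'I_n) : i \notin ord_range a b -> (i <= a)%N \/ (b < i)%N.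
Proof. by rewrite inE => h; lia. Qed.

(** With indices from 0, the total mass involves [X = b 0 ... b (j-1)] and the translation argument
    [Y = b 1 ... b j]. They are tied by [X b j = b 0 Y], which compares all these widths with the
    largest one. *)
Theorem upper_bound_exists (j : nat) p M : (0 < j)%N -> (j.+1 < n)%N -> 0 <= p < 1 ->
  exists2 C : R, 0 < C & forall K, solution K j p M -> forall u, @sphere R n u -> supp_fun K u <= C.
Proof.
move=> j0 jn /andP[p0 p1]; set N : R := n%:R; have N0 : 0 < N by rewrite ltr0n.
have q0 : 0 <= 1 - p by rewrite subr_ge0 ltW.
pose cT : R := 2 ^+ n / N ^+ n; have cT0 : 0 < cT by rewrite divr_gt0 ?exprn_gt0.
pose c3 : R := (expR M)^-1 / N `^ (1 - p) * (4 * N)^-1 ^+ n / 2 ^+ (n + n).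
have c30 : 0 < c3.
  by rewrite !mulr_gt0 ?invr_gt0 ?expR_gt0 ?powR_gt0 ?exprn_gt0 ?invr_gt0 ?mulr_gt0.
pose cU : R := 9 * curv_const n' j M * (2 ^+ n * 2).
have cU0 : 0 < cU.
  have jn'' : (j <= n')%N by rewrite -ltnS ltnW.
  by rewrite !mulr_gt0 ?exprn_gt0 ?expR_gt0// ltr0n bin_gt0.
pose C5 := cU / (c3 * cT); have C50 : 0 < C5 by rewrite divr_gt0// mulr_gt0.
pose C6 := C5 ^+ 2 ^+ j * cU * C5 / cT.
have C60 : 0 < C6.
  by apply: divr_gt0 => //; apply: mulr_gt0 => //; apply: mulr_gt0 => //; do 2 apply: exprn_gt0.
exists (N * (1 + C6)); first by rewrite mulr_gt0// addr_gt0.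
move=> K sol; have [cK symK _ _ _] := sol.
have o1 : (1%:M : 'M[R]_n) *m 1%:M^T = 1%:M by rewrite trmx1 mulmx1.
have [Q [b [x [[oQ xb xtri Kb bdec] _]]]] := greedy_frame_exists 0 cK o1.
have bpos i : 0 < b i.
  by have [r r0 [rb _]] := frame_width_pos sol oQ (fun y => Kb i y isT); exact: lt_le_trans rb.
have jn1 : (j < n)%N by exact: ltnW.
have n1 : (1 < n)%N by exact: leq_trans jn.
pose i0 : 'I_n := ord0; pose i1 : 'I_n := Ordinal n1.
pose ij : 'I_n := Ordinal jn1; pose ij1 : 'I_n := Ordinal jn.
pose Rr := b i0; pose b1 := b i1; pose bj := b ij.
have R0 : 0 < Rr by exact: bpos. have b10 : 0 < b1 by exact: bpos. have bj0 : 0 < bj by exact: bpos.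
have b1R : b1 <= Rr by exact: bdec.
have bjb1 : bj <= b1 by apply: bdec; rewrite /= j0.
have Kball y : K y -> enorm y <= N * Rr.
  move=> Ky; have oQT : Q^T *m (Q^T)^T = 1%:M by rewrite trmxK; exact: mulmx1C.
  rewrite -(enorm_orthogonal y oQT); apply: enorm_le_coord; first exact: ltW.
  by move=> i; rewrite -dotp_row (le_trans (Kb i y isT Ky))//; exact: bdec.
have NR : 0 < N * Rr by rewrite mulr_gt0.
have hNR u : @sphere R n u -> supp_fun K u <= N * Rr.
  by move=> u1; have := supp_fun_bound u cK Kball; rewrite (u1 : enorm u = 1) mulr1.
suff RC : Rr <= 1 + C6 by move=> u us; apply: (le_trans (hNR u us)); rewrite ler_pM2l.
pose JT := ord_prefix j; pose JI := ord_range 0 j.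
have cJI : #|JI| = j by rewrite card_ord_range// subn0.
pose X := \prod_(i in JT) b i; pose Y := \prod_(i in JI) b i.
have X0 : 0 < X by apply: prodr_gt0 => i _.
have Y0 : 0 < Y by apply: prodr_gt0 => i _.
have cJT : #|JT| = j by exact: card_ord_prefix.
have XY : X * bj = Rr * Y by exact: prod_prefix_range.
have Rq : 0 < Rr `^ (1 - p) by exact: powR_gt0.
(* The height is the width of index [j + 1], the first one left out; it exists because
   [j + 1 < n]. *)
have hb : c3 / Rr `^ (1 - p) <= Y.
  have D0 : 0 < (expR M)^-1 / (N * Rr) `^ (1 - p).
    by rewrite divr_gt0 ?invr_gt0 ?expR_gt0// powR_gt0.
  have ae := solution_lower sol q0 NR hNR.
  have := @curvature_product_lower R n' K Q b i0 JI _ (b ij1) cK oQ (fun y i Ky => Kb i y isT Ky) D0 (bpos ij1).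
  rewrite cJI => /(_ _ _ _ _ ae) h.
  have {}h : (expR M)^-1 / (N * Rr) `^ (1 - p) * (4 * N)^-1 ^+ n <= 2 ^+ (n + n) * Y.
    apply: h; first by rewrite -ltnS ltnW.
    - by rewrite inE.
    - by move=> i; rewrite inE => /andP[_ ij_]; apply: bdec => /=; exact: leqW.
    - move=> i ii /notin_range_gt[]; last by move=> ?; exact: bdec.
      by rewrite leqn0 => i00; case/eqP: ii; apply: val_inj; exact/eqP.
  move: h; rewrite powRM ?(ltW N0) ?(ltW R0)// => h.
  rewrite ler_pdivrMr// /c3 ler_pdivrMr ?exprn_gt0//.
  have Nq : 0 < N `^ (1 - p) by exact: powR_gt0.
  have := ler_wpM2r (ltW Rq) h; rewrite invfM.
  move: (N `^ (1 - p)) (Rr `^ (1 - p)) Nq Rq ((4 * N)^-1 ^+ n) (2 ^+ (n + n)) => N1 R1 N10 R10 f g.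
  have -> : (expR M)^-1 * (N1^-1 * R1^-1) * f * R1 = (expR M)^-1 / N1 * f.
    by field; rewrite !gt_eqF ?expR_gt0.
  by move/le_trans; apply; rewrite (_ : g * Y * R1 = Y * R1 * g)//; ring.
(* The disparity of the two largest widths, which is the loss in the upper bound on the total
   mass. *)
pose z := Num.sqrt (Rr / b1).
have zz : z ^+ 2 = Rr / b1 by rewrite sqr_sqrtr// divr_ge0 ?ltW.
have z1 : 1 <= z.
  have : 1 <= Rr / b1 by rewrite ler_pdivlMr// mul1r.
  by move/ler_wsqrtr; rewrite sqrtr1.
have z0 : 0 < z by exact: lt_le_trans z1.
have ha : cT * X <= cU * z / Rr `^ (1 - p).
  have h1 : cT * X <= Tm K (inord j).
    rewrite -cJT; apply: (Tm_lower (x := x) cK symK oQ).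
      by move=> i _; exact: xb.
    move=> i l; rewrite !inE -leqNgt => ij_ /orP[il|lj]; apply: xtri => //=.
    exact: leq_trans lj.
  apply: (le_trans h1).
  have jN : (inord j : 'I_n.+1) = j :> nat by rewrite inordK// ltnS ltnW.
  rewrite Tm_sphere ?jN//.
  pose rho := Rr; pose A := 2 ^+ n * 2 * z.
  have bS : borel (@sphere R n) by apply: borel_closed; exact: closed_sphere.
  have sol' : solution K (inord j : 'I_n.+1) p M by rewrite jN.
  have jj : (0 < (inord j : 'I_n.+1) < n)%N by rewrite jN j0.
  have lay : forall k : nat, sg (@sphere R n `&` [set u | supp_fun K u <= Rr / 4 ^+ k]) <= A / 8 ^+ k.
    (* On this sublevel set the point [x i0] bounds the first coordinate of [u] by [4^-k], and
       [x i1] bounds the second by [4 z^2 / 4^k]. As the second coordinate is at most 1, its square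
       obeys the same bound, whence [2 z / 2^k]; the product gives the decay [8^-k]. *)
    move=> k; pose h := Rr / 4 ^+ k; have h0 : 0 < h by rewrite divr_gt0// exprn_gt0.
    have f0 : 0 < 4 ^- k :> R by rewrite invr_gt0 exprn_gt0.
    pose bb (i : 'I_n) := if i == i0 then 4 ^- k else if i == i1 then 2 * z / 2 ^+ k else 1 : R.
    have bb0 i : 0 <= bb i.
      rewrite /bb; case: ifP => _; first exact: ltW.
      by case: ifP => // _; rewrite divr_ge0 ?exprn_ge0// mulr_ge0// ltW.
    have hK u y : K y -> supp_fun K u <= h -> `|dotp y u| <= h.
      move=> Ky uh; rewrite ler_norml; have := supp_fun_ge u cK Ky; have := supp_fun_ge u cK (symK _ Ky).
      rewrite dotpNr (dotpC u) => h1' h2'; move: h1' h2' uh; clear=> *; apply/andP; split; lra.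
    have [Kx0 xb0 _] := xb i0 isT; have [Kx1 xb1 _] := xb i1 isT.
    have exp y u : dotp y u = \sum_l dotp y (row l Q) * dotp u (row l Q).
      have oQT : Q^T *m (Q^T)^T = 1%:M by rewrite trmxK; exact: mulmx1C.
      by rewrite -(dotp_orthogonal y u oQT); apply: eq_bigr => l _; rewrite !dotp_row.
    apply: (@le_trans _ _ (\prod_i (2 * bb i))).
      apply: (sg_le_framebox _ oQ bb0); first by move=> u [].
      move=> u i [u1 uh]; have e1 : `|dotp u (row i Q)| <= 1.
        by apply: (le_trans (CauchySchwarz _ _)); rewrite (u1 : enorm u = 1) enorm_row// mulr1.
      have h1' : `|dotp u (row i0 Q)| <= 4 ^- k.
        have := hK u _ Kx0 uh; rewrite exp (bigD1 i0)//= big1 ?addr0; last first.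
          by move=> l li; rewrite xtri ?mul0r//= lt0n; exact: li.
        by rewrite xb0 normrM (gtr0_norm R0) ler_pM2l.
      rewrite /bb; case: eqVneq => [->//|ii0]; case: eqVneq => [ii1|//].
      rewrite ii1 in e1 *.
      have := hK u _ Kx1 uh; rewrite exp (bigD1 i0)//= (bigD1 i1)//= big1 ?addr0; last first.
        move=> l /andP[l0 l1]; rewrite xtri ?mul0r//= ltn_neqAle eq_sym; apply/andP; split; first exact: l1.
        by rewrite lt0n; exact: l0.
      rewrite xb1 -/b1 => h2'.
      have a1 : `|dotp (x i1) (row i0 Q)| <= Rr by exact: Kb.
      have h3' : `|dotp (x i1) (row i0 Q) * dotp u (row i0 Q)| <= h.
        by rewrite normrM; apply: ler_pM.
      have h4' : b1 * `|dotp u (row i1 Q)| <= 2 * h.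
        rewrite -(gtr0_norm b10) -normrM.
        have -> : b1 * dotp u (row i1 Q) = (dotp (x i1) (row i0 Q) * dotp u (row i0 Q) + b1 * dotp u (row i1 Q)) - dotp (x i1) (row i0 Q) * dotp u (row i0 Q) by ring.
        by apply: (le_trans (ler_normB _ _)); lra.
      have h5' : `|dotp u (row i1 Q)| ^+ 2 <= (2 * z / 2 ^+ k) ^+ 2.
        apply: (@le_trans _ _ (`|dotp u (row i1 Q)|)).
          by rewrite expr2 ler_piMl.
        rewrite expr_div_n exprMn zz -exprM mulnC exprM.
        have -> : 2 ^+ 2 = 4 :> R by ring.
        have -> : 4 * (Rr / b1) / 4 ^+ k = 2 * (2 * h) / b1 by rewrite /h; field; rewrite expf_neq0// gt_eqF.
        rewrite ler_pdivlMr// mulrC; apply: (le_trans h4'); rewrite ler_peMl// ?ler1n//.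
        by rewrite mulr_ge0// ltW.
      by rewrite -(ler_pXn2r (_ : (0 < 2)%N))// ?nnegrE// divr_ge0 ?exprn_ge0// mulr_ge0// ltW.
    rewrite big_split /= prodr_const card_ord (bigD1 i0)//= (bigD1 i1)//= big1 ?mulr1; last first.
      by move=> l /andP[/negbTE l0 /negbTE l1]; rewrite /bb l0 l1.
    rewrite /bb eqxx /= /A; have -> : 8 ^+ k = 4 ^+ k * 2 ^+ k :> R by rewrite -exprMn; congr (_ ^+ _); ring.
    rewrite le_eqVlt; apply/orP; left; apply/eqP; move: (2 ^+ n) => g.
    have x0 : 4 ^+ k != 0 :> R by rewrite expf_neq0.
    have y0 : 2 ^+ k != 0 :> R by rewrite expf_neq0.
    by move: (4 ^+ k) (2 ^+ k) x0 y0 => c d x0 y0; field; rewrite x0 y0.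
  have tot : sg (@sphere R n) <= A.
    apply: (@le_trans _ _ (\prod_(i < n) (2 * 1))).
      apply: (sg_le_framebox (Q := Q)) => // u i u1.
      by apply: (le_trans (CauchySchwarz _ _)); rewrite (u1 : enorm u = 1) enorm_row// mulr1.
    rewrite mulr1 prodr_const card_ord /A -mulrA ler_peMr ?exprn_ge0//; lra.
  have := layer_bound sol' jj bS (fun u h => h) p0 p1 R0 tot lay.
  rewrite jN => /le_trans; apply; rewrite /A /cU le_eqVlt; apply/orP; left; apply/eqP; ring.
have key : Rr <= C5 * bj * z.
  have h1 : cT * (Rr * Y) <= cU * z * bj * (Y / c3).
    rewrite -XY mulrA; apply: (le_trans (ler_wpM2r (ltW bj0) ha)).
    rewrite mulrAC; apply: ler_wpM2l; first by do 2 (apply: mulr_ge0; last exact: ltW); exact: ltW.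
    by rewrite ler_pdivlMr// mulrC.
  have cTY : 0 < cT * Y by rewrite mulr_gt0.
  rewrite -(ler_pM2l cTY); have -> : cT * Y * Rr = cT * (Rr * Y) by ring.
  apply: (le_trans h1); rewrite /C5 le_eqVlt; apply/orP; left; apply/eqP.
  by field; rewrite !gt_eqF.
(* Since [b j <= b 1] and [Rr = z^2 b 1], one factor [z] survives on the left. With [z] bounded, the
   widths up to index [j] are comparable to [Rr], and the bound on the total mass finally limits
   [Rr] itself. *)
have zC5 : z <= C5.
  have : Rr <= C5 * b1 * z.
    by apply: (le_trans key); rewrite ler_pM2r// ler_pM2l.
  have -> : Rr = z ^+ 2 * b1 by rewrite zz divfK// gt_eqF.
  have -> : C5 * b1 * z = C5 * (b1 * z) by ring.
  have -> : z ^+ 2 * b1 = z * (b1 * z) by ring.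
  by rewrite ler_pM2r// mulr_gt0.
have RbJ : Rr / C5 ^+ 2 <= bj.
  rewrite ler_pdivrMr ?exprn_gt0//; apply: (le_trans key).
  have -> : bj * C5 ^+ 2 = C5 * bj * C5 by ring.
  by rewrite ler_pM2l// mulr_gt0.
have XR : (Rr / C5 ^+ 2) ^+ j <= X.
  rewrite -{1}cJT -prodr_const; apply: ler_prod => i; rewrite inE => ij_.
  rewrite divr_ge0 ?(ltW R0) ?sqr_ge0//=; by apply: (le_trans RbJ); apply: bdec => /=; exact: ltnW.
have [R1|R1] := leP Rr 1; first by rewrite (le_trans R1)// lerDl ltW.
have RR : 1 <= Rr `^ (1 - p).
  by rewrite -[leLHS](powRr0 Rr); apply: ler_powR => //; exact: ltW.
have h1 : cT * (Rr / C5 ^+ 2) ^+ j <= cU * C5.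
  apply: (@le_trans _ _ (cT * X)); first by rewrite ler_pM2l.
  apply: (le_trans ha); rewrite ler_pdivrMr// -[leLHS]mulr1; apply: ler_pM => //.
  - by rewrite mulr_ge0 ?ltW.
  - by rewrite ler_pM2l.
have h2 : Rr <= Rr ^+ j by rewrite -{1}[Rr]expr1 ler_weXn2l// ltW.
apply: (le_trans h2); apply: (@le_trans _ _ C6); last by rewrite lerDr.
have C5j : 0 < C5 ^+ 2 ^+ j by rewrite !exprn_gt0.
rewrite /C6 ler_pdivlMr// mulrC.
have -> : cT * Rr ^+ j = C5 ^+ 2 ^+ j * (cT * (Rr / C5 ^+ 2) ^+ j).
  rewrite (expr_div_n Rr (C5 ^+ 2) j); move: (C5 ^+ 2 ^+ j) (lt0r_neq0 C5j) => g g0.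
  by rewrite mulrCA; congr (_ * _); rewrite mulrC divfK.
by rewrite -mulrA ler_pM2l.
Qed.

End UpperBoundTheorem.

(** * Lower bound *)

Section FlatBodies.
Variables (R : realType) (n' : nat).
Local Notation n := n'.+1.
Local Notation V := 'rV[R]_n.
Variable e : V.
Hypothesis e1 : enorm e = 1.
Implicit Types (K L C : set V) (x y z u : V) (s t d b : R) (m : 'I_n.+1).

Definition hpart z : V := z - dotp z e *: e.

Lemma dotp_ee : dotp e e = 1. Proof. by rewrite -sqr_enorm e1 expr1n. Qed.

Lemma dotp_hpart z : dotp (hpart z) e = 0.
Proof. by rewrite /hpart dotpBl dotpZl dotp_ee mulr1 subrr. Qed.

Lemma hpartK z : z = hpart z + dotp z e *: e. Proof. by rewrite subrK. Qed.

Lemma hpart_shift z t : hpart (z + t *: e) = hpart z.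
Proof. by rewrite /hpart dotpDl dotpZl dotp_ee mulr1 scalerDl opprD addrACA subrr addr0. Qed.

Lemma hpartB z y : hpart (z - y) = hpart z - hpart y.
Proof. by rewrite /hpart dotpBl; apply/rowP => i; rewrite !mxE; ring. Qed.

Lemma hpartZ t z : hpart (t *: z) = t *: hpart z.
Proof. by rewrite /hpart dotpZl; apply/rowP => i; rewrite !mxE; ring. Qed.

Lemma hpartD z y : hpart (z + y) = hpart z + hpart y.
Proof. by rewrite /hpart dotpDl; apply/rowP => i; rewrite !mxE; ring. Qed.

Lemma enorm_hpart_le z : enorm (hpart z) <= enorm z.
Proof.
rewrite -(ler_pXn2r (_ : (0 < 2)%N))// ?nnegrE ?enorm_ge0// !sqr_enorm.
have := hpartK z; have := dotp_hpart z; move: (hpart z) (dotp z e) => h a he ->.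
rewrite dotpDl !dotpDr !dotpZl !dotpZr (dotpC e) he dotp_ee.
by have := sqr_ge0 a; rewrite expr2; lra.
Qed.

Lemma abs_dotp_e z : `|dotp z e| <= enorm z.
Proof. by apply: (le_trans (CauchySchwarz _ _)); rewrite e1 mulr1. Qed.

Lemma enorm_le_parts z : enorm z <= enorm (hpart z) + `|dotp z e|.
Proof. by rewrite {1}(hpartK z) (le_trans (enormD _ _))// enormZ e1 mulr1. Qed.

Definition flat L := forall w, L w -> dotp w e = 0.

Lemma flat_scale L s : flat L -> flat (scaleS s L).
Proof. by move=> fL _ [w Lw <-]; rewrite dotpZl fL// mulr0. Qed.

(** A translation along the normal of the hyperplane leaves the projection onto a flat body
    unchanged. *)
Lemma psi_shift L x t : ccv L -> flat L -> psi L (x + t *: e) = psi L x + t *: e.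
Proof.
move=> cL fL; have [Lp _] := projP x cL.
suff -> : psi L (x + t *: e) = x + t *: e - proj L x by rewrite /psi addrAC.
rewrite /psi; congr (_ - _); apply: proj_uniq => // w Lw.
have we : dotp (w - proj L x) e = 0 by rewrite dotpBl !fL// subrr.
by rewrite addrAC dotpDr dotpZr we mulr0 addr0; exact: proj_var.
Qed.

Definition shift t C : set V := [set z | C (z - t *: e)].

Lemma mu_shift L s t C : ccv L -> flat L -> mu L s (shift t C) = mu L s C.
Proof.
move=> cL fL; rewrite /mu -[in RHS](leb_shift (t *: e)); congr (fine (leb_outer _)).
have cs := ccv_scale s cL; have fs := @flat_scale L s fL.
apply/seteqP; split => x.
  rewrite /preimage /= /shift /= => h; exists (x - t *: e); last by rewrite addrC subrK.
  by rewrite /preimage /= -scaleNr psi_shift// scaleNr.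
by move=> [y Cy <-]; rewrite /preimage /= /shift /= [t *: e + y]addrC psi_shift// addrK.
Qed.

Lemma Sig_shift L m t C : ccv L -> flat L -> Sig L m (shift t C) = Sig L m C.
Proof. by move=> cL fL; apply: eq_bigr => k _; rewrite mu_shift. Qed.

Definition squeeze d : 'M[R]_n := d *: 1%:M + (1 - d) *: (e^T *m e).

Lemma squeezeE d z : z *m squeeze d = d *: hpart z + dotp z e *: e.
Proof.
rewrite mulmxDr -!scalemxAr mulmx1 mulmxA mulmx_tr_dotp mul_scalar_mx /hpart.
by apply/rowP => i; rewrite !mxE; ring.
Qed.

Lemma det_squeeze d : 0 < d -> \det (squeeze d) = d ^+ n'.
Proof.
move=> d0; have -> : squeeze d = d *: (1%:M + ((1 - d) / d *: e^T) *m e).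
  rewrite scalerDr -scalemxAl scalerA; congr (_ + _ *: _).
  by rewrite mulrC divfK// gt_eqF.
rewrite detZ det_1_mulmxC -scalemxAr mulmx_tr_dotp dotp_ee det_mx11 !mxE eqxx mulr1n mulr1.
by rewrite exprS; field; rewrite gt_eqF.
Qed.

(** Squeezing the hyperplane directions by [d] carries [(s / d) L] to [s L] and, since [L] is flat,
    normal vectors to normal vectors. Hence the coefficient of order [m] is multiplied by
    [d^(n-1-m)]. *)
Lemma mu_squeeze L s d C : ccv L -> flat L -> 0 < d -> bnd C ->
  mu L s (mulmxr (squeeze d) @` C) = d ^+ n' * mu L (s / d) C.
Proof.
move=> cL fL d0 bC; have uD : squeeze d \in unitmx.
  by rewrite unitmxE det_squeeze// unitfE expf_neq0// gt_eqF.
have cs := ccv_scale (s / d) cL; have fs := @flat_scale L (s / d) fL.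
have cs' := ccv_scale s cL.
have E x : psi (scaleS s L) (x *m squeeze d) = psi (scaleS (s / d) L) x *m squeeze d.
  have [Lp _] := projP x cs; set y := proj (scaleS (s / d) L) x in Lp.
  have sE (w : V) : scaleS (s / d) L w -> scaleS s L (d *: w).
    by move=> [v Lv <-]; exists v => //; rewrite scalerA mulrC divfK// gt_eqF.
  have yE : y *m squeeze d = d *: y by rewrite squeezeE /hpart (fs _ Lp) !scale0r subr0 addr0.
  have pE : proj (scaleS s L) (x *m squeeze d) = y *m squeeze d.
    rewrite yE; apply: proj_uniq => //; first exact: sE.
    move=> _ [v Lv <-]; have Lw : scaleS (s / d) L ((s / d) *: v) by exists v.
    have -> : s *: v = d *: ((s / d) *: v) by rewrite scalerA mulrC divfK// gt_eqF.
    move: ((s / d) *: v) Lw => w Lw; rewrite -scalerBr -yE -mulmxBl dotpZl squeezeE dotpDr !dotpZr.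
    have we : dotp (w - y) e = 0 by rewrite dotpBl !fs// subrr.
    rewrite we mulr0 addr0 mulrA pmulr_rle0 ?mulr_gt0//.
    by rewrite /hpart dotpBr dotpZr we mulr0 subr0; exact: proj_var.
  by rewrite /psi pE mulmxBl.
rewrite /mu (_ : _ @^-1` _ = mulmxr (squeeze d) @` (psi (scaleS (s / d) L) @^-1` C)); last first.
  apply/seteqP; split => x.
    rewrite /preimage /= => -[c Cc cE]; exists (x *m invmx (squeeze d)); last by rewrite /= mulmxKV.
    have := E (x *m invmx (squeeze d)); rewrite mulmxKV// -cE /= => h.
    rewrite /preimage /=; suff <- : c = psi (scaleS (s / d) L) (x *m invmx (squeeze d)) by [].
    by rewrite -[LHS](mulmxK uD) h mulmxK.
  by move=> [y Cy <-]; rewrite /preimage /= E; exists (psi (scaleS (s / d) L) y).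
rewrite leb_mulmx// det_squeeze// gtr0_norm ?exprn_gt0// fineM//.
by rewrite muE.
Qed.

Lemma Sig_squeeze L m d C : ccv L -> flat L -> 0 < d -> borel C -> bnd C ->
  Sig L m (mulmxr (squeeze d) @` C) = d ^+ n' / d ^+ m * Sig L m C.
Proof.
move=> cL fL d0 bC bdC.
apply: (@Sig_uniq _ _ _ _ (fun i : 'I_n.+1 => d ^+ n' / d ^+ i * Sig L i C)) => s s0.
rewrite mu_squeeze// steiner_formula ?divr_gt0// mulr_sumr; apply: eq_bigr => i _.
by rewrite expr_div_n; field; rewrite expf_neq0// gt_eqF.
Qed.

(** A cone around [e] of aperture [d], truncated by a hyperplane and not by a sphere, so that
    squeezing changes only the aperture. *)
Definition ncone d b : set V := [set z | 0 < dotp z e <= b /\ enorm (hpart z) <= d * dotp z e].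

Lemma ncone_squeeze d b : 0 < d -> ncone d b = mulmxr (squeeze d) @` ncone 1 b.
Proof.
move=> d0; have dot x : dotp (x *m squeeze d) e = dotp x e.
  by rewrite squeezeE dotpDl !dotpZl dotp_hpart dotp_ee mulr0 add0r mulr1.
have hp x : hpart (x *m squeeze d) = d *: hpart x.
  rewrite squeezeE hpart_shift hpartZ; congr (_ *: _).
  by rewrite {1}/hpart dotp_hpart scale0r subr0.
have uD : squeeze d \in unitmx.
  by rewrite unitmxE det_squeeze// unitfE expf_neq0// gt_eqF.
have main x : ncone d b (x *m squeeze d) <-> ncone 1 b x.
  by rewrite /ncone /= dot hp enormZ (gtr0_norm d0) ler_pM2l// mul1r.
apply/seteqP; split => x; last by move=> [y /main h <-].
by rewrite -{1}(mulmxKV uD x) => /main h; exists (x *m invmx (squeeze d)) => //=; rewrite mulmxKV.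
Qed.

Lemma ncone_scale d t : 0 < t -> ncone d t = scaleS t (ncone d 1).
Proof.
move=> t0; have main x : ncone d t (t *: x) <-> ncone d 1 x.
  rewrite /ncone /= hpartZ dotpZl enormZ (gtr0_norm t0) pmulr_rgt0// -[X in _ <= X]mulr1.
  by rewrite ler_pM2l// mulrCA ler_pM2l// mulr1.
apply/seteqP; split => x; last by move=> [y /main h <-].
have xE : x = t *: (t^-1 *: x) by rewrite scalerA divff ?scale1r// gt_eqF.
by rewrite {1}xE => /main h; exists (t^-1 *: x) => //.
Qed.

Lemma bnd_ncone d b : 0 <= d -> bnd (ncone d b).
Proof.
move=> d0; exists (d * b + b) => x [/andP[x0 xb] h]; rewrite /eball /= (le_trans (enorm_le_parts _))//.
rewrite gtr0_norm// lerD// (le_trans h)// ler_wpM2l//.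
Qed.

Lemma ncone_eball d b : 0 <= d -> ncone d b `<=` @eball R n (d * b + b).
Proof.
move=> d0 x [/andP[x0 xb] h]; rewrite /eball /= (le_trans (enorm_le_parts _))//.
rewrite gtr0_norm// lerD// (le_trans h)// ler_wpM2l//.
Qed.

Lemma dotpr_continuous : continuous (fun z => dotp z e).
Proof.
rewrite (_ : (fun z => dotp z e) = dotp e); first exact: dotp_continuous.
by apply/funext => z; exact: dotpC.
Qed.

Lemma borel_pos : borel [set z : V | 0 < dotp z e].
Proof.
apply: borel_open; apply: (@open_comp _ _ (fun z : V => dotp z e) [set s | 0 < s]); last exact: open_gt.
by move=> x _; exact: dotpr_continuous.
Qed.

Lemma borel_narrow d : borel [set z : V | enorm (hpart z) <= d * dotp z e].
Proof.
rewrite (_ : [set z | _] = ~` [set z : V | d * dotp z e < enorm (hpart z)]); last first.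
  by apply/seteqP; split => z /=; rewrite leNgt => /negP.
apply: borelC; apply: borel_open; apply/open_enormP => x /= xd.
pose g := enorm (hpart x) - d * dotp x e; have g0 : 0 < g by rewrite subr_gt0.
have k0 : 0 < 1 + `|d| by rewrite ltr_pwDl.
exists (g / (1 + `|d|)); first exact: divr_gt0.
move=> y; rewrite ltr_pdivlMr// => yx.
have h1 : enorm (hpart x) <= enorm (hpart y) + enorm (y - x).
  rewrite -[hpart x](subrK (hpart y)) addrC (le_trans (enormD _ _))// lerD2l -hpartB.
  by rewrite (le_trans (enorm_hpart_le _))// enormBC.
have h2 : d * dotp y e - d * dotp x e <= `|d| * enorm (y - x).
  rewrite -mulrBr -dotpBl; apply: (le_trans (ler_norm _)).
  by rewrite normrM ler_wpM2l// abs_dotp_e.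
rewrite /= ; move: yx; rewrite mulrDr mulr1 [enorm _ * _]mulrC /g; lra.
Qed.

Lemma borel_ncone d b : borel (ncone d b).
Proof.
rewrite (_ : ncone d b = [set z | 0 < dotp z e] `&` [set z | dotp z e <= b] `&`
   [set z | enorm (hpart z) <= d * dotp z e]); last first.
  by apply/seteqP; split => z /=; [move=> [/andP[]]|move=> [[h1 h2] h3]; rewrite /ncone /= h1 h2].
apply: borelI; last exact: borel_narrow.
apply: borelI; first exact: borel_pos.
apply: borel_closed; rewrite (_ : [set z | _] = (fun z : V => dotp z e) @^-1` [set s | s <= b])//.
by apply: preimage_closed; [move=> x _; exact: dotpr_continuous|exact: closed_le].
Qed.

(** Squeezing reduces to aperture 1, where the cone can be compared with the unit ball by
    translation invariance along [e]. *)
Lemma Sig_ncone_lower L m d : ccv L -> flat L -> 0 < d ->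
  d ^+ n' / d ^+ m * (Tm L m / 4 ^+ n) <= Sig L m (ncone d 1).
Proof.
move=> cL fL d0; rewrite ncone_squeeze// Sig_squeeze//; [|exact: borel_ncone|exact: bnd_ncone].
rewrite ler_pM2l ?divr_gt0 ?exprn_gt0//.
(* The unit ball centred at [3 e] has heights between 2 and 4 and radius 1, and so lies in the cone
   of aperture 1 and height 4. *)
have h : Tm L m <= Sig L m (ncone 1 4).
  rewrite /Tm -(Sig_shift m 3 _ cL fL); apply: Sig_le => //; [exact: bnd_ncone| |exact: borel_ncone|].
    apply: (@borel_preimage R n' (fun x => x - 3 *: e)); last exact: borel_eball.
    by move=> x; apply: (continuousB _ (@cst_continuous _ _ _ _)) => //; exact: id_continuous.
  move=> z; rewrite /shift /eball /= => h; rewrite /ncone /=.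
  have h1 := le_trans (abs_dotp_e (z - 3 *: e)) h.
  have h2 := le_trans (enorm_hpart_le (z - 3 *: e)) h.
  move: h1 h2; rewrite dotpBl dotpZl dotp_ee mulr1 -scaleNr hpart_shift ler_norml => /andP[h1 h3] h2.
  by split; [apply/andP; split; lra|lra].
rewrite ler_pdivrMr ?exprn_gt0// (le_trans h)// ncone_scale// Sig_scale//; [|exact: borel_ncone|exact: bnd_ncone].
rewrite mulrC ler_wpM2l//; last by rewrite ler_weXn2l ?ler1n// leq_subr.
by apply: Sig_ge0 => //; [exact: borel_ncone|exact: bnd_ncone].
Qed.

Lemma mu_ncone_gap L s d t : ccv L -> flat L -> 0 < s -> 0 < d -> 0 <= t < 1 ->
  mu L s (ncone d (1 + t)) - mu L s (ncone d (1 - t)) <= n%:R * 2 ^+ n * t * mu L s (ncone d 1).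
Proof.
move=> cL fL s0 d0 /andP[t0 t1].
have bC := borel_ncone d; have bdC b := bnd_ncone b (ltW d0).
rewrite !steiner_formula// -sumrB mulr_sumr; apply: ler_sum => m _.
rewrite (ncone_scale d (_ : 0 < 1 + t)) ?(ncone_scale d (_ : 0 < 1 - t)) ?Sig_scale//; [|lra..].
have h0 : 0 <= s ^+ m * Sig L m (ncone d 1).
  by rewrite mulr_ge0 ?Sig_ge0// exprn_ge0// ltW.
have -> : s ^+ m * ((1 + t) ^+ (n - m) * Sig L m (ncone d 1)) - s ^+ m * ((1 - t) ^+ (n - m) * Sig L m (ncone d 1)) =
  ((1 + t) ^+ (n - m) - (1 - t) ^+ (n - m)) * (s ^+ m * Sig L m (ncone d 1)) by ring.
apply: ler_wpM2r => //; have t01 : 0 <= t <= 1 by rewrite t0 ltW.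
apply: (le_trans (expr_gap (n - m) t01)); rewrite ler_wpM2r//.
by apply: ler_pM; rewrite ?exprn_ge0// ?ler_nat ?leq_subr// ler_weXn2l ?ler1n// leq_subr.
Qed.

(** Of the shift along [e], the part [eps] restores the height lost by a perturbation of size [eps],
    and [eps / d] makes room for the sideways displacement at slope [d]. *)
Lemma ncone_close_upper d a c eps : 0 < d -> 0 <= eps -> enorm (a - c) <= eps -> ncone d 1 a ->
  ncone d (1 + 2 * (eps + eps / d)) (c + (eps + eps / d) *: e).
Proof.
move=> d0 e0 ac [/andP[a0 a1] ah].
have h1 := le_trans (abs_dotp_e (a - c)) ac; have h2 := le_trans (enorm_hpart_le (a - c)) ac.
move: h1; rewrite dotpBl ler_norml => /andP[h1 h3].
have ed : 0 <= eps / d by rewrite divr_ge0// ltW.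
have edE : d * (eps / d) = eps by rewrite mulrC divfK// gt_eqF.
have h4 : enorm (hpart c) <= enorm (hpart a) + eps.
  rewrite hpartB enormBC in h2; rewrite -[hpart c](subrK (hpart a)) addrC.
  by rewrite (le_trans (enormD _ _))// lerD2l.
have h5 : d * dotp a e <= d * (dotp c e + eps) by rewrite ler_pM2l//; lra.
rewrite /ncone /= hpart_shift dotpDl dotpZl dotp_ee mulr1; split.
  by apply/andP; split; lra.
by move: h5; rewrite !mulrDr edE; lra.
Qed.

Lemma ncone_close_lower d a c eps : 0 < d -> 0 < eps -> enorm (a - c) <= eps ->
  ncone d (1 - 2 * (eps + eps / d)) (c - (eps + eps / d) *: e) -> ncone d 1 a.
Proof.
move=> d0 e0 ac; rewrite /ncone /= -scaleNr hpart_shift dotpDl dotpZl dotp_ee mulr1.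
move=> [/andP[c0 c1] ch].
have h1 := le_trans (abs_dotp_e (a - c)) ac; have h2 := le_trans (enorm_hpart_le (a - c)) ac.
move: h1; rewrite dotpBl ler_norml => /andP[h1 h3].
have ed : 0 <= eps / d by rewrite divr_ge0 ?ltW.
have edE : d * (eps / d) = eps by rewrite mulrC divfK// gt_eqF.
have h4 : enorm (hpart a) <= enorm (hpart c) + eps.
  rewrite hpartB in h2; rewrite -[hpart a](subrK (hpart c)) addrC.
  by rewrite (le_trans (enormD _ _))// lerD2l.
split; first by apply/andP; split; lra.
have h5 : d * (dotp c e - eps) <= d * dotp a e by rewrite ler_pM2l//; lra.
by move: ch h5; rewrite !mulrDr !mulrN !mulrDr edE; lra.
Qed.

End FlatBodies.

Section FlatApproximation.
Variables (R : realType) (n' : nat).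
Local Notation n := n'.+1.
Local Notation V := 'rV[R]_n.
Implicit Types (K L w : set V) (e x y z u : V) (Q : 'M[R]_n) (d eps t r C : R) (j : 'I_n.+1).

Lemma ccv_hpart e K : enorm e = 1 -> ccv K -> ccv (hpart e @` K).
Proof.
move=> e1 [cK vK [a Ka]]; split.
- apply: continuous_compact cK; apply: continuous_subspaceT.
  apply: (@lipschitz_continuous R n n _ 1) => x y.
  by rewrite -hpartB mul1r enorm_hpart_le.
- move=> _ _ t [x Kx <-] [y Ky <-] t01; exists (t *: x + (1 - t) *: y); first exact: vK.
  by rewrite hpartD !hpartZ.
- by exists (hpart e a), a.
Qed.

Lemma flat_hpart e K : enorm e = 1 -> flat e (hpart e @` K).
Proof. by move=> e1 _ [x _ <-]; rewrite dotp_hpart. Qed.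

Definition approx_const (j : 'I_n.+1) C : R :=
  \sum_(k < n.+1) `|lagrange R n j k| * (n%:R * 2 ^+ n * (2 * (n.+1%:R * C + 2)) ^+ n).

(** Replacing [K] by its projection moves normal vectors by at most [eps], where [r] may be of order
    [eps^2] by the Hölder estimate. The displacement is absorbed by shifts along [e], which do not
    affect the flat body, and by changing the height of the cone to [1 + t] or [1 - t], which
    homogeneity controls. *)
Lemma flat_approx K e C r d eps t j : ccv K -> enorm e = 1 -> (forall y, K y -> enorm y <= C) ->
  (forall y, K y -> `|dotp y e| <= r) -> 0 < d <= 1 -> 0 < eps -> t = 2 * (eps + eps / d) -> t < 1 ->
  n.+1%:R * r <= 1 -> 7 * (n.+1%:R * r) <= eps ^+ 2 ->
  Sig (hpart e @` K) j (ncone e d 1) - Sig K j (ncone e d 1) <= approx_const j C * t.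
Proof.
move=> cK e1 KC Kr /andP[d0 d1] e0 tE t1 nr1 nre; set L := _ @` K.
have cL : ccv L by exact: ccv_hpart.
have fL : flat e L by exact: flat_hpart.
have [y0 Ky0] : K !=set0 by case: cK.
have r0 : 0 <= r by apply: le_trans (normr_ge0 _) (Kr _ Ky0).
have C0 : 0 <= C by apply: le_trans (enorm_ge0 _) (KC _ Ky0).
have ed0 : 0 < eps / d by rewrite divr_gt0.
have t0 : 0 < t by rewrite tE; lra.
have LC y : L y -> enorm y <= C.
  by move=> [x Kx <-]; rewrite (le_trans (enorm_hpart_le e1 _))// KC.
have KL y : K y -> exists2 z, L z & enorm (y - z) <= r.
  move=> Ky; exists (hpart e y); first by exists y.
  by rewrite /hpart subKr enormZ e1 mulr1 Kr.
have LK y : L y -> exists2 z, K z & enorm (y - z) <= r.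
  move=> [x Kx <-]; exists x => //.
  by rewrite enormBC /hpart subKr enormZ e1 mulr1 Kr.
have bdN b : bnd (ncone e d b) by apply: bnd_ncone => //; exact: ltW.
have key (k : 'I_n.+1) : `|mu L k.+1%:R (ncone e d 1) - mu K k.+1%:R (ncone e d 1)| <=
    n%:R * 2 ^+ n * (2 * (n.+1%:R * C + 2)) ^+ n * t.
  have s0 : 0 < k.+1%:R :> R by [].
  have sn : k.+1%:R <= n.+1%:R :> R by rewrite ler_nat.
  move: (k.+1%:R) s0 sn => s s0 sn.
  have csK : ccv (scaleS s K) by exact: ccv_scale.
  have csL : ccv (scaleS s L) by exact: ccv_scale.
  have hKL := hausdorff_scale (ltW s0) KL; have hLK := hausdorff_scale (ltW s0) LK.
  have sr : s * r <= n.+1%:R * r by rewrite ler_wpM2r.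
  have sr1 : s * r <= 1 by exact: le_trans nr1.
  (* The number 3 bounds the normal vectors concerned: the cone lies in the ball of radius 2, and
     the shift [t / 2] is below 1. This is the origin of the 7 in the hypothesis. *)
  have sre : s * r * (2 * 3 + 1) <= eps ^+ 2 by apply: le_trans nre; lra.
  have inN b x : b <= 1 -> ncone e d b x -> enorm x <= 2.
    move=> b1 xb; have := @ncone_eball R n' e e1 d b (ltW d0) x xb; rewrite /eball /= => /le_trans; apply.
    have [/andP[x0 xb'] _] := xb; have b0 : 0 < b by exact: lt_le_trans xb'.
    have db : d * b <= 1 * 1 by apply: ler_pM => //; exact: ltW.
    lra.
  have up : mu K s (ncone e d 1) <= mu L s (ncone e d (1 + t)).
    rewrite -(@mu_shift R n' e L s (- (t / 2)) _ cL fL) -lee_fin -!muE//.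
      apply: le_leb_outer => x xN.
      have xn : enorm (psi (scaleS s K) x) <= 3 by apply: (le_trans (inN _ _ (lexx 1) xN)); lra.
      have := psi_close csK csL e0 hKL hLK sr1 sre xn => cl.
      have := ncone_close_upper e1 d0 (ltW e0) cl xN.
      rewrite /preimage /shift /= scaleNr opprK -tE.
      by have -> : t / 2 = eps + eps / d by rewrite tE mulrC mulKf.
    have [q Nq] := bdN (1 + t); exists (q + t / 2) => x; rewrite /shift /= => /Nq; rewrite /eball /= => h.
    rewrite -[x](subrK (- (t / 2) *: e)) (le_trans (enormD _ _))// lerD//.
    by rewrite enormZ e1 mulr1 normrN ger0_norm// divr_ge0// ltW.
  have lo : mu L s (ncone e d (1 - t)) <= mu K s (ncone e d 1).
    have bs : bnd (shift e (t / 2) (ncone e d (1 - t))).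
      have [q Nq] := bdN (1 - t); exists (q + t / 2) => x; rewrite /shift /= => /Nq; rewrite /eball /= => h.
      rewrite -[x](subrK ((t / 2) *: e)) (le_trans (enormD _ _))// lerD//.
      by rewrite enormZ e1 mulr1 ger0_norm// divr_ge0// ltW.
    rewrite -(@mu_shift R n' e L s (t / 2) _ cL fL) -lee_fin -!muE//.
    apply: le_leb_outer => x xN.
    have xn : enorm (psi (scaleS s L) x) <= 3.
      rewrite -[psi _ x](subrK ((t / 2) *: e)) (le_trans (enormD _ _))//.
      rewrite enormZ e1 mulr1 ger0_norm ?divr_ge0 ?(ltW t0)//.
      have t1' : 1 - t <= 1 by lra.
      by have := inN _ _ t1' xN; lra.
    have := psi_close csL csK e0 hLK hKL sr1 sre xn; rewrite enormBC => cl.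
    apply: (ncone_close_lower e1 d0 e0 cl); move: xN; rewrite /preimage /shift /= -tE.
    by have -> : t / 2 = eps + eps / d by rewrite tE mulrC mulKf.
  have mono b b' : b <= b' -> mu L s (ncone e d b) <= mu L s (ncone e d b').
    move=> bb; apply: mu_le => // x [/andP[x0 xb] h]; split => //.
    by rewrite x0 (le_trans xb).
  have m1 := mono (1 - t) 1; have m2 := mono 1 (1 + t).
  have gap : mu L s (ncone e d (1 + t)) - mu L s (ncone e d (1 - t)) <=
      n%:R * 2 ^+ n * t * mu L s (ncone e d 1).
    by apply: mu_ncone_gap => //; rewrite (ltW t0).
  have muU : mu L s (ncone e d 1) <= (2 * (n.+1%:R * C + 2)) ^+ n.
    have nC : 0 <= n.+1%:R * C + 2 by rewrite addr_ge0// mulr_ge0.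
    apply: le_trans (vol_eball_le n' nC).
    apply: (@le_trans _ _ (mu L s (@eball R n 2))).
      by apply: mu_le => //; [exact: bnd_eball|move=> x; exact: inN].
    rewrite -lee_fin -muE//; last exact: bnd_eball.
    rewrite -volE; last exact: bnd_eball.
    apply: le_leb_outer => x x2; rewrite (psi_projK (scaleS s L) x) /eball /= (le_trans (enormD _ _))// lerD//.
    have [[y Ly yE] _] := projP x csL; rewrite -yE enormZ gtr0_norm//.
    by apply: ler_pM; rewrite ?enorm_ge0 ?(ltW s0)// LC.
  have gap' : n%:R * 2 ^+ n * t * mu L s (ncone e d 1) <= n%:R * 2 ^+ n * (2 * (n.+1%:R * C + 2)) ^+ n * t.
    rewrite [leRHS]mulrAC ler_wpM2l// !mulr_ge0// ltW //.
  have l1 : 1 - t <= 1 by rewrite gerBl ltW.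
  have l2 : 1 <= 1 + t by rewrite lerDl ltW.
  move: (m1 l1) (m2 l2) up lo gap gap'; clear; rewrite ler_norml => *; apply/andP; split; lra.
rewrite /Sig -sumrB /approx_const mulr_suml; apply: ler_sum => k _.
rewrite -mulrBr; apply: (le_trans (ler_norm _)); rewrite normrM -[leRHS]mulrA ler_wpM2l//.
Qed.

End FlatApproximation.

Section LowerBound.
Variables (R : realType) (n' : nat).
Local Notation n := n'.+1.
Local Notation V := 'rV[R]_n.
Implicit Types (K L w : set V) (e x y z u : V) (Q : 'M[R]_n) (d eps t r C c p M : R).

Definition narrow_cap e d : set V :=
  @sphere R n `&` [set z | 0 < dotp z e] `&` [set z | enorm (hpart e z) <= d * dotp z e].

Lemma narrow_cap_sphere e d : narrow_cap e d `<=` @sphere R n. Proof. by move=> u [[]]. Qed.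

Lemma borel_narrow_cap e d : enorm e = 1 -> borel (narrow_cap e d).
Proof.
move=> e1; apply: borelI; last exact: borel_narrow.
apply: borelI; last exact: borel_pos.
by apply: borel_closed; exact: closed_sphere.
Qed.

Lemma ncone_narrow_cap e d : enorm e = 1 -> 0 < d <= 1 ->
  ncone e d 1 `<=` scaleS 2 (cone01 (narrow_cap e d)).
Proof.
move=> e1 /andP[d0 d1] z zN; have [/andP[z0 z1] zh] := zN.
rewrite -cone_leE//.
have zn0 : 0 < enorm z.
  by rewrite enorm_gt0; apply/eqP => zE; move: z0; rewrite zE dotp0l ltxx.
have zn2 : enorm z <= 2.
  have := @ncone_eball R n' e e1 d 1 (ltW d0) z zN; rewrite /eball /= => /le_trans; apply; lra.
have zi : 0 < (enorm z)^-1 by rewrite invr_gt0.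
exists (enorm z), ((enorm z)^-1 *: z); last first.
  by rewrite zn0 scalerA divff ?scale1r ?gt_eqF.
split; first split.
- by rewrite /sphere /= enormZ gtr0_norm// mulVf// gt_eqF.
- by rewrite /= dotpZl mulr_gt0.
- by rewrite /= hpartZ dotpZl enormZ gtr0_norm// mulrCA ler_pM2l.
Qed.

Lemma abs_dotp_supp K y u : ccv K -> origin_symmetric K -> K y -> `|dotp y u| <= supp_fun K u.
Proof.
move=> cK symK Ky; rewrite ler_norml; have := supp_fun_ge u cK Ky; have := supp_fun_ge u cK (symK _ Ky).
rewrite dotpNr (dotpC u) => h1 h2; apply/andP; split; lra.
Qed.

Lemma dotp_expand Q y u : Q *m Q^T = 1%:M ->
  dotp y u = \sum_l dotp y (row l Q) * dotp u (row l Q).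
Proof.
move=> oQ; have oQT : Q^T *m (Q^T)^T = 1%:M by rewrite trmxK; exact: mulmx1C.
by rewrite -(dotp_orthogonal y u oQT); apply: eq_bigr => l _; rewrite !dotp_row.
Qed.

Lemma dotp_hpart_row Q (i : 'I_n) z : Q *m Q^T = 1%:M ->
  dotp (hpart (row ord0 Q) z) (row i Q) = if i == ord0 then 0 else dotp z (row i Q).
Proof.
move=> oQ; rewrite /hpart dotpBl dotpZl dotp_rows// eq_sym.
by case: eqVneq => [->|_]; rewrite ?mulr1 ?subrr// mulr0 subr0.
Qed.

(* Near the direction [row 0 Q] of smallest width the support function still grows linearly in two
   further coordinates, so the sublevel sets of the cap gain the factor [t^2]. *)
Lemma sg_narrow_cap_sublevel K Q (b : 'I_n -> R) (x : 'I_n -> V) (i1 i2 : 'I_n) d t r c C :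
  ccv K -> origin_symmetric K -> greedy_frame K 1 Q b x -> i1 = 1%N :> nat -> i2 = 2%N :> nat ->
  (forall u, @sphere R n u -> r <= supp_fun K u) -> supp_fun K (row ord0 Q) <= r ->
  0 < r -> 0 < d <= 1 -> 0 < c -> c <= b i2 -> b i1 <= C -> 0 <= C ->
  sg (narrow_cap (row ord0 Q) d `&` [set u | supp_fun K u <= t]) <=
    2 ^+ n * ((2 + 2 * C / c) / c * t) ^+ 2 * d ^+ (n - 3).
Proof.
move=> cK symK [oQ xb xtri Kb bdec] i1E i2E hr he r0 /andP[d0 d1] c0 cb2 b1C C0.
set e := row ord0 Q; have e1 : enorm e = 1 by exact: enorm_row.
have i10 : i1 != ord0 by rewrite -val_eqE /= i1E.
have i20 : i2 != ord0 by rewrite -val_eqE /= i2E.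
have i21 : i2 != i1 by rewrite -val_eqE /= i1E i2E.
have b21 : b i2 <= b i1 by apply: bdec; rewrite i1E i2E.
have cb1 : c <= b i1 by exact: le_trans b21.
have [[u0 [[[u0s _] _] /= u0t]]|emp] := pselect (narrow_cap e d `&` [set u | supp_fun K u <= t] !=set0); last first.
  rewrite (_ : _ `&` _ = set0); last by apply/eqP/negPn/negP => /set0P.
  rewrite /sg (_ : cone01 set0 = set0); last by rewrite -subset0 => ? [? [? []]].
  rewrite outer_measure0; apply: mulr_ge0; last by apply: exprn_ge0; exact: ltW.
  by apply: mulr_ge0; [exact: exprn_ge0|exact: sqr_ge0].
have t0 : 0 < t by apply: lt_le_trans r0 _; exact: le_trans (hr _ u0s) u0t.
pose k := (2 + 2 * C / c) / c * t.
have k0 : 0 < k.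
  by rewrite mulr_gt0// divr_gt0// ltr_pwDl// divr_ge0 ?mulr_ge0 ?(ltW c0).
pose bb (i : 'I_n) := if i == ord0 then 1 else if (i == i1) || (i == i2) then k else d.
have bb0 i : 0 <= bb i.
  by rewrite /bb; case: ifP => // _; case: ifP => _; exact: ltW.
apply: (@le_trans _ _ (\prod_i (2 * bb i))).
  apply: (sg_le_framebox _ oQ bb0); first by move=> u [/narrow_cap_sphere].
  move=> u i [[[us ue] uh] /= ut]; have rt : r <= t by exact: le_trans (hr _ us) ut.
  have abs1 l : `|dotp u (row l Q)| <= 1.
    by apply: (le_trans (CauchySchwarz _ _)); rewrite (us : enorm u = 1) enorm_row// mulr1.
  have i11 : (1 <= i1)%N by rewrite i1E.
  have i22 : (1 <= i2)%N by rewrite i2E.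
  have [Kx1 xb1 _] := xb i1 i11; have [Kx2 xb2 _] := xb i2 i22.
  have xe y : K y -> `|dotp y e * dotp u e| <= t.
    move=> Ky; rewrite normrM -[leRHS]mulr1; apply: ler_pM => //; last exact: abs1.
    by apply: (le_trans (abs_dotp_supp e cK symK Ky)); exact: le_trans rt.
  have h1 : b i1 * `|dotp u (row i1 Q)| <= 2 * t.
    have := le_trans (abs_dotp_supp u cK symK Kx1) ut; rewrite (dotp_expand _ _ oQ) (bigD1 ord0)//=.
    rewrite (bigD1 i1)//= big1 ?addr0 ?xb1; last first.
      move=> l /andP[l0 l1]; rewrite xtri ?mul0r// i1E /= ltn_neqAle lt0n; apply/andP; split; last exact: l0.
      by rewrite eq_sym -i1E; exact: l1.
    move=> h; have b10 : 0 < b i1 by exact: lt_le_trans cb1.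
    rewrite -{1}(gtr0_norm b10) -normrM.
    have -> : b i1 * dotp u (row i1 Q) = (dotp (x i1) e * dotp u e + b i1 * dotp u (row i1 Q)) - dotp (x i1) e * dotp u e by ring.
    by apply: (le_trans (ler_normB _ _)); have := xe _ Kx1; move: h; rewrite -/e; lra.
  have h1' : `|dotp u (row i1 Q)| <= 2 / c * t.
    rewrite mulrAC ler_pdivlMr// mulrC; apply: le_trans h1; by rewrite ler_wpM2r.
  have h2 : b i2 * `|dotp u (row i2 Q)| <= 2 * t + C * (2 / c * t).
    have := le_trans (abs_dotp_supp u cK symK Kx2) ut; rewrite (dotp_expand _ _ oQ) (bigD1 ord0)//=.
    rewrite (bigD1 i1)//= (bigD1 i2) ?i20//= big1 ?addr0 ?xb2; last first.
      move=> l /andP[/andP[l0 l1] l2]; rewrite xtri ?mul0r// i2E /=.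
      rewrite ltn_neqAle eq_sym -{1}i2E; apply/andP; split; first exact: l2.
      by rewrite ltn_neqAle lt0n eq_sym -{1}i1E; apply/andP; split; [exact: l1|exact: l0].
    have a2 : `|dotp (x i2) (row i1 Q) * dotp u (row i1 Q)| <= C * (2 / c * t).
      rewrite normrM; apply: ler_pM => //; apply: le_trans b1C.
      by apply: Kb => //; rewrite i1E.
    move=> h; have b20 : 0 < b i2 by exact: lt_le_trans cb2.
    rewrite -{1}(gtr0_norm b20) -normrM.
    have -> : b i2 * dotp u (row i2 Q) = (dotp (x i2) e * dotp u e + (dotp (x i2) (row i1 Q) * dotp u (row i1 Q) + b i2 * dotp u (row i2 Q))) - dotp (x i2) e * dotp u e - dotp (x i2) (row i1 Q) * dotp u (row i1 Q) by ring.
    apply: (le_trans (ler_normB _ _)); apply: lerD => //.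
    by apply: (le_trans (ler_normB _ _)); have := xe _ Kx2; move: h; rewrite -/e; lra.
  have h2' : `|dotp u (row i2 Q)| <= k.
    have -> : k = (2 * t + C * (2 / c * t)) / c by rewrite /k; field; rewrite gt_eqF.
    by rewrite ler_pdivlMr// mulrC; apply: le_trans h2; rewrite ler_wpM2r.
  have k1 : 2 / c * t <= k.
    rewrite /k ler_wpM2r ?(ltW t0)// ler_wpM2r ?invr_ge0 ?(ltW c0)// lerDl.
    by rewrite divr_ge0 ?mulr_ge0 ?(ltW c0).
  rewrite /bb; case: eqVneq => [->|i0]; first exact: abs1.
  case: eqVneq => [->|ii1] /=; first exact: le_trans k1.
  case: eqVneq => [->//|ii2].
  rewrite -[dotp u _](_ : dotp (hpart e u) (row i Q) = _); last by rewrite dotp_hpart_row// (negbTE i0).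
  apply: (le_trans (CauchySchwarz _ _)); rewrite enorm_row// mulr1 (le_trans uh)//.
  by rewrite -[leRHS]mulr1 ler_pM2l// (le_trans (ler_norm _))// abs1.
rewrite big_split /= prodr_const card_ord -mulrA ler_pM2l ?exprn_gt0//.
rewrite (bigD1 ord0)//= {1}/bb eqxx mul1r (bigD1 i1)//= (bigD1 i2) ?i20//= mulrA.
have -> : bb i1 * bb i2 = k ^+ 2 by rewrite /bb (negbTE i10) (negbTE i20) !eqxx orbT.
rewrite ler_wpM2l ?sqr_ge0// (eq_bigr (fun=> d)); last first.
  by move=> i /andP[/andP[/negbTE h0 /negbTE h1] /negbTE h2]; rewrite /bb h0 h1 h2.
rewrite prodr_const le_eqVlt; apply/orP; left; apply/eqP; congr (_ ^+ _).
rewrite -[in RHS](card_ord n) -[#|'I_n|]cardsT.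
have -> : (#|[set: 'I_n]%SET| - 3)%N = #|([set: 'I_n] :\ ord0 :\ i1 :\ i2)%SET|.
  rewrite (cardsD1 ord0 [set: 'I_n]%SET) (cardsD1 i1 ([set: 'I_n] :\ ord0)%SET).
  rewrite (cardsD1 i2 ([set: 'I_n] :\ ord0 :\ i1)%SET) !inE i10 i20 i21 /=.
  by rewrite !add1n !subSS subn0.
apply: eq_card => i; rewrite !inE andbT [RHS]andbC; congr (_ && _); exact: andbC.
Qed.

Lemma sg_narrow_cap Q d : Q *m Q^T = 1%:M -> 0 < d <= 1 ->
  sg (narrow_cap (row ord0 Q) d) <= 2 ^+ n * d ^+ n'.
Proof.
move=> oQ /andP[d0 d1]; set e := row ord0 Q.
pose bb (i : 'I_n) := if i == ord0 then 1 else d.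
have bb0 i : 0 <= bb i by rewrite /bb; case: ifP => // _; exact: ltW.
apply: (@le_trans _ _ (\prod_i (2 * bb i))).
  apply: (sg_le_framebox _ oQ bb0); first exact: narrow_cap_sphere.
  move=> u i [[us ue] uh].
  have abs1 l : `|dotp u (row l Q)| <= 1.
    by apply: (le_trans (CauchySchwarz _ _)); rewrite (us : enorm u = 1) enorm_row// mulr1.
  rewrite /bb; case: eqVneq => [->|i0]; first exact: abs1.
  rewrite -[dotp u _](_ : dotp (hpart e u) (row i Q) = _); last by rewrite dotp_hpart_row// (negbTE i0).
  apply: (le_trans (CauchySchwarz _ _)); rewrite enorm_row// mulr1 (le_trans uh)//.
  by rewrite -[leRHS]mulr1 ler_pM2l// (le_trans (ler_norm _))// abs1.
rewrite big_split /= prodr_const card_ord ler_pM2l ?exprn_gt0//.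
rewrite (bigD1 ord0)//= {1}/bb eqxx mul1r (eq_bigr (fun=> d)); last by move=> i /negbTE h; rewrite /bb h.
rewrite prodr_const le_eqVlt; apply/orP; left; apply/eqP; congr (_ ^+ _).
transitivity #|predC1 (ord0 : 'I_n)|; first by apply: eq_card => i; rewrite !inE.
by rewrite cardC1 card_ord.
Qed.

End LowerBound.

Section LowerBoundTheorem.
Variables (R : realType) (n' : nat).
Local Notation n := n'.+1.
Local Notation V := 'rV[R]_n.
Implicit Types (K L w : set V) (e x y z u : V) (Q : 'M[R]_n) (d eps t r C c p M : R).

Lemma range_shift (j : nat) (j1 : (j.+1 < n)%N) (n1 : (1 < n)%N) :
  (Ordinal j1 |: ord_range n' 0 j)%SET = (Ordinal n1 |: ord_range n' 1 j.+1)%SET.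
Proof. by apply/setP => i; rewrite !inE -!val_eqE /=; move: (val i) => k; lia. Qed.

Lemma prod_range_shift (j : nat) (j1 : (j.+1 < n)%N) (n1 : (1 < n)%N) (b : 'I_n -> R) :
  b (Ordinal j1) * \prod_(i in ord_range n' 0 j) b i =
  b (Ordinal n1) * \prod_(i in ord_range n' 1 j.+1) b i.
Proof.
rewrite -big_setU1 ?range_shift ?big_setU1//; first by rewrite inE.
by rewrite inE /= ltnn.
Qed.

Definition product_const (p M C : R) : R :=
  (expR M)^-1 / C `^ (1 - p) * (4 * n%:R)^-1 ^+ n / 2 ^+ (n + n).

(** Row 0 is now the direction of least width [r]. The translation argument runs along row 1, the
    largest of the other widths, and retains the widths of indices 2 to [j + 1]. *)
Lemma frame_product_lower K (j : nat) p M Q (b : 'I_n -> R) (x : 'I_n -> V) C :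
  solution K j p M -> (0 < j)%N -> (j.+1 < n)%N -> 0 <= 1 - p -> 0 < C ->
  (forall u, @sphere R n u -> supp_fun K u <= C) -> greedy_frame K 1 Q b x ->
  (forall u, @sphere R n u -> supp_fun K (row ord0 Q) <= supp_fun K u) ->
  product_const p M C <= \prod_(i in ord_range n' 1 j.+1) b i.
Proof.
move=> sol j0 j1 q0 C0 hC [oQ xb xtri Kb bdec] emin; have [cK symK _ _ _] := sol.
set e := row ord0 Q; set r := supp_fun K e.
have eS l : @sphere R n (row l Q) by exact: enorm_row.
have r0 : 0 < r by have [_ _ [r' r'0 hr'] _ _] := sol; exact: lt_le_trans (hr' _ (eS ord0)).
pose b' (i : 'I_n) := if i == ord0 then r else b i.
have Kb' y (i : 'I_n) : K y -> `|dotp y (row i Q)| <= b' i.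
  move=> Ky; rewrite /b'; case: eqVneq => [->|i0]; first exact: abs_dotp_supp.
  by apply: Kb => //; rewrite lt0n.
have rb (i : 'I_n) : r <= b' i.
  rewrite /b'; case: eqVneq => // i0; apply: (le_trans (emin _ (eS i))).
  apply: supp_fun_le => // y Ky; rewrite dotpC; apply: le_trans (Kb i y _ Ky); first exact: ler_norm.
  by rewrite lt0n.
pose J := ord_range n' 1 j.+1.
have cJ : #|J| = j by rewrite card_ord_range// subn1.
have n1 : (1 < n)%N by exact: leq_trans j1.
pose i1 : 'I_n := Ordinal n1.
have D0 : 0 < (expR M)^-1 / C `^ (1 - p).
  by rewrite divr_gt0 ?invr_gt0 ?expR_gt0// powR_gt0.
have jn' : (j <= n')%N by rewrite -ltnS ltnW.
have prodE : \prod_(i in J) b' i = \prod_(i in J) b i.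
  apply: eq_bigr => i; rewrite inE => /andP[i1_ _]; rewrite /b'.
  by case: eqVneq i1_ => // ->.
have ae := solution_lower sol q0 C0 hC.
have main ep : 0 < ep -> (forall i, i \in J -> ep <= b' i) ->
    (forall i, i != i1 -> i \notin J -> b' i <= ep) ->
    (expR M)^-1 / C `^ (1 - p) * (4 * n%:R)^-1 ^+ n <= 2 ^+ (n + n) * \prod_(i in J) b' i.
  move=> ep0 h1 h2; apply: (curvature_product_lower cK oQ Kb' D0 ep0 _ _ h1 h2).
  - by rewrite cJ.
  - by rewrite inE.
  - by rewrite cJ.
rewrite /product_const ler_pdivrMr ?exprn_gt0// -prodE.
have cases (i : 'I_n) : i != i1 -> i \notin J -> i = ord0 \/ (j.+1 < i)%N.
  move=> ii1 /notin_range_gt[il|]; last by right.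
  left; apply: val_inj => /=; move: il; rewrite leq_eqVlt ltnS leqn0 => /orP[/eqP E|/eqP//].
  by case/eqP: ii1; apply: val_inj.
(* The height is the width of index [j + 2]; when [j + 2 = n] there is none, and the minimal width
   [r] takes its place. *)
have [j2|j2] := ltnP j.+2 n.
  have b2E : b' (Ordinal j2) = b (Ordinal j2) by [].
  rewrite [X in _ <= X]mulrC; apply: (main (b' (Ordinal j2))).
  - by apply: lt_le_trans r0 (rb _).
  - move=> i; rewrite inE => /andP[il ir]; rewrite b2E /b'.
    case: eqVneq il => [->//|_] il; apply: bdec; rewrite (ltnW il) /=; exact: leqW.
  - move=> i ii1 iJ; case: (cases i ii1 iJ) => [->|il]; first exact: (rb (Ordinal j2)).
    rewrite b2E /b'; case: eqVneq il => [->//|_] il; exact: bdec.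
rewrite [X in _ <= X]mulrC; apply: (main r) => // i ii1 iJ.
case: (cases i ii1 iJ) => [->|il]; first by rewrite /b' eqxx.
by have := leq_trans (ltn_ord i) j2; rewrite ltnNge il.
Qed.

(** The projection kills row 0 and keeps the triangular system of the other rows. The product of the
    widths 1 to [j] dominates that of the widths 2 to [j + 1]. *)
Lemma flat_Tm_lower K (j : nat) Q (b : 'I_n -> R) (x : 'I_n -> V) c :
  ccv K -> origin_symmetric K -> (j.+1 < n)%N -> greedy_frame K 1 Q b x ->
  (forall i : 'I_n, (1 <= i)%N -> 0 < b i) ->
  c <= \prod_(i in ord_range n' 1 j.+1) b i ->
  2 ^+ n / n%:R ^+ n * c <= Tm (hpart (row ord0 Q) @` K) (inord j).
Proof.
move=> cK symK j1 [oQ xb xtri Kb bdec] bpos cb.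
set e := row ord0 Q; have e1 : enorm e = 1 by exact: enorm_row.
have n1 : (1 < n)%N by exact: leq_trans j1.
have cJ : #|ord_range n' 0 j| = j by rewrite card_ord_range ?subn0// ltnW.
have symL : origin_symmetric (hpart e @` K).
  by move=> _ [y Ky <-]; exists (- y); [exact: symK|rewrite -scaleN1r hpartZ scaleN1r].
rewrite -[j in inord j]cJ; apply: le_trans (Tm_lower (x := fun i => hpart e (x i)) (b := b) (ccv_hpart e1 cK) symL oQ _ _).
- rewrite ler_pM2l ?divr_gt0 ?exprn_gt0 ?ltr0n//; apply: (le_trans cb).
  have bj0 : 0 < b (Ordinal j1) by exact: bpos.
  rewrite -(ler_pM2l bj0) prod_range_shift ler_wpM2r//; last exact: bdec.
  apply: prodr_ge0 => i; rewrite inE => /andP[i1 _]; apply/ltW/bpos; exact: ltnW.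
- move=> i; rewrite inE => /andP[i0 ij]; have [Kx xi bi] := xb i i0.
  split => //.
  by rewrite dotp_hpart_row// xi; case: eqVneq i0 => // ->.
- move=> i l; rewrite inE => /andP[i0 ij] h; rewrite dotp_hpart_row//.
  case: eqVneq h => // l0 /orP[il|]; first by apply: xtri; rewrite i0.
  rewrite inE negb_and -!leqNgt leqn0 => /orP[/eqP lz|jl]; first by case/eqP: l0; apply: val_inj.
  by apply: xtri; rewrite i0 /= (leq_ltn_trans ij)// ltnNge -ltnS.
Qed.

End LowerBoundTheorem.

Section LowerBoundMain.
Variables (R : realType) (n' : nat).
Local Notation n := n'.+1.
Local Notation V := 'rV[R]_n.
Implicit Types (K L w : set V) (e x y z u : V) (Q : 'M[R]_n) (d eps t r C c p M : R).

(** The exclusion of [(p, j) = (0, 1)] acts here: it says that [j > 1 - p]. For [p > 0] one takes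
    [d = y^(1/p)], so that [d = y d^(1-p)]; for [j > 1] already [d = y] works. *)
Lemma small_power (p A : R) (j : nat) : 0 <= p < 1 -> (0 < j)%N -> 0 < p \/ (1 < j)%N -> 0 < A ->
  exists2 d, 0 < d <= 1 & d ^+ j <= A * d `^ (1 - p).
Proof.
move=> /andP[p0 p1] j0 pj A0; pose y := Num.min 1 A.
have y0 : 0 < y by rewrite lt_min ltr01.
have y1 : y <= 1 by rewrite ge_min lexx.
have yA : y <= A by rewrite ge_min lexx orbT.
case: pj => [pp|j1].
  have d0 : 0 < y `^ p^-1 by exact: powR_gt0.
  have d1 : y `^ p^-1 <= 1.
    rewrite -[leRHS](powRr0 y); apply: ger_powR; first by rewrite y0.
    by rewrite invr_ge0.
  exists (y `^ p^-1); first by rewrite d0.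
  apply: (@le_trans _ _ (y `^ p^-1)).
    by rewrite -[leRHS]expr1; apply: ler_wiXn2l => //; exact: ltW.
  have E : y `^ p^-1 = (y `^ p^-1) `^ p * (y `^ p^-1) `^ (1 - p).
    rewrite -powRD; last by rewrite (gt_eqF d0) implybT.
    by rewrite addrC subrK powRr1// ltW.
  rewrite {1}E ler_pM2r ?powR_gt0// -powRrM mulVf ?gt_eqF// powRr1//; exact: ltW.
exists y; first by rewrite y0.
apply: (@le_trans _ _ (y ^+ 2)); first by apply: ler_wiXn2l => //; exact: ltW.
rewrite expr2; apply: ler_pM => //; [exact: ltW|exact: ltW|].
by apply: ger1_powR; [rewrite y0|rewrite gerBl].
Qed.

(** The layers of [h_K] start at level [d]. The widths of rows 1 and 2 are bounded below, so a
    sublevel set loses two factors [4^-k], more than the [8^-k] that [layer_bound] asks for, and the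
    powers of [d] recombine to [d^(n-1)]. *)
Lemma Sig_ncone_upper K (j : 'I_n.+1) p M Q (b : 'I_n -> R) (x : 'I_n -> V) d c C r :
  solution K j p M -> (0 < j)%N -> (j.+1 < n)%N -> 0 <= p < 1 -> greedy_frame K 1 Q b x ->
  (forall u, @sphere R n u -> r <= supp_fun K u) -> supp_fun K (row ord0 Q) <= r -> 0 < r ->
  0 < d <= 1 -> 0 < c -> (forall i : 'I_n, i = 2%N :> nat -> c <= b i) ->
  (forall i : 'I_n, i = 1%N :> nat -> b i <= C) -> 0 <= C ->
  Sig K j (ncone (row ord0 Q) d 1) <=
  9 * curv_const n' j M * (2 ^+ n * 2 ^+ n * (1 + ((2 + 2 * C / c) / c) ^+ 2)) * d ^+ n' / d `^ (1 - p).
Proof.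
move=> sol j0 j1 /andP[p0 p1] gf hr he r0 d01 c0 cb bC C0; have [cK symK _ _ _] := sol.
have [oQ _ _ _ _] := gf; have [d0 d1] := andP d01.
set e := row ord0 Q; have e1 : enorm e = 1 by exact: enorm_row.
have n1 : (1 < n)%N by exact: leq_trans j1.
have n2 : (2 < n)%N by exact: leq_trans j1.
pose w := narrow_cap e d; have ws : w `<=` @sphere R n := @narrow_cap_sphere R n' e d.
have bw : borel w by exact: borel_narrow_cap.
set k := (2 + 2 * C / c) / c.
pose A := 2 ^+ n * (1 + k ^+ 2) * d ^+ n'.
have dn0 : 0 < d ^+ n' by rewrite exprn_gt0.
have dE : d ^+ 2 * d ^+ (n - 3) = d ^+ n' by rewrite -exprD subSS subnKC.
have wA : sg w <= A.
  apply: (le_trans (sg_narrow_cap oQ d01)); rewrite /A ler_pM2r// ler_peMr ?exprn_ge0//.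
  by rewrite lerDl sqr_ge0.
have lay l : sg (w `&` [set u | supp_fun K u <= d / 4 ^+ l]) <= A / 8 ^+ l.
  have := @sg_narrow_cap_sublevel R n' K Q b x (Ordinal n1) (Ordinal n2) d (d / 4 ^+ l) r c C
    cK symK gf erefl erefl hr he r0 d01 c0 (cb (Ordinal n2) erefl) (bC (Ordinal n1) erefl) C0.
  move/le_trans; apply; rewrite -/k.
  have -> : 2 ^+ n * (k * (d / 4 ^+ l)) ^+ 2 * d ^+ (n - 3) = 2 ^+ n * k ^+ 2 * d ^+ n' / (4 ^+ l) ^+ 2.
    have aux (a k' a' a3 f : R) : a * (k' * (a' / f)) ^+ 2 * a3 = a * k' ^+ 2 * (a' ^+ 2 * a3) / f ^+ 2.
      by rewrite !exprMn exprVn; ring.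
    by rewrite aux dE.
  rewrite /A; apply: ler_pM; rewrite ?invr_ge0 ?exprn_ge0//.
  - by apply: mulr_ge0; [apply: mulr_ge0; [exact: exprn_ge0|exact: sqr_ge0]|exact: ltW].
  - by rewrite ler_wpM2r ?(ltW dn0)// ler_wpM2l ?exprn_ge0// lerDr.
  - rewrite lef_pV2 ?posrE ?exprn_gt0// -exprM mulnC exprM; apply: lerXn2r; rewrite ?nnegrE//; lra.
have jn : (j < n)%N by exact: ltnW.
have h := layer_bound sol (introT andP (conj j0 jn)) bw ws p0 p1 d0 wA lay.
have bcw := borel_cone01 ws bw; have bdw := bnd_cone01 ws.
apply: (@le_trans _ _ (Sig K j (scaleS 2 (cone01 w)))).
  apply: Sig_le => //; [exact: bnd_scale|exact: borel_ncone|exact: borel_scale|].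
  exact: ncone_narrow_cap.
rewrite Sig_scale//; apply: (@le_trans _ _ (2 ^+ n * Sig K j (cone01 w))).
  by rewrite ler_wpM2r ?Sig_ge0// ler_weXn2l ?ler1n// leq_subr.
apply: (le_trans (ler_wpM2l (exprn_ge0 n (ler0n R 2)) h)); rewrite /A le_eqVlt; apply/orP; left; apply/eqP.
ring.
Qed.

(** The aperture [d], the error [t], the accuracy [eps] and the threshold [rho] are chosen in this
    order, each from the preceding ones and from constants independent of [K]; only then is a body
    with least value below [rho] considered. *)
Theorem lower_bound_exists (j : nat) p M : (0 < j)%N -> (j.+1 < n)%N -> 0 <= p < 1 ->
  0 < p \/ (1 < j)%N ->
  exists2 c, 0 < c & forall K, solution K j p M -> forall u, @sphere R n u -> c <= supp_fun K u.
Proof.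
move=> j0 j1 p01 pj; have [p0 p1] := andP p01.
have q0 : 0 <= 1 - p by rewrite subr_ge0 ltW.
have [C C0 hC] := upper_bound_exists M j0 j1 p01.
have jn' : (j < n.+1)%N by rewrite ltnS ltnW// ltnW.
pose jo : 'I_n.+1 := Ordinal jn'.
have joE : inord j = jo by apply: val_inj; rewrite /= inordK.
pose c9 := product_const n' p M C.
have c90 : 0 < c9.
  apply: divr_gt0; last exact: exprn_gt0.
  apply: mulr_gt0; last by rewrite exprn_gt0// invr_gt0 mulr_gt0// ltr0n.
  by rewrite divr_gt0 ?invr_gt0 ?expR_gt0// powR_gt0.
(* Lower bound for the width of index 2: if it is below 1, the product of the [j] widths from index
   2 on is at most that width, while [c9] bounds the product from below. *)
pose cb := Num.min 1 c9; have cb0 : 0 < cb by rewrite lt_min ltr01.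
pose cT := 2 ^+ n / n%:R ^+ n * c9 / 4 ^+ n.
have cT0 : 0 < cT.
  apply: divr_gt0; last exact: exprn_gt0.
  by apply: mulr_gt0 => //; apply: divr_gt0; apply: exprn_gt0; rewrite ?ltr0n.
pose CU := 9 * curv_const n' j M * (2 ^+ n * 2 ^+ n * (1 + ((2 + 2 * C / cb) / cb) ^+ 2)).
have CU0 : 0 < CU.
  rewrite /CU; set s := _ ^+ 2; have s0 : 0 <= s by exact: sqr_ge0.
  have s1 : 0 < 1 + s by rewrite ltr_pwDl.
  have jn'' : (j <= n')%N by rewrite -ltnS ltnW.
  by rewrite !mulr_gt0 ?exprn_gt0 ?expR_gt0// ltr0n bin_gt0.
have A0 : 0 < cT / 4 / CU by apply: divr_gt0 => //; exact: divr_gt0.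
(* Makes the curvature bound at most a quarter of the mass [m cT] that the projection puts on the
   cone. *)
have [d d01 dj] := small_power p01 j0 pj A0; have [d0 d1] := andP d01.
pose m := d ^+ n' / d ^+ j; have m0 : 0 < m by rewrite divr_gt0 ?exprn_gt0.
have upper : CU * d ^+ n' / d `^ (1 - p) <= m * cT / 4.
  have dp : 0 < d `^ (1 - p) by exact: powR_gt0.
  rewrite ler_pdivrMr// /m.
  have -> : d ^+ n' / d ^+ j * cT / 4 * d `^ (1 - p) = d ^+ n' / d ^+ j * CU * (cT / 4 / CU * d `^ (1 - p)).
    by field; rewrite gt_eqF//= expf_neq0// gt_eqF.
  apply: (@le_trans _ _ (d ^+ n' / d ^+ j * CU * d ^+ j)).
    rewrite le_eqVlt; apply/orP; left; apply/eqP; field; rewrite expf_neq0// gt_eqF//.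
  by rewrite ler_pM2l// mulr_gt0.
pose AA := approx_const jo C.
have AA0 : 0 <= AA.
  apply: sumr_ge0 => k _; rewrite mulr_ge0// mulr_ge0 ?mulr_ge0 ?exprn_ge0//.
  by rewrite mulr_ge0// addr_ge0// mulr_ge0// ltW.
(* Makes the error of passing to the projection at most another quarter. *)
pose t := Num.min (1 / 2) (m * cT / 4 / (AA + 1)).
have AA1 : 0 < AA + 1 by rewrite ltr_wpDl.
have t0 : 0 < t.
  rewrite lt_min divr_gt0//=; apply: divr_gt0 => //; apply: divr_gt0 => //; exact: mulr_gt0.
have t1 : t < 1.
  have : t <= 1 / 2 by rewrite ge_min lexx.
  move/le_lt_trans; apply; lra.
have AAt : AA * t <= m * cT / 4.
  apply: (@le_trans _ _ ((AA + 1) * t)); first by rewrite ler_pM2r// lerDl.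
  by rewrite mulrC -ler_pdivlMr// ge_min lexx orbT.
pose eps := t / 2 / (1 + d^-1).
have d2 : 0 < 1 + d^-1 by rewrite ltr_wpDr// invr_ge0 ltW.
have eps0 : 0 < eps by rewrite !divr_gt0.
have tE : t = 2 * (eps + eps / d).
  have -> : eps + eps / d = eps * (1 + d^-1) by rewrite mulrDr mulr1.
  by rewrite /eps divfK ?gt_eqF// mulrC divfK.
(* Any [r] below this satisfies both smallness conditions of [flat_approx]. *)
pose rho := Num.min (n.+1%:R^-1) (eps ^+ 2 / (7 * n.+1%:R)).
have rho0 : 0 < rho by rewrite lt_min invr_gt0 ltr0n /= divr_gt0 ?exprn_gt0// mulr_gt0// ltr0n.
exists rho => // K sol; have [cK symK [r' r'0 hr'] _ _] := sol.
have hCK := hC K sol.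
have e00 : enorm (delta_mx ord0 ord0 : V) = 1.
  apply/eqP; rewrite -sqrp_eq1 ?enorm_ge0// sqr_enorm dotpE trmx_delta.
  by rewrite mul_delta_mx mxE !eqxx.
have cS : compact (@sphere R n).
  apply: (subclosed_compact (@closed_sphere R n') (@compact_eball R n 1)).
  by move=> u; rewrite /eball /sphere /= => ->.
have S0 : @sphere R n !=set0 by exists (delta_mx ord0 ord0).
have cf : {within @sphere R n, continuous (supp_fun K)}.
  by apply: continuous_subspaceT; exact: supp_fun_continuous.
have [e /set_mem eS eP] := EVT_min_rV S0 cS cf.
have emin u : @sphere R n u -> supp_fun K e <= supp_fun K u by move=> us; apply: eP; exact: mem_set.
suff re : rho <= supp_fun K e by move=> u us; exact: le_trans (emin u us).
rewrite leNgt; apply/negP => rr.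
have ee : enorm (delta_mx ord0 ord0 : V) = enorm e by rewrite e00.
have [Q0 [oQ0 Q0e _]] := householder ee.
have [Q [b [x [gf Qrow]]]] := greedy_frame_exists 1 cK oQ0.
have Qe : row ord0 Q = e by rewrite Qrow// rowE.
have [oQ xb xtri Kb bdec] := gf.
have rS l : @sphere R n (row l Q) by exact: enorm_row.
set r := supp_fun K e in rr.
have r0 : 0 < r by apply: (lt_le_trans r'0); exact: hr'.
have KC y : K y -> enorm y <= C.
  move=> Ky; have [->|y0] := eqVneq y 0; first by rewrite enorm0 ltW.
  have ey : 0 < enorm y by rewrite enorm_gt0.
  have us : @sphere R n ((enorm y)^-1 *: y).
    by rewrite /sphere /= enormZ gtr0_norm ?invr_gt0// mulVf// gt_eqF.
  have := le_trans (supp_fun_ge _ cK Ky) (hCK _ us).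
  by rewrite dotpZl -sqr_enorm expr2 mulrA mulVf ?mul1r// gt_eqF.
have bpos (i : 'I_n) : (1 <= i)%N -> 0 < b i.
  move=> i1; apply: (lt_le_trans r'0); apply: (le_trans (hr' _ (rS i))).
  apply: supp_fun_le => // y Ky; rewrite dotpC; apply: le_trans (Kb i y i1 Ky); exact: ler_norm.
have prodb : c9 <= \prod_(i in ord_range n' 1 j.+1) b i.
  apply: (frame_product_lower sol j0 j1 q0 C0 hCK gf).
  by move=> u us; rewrite Qe; exact: emin.
have lowT := flat_Tm_lower cK symK j1 gf bpos prodb.
have e1 : enorm e = 1 := eS.
have cb2 (i : 'I_n) : i = 2%N :> nat -> cb <= b i.
  move=> i2; rewrite leNgt; apply/negP => bi.
  have i1 : (1 <= i)%N by rewrite i2.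
  have b1 : b i < 1 by apply: (lt_le_trans bi); rewrite ge_min lexx.
  have b9 : b i < c9 by apply: (lt_le_trans bi); rewrite ge_min lexx orbT.
  have cJ : #|ord_range n' 1 j.+1| = j by rewrite card_ord_range// subn1.
  have : \prod_(i in ord_range n' 1 j.+1) b i <= b i ^+ j.
    rewrite -{2}cJ -prodr_const; apply: ler_prod => l; rewrite inE => /andP[l1 _].
    rewrite ltW ?bpos ?(ltnW l1)//=; apply: bdec; rewrite i2 //.
  have : b i ^+ j <= b i.
    by rewrite -[leRHS]expr1; apply: ler_wiXn2l => //; apply: ltW => //; exact: bpos.
  move=> h1 h2; have := le_lt_trans (le_trans prodb (le_trans h2 h1)) b9.
  by rewrite ltxx.
have bC (i : 'I_n) : i = 1%N :> nat -> b i <= C.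
  move=> i1; have i1' : (1 <= i)%N by rewrite i1.
  have [Kx <- _] := xb i i1'; rewrite (le_trans (dotp_le _ _))// enorm_row// mulr1; exact: KC.
have up := @Sig_ncone_upper K jo p M Q b x d cb C r sol j0 j1 p01 gf emin _ r0 d01 cb0 cb2 bC (ltW C0).
rewrite Qe in up lowT; have {}up := up (lexx _).
pose L := hpart e @` K.
have cL : ccv L by exact: ccv_hpart.
have fL : flat e L by exact: flat_hpart.
have low := Sig_ncone_lower e1 jo cL fL d0.
have Kr y : K y -> `|dotp y e| <= r by move=> Ky; exact: abs_dotp_supp.
have nr1 : n.+1%:R * r <= 1.
  rewrite mulrC -ler_pdivlMr ?ltr0n// div1r ltW// (lt_le_trans rr)// ge_min lexx //.
have nre : 7 * (n.+1%:R * r) <= eps ^+ 2.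
  by rewrite mulrA mulrC -ler_pdivlMr ?mulr_gt0 ?ltr0n// ltW// (lt_le_trans rr)// ge_min lexx orbT.
have ap := flat_approx jo cK e1 KC Kr d01 eps0 tE t1 nr1 nre.
have lowT' : m * cT <= Sig L jo (ncone e d 1).
  apply: le_trans low; rewrite /m ler_pM2l// /cT ler_pM2r ?invr_gt0 ?exprn_gt0//.
  by rewrite -joE.
(* The projection has mass at least [m cT] on the cone, [K] at most a quarter of that, and they
   differ by at most a quarter. *)
have mc : 0 < m * cT by rewrite mulr_gt0.
have up' : Sig K jo (ncone e d 1) <= m * cT / 4 by apply: le_trans upper.
by move: (le_trans ap AAt) lowT' mc up'; rewrite -/L; clear; lra.
Qed.

End LowerBoundMain.

(** * From the equation to the uniform bounds *)

Section FromConvexBody.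
Variables (R : realType) (n' : nat).
Local Notation n := n'.+1.
Local Notation V := 'rV[R]_n.
Implicit Types (K : set V) (u x y : V) (p M : R).

Lemma sph_ae_and (P P' : V -> Prop) : sph_ae P -> sph_ae P' -> sph_ae (fun u => P u /\ P' u).
Proof.
move=> /sph_ae_leb0 h1 /sph_ae_leb0 h2; rewrite /sph_ae /sph_outer.
rewrite (_ : leb_outer _ = 0)%E ?mule0//; apply/eqP; rewrite eq_le outer_measure_ge0 andbT.
apply: (@le_trans _ _ (leb_outer (cone01 [set u | @sphere R n u /\ ~ P u] `|`
    cone01 [set u | @sphere R n u /\ ~ P' u]))).
  apply: le_leb_outer => x [t [u [us h] h']]; have [Pu|nPu] := pselect (P u).
    by right; exists t, u => //; split => // P'u; exact: h.
  by left; exists t, u.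
apply: (le_trans (outer_measureU2 _ _ _)).
by rewrite [X in (X + _)%E]h1 [X in (_ + X)%E]h2 adde0.
Qed.

(** A ball in [K] averaged with its reflection in the origin gives a ball about the origin. *)
Lemma symmetric_body_ball K : convex_body K -> origin_symmetric K ->
  exists2 r : R, 0 < r & forall u, @sphere R n u -> r <= supp_fun K u.
Proof.
move=> [cK [vK [x /enorm_nbhs[d d0 dK]]]] symK.
have cc : ccv K by split => //; exists x; apply: dK; rewrite subrr enorm0.
exists (d / 2); first by rewrite divr_gt0.
move=> u us; have ud (s : R) : `|s| <= d / 2 -> K (x + s *: u).
  move=> sd; apply: dK; rewrite addrAC subrr add0r enormZ (us : enorm u = 1) mulr1.
  by apply: (le_lt_trans sd); lra.
have Ku : K ((d / 2) *: u).
  have -> : (d / 2) *: u = 2^-1 *: (x + (d / 2) *: u) + (1 - 2^-1) *: (- (x + (- (d / 2)) *: u)).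
    by apply/rowP => i; rewrite !mxE; field.
  apply: vK; last by apply/andP; split; lra.
    by apply: ud; rewrite ger0_norm// ltW// divr_gt0.
  by apply/symK/ud; rewrite normrN ger0_norm// ltW// divr_gt0.
have := supp_fun_ge u cc Ku.
by rewrite dotpZr -sqr_enorm (us : enorm u = 1) expr1n mulr1.
Qed.

Lemma solution_of_equation K (j : nat) p M (g : V -> R) : convex_body K -> origin_symmetric K ->
  ess_bound_log g M -> solves_Lp_Christoffel_Minkowski K p j g -> solution K j p M.
Proof.
move=> bK symK gM [ac ae]; have [cK [vK [x /enorm_nbhs[d d0 dK]]]] := bK; split => //.
- by split => //; exists x; apply: dK; rewrite subrr enorm0.
- exact: symmetric_body_ball.
apply: sph_ae_imply (sph_ae_and ae gM) => u us [[s sj sg_] [g0 gln]]; exists s => //.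
move: gln; rewrite sg_ ler_norml => /andP[h1 h2].
by rewrite -expRN -[g u]lnK// !ler_expR h1 h2.
Qed.

Lemma bound_for_order (j : nat) p M : (0 < j)%N -> (j.+1 < n)%N -> 0 <= p < 1 ->
  exists2 C : R, 1 < C & forall K, solution K j p M ->
    (forall u, @sphere R n u -> supp_fun K u < C) /\
    ((p, j) <> (0, 1%N) -> forall u, @sphere R n u -> C^-1 < supp_fun K u).
Proof.
move=> j0 j1 p01; have [C C0 hC] := upper_bound_exists M j0 j1 p01.
have [pj|npj] := pselect (0 < p \/ (1 < j)%N).
  have [c c0 hc] := lower_bound_exists M j0 j1 p01 pj.
  have ci : 0 < c^-1 by rewrite invr_gt0.
  exists (1 + C + c^-1); first by rewrite -addrA ltrDl addr_gt0.
  have D0 : 0 < 1 + C + c^-1 by rewrite !addr_gt0.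
  move=> K sol; split => [u us|_ u us].
    by apply: (le_lt_trans (hC K sol u us)); lra.
  apply: lt_le_trans (hc K sol u us).
  by rewrite invf_plt ?posrE//; lra.
exists (1 + C); first by rewrite ltrDl.
move=> K sol; split => [u us|pj]; first by apply: (le_lt_trans (hC K sol u us)); lra.
exfalso; case: npj; have [j1'|j1'] := ltnP 1 j; first by right.
left; rewrite lt_neqAle; case/andP: p01 => -> _; rewrite andbT eq_sym; apply/eqP => pz.
by apply: pj; rewrite pz; congr (_, _); apply/eqP; rewrite eqn_leq j1' j0.
Qed.

End FromConvexBody.

Theorem theorem5p1 (R : realType) (n : nat) (p M : R) :
  (3 <= n)%N -> 0 <= p < 1 ->
  exists C : R, 1 < C /\
  forall (j : nat) (K : set 'rV[R]_n) (g : 'rV[R]_n -> R),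
    (1 <= j <= n - 2)%N ->
    convex_body K -> origin_symmetric K ->
    even_on_sphere g -> measurable_on_sphere g -> Linf_norm_log g M ->
    solves_Lp_Christoffel_Minkowski K p j g ->
    (forall x, sphere x -> supp_fun K x < C) /\
    ((p, j) <> (0, 1%N) -> forall x, sphere x -> C^-1 < supp_fun K x).
Proof.
case: n => // n' n3 p01.
(* The constant may not depend on [j]; one constant is chosen for each of the finitely many orders,
   and their sum dominates them all. *)
pose P (j : 'I_n'.+1) (C : R) := 1 < C /\ forall K : set 'rV[R]_n'.+1,
  (0 < j)%N -> (j.+1 < n'.+1)%N -> solution K j p M ->
  (forall u, sphere u -> supp_fun K u < C) /\
  ((p, j : nat) <> (0, 1%N) -> forall u, sphere u -> C^-1 < supp_fun K u).
have /choice[F FP] : forall j, exists C, P j C.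
  (* Orders outside the admissible range receive the dummy constant 2, so that every summand is
     above 1. *)
  move=> j; have [/andP[j0 j1]|nj] := boolP ((0 < j)%N && (j.+1 < n'.+1)%N).
    have [C C1 hC] := @bound_for_order R n' j p M j0 j1 p01.
    by exists C; split => // K _ _; exact: hC.
  exists 2; split; first by rewrite ltr1n.
  by move=> K j0 j1; rewrite j0 j1 in nj.
have F0 j : 0 < F j by apply: lt_trans (FP j).1; exact: ltr01.
have FS (j : 'I_n'.+1) : F j <= \sum_i F i.
  by rewrite (bigD1 j)//= lerDl sumr_ge0// => i _; exact: ltW.
exists (\sum_i F i); split; first exact: lt_le_trans (FP ord0).1 (FS ord0).
move=> j K g /andP[j0 jn] bK symK _ _ [gM _] sol.
have jn' : (j < n'.+1)%N by lia.
have j1 : (j.+1 < n'.+1)%N by lia.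
have [h1 h2] := (FP (Ordinal jn')).2 K j0 j1 (solution_of_equation bK symK gM sol).
split => [x xs|pj x xs]; first exact: lt_le_trans (h1 x xs) (FS _).
apply: le_lt_trans (h2 pj x xs); rewrite lef_pV2 ?posrE//.
exact: lt_le_trans (FS (Ordinal jn')).
Qed.
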